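(* Let $\alpha,\beta,\mu,\nu$ be real, let $\tau\in\mathbb{C}$ with $|\arg\tau|<\pi/2$, $z=i\tau$, $q=e(z)=e^{-2\pi\tau}$. Set $$\mathcal{B}_1(s,\alpha,\mu)=i\sin(\pi s)\psi(s,-\alpha,-\mu)=ie(\alpha\mu)\frac{(2\pi)^s}{2\Gamma(s)}\bigl\{e^{\pi i(1-s)/2}\psi(1-s,-\mu,\alpha)+e^{-\pi i(1-s)/2}\psi(1-s,\mu,-\alpha)\bigr\},$$ $$\mathcal{B}_2(s,\beta,\nu)=e^{\pi is/2}\psi(s,-\beta,-\nu)+e^{-\pi is/2}\psi(s,\beta,\nu)=e(\beta\nu)\frac{(2\pi)^s}{\Gamma(s)}\psi(1-s,\nu,-\beta)$$ (the second equalities holding identically in $s$). For an integer $J\ge 0$ let $$S_J(s;\alpha,\beta;\mu,\nu;z)=2\sin(\pi s)\sum_{j=-1}^{J-1}\frac{i^{j+1}(s)_j}{(j+1)!}\psi(s+j,-\alpha,-\mu)\,\mathcal{C}_{j+1}(\langle\beta\rangle,\widetilde{e}(\nu))\,\tau^j,$$ and define $R_J(s;\alpha,\beta;\mu,\nu;z)$ by $$F_{\mathbb{Z}^2}(s;\alpha,\beta;\mu,\nu;z)=\delta(\beta)\mathcal{B}_1(s,\alpha,\mu)+\delta(\alpha)\mathcal{B}_2(s,\beta,\nu)\tau^{-s}+S_J(s;\alpha,\beta;\mu,\nu;z)+R_J(s;\alpha,\beta;\mu,\nu;z).$$ Then for every $s$ with $\operatorname{Re}s>-J$ and every small $\eta>0$,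 $$R_J(s;\alpha,\beta;\mu,\nu;z)=O(|\tau|^J)$$ as $\tau\to0$ through $|\arg\tau|\le\pi/2-\eta$, the implied constant depending at most on $s,\alpha,\beta,\mu,\nu,J,\eta$.
   Context: Notation: $e(x)=e^{2\pi ix}$; for real $x$, $\delta(x)=1$ if $x\in\mathbb{Z}$ and $0$ otherwise; $\langle x\rangle=x-\lfloor x\rfloor$. $(s)_j=\Gamma(s+j)/\Gamma(s)$ for any integer $j$ (so $(s)_{-1}=1/(s-1)$). Powers $\tau^{-s},\tau^j$ use the principal branch. $\psi(r,\gamma,\kappa)=\sum_{k\in\mathbb{Z},\,k>-\gamma}e\{(\gamma+k)\kappa\}(\gamma+k)^{-r}$ for $\operatorname{Re}r>1$, meromorphically continued to $\mathbb{C}$. For $X\in\mathbb{C}$ and real $\kappa$, the numbers $\mathcal{C}_k(X,\widetilde{e}(\kappa))$ ($k\ge0$) are defined by the Taylor expansion at $Z=0$: $$\frac{Z\,e(X\kappa)\,e^{XZ}}{e(\kappa)e^Z-1}=\sum_{k=0}^\infty\frac{\mathcal{C}_k(X,\widetilde{e}(\kappa))}{k!}Z^k$$ (for $\kappa=0$ these are the Bernoulli polynomials $B_k(X)$). For $z$ in the upper half-plane and $\operatorname{Re}s>2$, $F^{\pm}_{\mathbb{Z}^2}(s;\alpha,\beta;\mu,\nu;z)=\sum'_{m,n\in\mathbb{Z}}e\{(\alpha+m)\mu+(\beta+n)\nu\}\{\alpha+m+(\beta+n)z\}^{-s}$, omitting the term where the base vanishes, with arguments of the bases in $(-\pi,\pi]$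 for $F^+$ and in $[-\pi,\pi)$ for $F^-$; $F_{\mathbb{Z}^2}=\frac12(F^++F^-)$, holomorphically continued to all $s\in\mathbb{C}$. *)

(* Defs.v *)
(* Stdlib reals and Coquelicot complex numbers. *)
From Stdlib Require Import Reals ZArith List ClassicalEpsilon.
From Coquelicot Require Import Coquelicot.
Open Scope R_scope.
Open Scope C_scope.

Definition Cexp (z : C) : C := (exp (Re z) * cos (Im z), exp (Re z) * sin (Im z))%R.
Definition Csin (z : C) : C := (Cexp (Ci * z) - Cexp (- (Ci * z))) / (2 * Ci).

Definition e (x : C) : C := Cexp (2 * PI * Ci * x).

(* Argument in (-PI, PI]; irrelevant value at 0. *)
Definition arg_p (z : C) : R :=
  if Rle_dec 0 (Im z) then acos (Re z / Cmod z) else (- acos (Re z / Cmod z))%R.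

(* Argument in [-PI, PI); irrelevant value at 0. *)
Definition arg_m (z : C) : R :=
  if Rlt_dec 0 (Im z) then acos (Re z / Cmod z) else (- acos (Re z / Cmod z))%R.

Definition cpow_arg (arg : C -> R) (z w : C) : C := Cexp (w * (ln (Cmod z), arg z)).
Definition cpow : C -> C -> C := cpow_arg arg_p.

Definition delta (x : R) : C :=
  if excluded_middle_informative (exists k : Z, x = IZR k) then 1 else 0.

(* Unordered summation: convergence along the finite subsets of [A]. *)
Definition has_sum {A : Type} (f : A -> C) (l : C) : Prop :=
  forall eps : posreal, exists L0 : list A, forall L : list A,
    NoDup L -> incl L0 L ->
    (Cmod (fold_right (fun a acc => f a + acc) 0 L - l)%C < eps)%R.

Definition holomorphic_at (f : C -> C) (s0 : C) : Prop :=
  locally (T := C_UniformSpace) s0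
    (fun s => ex_derive (K := C_AbsRing) (V := C_NormedModule) f s).

Definition pole_at (f : C -> C) (s0 : C) : Prop :=
  exists (n : nat) (g : C -> C),
    (0 < n)%nat /\ holomorphic_at g s0 /\ g s0 <> 0 /\
    locally' (T := C_UniformSpace) s0 (fun s => f s = g s / (s - s0) ^ n).

(* The value of a meromorphic function at a pole is left unconstrained. *)
Definition meromorphic (f : C -> C) : Prop :=
  forall s0 : C, holomorphic_at f s0 \/ pole_at f s0.

Definition entire (f : C -> C) : Prop := forall s0 : C, holomorphic_at f s0.

(* [f] takes the value [l] at [s], a removable singularity of the expression [f s]
   being filled in.  [C_lim f s] is that value whenever it exists. *)
Definition has_value (f : C -> C) (s l : C) : Prop :=
  filterlim f (locally' (T := C_UniformSpace) s) (locally (T := C_UniformSpace) l).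

(* Euler's integral for [Re s > 0], continued meromorphically. *)
Definition Gamma : C -> C :=
  epsilon (inhabits (fun _ => RtoC 0)) (fun f =>
    meromorphic f /\
    forall s : C, (0 < Re s)%R ->
      is_RInt_gen (V := C_R_NormedModule)
        (fun t : R => RtoC (exp (- t)) * cpow (RtoC t) (s - 1))
        (at_right 0) (Rbar_locally p_infty) (f s)).

Definition poch (s : C) (j : Z) : C := Gamma (s + IZR j) / Gamma s.

Definition psi_term (r : C) (gamma kappa : R) (k : Z) : C :=
  if Rlt_dec (- gamma) (IZR k)
  then e (RtoC ((gamma + IZR k) * kappa)) * cpow (RtoC (gamma + IZR k)) (- r)
  else 0.

Definition psi_continuation (gamma kappa : R) : C -> C :=
  epsilon (inhabits (fun _ => RtoC 0)) (fun f =>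
    meromorphic f /\
    forall r : C, (1 < Re r)%R -> has_sum (psi_term r gamma kappa) (f r)).

Definition psi (r : C) (gamma kappa : R) : C := psi_continuation gamma kappa r.

(* [Cnum k X kappa] is C_k(X, e~(kappa)).  The punctured neighbourhood is needed because
   the generating function is 0/0 at Z = 0 when [kappa] is an integer. *)
Definition Cnum (k : nat) (X : C) (kappa : R) : C :=
  epsilon (inhabits (fun _ => RtoC 0)) (fun c : nat -> C =>
    locally' (T := C_UniformSpace) (RtoC 0) (fun w : C =>
      is_pseries (K := C_AbsRing) (V := C_NormedModule)
        (fun k => c k / INR (fact k)) w
        (w * e (X * kappa) * Cexp (X * w) / (e kappa * Cexp w - 1)))) k.

Definition F_term (arg : C -> R) (s : C) (alpha beta mu nu : R) (z : C) (p : Z * Z) : C :=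
  let '(m, n) := p in
  let base := RtoC (alpha + IZR m) + RtoC (beta + IZR n) * z in
  if Ceq_dec base 0 then 0
  else e (RtoC ((alpha + IZR m) * mu + (beta + IZR n) * nu)) * cpow_arg arg base (- s).

Definition F_continuation (alpha beta mu nu : R) (z : C) : C -> C :=
  epsilon (inhabits (fun _ => RtoC 0)) (fun f =>
    entire f /\
    forall s : C, (2 < Re s)%R ->
      exists Fp Fm : C,
        has_sum (F_term arg_p s alpha beta mu nu z) Fp /\
        has_sum (F_term arg_m s alpha beta mu nu z) Fm /\
        f s = (Fp + Fm) / 2).

Definition F_Z2 (s : C) (alpha beta mu nu : R) (z : C) : C :=
  F_continuation alpha beta mu nu z s.

Definition calB1_left (alpha mu : R) (s : C) : C :=
  Ci * Csin (PI * s) * psi s (- alpha) (- mu).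

Definition calB1_right (alpha mu : R) (s : C) : C :=
  Ci * e (RtoC (alpha * mu)) * (cpow (RtoC (2 * PI)) s / (2 * Gamma s)) *
  (Cexp (PI * Ci * (1 - s) / 2) * psi (1 - s) (- mu) alpha +
   Cexp (- (PI * Ci * (1 - s) / 2)) * psi (1 - s) mu (- alpha)).

Definition calB1 (s : C) (alpha mu : R) : C := C_lim (calB1_left alpha mu) s.

Definition calB2_left (beta nu : R) (s : C) : C :=
  Cexp (PI * Ci * s / 2) * psi s (- beta) (- nu) +
  Cexp (- (PI * Ci * s / 2)) * psi s beta nu.

Definition calB2_right (beta nu : R) (s : C) : C :=
  e (RtoC (beta * nu)) * (cpow (RtoC (2 * PI)) s / Gamma s) * psi (1 - s) nu (- beta).

Definition calB2 (s : C) (beta nu : R) : C := C_lim (calB2_left beta nu) s.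

(* The summation index is shifted: [k] stands for j + 1, so that k = 0, ..., J
   corresponds to j = -1, ..., J - 1. *)
Definition S_J_expr (J : nat) (alpha beta mu nu : R) (tau s : C) : C :=
  2 * Csin (PI * s) *
  sum_n (G := C_AbelianGroup) (fun k : nat =>
    let j := (Z.of_nat k - 1)%Z in
    Ci ^ k * poch s j / INR (fact k) * psi (s + IZR j) (- alpha) (- mu) *
    Cnum k (RtoC (frac_part beta)) nu * cpow tau (IZR j)) J.

(* Both [poch] and [psi] may be singular at integers [s]; these singularities are
   cancelled by the sine. *)
Definition S_J (J : nat) (s : C) (alpha beta mu nu : R) (tau : C) : C :=
  C_lim (S_J_expr J alpha beta mu nu tau) s.

Definition R_J (J : nat) (s : C) (alpha beta mu nu : R) (tau : C) : C :=
  F_Z2 s alpha beta mu nu (Ci * tau)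
  - delta beta * calB1 s alpha mu
  - delta alpha * calB2 s beta nu * cpow tau (- s)
  - S_J J s alpha beta mu nu tau.

(* Main.v *)
(** Put h = i tau and let psi, B_1, B_2 be as in the statement.

    Functional equation.  Comparing Fourier coefficients of the periodisation of
    t_+^(s-1) e^(-2 pi w t) gives the Lipschitz formula
      Sum_(k+v>0) (k+v)^(s-1) e^(-2 pi w (k+v)) = Gamma(s) (2 pi)^(-s) Sum_n e(n v) (w + i n)^(-s).
    With w = rho + i beta both sides continue to Re s > -2 by Euler-Maclaurin summation; for
    -2 < Re s < -1 one may let rho -> 0, which is the identity for B_2.  B_1 is a combination
    of B_2(alpha, mu) and B_2(-alpha, -mu).

    Expansion.  For Re s > 2 split the lattice sum by the sign of a = alpha + m.  The terms with
    a = 0 give delta(alpha) tau^(-s) B_2.  The others are sums along the full lines a + (beta + n) h;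
    when a < 0 the jump of the argument adds delta(beta) B_1 and 2 i sin(pi s) times half lines.
    The generating function of the C_k says exactly that, for
    G(b) = Sum_(k <= N) C_k / k! (s-1)_k h^k b^(1-s-k), the difference e(nu) G(b - h) - G(b) is
    the lattice term e(X nu) (s-1) h (b - X h)^(-s) up to O(h^(N+1)).  This telescopes: a full line
    leaves only defects, a half line leaves G, hence S_J, and defects.  In the sector
    |a + y h| >= c sqrt(a |h| (1 + |n|)), so for large N all defects sum to O(|h|^(J+1)) locally
    uniformly in s, which also continues the lattice sum.  The resulting expression carries the
    factor (s-1)(s-2) h; the zeros at 1 and 2 are avoided by bounding R_J on a circle around s. *)

(* [Gamma], [psi], [F_Z2] and the numbers C_k are chosen by [epsilon]. Each first needs an existence
   proof and is then known only through uniqueness, for the meromorphic ones only off isolated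
   points. Hence the many identities on punctured neighbourhoods, which the identity theorem carries
   around and which become values only where both sides are holomorphic.

   The obstacle is uniformity in h. The lower bound by a square root makes the double series of
   defects converge, but it spends half of the gain: order N of the expansion leaves about
   |h|^(N/2). So N is taken far beyond J, and the terms of the expansion of order above J go back
   into the remainder. The exponent J + 1 is aimed at because the normalising factor h is divided
   out at the end.

   One device continues both psi and the lattice sum: a finite Euler-Maclaurin expansion plus an
   absolutely convergent series of defects. Direction h = 1 gives psi, h = i and h = -i the two
   sides of the functional equation, h = i tau the lattice. *)
Require Import Defs.
From Stdlib Require Import Reals ZArith List Lra Lia Psatz Permutation ClassicalEpsilon FunctionalExtensionality Classical.
From Coquelicot Require Import Coquelicot.
Open Scope R_scope.

(** * Limits and complex derivatives *)

Notation cnear := (locally (T := C_UniformSpace)).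
Notation cnear' := (locally' (T := C_UniformSpace)).
Ltac ctri := eapply Rle_trans; [apply Cmod_triangle|].
Ltac rtri := eapply Rle_trans; [apply Rabs_triang|].
Ltac ceq := apply injective_projections; simpl; ring.

Definition tends {T : Type} (F : (T -> Prop) -> Prop) (f : T -> C) (l : C) : Prop :=
  forall eps : R, 0 < eps -> F (fun x => Cmod (f x - l) < eps).

Lemma Cmod_minus_sym (a b : C) : Cmod (a - b) = Cmod (b - a).
Proof. rewrite <- Cmod_opp. f_equal. ring. Qed.

Lemma Cmod_triangle_minus (a b : C) : Cmod (a - b) <= Cmod a + Cmod b.
Proof. unfold Cminus. rewrite <- (Cmod_opp b). apply Cmod_triangle. Qed.

Ltac ctrim := eapply Rle_trans; [apply Cmod_triangle_minus|].
Lemma Cmod_triangle_inv (a b : C) : Cmod a - Cmod b <= Cmod (a - b).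
Proof. pose proof (Cmod_triangle (a - b) b) as H. replace (a - b + b)%C with a in H by ring. lra. Qed.

Lemma Cmod_triangle3 (a b c : C) : Cmod (a - c) <= Cmod (a - b) + Cmod (b - c).
Proof. replace (a - c)%C with ((a - b) + (b - c))%C by ring. apply Cmod_triangle. Qed.

Lemma Cmod_le_sum (z : C) : Cmod z <= Rabs (fst z) + Rabs (snd z).
Proof.
  replace z with (RtoC (fst z) + Ci * RtoC (snd z))%C at 1.
  - ctri. rewrite Cmod_mult, !Cmod_R, Cmod_Ci. lra.
  - destruct z. ceq.
Qed.

Lemma Rabs_fst_le (z : C) : Rabs (fst z) <= Cmod z.
Proof. eapply Rle_trans; [apply Rmax_l|apply Rmax_Cmod]. Qed.

Lemma Rabs_snd_le (z : C) : Rabs (snd z) <= Cmod z.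
Proof. eapply Rle_trans; [apply Rmax_r|apply Rmax_Cmod]. Qed.

Lemma Cmod_pos (z : C) : z <> 0 -> 0 < Cmod z.
Proof. apply Cmod_gt_0. Qed.

Lemma Cmod_zero_eq (z : C) : Cmod z <= 0 -> z = 0.
Proof. intros H. apply Cmod_eq_0. pose proof (Cmod_ge_0 z). lra. Qed.

(** The uniform structure of [C] is the product one, so its balls are squares. A square of half the
    radius fits into a disc, and from here on limits are handled with [Cmod]. *)
Lemma locally_Cmod (z : C) (P : C -> Prop) :
  cnear z P <-> exists d, 0 < d /\ forall w, Cmod (w - z) < d -> P w.
Proof.
  split.
  - intros [d Hd]. exists d. split; [apply cond_pos|]. intros w Hw. apply Hd. split; simpl.
    + eapply Rle_lt_trans; [|exact Hw]. apply (Rabs_fst_le (w - z)).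
    + eapply Rle_lt_trans; [|exact Hw]. apply (Rabs_snd_le (w - z)).
  - intros [d [H0 Hd]]. assert (H2 : 0 < d / 2) by lra. exists (mkposreal _ H2). intros w [H1 H3]. apply Hd. eapply Rle_lt_trans; [apply Cmod_le_sum|].
    unfold ball in *; simpl in *. unfold AbsRing_ball, abs, minus, plus, opp in *; simpl in *. unfold Rminus. lra.
Qed.

Lemma locally'_Cmod (z : C) (P : C -> Prop) :
  cnear' z P <->
  exists d, 0 < d /\ forall w, Cmod (w - z) < d -> w <> z -> P w.
Proof. unfold locally', within. rewrite locally_Cmod. tauto. Qed.

Lemma locally_R (x : R) (P : R -> Prop) :
  locally x P <-> exists d, 0 < d /\ forall y, Rabs (y - x) < d -> P y.
Proof.
  split.
  - intros [d Hd]. exists d. split; [apply cond_pos|]. intros y Hy. apply Hd, Hy.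
  - intros [d [H0 Hd]]. exists (mkposreal _ H0). intros y Hy. apply Hd, Hy.
Qed.

Lemma tends_filterlim {T} (F : (T -> Prop) -> Prop) {FF : Filter F} (f : T -> C) (l : C) :
  tends F f l <-> filterlim f F (cnear l).
Proof.
  split.
  - intros H P HP. apply locally_Cmod in HP. destruct HP as [d [H0 Hd]].
    specialize (H d H0). unfold filtermap. revert H. apply filter_imp. intros x Hx. apply Hd, Hx.
  - intros H eps He. apply (H (fun w => Cmod (w - l) < eps)). apply locally_Cmod. exists eps. split; auto.
Qed.

Section TendsAlg.
Context {T : Type} (F : (T -> Prop) -> Prop) {FF : Filter F}.

Lemma tends_const (c : C) : tends F (fun _ => c) c.
Proof. intros eps He. apply filter_forall. intros _. replace (c - c)%C with (RtoC 0) by ring. now rewrite Cmod_0. Qed.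

Lemma tends_ext_F (f g : T -> C) l : F (fun x => f x = g x) -> tends F f l -> tends F g l.
Proof. intros He H eps Hp. generalize (filter_and _ _ He (H eps Hp)). apply filter_imp. intros x [H1 H2]. now rewrite <- H1. Qed.

Lemma tends_ext (f g : T -> C) l : (forall x, f x = g x) -> tends F f l -> tends F g l.
Proof. intros He. apply tends_ext_F. apply filter_forall, He. Qed.

Lemma tends_plus (f g : T -> C) a b :
  tends F f a -> tends F g b -> tends F (fun x => f x + g x)%C (a + b)%C.
Proof.
  intros Hf Hg eps He. assert (He2 : 0 < eps / 2) by lra. generalize (filter_and _ _ (Hf _ He2) (Hg _ He2)). apply filter_imp. intros x [H1 H2].
  replace (f x + g x - (a + b))%C with ((f x - a) + (g x - b))%C by ring. eapply Rle_lt_trans; [apply Cmod_triangle|lra].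
Qed.

Lemma tends_mult (f g : T -> C) a b :
  tends F f a -> tends F g b -> tends F (fun x => f x * g x)%C (a * b)%C.
Proof.
  intros Hf Hg eps He. pose proof (Cmod_ge_0 a) as Ha. pose proof (Cmod_ge_0 b) as Hb. set (K := Cmod a + Cmod b + 1). assert (HK : 0 < K) by (unfold K; lra).
  assert (He1 : 0 < Rmin 1 (eps / (2 * K))).
  { apply Rmin_pos; [lra|]. apply Rdiv_lt_0_compat; lra. }
  generalize (filter_and _ _ (Hf _ He1) (Hg _ He1)). apply filter_imp. intros x [H1 H2].
  assert (H3 := Rmin_l 1 (eps / (2 * K))). assert (H4 := Rmin_r 1 (eps / (2 * K))).
  replace (f x * g x - a * b)%C with ((f x - a) * (g x - b) + (f x - a) * b + a * (g x - b))%C by ring. eapply Rle_lt_trans; [apply Cmod_triangle|].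
  eapply Rle_lt_trans; [apply Rplus_le_compat_r, Cmod_triangle|]. rewrite !Cmod_mult. assert (H5 : eps / (2 * K) * K = eps / 2) by (field; lra).
  set (e1 := eps / (2 * K)) in *. pose proof (Cmod_ge_0 (g x - b)). unfold K in *. nra.
Qed.

Lemma tends_opp (f : T -> C) a : tends F f a -> tends F (fun x => - f x)%C (- a)%C.
Proof.
  intros H. replace (- a)%C with (-1 * a)%C by ring. apply tends_ext with (fun x => -1 * f x)%C; [intros; ring|]. apply tends_mult; [apply tends_const|exact H].
Qed.

Lemma tends_minus (f g : T -> C) a b :
  tends F f a -> tends F g b -> tends F (fun x => f x - g x)%C (a - b)%C.
Proof. intros. apply tends_plus; [assumption|now apply tends_opp]. Qed.

Lemma tends_inv (f : T -> C) (a : C) : a <> 0 -> tends F f a -> tends F (fun x => / f x)%C (/ a)%C.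
Proof.
  intros Ha Hf eps He. assert (Hm := Cmod_pos a Ha). assert (He1 : 0 < Rmin (Cmod a / 2) (eps * (Cmod a * Cmod a) / 2)).
  { apply Rmin_pos; [lra|]. assert (0 < Cmod a * Cmod a) by nra. nra. }
  generalize (Hf _ He1). apply filter_imp. intros x H1. assert (H3 := Rmin_l (Cmod a / 2) (eps * (Cmod a * Cmod a) / 2)).
  assert (H4 := Rmin_r (Cmod a / 2) (eps * (Cmod a * Cmod a) / 2)). assert (H5 : Cmod a / 2 < Cmod (f x)).
  { pose proof (Cmod_triangle_inv a (a - f x)) as H. replace (a - (a - f x))%C with (f x) in H by ring. rewrite (Cmod_minus_sym a (f x)) in H. lra. }
  assert (Hfx : f x <> 0). { intros E. rewrite E, Cmod_0 in H5. lra. }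
  replace (/ f x - / a)%C with ((a - f x) * / (f x * a))%C by (field; auto). rewrite Cmod_mult, Cmod_inv by (apply Cmult_neq_0; auto). rewrite Cmod_mult.
  rewrite Cmod_minus_sym. apply Rmult_lt_reg_r with (Cmod (f x) * Cmod a); [nra|]. rewrite Rmult_assoc, Rinv_l, Rmult_1_r by nra.
  eapply Rlt_le_trans; [exact H1|]. eapply Rle_trans; [exact H4|]. nra.
Qed.

Lemma tends_pow (f : T -> C) a n : tends F f a -> tends F (fun x => f x ^ n)%C (a ^ n)%C.
Proof. intros H. induction n; simpl; [apply tends_const|]. now apply tends_mult. Qed.

Lemma tends_0_bound (f : T -> C) (g : T -> R) l :
  F (fun x => Cmod (f x - l) <= g x) -> filterlim g F (locally 0) -> tends F f l.
Proof.
  intros H Hg eps He. assert (H1 : F (fun x => Rabs (g x - 0) < eps)).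
  { apply (Hg (fun y => Rabs (y - 0) < eps)). apply locally_R. exists eps. auto. }
  generalize (filter_and _ _ H H1). apply filter_imp. intros x [A B]. rewrite Rminus_0_r in B. pose proof (Rle_abs (g x)). lra.
Qed.

Lemma tends_fst (f : T -> C) l : tends F f l -> filterlim (fun x => fst (f x)) F (locally (fst l)).
Proof.
  intros H P HP. apply locally_R in HP. destruct HP as [d [H0 Hd]]. unfold filtermap. generalize (H d H0). apply filter_imp. intros x Hx. apply Hd.
  eapply Rle_lt_trans; [|exact Hx]. apply (Rabs_fst_le (f x - l)).
Qed.

Lemma tends_snd (f : T -> C) l : tends F f l -> filterlim (fun x => snd (f x)) F (locally (snd l)).
Proof.
  intros H P HP. apply locally_R in HP. destruct HP as [d [H0 Hd]]. unfold filtermap. generalize (H d H0). apply filter_imp. intros x Hx. apply Hd.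
  eapply Rle_lt_trans; [|exact Hx]. apply (Rabs_snd_le (f x - l)).
Qed.

Lemma tends_pair (f : T -> C) l :
  filterlim (fun x => fst (f x)) F (locally (fst l)) ->
  filterlim (fun x => snd (f x)) F (locally (snd l)) -> tends F f l.
Proof.
  intros H1 H2 eps He. assert (He2 : 0 < eps / 2) by lra. assert (A : F (fun x => Rabs (fst (f x) - fst l) < eps / 2)).
  { apply (H1 (fun y => Rabs (y - fst l) < eps / 2)), locally_R. exists (eps / 2). auto. }
  assert (B : F (fun x => Rabs (snd (f x) - snd l) < eps / 2)).
  { apply (H2 (fun y => Rabs (y - snd l) < eps / 2)), locally_R. exists (eps / 2). auto. }
  generalize (filter_and _ _ A B). apply filter_imp. intros x [A1 B1]. eapply Rle_lt_trans; [apply Cmod_le_sum|].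
  change (fst (f x - l)%C) with (fst (f x) - fst l). change (snd (f x - l)%C) with (snd (f x) - snd l). lra.
Qed.

End TendsAlg.

Lemma tends_unique {T} (F : (T -> Prop) -> Prop) {FF : ProperFilter F} (f : T -> C) a b :
  tends F f a -> tends F f b -> a = b.
Proof.
  intros Ha Hb. apply Ceq_minus, Cmod_zero_eq, Rnot_lt_le. intros H. assert (H2 : 0 < Cmod (a - b) / 2) by lra.
  destruct (filter_ex _ (filter_and _ _ (Ha _ H2) (Hb _ H2))) as [x [H3 H4]]. pose proof (Cmod_triangle3 a (f x) b). rewrite (Cmod_minus_sym a (f x)) in H0. lra.
Qed.

Lemma tends_le {T} (F : (T -> Prop) -> Prop) {FF : ProperFilter F} (f : T -> C) l M :
  tends F f l -> F (fun x => Cmod (f x) <= M) -> Cmod l <= M.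
Proof.
  intros H HM. apply Rnot_lt_le. intros Hlt. assert (H2 : 0 < Cmod l - M) by lra. destruct (filter_ex _ (filter_and _ _ (H _ H2) HM)) as [x [H3 H4]].
  pose proof (Cmod_triangle_inv l (f x)). rewrite Cmod_minus_sym in H0. lra.
Qed.

Definition ccont (f : C -> C) (z : C) : Prop := tends (cnear z) f (f z).
Definition rcont (f : R -> C) (x : R) : Prop := tends (locally x) f (f x).

Lemma tends_comp {T} (F : (T -> Prop) -> Prop) {FF : Filter F} (f : C -> C) (g : T -> C) l :
  ccont f l -> tends F g l -> tends F (fun x => f (g x)) (f l).
Proof.
  intros Hf Hg eps He. specialize (Hf eps He). apply locally_Cmod in Hf. destruct Hf as [d [H0 Hd]]. generalize (Hg d H0). apply filter_imp. auto.
Qed.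

Lemma rcont_continuous (f : R -> C) x : rcont f x <-> continuous (U := C_R_NormedModule) f x.
Proof. apply (tends_filterlim (locally x) f (f x)). Qed.

Lemma tends_id (z : C) : tends (cnear z) (fun x => x) z.
Proof. intros eps He. apply locally_Cmod. exists eps. auto. Qed.

Lemma tends_RtoC (x : R) : tends (locally x) RtoC (RtoC x).
Proof. intros eps He. apply locally_R. exists eps. split; auto. intros y Hy. rewrite <- RtoC_minus, Cmod_R. exact Hy. Qed.

Lemma tends_locally' (f : C -> C) z l :
  tends (cnear z) f l -> tends (cnear' z) f l.
Proof. intros H eps He. generalize (H eps He). apply filter_le_within. Qed.

Lemma has_value_tends f s l : has_value f s l <-> tends (cnear' s) f l.
Proof. unfold has_value. symmetry. apply tends_filterlim. apply _. Qed.

Lemma C_locally'_proper (z : C) : ProperFilter (cnear' z).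
Proof.
  split; [|apply _]. intros P HP. apply locally'_Cmod in HP. destruct HP as [d [H0 Hd]]. exists (z + RtoC (d / 2))%C. apply Hd.
  - replace (z + RtoC (d / 2) - z)%C with (RtoC (d / 2)) by ring. rewrite Cmod_R, Rabs_pos_eq; lra.
  - intros E. assert (H : RtoC (d / 2) = 0).
    { replace (RtoC (d / 2)) with (z + RtoC (d / 2) - z)%C by ring. rewrite E. ring. }
    apply RtoC_inj in H. lra.
Qed.
#[global] Existing Instance C_locally'_proper.

(* Caratheodory's form of differentiability, along an embedding [j] of the source into [C];
   it covers complex derivatives ([j = id]) and curves ([j = RtoC]) at once. *)
Definition gder {T : UniformSpace} (j : T -> C) (f : T -> C) (x : T) (l : C) : Prop :=
  exists phi : T -> C, phi x = l /\ tends (locally x) phi l /\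
    forall y, f y = (f x + phi y * (j y - j x))%C.

Section GDer.
Context {T : UniformSpace} (j : T -> C).

Lemma gder_const c x : gder j (fun _ => c) x 0.
Proof. exists (fun _ => RtoC 0). split; [|split]; auto; [apply tends_const; apply _|intros; ring]. Qed.

Lemma gder_j x : gder j j x 1.
Proof. exists (fun _ => RtoC 1). split; [|split]; auto; [apply tends_const; apply _|intros; ring]. Qed.

Lemma gder_tends f x l : tends (locally x) j (j x) -> gder j f x l -> tends (locally x) f (f x).
Proof.
  intros Hj [p [H1 [H2 H3]]]. apply tends_ext with (fun y => f x + p y * (j y - j x))%C; [apply _|intros; symmetry; apply H3|].
  assert (K : tends (locally x) (fun y => f x + p y * (j y - j x))%C (f x + l * (j x - j x))%C).
  { apply tends_plus; [apply _|apply tends_const; apply _|].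
    apply tends_mult; [apply _|exact H2|]. apply tends_minus; [apply _|exact Hj|apply tends_const; apply _]. }
  replace (f x + l * (j x - j x))%C with (f x) in K by ring. exact K.
Qed.

Lemma gder_plus f g x a b :
  gder j f x a -> gder j g x b -> gder j (fun y => f y + g y)%C x (a + b)%C.
Proof.
  intros [p [H1 [H2 H3]]] [q [K1 [K2 K3]]]. exists (fun y => p y + q y)%C. split; [|split].
  - now rewrite H1, K1.
  - apply tends_plus; [apply _|assumption|assumption].
  - intros y. rewrite (H3 y), (K3 y). ring.
Qed.

Lemma gder_mult f g x a b : tends (locally x) j (j x) ->
  gder j f x a -> gder j g x b -> gder j (fun y => f y * g y)%C x (a * g x + f x * b)%C.
Proof.
  intros Hj Hf Hg. pose proof (gder_tends _ _ _ Hj Hg) as Cg. destruct Hf as [p [H1 [H2 H3]]], Hg as [q [K1 [K2 K3]]].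
  exists (fun y => p y * g y + f x * q y)%C. split; [|split].
  - now rewrite H1, K1.
  - apply tends_plus; [apply _| |]; apply tends_mult; try apply _; try assumption. apply tends_const; apply _.
  - intros y. rewrite (H3 y). replace (f x * g x)%C with (f x * (g y - q y * (j y - j x)))%C by (rewrite (K3 y); ring). ring.
Qed.

Lemma gder_ext f g x l : (forall y, f y = g y) -> gder j f x l -> gder j g x l.
Proof. intros E [p [H1 [H2 H3]]]. exists p. repeat split; auto. intros y. rewrite <- !E. apply H3. Qed.

Lemma gder_eq f x l l' : l = l' -> gder j f x l -> gder j f x l'.
Proof. now intros ->. Qed.

Lemma gder_opp f x a : tends (locally x) j (j x) -> gder j f x a -> gder j (fun y => - f y)%C x (- a)%C.
Proof.
  intros Hj H. apply gder_ext with (fun y => (- (1)) * f y)%C; [intros; ring|].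
  eapply gder_eq; [|apply gder_mult; [exact Hj|apply gder_const|exact H]]. cbv beta. ring.
Qed.

Lemma gder_minus f g x a b : tends (locally x) j (j x) ->
  gder j f x a -> gder j g x b -> gder j (fun y => f y - g y)%C x (a - b)%C.
Proof. intros. apply gder_plus; [assumption|now apply gder_opp]. Qed.

Lemma gder_comp (f : C -> C) g x a b : tends (locally x) j (j x) ->
  gder (T := C_UniformSpace) (fun z => z) f (g x) a -> gder j g x b -> gder j (fun y => f (g y)) x (a * b)%C.
Proof.
  intros Hj Hf Hg. pose proof (gder_tends _ _ _ Hj Hg) as Cg. destruct Hf as [p [H1 [H2 H3]]], Hg as [q [K1 [K2 K3]]].
  exists (fun y => p (g y) * q y)%C. split; [|split].
  - now rewrite H1, K1.
  - apply tends_mult; [apply _| |assumption]. intros eps He. destruct (proj1 (locally_Cmod _ _) (H2 eps He)) as [d [H0 Hd]].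
    generalize (Cg d H0). apply filter_imp. auto.
  - intros y. rewrite (H3 (g y)). replace (g y - g x)%C with (q y * (j y - j x))%C by (rewrite (K3 y); ring). ring.
Qed.

End GDer.

Definition cder (f : C -> C) (z l : C) : Prop := gder (T := C_UniformSpace) (fun w => w) f z l.
Definition rder (f : R -> C) (x : R) (l : C) : Prop := gder (T := R_UniformSpace) RtoC f x l.

Lemma cder_intro f z l :
  (forall eps, 0 < eps -> exists d, 0 < d /\ forall w, Cmod (w - z) < d ->
     Cmod (f w - f z - l * (w - z)) <= eps * Cmod (w - z)) -> cder f z l.
Proof.
  intros H. exists (fun w => if Ceq_dec w z then l else ((f w - f z) / (w - z))%C). split; [|split].
  - destruct (Ceq_dec z z); congruence.
  - intros eps He. assert (He2 : 0 < eps / 2) by lra. destruct (H _ He2) as [d [H0 Hd]]. apply locally_Cmod. exists d. split; [exact H0|]. intros w Hw.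
    destruct (Ceq_dec w z) as [E|E].
    + replace (l - l)%C with (RtoC 0) by ring. now rewrite Cmod_0.
    + assert (E' : (w - z)%C <> 0) by (intros E'; apply E; now apply Ceq_minus). pose proof (Cmod_pos _ E').
      replace ((f w - f z) / (w - z) - l)%C with ((f w - f z - l * (w - z)) / (w - z))%C by (field; auto).
      unfold Cdiv. rewrite Cmod_mult, Cmod_inv by auto. specialize (Hd w Hw). apply Rle_lt_trans with (eps / 2); [|lra].
      apply Rmult_le_reg_r with (Cmod (w - z)); [lra|]. rewrite Rmult_assoc, Rinv_l, Rmult_1_r; lra.
  - intros w. destruct (Ceq_dec w z) as [E|E].
    + rewrite E. ring.
    + assert (E' : (w - z)%C <> 0) by (intros E'; apply E; now apply Ceq_minus). field. auto.
Qed.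

Lemma cder_elim f z l : cder f z l ->
  (forall eps, 0 < eps -> exists d, 0 < d /\ forall w, Cmod (w - z) < d ->
     Cmod (f w - f z - l * (w - z)) <= eps * Cmod (w - z)).
Proof.
  intros [p [H1 [H2 H3]]] eps He. destruct (proj1 (locally_Cmod _ _) (H2 eps He)) as [d [H0 Hd]]. exists d. split; auto. intros w Hw. rewrite (H3 w).
  replace (f z + p w * (w - z) - f z - l * (w - z))%C with ((p w - l) * (w - z))%C by ring.
  rewrite Cmod_mult. apply Rmult_le_compat_r; [apply Cmod_ge_0|]. left. now apply Hd.
Qed.

Lemma cder_is_derive f z l :
  cder f z l <-> is_derive (K := C_AbsRing) (V := C_NormedModule) f z l.
Proof.
  split.
  - intros H. split; [apply is_linear_scal_l|]. intros x Hx. assert (x = z).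
    { symmetry. apply (is_filter_lim_locally_unique (K := C_AbsRing) (V := AbsRing_NormedModule C_AbsRing)). exact Hx. }
    subst x. intros eps. destruct (cder_elim _ _ _ H eps (cond_pos eps)) as [d [H0 Hd]]. exists (mkposreal _ H0). intros w Hw. specialize (Hd w Hw).
    change (Cmod (f w - f z - (w - z) * l)%C <= eps * Cmod (w - z)%C). now rewrite (Cmult_comm (w - z)).
  - intros [_ H]. apply cder_intro. intros eps He. specialize (H z (fun P HP => HP) (mkposreal _ He)).
    destruct H as [d Hd]. exists d. split; [apply cond_pos|]. intros w Hw. specialize (Hd w Hw).
    change (Cmod (f w - f z - (w - z) * l)%C <= eps * Cmod (w - z)%C) in Hd. now rewrite (Cmult_comm (w - z)) in Hd.
Qed.

Definition hol (f : C -> C) (z : C) : Prop :=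
  cnear z (fun w => exists l, cder f w l).

Lemma hol_holomorphic_at f z : hol f z <-> holomorphic_at f z.
Proof. unfold hol, holomorphic_at. split; apply filter_imp; intros w [l Hl]; exists l; now apply cder_is_derive. Qed.

Lemma cder_ccont f z l : cder f z l -> ccont f z.
Proof. apply gder_tends. apply tends_id. Qed.

Lemma hol_ccont f z : hol f z -> ccont f z.
Proof. intros H. apply locally_singleton in H. destruct H as [l Hl]. now apply cder_ccont in Hl. Qed.

Lemma rder_rcont f x l : rder f x l -> rcont f x.
Proof. apply (gder_tends RtoC f x l). apply tends_RtoC. Qed.

Lemma cder_inv (z : C) : z <> 0 -> cder Cinv z (- / (z * z))%C.
Proof.
  (* The slope has to work for every [w], also for [w = 0], where the inverse has only a default
     value. There the bare difference quotient is taken, which does not affect the limit at [z]. *)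
  intros Hz. exists (fun w => if Ceq_dec w 0 then ((/ w - / z) / (w - z))%C else (- / (w * z))%C). split; [|split].
  - destruct (Ceq_dec z 0); congruence.
  - apply tends_ext_F with (fun w => - / (w * z))%C; [apply _| |].
    + apply locally_Cmod. exists (Cmod z). split; [now apply Cmod_pos|]. intros w Hw.
      destruct (Ceq_dec w 0); auto. subst w. replace (0 - z)%C with (- z)%C in Hw by ring. rewrite Cmod_opp in Hw. lra.
    + apply tends_opp; [apply _|]. apply tends_inv; [apply _|now apply Cmult_neq_0|]. apply tends_mult; [apply _|apply tends_id|apply tends_const; apply _].
  - intros w. destruct (Ceq_dec w 0) as [E|E].
    + subst w. assert ((0 - z)%C <> 0). { intros E. apply Hz. replace z with (- (0 - z))%C by ring. rewrite E. ring. }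
      generalize (/ 0)%C. intros u. unfold Cdiv. rewrite <- Cmult_assoc, Cinv_l by assumption. ring.
    + field. auto.
Qed.

Lemma hol_pointwise1 (G : C -> C) f z :
  (forall w l, cder f w l -> exists l', cder (fun x => G (f x)) w l') -> hol f z -> hol (fun x => G (f x)) z.
Proof. intros H. unfold hol. apply filter_imp. intros w [l Hl]. eauto. Qed.

Lemma hol_const c z : hol (fun _ => c) z.
Proof. unfold hol. apply filter_forall. intros w. exists 0. apply gder_const. Qed.

Lemma hol_id z : hol (fun w => w) z.
Proof. unfold hol. apply filter_forall. intros w. exists 1. apply (gder_j (T := C_UniformSpace) (fun w => w)). Qed.

Lemma hol_plus f g z : hol f z -> hol g z -> hol (fun w => f w + g w)%C z.
Proof.
  unfold hol. intros Hf Hg. generalize (filter_and _ _ Hf Hg). apply filter_imp. intros w [[a Ha] [b Hb]]. exists (a + b)%C. now apply gder_plus.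
Qed.

Lemma hol_mult f g z : hol f z -> hol g z -> hol (fun w => f w * g w)%C z.
Proof.
  unfold hol. intros Hf Hg. generalize (filter_and _ _ Hf Hg). apply filter_imp. intros w [[a Ha] [b Hb]].
  exists (a * g w + f w * b)%C. apply gder_mult; auto. apply tends_id.
Qed.

Lemma hol_opp f z : hol f z -> hol (fun w => - f w)%C z.
Proof. apply (hol_pointwise1 Copp). intros w l Hl. exists (- l)%C. apply gder_opp; [apply tends_id|exact Hl]. Qed.

Lemma hol_minus f g z : hol f z -> hol g z -> hol (fun w => f w - g w)%C z.
Proof. intros. apply hol_plus; [assumption|now apply hol_opp]. Qed.

Lemma cder_comp f g z a b : cder f (g z) a -> cder g z b -> cder (fun w => f (g w)) z (a * b)%C.
Proof. intros. apply gder_comp; auto. apply tends_id. Qed.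

Lemma hol_comp f g z : hol f (g z) -> hol g z -> hol (fun w => f (g w)) z.
Proof.
  intros Hf Hg. pose proof (hol_ccont _ _ Hg) as Hc. apply locally_Cmod in Hf. destruct Hf as [d [H0 Hd]].
  unfold hol. generalize (filter_and _ _ Hg (Hc d H0)). unfold hol. apply filter_imp. intros w [[b Hb] Hw].
  destruct (Hd _ Hw) as [a Ha]. exists (a * b)%C. now apply cder_comp.
Qed.

Lemma hol_inv f z : hol f z -> f z <> 0 -> hol (fun w => / f w)%C z.
Proof.
  intros Hf Hz. apply (hol_comp Cinv f); [|exact Hf]. unfold hol. apply locally_Cmod. exists (Cmod (f z)). split; [now apply Cmod_pos|]. intros w Hw.
  exists (- / (w * w))%C. apply cder_inv. intros E. subst w. replace (0 - f z)%C with (- f z)%C in Hw by ring. rewrite Cmod_opp in Hw. lra.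
Qed.

Lemma hol_div f g z : hol f z -> hol g z -> g z <> 0 -> hol (fun w => f w / g w)%C z.
Proof. intros. apply hol_mult; [assumption|now apply hol_inv]. Qed.

Lemma hol_pow f z n : hol f z -> hol (fun w => f w ^ n)%C z.
Proof. intros H. induction n; simpl; [apply hol_const|now apply hol_mult]. Qed.

Lemma hol_locally f z : hol f z -> cnear z (fun w => hol f w).
Proof. intros H. now apply locally_locally in H. Qed.

Lemma hol_ext_loc f g z :
  cnear z (fun w => f w = g w) -> hol f z -> hol g z.
Proof.
  unfold hol. intros He Hf. apply locally_locally in He. generalize (filter_and _ _ He Hf). unfold hol. apply filter_imp.
  intros w [Hw [l Hl]]. exists l. apply cder_intro. intros eps Hp. destruct (cder_elim _ _ _ Hl eps Hp) as [d [H0 Hd]].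
  pose proof (locally_singleton _ _ Hw) as E. apply locally_Cmod in Hw. destruct Hw as [d' [H0' Hd']]. exists (Rmin d d'). split; [now apply Rmin_pos|]. intros y Hy.
  rewrite <- E, <- Hd' by (eapply Rlt_le_trans; [exact Hy|apply Rmin_r]). apply Hd. eapply Rlt_le_trans; [exact Hy|apply Rmin_l].
Qed.

Create HintDb cx.
#[local] Hint Resolve hol_const hol_id hol_plus hol_mult hol_opp hol_minus : cx.
#[local] Hint Extern 1 (tends _ (fun _ => ?c) ?c) => apply tends_const; apply _ : cx.
#[local] Hint Extern 2 (tends _ (fun _ => (_ + _)%C) _) => apply tends_plus; [apply _| |] : cx.
#[local] Hint Extern 2 (tends _ (fun _ => (_ - _)%C) _) => apply tends_minus; [apply _| |] : cx.
#[local] Hint Extern 2 (tends _ (fun _ => (_ * _)%C) _) => apply tends_mult; [apply _| |] : cx.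
Ltac cx := intros; solve [auto 15 with cx].
Ltac pos := intros; repeat first [ assumption | lra | apply Cmod_ge_0 | apply Rabs_pos | apply pos_INR
  | apply Rmult_le_pos | apply Rmult_lt_0_compat | apply pow_le | apply pow_lt | apply Rdiv_lt_0_compat
  | apply Rinv_0_lt_compat | apply Rmin_pos | apply exp_pos | left; apply exp_pos | left; apply Rinv_0_lt_compat ].

(** * The complex exponential *)

Lemma Cexp_plus (z w : C) : Cexp (z + w) = (Cexp z * Cexp w)%C.
Proof. unfold Cexp, Re, Im. simpl. rewrite exp_plus, cos_plus, sin_plus. ceq. Qed.

Lemma Cexp_0 : Cexp 0 = 1.
Proof. unfold Cexp. simpl. rewrite exp_0, cos_0, sin_0. ceq. Qed.

Lemma Cmod_Cexp (z : C) : Cmod (Cexp z) = exp (Re z).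
Proof.
  unfold Cmod, Cexp. simpl. replace (_ + _) with (Rsqr (exp (Re z)) * (Rsqr (sin (Im z)) + Rsqr (cos (Im z)))) by (unfold Rsqr; ring).
  rewrite sin2_cos2, Rmult_1_r. apply sqrt_Rsqr. pos.
Qed.

Lemma Cexp_nz (z : C) : Cexp z <> 0.
Proof. apply Cmod_gt_0. rewrite Cmod_Cexp. apply exp_pos. Qed.

Lemma Cexp_opp (z : C) : Cexp (- z) = (/ Cexp z)%C.
Proof.
  assert (H : (Cexp (- z) * Cexp z)%C = 1).
  { rewrite <- Cexp_plus. replace (- z + z)%C with (RtoC 0) by ring. apply Cexp_0. }
  pose proof (Cexp_nz z). replace (Cexp (- z)) with (Cexp (- z) * Cexp z * / Cexp z)%C by (field; auto). rewrite H. ring.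
Qed.

Lemma Cexp_R (x : R) : Cexp (RtoC x) = RtoC (exp x).
Proof. unfold Cexp, RtoC. simpl. now rewrite cos_0, sin_0, Rmult_1_r, Rmult_0_r. Qed.

(** Both bounds come from [1 + y <= exp y], taken at [x] and at [- x]; the second one is
    inverted. *)
Lemma exp_second_order (x : R) : Rabs x <= 1 / 2 -> Rabs (exp x - 1 - x) <= 2 * (x * x).
Proof.
  intros H. apply Rabs_le_between in H. pose proof (exp_ineq1_le x). pose proof (exp_ineq1_le (- x)) as H1. rewrite exp_Ropp in H1.
  assert (K2 : exp x * (1 - x) <= 1).
  { apply Rmult_le_compat_l with (r := exp x) in H1; [|lra]. rewrite Rinv_r in H1; lra. }
  rewrite Rabs_pos_eq by lra. nra.
Qed.

Lemma cos_second_order (y : R) : Rabs (cos y - 1) <= y * y.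
Proof.
  replace (cos y) with (cos (2 * (y / 2))) by (f_equal; field). rewrite cos_2a_sin. assert (Rabs (sin (y / 2)) <= Rabs (y / 2)).
  { destruct (MVT_gen sin 0 (y / 2) cos) as [c [_ Hc]].
    - intros. auto_derive; auto. ring.
    - intros. apply continuity_pt_filterlim, continuous_sin.
    - rewrite sin_0, !Rminus_0_r in Hc. rewrite Hc, Rabs_mult. pose proof (COS_bound c).
      assert (Rabs (cos c) <= 1) by (apply Rabs_le; lra). pose proof (Rabs_pos (y / 2)). nra. }
  apply Rsqr_le_abs_1 in H. unfold Rsqr in H. apply Rabs_le. nra.
Qed.

Lemma sin_second_order (y : R) : Rabs y <= 1 -> Rabs (sin y - y) <= y * y.
Proof.
  intros Hy. destruct (MVT_gen (fun u => sin u - u) 0 y (fun u => cos u - 1)) as [c [Hc1 Hc]].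
  - intros. auto_derive; auto. ring.
  - intros. apply continuity_pt_minus; [apply continuity_sin|apply derivable_continuous, derivable_id].
  - rewrite sin_0, !Rminus_0_r in Hc. rewrite Hc, Rabs_mult. pose proof (cos_second_order c). pose proof (Rabs_pos y). assert (c * c <= y * y).
    { unfold Rmin, Rmax in Hc1. destruct (Rle_dec 0 y); nra. }
    nra.
Qed.

(** The explicit quadratic error gives the derivative of [Cexp], and later differentiation under the
    integral sign in [exp_int_cder]. *)
Lemma Cexp_second_order (w : C) : Cmod w <= 1 / 2 -> Cmod (Cexp w - 1 - w) <= 10 * (Cmod w * Cmod w).
Proof.
  intros H. destruct w as [x y]. pose proof (Rabs_fst_le (x, y)) as Hx. pose proof (Rabs_snd_le (x, y)) as Hy. simpl in Hx, Hy.
  eapply Rle_trans; [apply Cmod_le_sum|]. simpl. set (m := Cmod (x, y)) in *. pose proof (Rabs_pos x). pose proof (Rabs_pos y).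
  assert (E1 := exp_second_order x ltac:(lra)). assert (E2 := cos_second_order y). assert (E3 := sin_second_order y ltac:(lra)).
  assert (xx : x * x = Rabs x * Rabs x) by (rewrite <- Rabs_mult; symmetry; apply Rabs_pos_eq; nra).
  assert (yy : y * y = Rabs y * Rabs y) by (rewrite <- Rabs_mult; symmetry; apply Rabs_pos_eq; nra).
  replace (exp x * cos y + - (1) + - x) with ((exp x - 1 - x) * cos y + (1 + x) * (cos y - 1)) by ring.
  replace (exp x * sin y + - 0 + - y) with ((exp x - 1) * sin y + (sin y - y)) by ring. pose proof (COS_bound y).
  assert (C1 : Rabs (cos y) <= 1) by (apply Rabs_le; lra). assert (S1 : Rabs (sin y) <= 2 * m).
  { replace (sin y) with ((sin y - y) + y) by ring. rtri. nra. }
  assert (X1 : Rabs (exp x - 1) <= 2 * m).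
  { replace (exp x - 1) with ((exp x - 1 - x) + x) by ring. rtri. nra. }
  assert (X2 : Rabs (1 + x) <= 2) by (apply Rabs_le_between in Hx; apply Rabs_le; lra). pose proof (Rabs_pos (sin y)). pose proof (Rabs_pos (cos y)).
  pose proof (Rabs_pos (1 + x)). assert (T1 : Rabs (exp x - 1 - x) * Rabs (cos y) <= 2 * (m * m)) by nra.
  assert (T2 : Rabs (1 + x) * Rabs (cos y - 1) <= 2 * (m * m)) by nra. assert (T3 : Rabs (exp x - 1) * Rabs (sin y) <= 4 * (m * m)) by nra.
  assert (T4 : Rabs (sin y - y) <= m * m) by nra. rewrite <- !Rabs_mult in *.
  eapply Rle_trans; [apply Rplus_le_compat; apply Rabs_triang|]. assert (0 <= m * m) by nra. lra.
Qed.

Lemma cder_Cexp (z : C) : cder Cexp z (Cexp z).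
Proof.
  apply cder_intro. intros eps He. pose proof (Cmod_pos _ (Cexp_nz z)) as Hp. exists (Rmin (1 / 2) (eps / (10 * Cmod (Cexp z)))). split.
  - pos.
  - intros w Hw. replace w with (z + (w - z))%C at 1 by ring. rewrite Cexp_plus. set (d := (w - z)%C) in *.
    replace (Cexp z * Cexp d - Cexp z - Cexp z * d)%C with (Cexp z * (Cexp d - 1 - d))%C by ring.
    rewrite Cmod_mult. pose proof (Rmin_l (1 / 2) (eps / (10 * Cmod (Cexp z)))). pose proof (Rmin_r (1 / 2) (eps / (10 * Cmod (Cexp z)))).
    pose proof (Cexp_second_order d ltac:(lra)). assert (E : eps / (10 * Cmod (Cexp z)) * (10 * Cmod (Cexp z)) = eps) by (field; lra).
    set (q := eps / (10 * Cmod (Cexp z))) in *. apply Rle_trans with (Cmod (Cexp z) * (10 * (Cmod d * Cmod d))).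
    + apply Rmult_le_compat_l; lra.
    + rewrite <- E. assert (0 <= Cmod (Cexp z) * Cmod d) by pos. nra.
Qed.

Lemma hol_Cexp (f : C -> C) z : hol f z -> hol (fun w => Cexp (f w)) z.
Proof. apply (hol_pointwise1 Cexp). intros w l Hl. exists (Cexp (f w) * l)%C. apply cder_comp; [apply cder_Cexp|exact Hl]. Qed.

Lemma ccont_Cexp (z : C) : ccont Cexp z.
Proof. eapply cder_ccont, cder_Cexp. Qed.

Lemma e_plus (x y : C) : e (x + y) = (e x * e y)%C.
Proof. unfold e. rewrite <- Cexp_plus. f_equal. ring. Qed.

Lemma e_R (x : R) : e (RtoC x) = (cos (2 * PI * x), sin (2 * PI * x)).
Proof.
  unfold e, Cexp. simpl. replace (((2 * PI - 0 * 0) * 0 - (2 * 0 + 0 * PI) * 1) * x - ((2 * PI - 0 * 0) * 1 + (2 * 0 + 0 * PI) * 0) * 0)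
    with 0 by ring.
  replace (((2 * PI - 0 * 0) * 0 - (2 * 0 + 0 * PI) * 1) * 0 + ((2 * PI - 0 * 0) * 1 + (2 * 0 + 0 * PI) * 0) * x)
    with (2 * PI * x) by ring.
  rewrite exp_0. now rewrite !Rmult_1_l.
Qed.

Lemma e_0 : e 0 = 1.
Proof. rewrite e_R, Rmult_0_r, cos_0, sin_0. reflexivity. Qed.

Lemma e_opp (x : C) : e (- x) = (/ e x)%C.
Proof. unfold e. rewrite <- Cexp_opp. f_equal. ring. Qed.

Lemma e_nz (x : C) : e x <> 0.
Proof. apply Cexp_nz. Qed.

Lemma Cmod_e (x : R) : Cmod (e (RtoC x)) = 1.
Proof.
  rewrite e_R. unfold Cmod. simpl. replace (_ + _) with (Rsqr (sin (2 * PI * x)) + Rsqr (cos (2 * PI * x))) by (unfold Rsqr; ring). rewrite sin2_cos2. apply sqrt_1.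
Qed.

Lemma e_nat (n : nat) : e (INR n)%R = 1.
Proof. rewrite e_R. replace (2 * PI * INR n) with (0 + 2 * INR n * PI) by ring. rewrite cos_period, sin_period, cos_0, sin_0. reflexivity. Qed.

Lemma e_Z (k : Z) : e (IZR k)%R = 1.
Proof.
  destruct (Z_le_gt_dec 0 k) as [H|H].
  - rewrite <- (Z2Nat.id k H), <- INR_IZR_INZ. apply e_nat.
  - replace k with (- Z.of_nat (Z.to_nat (- k)))%Z by lia. rewrite opp_IZR, <- INR_IZR_INZ, RtoC_opp, e_opp, e_nat. field.
Qed.

Lemma e_plus_Z (x : R) (k : Z) : e (x + IZR k)%R = e (RtoC x).
Proof. rewrite RtoC_plus, e_plus, e_Z. ring. Qed.

(** * Argument, logarithm and powers *)

(** The plane cut along the nonpositive real axis, where the principal logarithm is holomorphic. *)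
Definition slit (z : C) : Prop := 0 < Re z \/ Im z <> 0.
Definition Log (z : C) : C := (ln (Cmod z), arg_p z).

Lemma slit_nz (z : C) : slit z -> z <> 0.
Proof. intros [H|H] E; subst z; simpl in H; lra. Qed.

Lemma arg_p_unique (z : C) (t : R) : z <> 0 -> - PI < t <= PI ->
  Cmod z * cos t = Re z -> Cmod z * sin t = Im z -> arg_p z = t.
Proof.
  intros Hz Ht Hc Hs. apply Cmod_pos in Hz. unfold arg_p. replace (Re z / Cmod z) with (cos t) by (rewrite <- Hc; field; lra). destruct (Rle_dec 0 (Im z)) as [H|H].
  - assert (0 <= t).
    { apply Rnot_lt_le. intros Hn. assert (sin (- t) > 0) by (apply sin_gt_0; lra). rewrite sin_neg in H0. nra. }
    apply acos_cos. lra.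
  - assert (t < 0).
    { apply Rnot_le_lt. intros Hn. assert (0 <= sin t) by (apply sin_ge_0; lra). nra. }
    rewrite <- (cos_neg t). rewrite acos_cos; lra.
Qed.

Lemma arg_p_bound (z : C) : - PI <= arg_p z <= PI.
Proof. unfold arg_p. pose proof (acos_bound (Re z / Cmod z)). destruct (Rle_dec 0 (Im z)); lra. Qed.

Lemma arg_p_spec (z : C) : z <> 0 -> Cmod z * cos (arg_p z) = Re z /\ Cmod z * sin (arg_p z) = Im z.
Proof.
  intros Hz. apply Cmod_pos in Hz. assert (Hb : -1 <= Re z / Cmod z <= 1).
  { pose proof (Rabs_fst_le z) as H. apply Rabs_le_between in H. unfold Re. split; [apply Rmult_le_reg_r with (Cmod z)|apply Rmult_le_reg_r with (Cmod z)]; try lra;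
    unfold Rdiv; rewrite Rmult_assoc, Rinv_l by lra; lra. }
  assert (Hsq : Cmod z * sqrt (1 - (Re z / Cmod z)²) = Rabs (Im z)).
  { rewrite <- (sqrt_Rsqr (Cmod z)) at 1 by lra. rewrite <- sqrt_mult_alt by apply Rle_0_sqr. rewrite <- sqrt_Rsqr_abs. f_equal. unfold Rsqr.
    assert (Hm : Cmod z * Cmod z = Re z * Re z + Im z * Im z).
    { unfold Cmod. rewrite sqrt_sqrt; [unfold Re, Im; ring|]. nra. }
    replace (Im z * Im z) with (Cmod z * Cmod z - Re z * Re z) by lra. field. lra. }
  unfold arg_p. destruct (Rle_dec 0 (Im z)) as [H|H].
  - rewrite cos_acos by lra. rewrite sin_acos by lra. rewrite Hsq, Rabs_pos_eq by lra. split; [field; lra|lra].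
  - rewrite cos_neg, sin_neg, cos_acos, sin_acos by lra. split; [field; lra|]. rewrite Ropp_mult_distr_r_reverse, Hsq, Rabs_left by lra. ring.
Qed.

Lemma Cexp_Log (z : C) : z <> 0 -> Cexp (Log z) = z.
Proof.
  intros Hz. destruct (arg_p_spec z Hz) as [H1 H2]. apply Cmod_pos in Hz. unfold Cexp, Log. simpl. rewrite exp_ln by exact Hz. rewrite H1, H2. now destruct z.
Qed.

Lemma Log_Cexp w : - PI < Im w <= PI -> Log (Cexp w) = w.
Proof.
  intros H. unfold Log. rewrite Cmod_Cexp, ln_exp. rewrite (arg_p_unique _ (Im w)).
  - now destruct w.
  - apply Cexp_nz.
  - exact H.
  - now rewrite Cmod_Cexp.
  - now rewrite Cmod_Cexp.
Qed.

Lemma Log_unique w z : - PI < Im w <= PI -> Cexp w = z -> Log z = w.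
Proof. intros H <-. now apply Log_Cexp. Qed.

Lemma slit_den (z : C) : slit z -> 0 < Cmod z + Re z.
Proof.
  intros H. pose proof (Rabs_fst_le z) as H1. change (fst z) with (Re z) in H1. apply Rabs_le_between in H1. destruct H as [H|H].
  - lra.
  - destruct (Req_dec (Cmod z + Re z) 0) as [E|E]; [|lra]. exfalso. apply H. assert (Hm : Cmod z * Cmod z = Re z * Re z + Im z * Im z).
    { unfold Cmod. rewrite sqrt_sqrt; [unfold Re, Im; ring|]. nra. }
    nra.
Qed.

(** The half-angle formula is a single expression on the whole cut plane, while the definition
    through [acos] changes form across the positive axis. Continuity of [Log] follows from it
    without cases. *)
Lemma arg_p_atan (z : C) : slit z -> arg_p z = 2 * atan (Im z / (Cmod z + Re z)).
Proof.
  intros Hs. pose proof (slit_den z Hs) as Hd. pose proof (slit_nz z Hs) as Hz. assert (Hm : Cmod z * Cmod z = Re z * Re z + Im z * Im z).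
  { unfold Cmod. rewrite sqrt_sqrt; [unfold Re, Im; ring|]. nra. }
  set (q := Im z / (Cmod z + Re z)). assert (Hq : 1 + q² = 2 * Cmod z / (Cmod z + Re z)).
  { unfold q, Rsqr. apply Rmult_eq_reg_r with ((Cmod z + Re z) * (Cmod z + Re z)); [|nra]. field_simplify; [|lra|lra]. nra. }
  pose proof (Cmod_pos z Hz) as Hp. assert (Hq0 : 0 < 1 + q²) by (pose proof (Rle_0_sqr q); lra).
  assert (Hs2 : sqrt (1 + q²) * sqrt (1 + q²) = 1 + q²) by (apply sqrt_sqrt; lra). pose proof (sqrt_lt_R0 _ Hq0) as Hs0. pose proof (atan_bound q) as Hb.
  apply arg_p_unique; auto; [lra| |].
  - rewrite cos_2a_cos, cos_atan. replace (2 * (1 / sqrt (1 + q²)) * (1 / sqrt (1 + q²)) - 1) with (2 / (1 + q²) - 1).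
    + rewrite Hq. field. lra.
    + rewrite <- Hs2 at 1. field. lra.
  - rewrite sin_2a, cos_atan, sin_atan. replace (2 * (q / sqrt (1 + q²)) * (1 / sqrt (1 + q²))) with (2 * q / (1 + q²)).
    + rewrite Hq. unfold q. field. lra.
    + rewrite <- Hs2 at 1. field. lra.
Qed.

Lemma slit_open (z : C) : slit z -> cnear z slit.
Proof.
  intros H. apply locally_Cmod. destruct H as [H|H].
  - exists (Re z). split; [exact H|]. intros w Hw. left. pose proof (Rabs_fst_le (w - z)) as H1. change (fst (w - z)%C) with (Re w - Re z) in H1.
    apply Rabs_le_between in H1. lra.
  - exists (Rabs (Im z)). split; [now apply Rabs_pos_lt|]. intros w Hw. right. intros E.
    pose proof (Rabs_snd_le (w - z)) as H1. change (snd (w - z)%C) with (Im w - Im z) in H1. rewrite E, Rminus_0_l, Rabs_Ropp in H1. lra.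
Qed.

Lemma tends_Cmod {T} (F : (T -> Prop) -> Prop) {FF : Filter F} (f : T -> C) l :
  tends F f l -> filterlim (fun x => Cmod (f x)) F (locally (Cmod l)).
Proof.
  intros H P HP. apply locally_R in HP. destruct HP as [d [H0 Hd]]. unfold filtermap. generalize (H d H0). apply filter_imp. intros x Hx. apply Hd. apply Rabs_def1.
  - eapply Rle_lt_trans; [apply Cmod_triangle_inv|exact Hx].
  - pose proof (Cmod_triangle_inv l (f x)). rewrite Cmod_minus_sym in H1. lra.
Qed.

Lemma ccont_Log (z : C) : slit z -> ccont Log z.
Proof.
  intros Hs. pose proof (slit_nz z Hs) as Hz. pose proof (slit_den z Hs) as Hd. apply (tends_pair (cnear z)).
  - unfold Log at 2. cbn [fst]. apply (filterlim_comp _ _ _ Cmod ln _ (locally (Cmod z))).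
    + apply (tends_Cmod (cnear z) (fun x => x)), tends_id.
    + apply continuity_pt_filterlim. apply derivable_continuous_pt. exists (/ Cmod z). apply derivable_pt_lim_ln. now apply Cmod_pos.
  - unfold Log at 2. cbn [snd]. apply filterlim_ext_loc with (fun w => 2 * atan (Im w / (Cmod w + Re w))).
    + generalize (slit_open z Hs). apply filter_imp. intros w Hw. unfold Log. cbn [snd]. symmetry. now apply arg_p_atan.
    + rewrite arg_p_atan by assumption. assert (Tid := tends_id z). pose proof (tends_fst _ _ _ Tid) as T1. pose proof (tends_snd _ _ _ Tid) as T2.
      pose proof (tends_Cmod _ _ _ Tid) as T3. assert (T4 : filterlim (fun w : C => Im w / (Cmod w + Re w)) (cnear z)
                   (locally (Im z / (Cmod z + Re z)))).
      { assert (H1 : filterlim (fun w : C => Cmod w + Re w) (cnear z) (locally (Cmod z + Re z))).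
        { eapply filterlim_comp_2; [exact T3|exact T1|apply (filterlim_plus (V := R_NormedModule) (Cmod z) (Re z))]. }
        assert (H2 : filterlim (fun w : C => / (Cmod w + Re w)) (cnear z) (locally (/ (Cmod z + Re z)))).
        { eapply filterlim_comp; [exact H1|]. apply continuity_pt_filterlim.
          apply (continuity_pt_inv (fun x => x)); [apply derivable_continuous_pt, derivable_pt_id|lra]. }
        unfold Rdiv. eapply (filterlim_comp_2 _ _ Rmult); [exact T2|exact H2|apply (filterlim_mult (K := R_AbsRing) (Im z) (/ (Cmod z + Re z)))]. }
      apply (filterlim_comp _ _ _ (fun w : C => Im w / (Cmod w + Re w)) (fun x => 2 * atan x) _ _ _ T4).
      apply (continuity_pt_filterlim (fun x => 2 * atan x)). apply derivable_continuous_pt. apply derivable_pt_scal. apply derivable_pt_atan.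
Qed.

(** Inverse function rule in Caratheodory form: the slope function of [Cexp] at [Log z], composed
    with the continuous [Log], tends to [z], and its inverse is the slope function of [Log]. *)
Lemma cder_Log (z : C) : slit z -> cder Log z (/ z)%C.
Proof.
  intros Hs. pose proof (slit_nz z Hs) as Hz. destruct (cder_Cexp (Log z)) as [p [H1 [H2 H3]]]. assert (Hc : tends (cnear z) (fun w => p (Log w)) (Cexp (Log z))).
  { intros eps He. specialize (H2 eps He). apply locally_Cmod in H2. destruct H2 as [d [H0 Hd]]. generalize (ccont_Log z Hs d H0). apply filter_imp. cx. }
  rewrite Cexp_Log in Hc by exact Hz. exists (fun w => if Ceq_dec w z then (/ z)%C else ((Log w - Log z) / (w - z))%C). split; [|split].
  - destruct (Ceq_dec z z); congruence.
  - apply tends_ext_F with (fun w => / p (Log w))%C; [apply _| |apply tends_inv; [apply _|exact Hz|exact Hc]].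
    generalize (filter_and _ _ (slit_open z Hs) (Hc _ (Cmod_pos z Hz))). apply filter_imp. intros w [Hw Hw2]. assert (Hp : p (Log w) <> 0).
    { intros E. rewrite E in Hw2. replace (0 - z)%C with (- z)%C in Hw2 by ring. rewrite Cmod_opp in Hw2. lra. }
    destruct (Ceq_dec w z) as [E|E].
    + subst w. rewrite H1, Cexp_Log; auto.
    + pose proof (H3 (Log w)) as Hq. rewrite !Cexp_Log in Hq by (try exact Hz; now apply slit_nz).
      assert (E' : (w - z)%C <> 0) by (intros E'; apply E; now apply Ceq_minus).
      assert (Ed : (w - z)%C = (p (Log w) * (Log w - Log z))%C) by (rewrite Hq at 1; ring). rewrite Ed. assert ((Log w - Log z)%C <> 0).
      { intros E2. apply E'. rewrite Ed, E2. ring. }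
      field. auto.
  - intros w. destruct (Ceq_dec w z) as [E|E].
    + rewrite E. ring.
    + assert (E' : (w - z)%C <> 0) by (intros E'; apply E; now apply Ceq_minus). field. auto.
Qed.

Lemma hol_Log (f : C -> C) z : slit (f z) -> hol f z -> hol (fun w => Log (f w)) z.
Proof. intros Hs. apply hol_comp. unfold hol. generalize (slit_open _ Hs). apply filter_imp. intros w Hw. exists (/ w)%C. now apply cder_Log. Qed.

Lemma cpow_Log (z : C) w : cpow z w = Cexp (w * Log z).
Proof. reflexivity. Qed.

Lemma cpow_plus (z : C) a b : cpow z (a + b) = (cpow z a * cpow z b)%C.
Proof. rewrite !cpow_Log, <- Cexp_plus. f_equal. ring. Qed.

Lemma cpow_1 (z : C) : z <> 0 -> cpow z 1 = z.
Proof. intros H. rewrite cpow_Log, Cmult_1_l. now apply Cexp_Log. Qed.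

Lemma cpow_0 (z : C) : cpow z 0 = 1.
Proof. rewrite cpow_Log, Cmult_0_l. apply Cexp_0. Qed.

Lemma cpow_nz (z w : C) : cpow z w <> 0.
Proof. apply Cexp_nz. Qed.

Lemma cpow_opp (z : C) w : cpow z (- w) = (/ cpow z w)%C.
Proof. rewrite !cpow_Log, <- Cexp_opp. f_equal. ring. Qed.

Lemma cpow_nat (z : C) n : z <> 0 -> cpow z (RtoC (INR n)) = (z ^ n)%C.
Proof.
  intros H. induction n.
  - simpl. apply cpow_0.
  - rewrite S_INR, RtoC_plus, cpow_plus, IHn, cpow_1 by exact H. simpl. ring.
Qed.

Lemma Log_pos (x : R) : 0 < x -> Log (RtoC x) = RtoC (ln x).
Proof.
  intros H. apply Log_unique.
  - simpl. pose proof PI_RGT_0. lra.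
  - rewrite Cexp_R, exp_ln; auto.
Qed.

Lemma cpow_pos (x : R) w : 0 < x -> cpow (RtoC x) w = Cexp (w * RtoC (ln x)).
Proof. intros H. now rewrite cpow_Log, Log_pos. Qed.

Lemma Cmod_cpow (z : C) w : Cmod (cpow z w) = exp (Re w * ln (Cmod z) - Im w * arg_p z).
Proof. rewrite cpow_Log, Cmod_Cexp. reflexivity. Qed.

Lemma Cmod_cpow_le (z : C) w : Cmod (cpow z w) <= Rpower (Cmod z) (Re w) * exp (PI * Rabs (Im w)).
Proof.
  rewrite Cmod_cpow. unfold Rpower. rewrite <- exp_plus. assert (H : - (Im w * arg_p z) <= PI * Rabs (Im w)).
  { pose proof (Rle_abs (- (Im w * arg_p z))) as H1. rewrite Rabs_Ropp, Rabs_mult in H1.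
    pose proof (arg_p_bound z) as H2. assert (Rabs (arg_p z) <= PI) by (apply Rabs_le; lra). pose proof (Rabs_pos (Im w)). nra. }
  destruct (Rle_lt_or_eq_dec (Re w * ln (Cmod z) - Im w * arg_p z) (Re w * ln (Cmod z) + PI * Rabs (Im w))) as [H1|H1];
    [lra|left; now apply exp_increasing|right; now rewrite H1].
Qed.

Lemma Cmod_cpow_pos (x : R) w : 0 < x -> Cmod (cpow (RtoC x) w) = Rpower x (Re w).
Proof. intros H. rewrite cpow_pos, Cmod_Cexp by exact H. unfold Rpower. f_equal. simpl. unfold Re. ring. Qed.

Lemma cder_cpow_base (a b : C) : slit b -> cder (fun z => cpow z a) b (a * cpow b (a - 1))%C.
Proof.
  intros Hs. pose proof (slit_nz b Hs) as Hb. assert (H : cder (fun z => Cexp (a * Log z)) b (Cexp (a * Log b) * (0 * Log b + a * / b))%C).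
  { apply (cder_comp Cexp (fun z => (a * Log z)%C)); [apply cder_Cexp|].
    apply (gder_mult (T := C_UniformSpace) (fun w => w) (fun _ => a) Log); [apply tends_id|apply gder_const|now apply cder_Log]. }
  unfold cder in *. eapply gder_eq; [|exact H]. unfold Cminus. rewrite cpow_plus, cpow_opp, cpow_1 by exact Hb. rewrite cpow_Log. ring.
Qed.

Lemma hol_cpow_exp (f : C -> C) b z : hol f z -> hol (fun s => cpow b (f s)) z.
Proof. intros H. apply (hol_Cexp (fun s => (f s * Log b)%C)). cx. Qed.

Lemma hol_cpow_base (f : C -> C) a z : slit (f z) -> hol f z -> hol (fun w => cpow (f w) a) z.
Proof. intros H1 H. apply (hol_Cexp (fun w => (a * Log (f w))%C)). apply hol_mult; [cx|now apply hol_Log]. Qed.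

Lemma hol_Csin (f : C -> C) z : hol f z -> hol (fun s => Csin (f s)) z.
Proof. intros H. unfold Csin, Cdiv. apply hol_mult; [|cx]. apply hol_minus; apply hol_Cexp; [|cx]; apply hol_mult; auto using hol_const. Qed.

#[local] Hint Resolve hol_cpow_exp hol_Cexp hol_Csin : cx.

(** * Goursat and Cauchy *)

Definition CInt (g : R -> C) (a b : R) : C := RInt (V := C_R_CompleteNormedModule) g a b.
Definition con (g : R -> C) (a b : R) : Prop := forall t, a <= t <= b -> rcont g t.

Lemma norm_C_R (z : C) : norm (K := R_AbsRing) (V := C_R_NormedModule) z = Cmod z.
Proof. change (norm (K := R_AbsRing) (V := C_R_NormedModule) z) with (sqrt (Rabs (fst z) ^ 2 + Rabs (snd z) ^ 2)). now rewrite !pow2_abs. Qed.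

Lemma con_ex (g : R -> C) a b : a <= b -> con g a b -> ex_RInt (V := C_R_NormedModule) g a b.
Proof.
  intros Hab H. apply (ex_RInt_continuous (V := C_R_CompleteNormedModule)).
  rewrite Rmin_left, Rmax_right by exact Hab. intros t Ht. apply rcont_continuous. now apply H.
Qed.

Lemma CInt_is (g : R -> C) a b : a <= b -> con g a b -> is_RInt (V := C_R_NormedModule) g a b (CInt g a b).
Proof. intros Hab H. apply (RInt_correct (V := C_R_CompleteNormedModule)). now apply con_ex. Qed.

Lemma CInt_eq (g : R -> C) a b l : is_RInt (V := C_R_NormedModule) g a b l -> CInt g a b = l.
Proof. apply (is_RInt_unique (V := C_R_CompleteNormedModule)). Qed.

Lemma CInt_ext (f g : R -> C) a b : a <= b -> (forall t, a <= t <= b -> f t = g t) -> CInt f a b = CInt g a b.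
Proof. intros Hab H. apply (RInt_ext (V := C_R_CompleteNormedModule)). rewrite Rmin_left, Rmax_right by exact Hab. intros t Ht. apply H. lra. Qed.

Lemma CInt_plus (f g : R -> C) a b : a <= b -> con f a b -> con g a b ->
  CInt (fun t => f t + g t)%C a b = (CInt f a b + CInt g a b)%C.
Proof. intros Hab Hf Hg. apply CInt_eq. apply (is_RInt_plus (V := C_R_NormedModule)); now apply CInt_is. Qed.

Lemma CInt_scal (c : C) (g : R -> C) a b : a <= b -> con g a b ->
  CInt (fun t => c * g t)%C a b = (c * CInt g a b)%C.
Proof.
  intros Hab Hg. apply CInt_eq. pose proof (CInt_is _ _ _ Hab Hg) as H.
  pose proof (is_RInt_fct_extend_fst (U := R_NormedModule) (V := R_NormedModule) _ _ _ _ H) as H1.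
  pose proof (is_RInt_fct_extend_snd (U := R_NormedModule) (V := R_NormedModule) _ _ _ _ H) as H2.
  apply (is_RInt_fct_extend_pair (U := R_NormedModule) (V := R_NormedModule)).
  - apply (is_RInt_minus (V := R_NormedModule) (fun t => fst c * fst (g t)) (fun t => snd c * snd (g t)));
    now apply (is_RInt_scal (V := R_NormedModule)).
  - apply (is_RInt_plus (V := R_NormedModule) (fun t => fst c * snd (g t)) (fun t => snd c * fst (g t)));
    now apply (is_RInt_scal (V := R_NormedModule)).
Qed.

Lemma con_const c a b : con (fun _ => c) a b.
Proof. intros t _. apply tends_const; apply _. Qed.
Lemma con_plus f g a b : con f a b -> con g a b -> con (fun t => f t + g t)%C a b.
Proof. intros Hf Hg t Ht. apply tends_plus; [apply _|now apply Hf|now apply Hg]. Qed.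
Lemma con_mult f g a b : con f a b -> con g a b -> con (fun t => f t * g t)%C a b.
Proof. intros Hf Hg t Ht. apply tends_mult; [apply _|now apply Hf|now apply Hg]. Qed.
Lemma con_opp f a b : con f a b -> con (fun t => - f t)%C a b.
Proof. intros Hf t Ht. apply tends_opp; [apply _|now apply Hf]. Qed.
Lemma con_minus f g a b : con f a b -> con g a b -> con (fun t => f t - g t)%C a b.
Proof. intros Hf Hg. apply con_plus; [exact Hf|now apply con_opp]. Qed.
Lemma con_inv (f : R -> C) a b : con f a b -> (forall t, a <= t <= b -> f t <> 0) -> con (fun t => / f t)%C a b.
Proof. intros Hf Hz t Ht. apply tends_inv; [apply _|cx|now apply Hf]. Qed.
Lemma con_div (f g : R -> C) a b : con f a b -> con g a b -> (forall t, a <= t <= b -> g t <> 0) ->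
  con (fun t => f t / g t)%C a b.
Proof. intros Hf Hg Hz. apply con_mult; [exact Hf|now apply con_inv]. Qed.
Lemma con_comp (f : C -> C) g a b : con g a b -> (forall t, a <= t <= b -> ccont f (g t)) -> con (fun t => f (g t)) a b.
Proof. intros Hg Hf t Ht. apply (tends_comp (locally t) f g); auto. now apply Hg. Qed.
Lemma con_sub f a b c d : con f a b -> a <= c -> d <= b -> con f c d.
Proof. intros Hf H1 H2 t Ht. apply Hf. lra. Qed.
#[local] Hint Resolve con_const con_plus con_mult con_opp con_minus : cx.

Lemma con_rder f df a b : (forall t, a <= t <= b -> rder f t (df t)) -> con f a b.
Proof. intros H t Ht. eapply rder_rcont. now apply H. Qed.

Lemma CInt_minus (f g : R -> C) a b : a <= b -> con f a b -> con g a b ->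
  CInt (fun t => f t - g t)%C a b = (CInt f a b - CInt g a b)%C.
Proof. intros Hab Hf Hg. apply CInt_eq. apply (is_RInt_minus (V := C_R_NormedModule)); now apply CInt_is. Qed.

Lemma CInt_const (c : C) a b : CInt (fun _ => c) a b = (RtoC (b - a) * c)%C.
Proof. unfold CInt. rewrite RInt_const. apply injective_projections; simpl; unfold scal; simpl; unfold mult; simpl; ring. Qed.

Lemma CInt_bound (g : R -> C) a b M : a <= b -> con g a b ->
  (forall t, a <= t <= b -> Cmod (g t) <= M) -> Cmod (CInt g a b) <= (b - a) * M.
Proof.
  intros Hab Hg HM. rewrite <- norm_C_R. apply (norm_RInt_le_const (V := C_R_NormedModule) g a b (CInt g a b) M Hab).
  - intros t Ht. rewrite norm_C_R. now apply HM.
  - now apply CInt_is.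
Qed.

Lemma CInt_Chasles (g : R -> C) a b c : a <= b -> b <= c -> con g a c ->
  (CInt g a b + CInt g b c)%C = CInt g a c.
Proof.
  intros H1 H2 Hg. apply (RInt_Chasles (V := C_R_CompleteNormedModule)); apply con_ex; auto;
  eapply con_sub; eauto; lra.
Qed.

Lemma rder_components f x l : rder f x l ->
  is_derive (fun t => fst (f t)) x (fst l) /\ is_derive (fun t => snd (f t)) x (snd l).
Proof.
  intros [p [H1 [H2 H3]]]. split; apply is_derive_Reals; intros eps He;
  destruct (proj1 (locally_R _ _) (H2 eps He)) as [d [H0 Hd]]; exists (mkposreal _ H0);
  intros h Hh Hhd; simpl in Hhd; specialize (Hd (x + h)); rewrite (H3 (x + h)).
  - eapply Rle_lt_trans; [|apply Hd; replace (x + h - x) with h by ring; exact Hhd]. eapply Rle_trans; [|apply Rabs_fst_le]. right. f_equal. simpl. field. exact Hh.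
  - eapply Rle_lt_trans; [|apply Hd; replace (x + h - x) with h by ring; exact Hhd]. eapply Rle_trans; [|apply Rabs_snd_le]. right. f_equal. simpl. field. exact Hh.
Qed.

Lemma CInt_FTC (G g : R -> C) a b : a <= b ->
  (forall t, a <= t <= b -> rder G t (g t)) -> con g a b -> CInt g a b = (G b - G a)%C.
Proof.
  intros Hab HG Hg. apply CInt_eq. apply (is_RInt_fct_extend_pair (U := R_NormedModule) (V := R_NormedModule)).
  - apply (is_RInt_derive (V := R_CompleteNormedModule) (fun t => fst (G t)) (fun t => fst (g t)));
    rewrite Rmin_left, Rmax_right by exact Hab; intros t Ht.
    + apply rder_components. now apply HG.
    + apply (tends_fst (locally t) g (g t)). now apply Hg.
  - apply (is_RInt_derive (V := R_CompleteNormedModule) (fun t => snd (G t)) (fun t => snd (g t)));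
    rewrite Rmin_left, Rmax_right by exact Hab; intros t Ht.
    + apply rder_components. now apply HG.
    + apply (tends_snd (locally t) g (g t)). now apply Hg.
Qed.

Lemma con_bounded (g : R -> C) a b : a <= b -> con g a b ->
  exists M, 0 < M /\ forall t, a <= t <= b -> Cmod (g t) <= M.
Proof.
  intros Hab Hg. destruct (ex_RInt_ub (V := C_R_NormedModule) g a b (con_ex _ _ _ Hab Hg)) as [M HM]. rewrite Rmin_left, Rmax_right in HM by exact Hab.
  exists (Rmax M 1). split; [eapply Rlt_le_trans; [|apply Rmax_r]; lra|]. intros t Ht. rewrite <- norm_C_R. eapply Rle_trans; [cx|apply Rmax_l].
Qed.

Lemma rder_RtoC t : rder RtoC t 1.
Proof. apply (gder_j (T := R_UniformSpace) RtoC). Qed.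

Lemma rder_comp f g t a b : cder f (g t) a -> rder g t b -> rder (fun u => f (g u)) t (a * b)%C.
Proof. intros. apply (gder_comp (T := R_UniformSpace) RtoC); auto. apply tends_RtoC. Qed.
Lemma rder_mult f g t a b : rder f t a -> rder g t b -> rder (fun u => f u * g u)%C t (a * g t + f t * b)%C.
Proof. intros. apply (gder_mult (T := R_UniformSpace) RtoC); auto. apply tends_RtoC. Qed.
Lemma rder_plus f g t a b : rder f t a -> rder g t b -> rder (fun u => f u + g u)%C t (a + b)%C.
Proof. apply (gder_plus (T := R_UniformSpace) RtoC). Qed.
Lemma rder_const c t : rder (fun _ => c) t 0.
Proof. apply (gder_const (T := R_UniformSpace) RtoC). Qed.
Lemma rder_scal c f t a : rder f t a -> rder (fun u => c * f u)%C t (c * a)%C.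
Proof. intros H. eapply gder_eq; [|apply (gder_mult (T := R_UniformSpace) RtoC); [apply tends_RtoC|apply gder_const|exact H]]. cbv beta. ring. Qed.
Lemma rder_eq f t a b : a = b -> rder f t a -> rder f t b.
Proof. apply gder_eq. Qed.
Lemma rder_ext f g t a : (forall u, f u = g u) -> rder f t a -> rder g t a.
Proof. apply gder_ext. Qed.

Section SquareInduction.
Variable P : R -> R -> R -> Prop.
Let sub a c h := 0 <= a /\ a + h <= 1 /\ 0 <= c /\ c + h <= 1.
Hypothesis Hquarter : forall a c h, 0 < h -> sub a c h ->
  P a c (h / 2) -> P (a + h / 2) c (h / 2) -> P a (c + h / 2) (h / 2) ->
  P (a + h / 2) (c + h / 2) (h / 2) -> P a c h.
Hypothesis Hlocal : forall x y, 0 <= x <= 1 -> 0 <= y <= 1 -> exists d, 0 < d /\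
  forall a c h, 0 < h < d -> sub a c h -> a <= x <= a + h -> c <= y <= c + h -> P a c h.

(** The last quarter is returned without a test: if the other three satisfy [P] and the whole square
    does not, [Hquarter] forces this one to be bad. *)
Definition bad_quarter (q : R * R * R) : R * R * R :=
  let '(a, c, h) := q in
  if excluded_middle_informative (P a c (h / 2)) then
  if excluded_middle_informative (P (a + h / 2) c (h / 2)) then
  if excluded_middle_informative (P a (c + h / 2) (h / 2)) then (a + h / 2, c + h / 2, h / 2)
  else (a, c + h / 2, h / 2) else (a + h / 2, c, h / 2) else (a, c, h / 2).

Definition bad_seq (n : nat) : R * R * R := Nat.iter n bad_quarter (0, 0, 1).

Lemma bad_quarter_spec a c h : 0 < h -> sub a c h -> ~ P a c h ->
  let '(a', c', h') := bad_quarter (a, c, h) in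
  h' = h / 2 /\ ~ P a' c' h' /\ a <= a' /\ a' + h' <= a + h /\ c <= c' /\ c' + h' <= c + h.
Proof.
  intros Hh Hs HP. unfold bad_quarter. destruct (excluded_middle_informative (P a c (h / 2))) as [H1|H1]; [|repeat split; auto; lra].
  destruct (excluded_middle_informative (P (a + h / 2) c (h / 2))) as [H2|H2]; [|repeat split; auto; lra].
  destruct (excluded_middle_informative (P a (c + h / 2) (h / 2))) as [H3|H3]; [|repeat split; auto; lra]. repeat split; try lra. cx.
Qed.

(** Goursat's bisection as an induction principle: if [P] failed, nested bad squares would shrink to
    a point around which [Hlocal] makes all small squares good. *)
Lemma square_induction : P 0 0 1.
Proof.
  apply NNPP. intros HP. set (A n := fst (fst (bad_seq n))). set (Cc n := snd (fst (bad_seq n))). set (h n := snd (bad_seq n)).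
  assert (Inv : forall n, 0 < h n /\ h n = (/ 2) ^ n /\ sub (A n) (Cc n) (h n) /\ ~ P (A n) (Cc n) (h n)).
  { induction n as [|n [I1 [I2 [I3 I4]]]].
    - unfold A, Cc, h, sub; simpl. repeat split; auto; lra.
    - pose proof (bad_quarter_spec _ _ _ I1 I3 I4) as S. unfold A, Cc, h in *. simpl bad_seq. change (Nat.iter n bad_quarter (0, 0, 1)) with (bad_seq n) in *.
      unfold bad_seq in *. simpl Nat.iter. destruct (Nat.iter n bad_quarter (0, 0, 1)) as [[a c] k]. simpl in I1, I2, I3, I4.
      change (fst (fst (a, c, k))) with a in S. change (snd (fst (a, c, k))) with c in S. change (snd (a, c, k)) with k in S.
      destruct (bad_quarter (a, c, k)) as [[a' c'] k']. simpl. unfold sub in *. destruct S as [S1 [S2 S3]]. repeat split; auto; try lra. }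
  assert (Mono : forall n, A n <= A (S n) /\ A (S n) + h (S n) <= A n + h n /\ Cc n <= Cc (S n) /\ Cc (S n) + h (S n) <= Cc n + h n).
  { intros n. destruct (Inv n) as [I1 [I2 [I3 I4]]]. pose proof (bad_quarter_spec _ _ _ I1 I3 I4) as S.
    unfold A, Cc, h in *. unfold bad_seq in *. simpl Nat.iter in *. destruct (Nat.iter n bad_quarter (0, 0, 1)) as [[a c] k].
    change (fst (fst (a, c, k))) with a in *. change (snd (fst (a, c, k))) with c in *. change (snd (a, c, k)) with k in *.
    destruct (bad_quarter (a, c, k)) as [[a' c'] k']. simpl. tauto. }
  assert (MonoN : forall n m, (n <= m)%nat -> A n <= A m /\ A m + h m <= A n + h n /\ Cc n <= Cc m /\ Cc m + h m <= Cc n + h n).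
  { intros n m Hnm. induction Hnm as [|m Hnm IH]; [lra|]. pose proof (Mono m). lra. }
  assert (Lim : forall B : nat -> R, (forall n m, (n <= m)%nat -> B n <= B m /\ B m + h m <= B n + h n) ->
    exists x, forall n, B n <= x <= B n + h n).
  { intros B HB. destruct (completeness (fun x => exists n, x = B n)) as [x [Hx1 Hx2]].
    - exists (B O + h O). intros y [n ->]. destruct (HB O n ltac:(lia)). pose proof (proj1 (Inv n)). lra.
    - exists (B O). now exists O.
    - exists x. intros n. split; [apply Hx1; now exists n|]. apply Hx2. intros y [m ->]. destruct (Nat.le_ge_cases n m) as [H|H].
      + destruct (HB n m H). pose proof (proj1 (Inv m)). lra.
      + destruct (HB m n H). pose proof (proj1 (Inv n)). lra. }
  destruct (Lim A) as [x Hx]. { intros n m H. pose proof (MonoN n m H). tauto. }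
  destruct (Lim Cc) as [y Hy]. { intros n m H. pose proof (MonoN n m H). tauto. }
  pose proof (Inv O) as I0. unfold sub in I0. destruct (Hlocal x y) as [d [H0 Hd]].
  { specialize (Hx O). lra. }
  { specialize (Hy O). lra. }
  destruct (pow_lt_1_zero (/ 2)) with (y := d) as [n Hn]; [rewrite Rabs_pos_eq; lra|exact H0|].
  specialize (Hn n (Nat.le_refl n)). destruct (Inv n) as [I1 [I2 [I3 I4]]]. apply I4. apply Hd; auto. rewrite I2. rewrite I2 in I1. rewrite Rabs_pos_eq in Hn; lra.
Qed.
End SquareInduction.

Section Goursat.
Variables (Phi Phix Phiy : R -> R -> C) (f : C -> C) (M : R).
Let inQ x y := 0 <= x <= 1 /\ 0 <= y <= 1.
Hypothesis HM : 0 < M.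
Hypothesis Hx : forall x y, inQ x y -> rder (fun t => Phi t y) x (Phix x y).
Hypothesis Hy : forall x y, inQ x y -> rder (fun t => Phi x t) y (Phiy x y).
Hypothesis Cx : forall x y, inQ x y -> rcont (fun t => Phix t y) x.
Hypothesis Cy : forall x y, inQ x y -> rcont (fun t => Phiy x t) y.
Hypothesis Bx : forall x y, inQ x y -> Cmod (Phix x y) <= M.
Hypothesis By : forall x y, inQ x y -> Cmod (Phiy x y) <= M.
Hypothesis Lip : forall x y x' y', inQ x y -> inQ x' y' -> Cmod (Phi x y - Phi x' y') <= M * (Rabs (x - x') + Rabs (y - y')).
Hypothesis Hf : forall x y, inQ x y -> exists l, cder f (Phi x y) l.

Let gx y := fun t => (f (Phi t y) * Phix t y)%C.
Let gy x := fun t => (f (Phi x t) * Phiy x t)%C.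
(** The integral of [f] along the image under [Phi] of the boundary of a square, counterclockwise.
    Working with a parametrised square, not necessarily injective, covers the deformation of one
    circle into another. *)
Definition boundary_int (a c h : R) : C :=
  (CInt (gx c) a (a + h) - CInt (gx (c + h)) a (a + h) + CInt (gy (a + h)) c (c + h) - CInt (gy a) c (c + h))%C.

Lemma con_gx y : 0 <= y <= 1 -> con (gx y) 0 1.
Proof.
  intros H t Ht. assert (Q : inQ t y) by (split; lra). apply tends_mult; [apply _| |now apply Cx].
  destruct (Hf t y Q) as [l Hl]. apply (tends_comp (locally t) f (fun t => Phi t y)).
  - now apply cder_ccont in Hl.
  - apply (rder_rcont (fun t => Phi t y) t (Phix t y)). now apply Hx.
Qed.

Lemma con_gy x : 0 <= x <= 1 -> con (gy x) 0 1.
Proof.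
  intros H t Ht. assert (Q : inQ x t) by (split; lra). apply tends_mult; [apply _| |now apply Cy].
  destruct (Hf x t Q) as [l Hl]. apply (tends_comp (locally t) f (fun t => Phi x t)).
  - now apply cder_ccont in Hl.
  - apply (rder_rcont (fun t => Phi x t) t (Phiy x t)). now apply Hy.
Qed.

(** The affine part of [f] at [z] has the primitive [B], whose increments cancel around a closed
    contour. Each edge therefore contributes only the error of the affine approximation. *)
Lemma edge_estimate (g dg : R -> C) a b z l E : a <= b -> con (fun t => f (g t) * dg t)%C a b ->
  (forall t, a <= t <= b -> rder g t (dg t)) -> con dg a b -> (forall t, a <= t <= b -> Cmod (dg t) <= M) ->
  (forall t, a <= t <= b -> Cmod (f (g t) - f z - l * (g t - z)) <= E) -> 0 <= E ->
  let B := fun w => ((f z - l * z) * w + l / 2 * (w * w))%C in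
  Cmod (CInt (fun t => f (g t) * dg t)%C a b - (B (g b) - B (g a))) <= (b - a) * (E * M).
Proof.
  intros Hab Hc Hg Hdg Hb HE HE0 B. assert (Hcg : con g a b) by (intros t Ht; eapply rder_rcont; now apply Hg).
  assert (HB : CInt (fun t => (f z + l * (g t - z)) * dg t)%C a b = (B (g b) - B (g a))%C).
  { apply (CInt_FTC (fun t => B (g t))); [exact Hab| |].
    - intros t Ht. unfold B. specialize (Hg t Ht). eapply rder_eq; [|apply rder_plus; [apply rder_scal, Hg|apply rder_scal, rder_mult; apply Hg]]. field.
    - cx. }
  rewrite <- HB. rewrite <- CInt_minus; auto.
  2:{ cx. }
  apply CInt_bound; auto.
  - cx.
  - intros t Ht. replace (f (g t) * dg t - (f z + l * (g t - z)) * dg t)%C with ((f (g t) - f z - l * (g t - z)) * dg t)%C by ring.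
    rewrite Cmod_mult. apply Rmult_le_compat; auto using Cmod_ge_0.
Qed.

Lemma goursat_eps eps : 0 < eps -> Cmod (boundary_int 0 0 1) <= eps.
Proof.
  intros He. cut (Cmod (boundary_int 0 0 1) <= eps * (1 * 1)); [lra|]. apply (square_induction (fun a c h => Cmod (boundary_int a c h) <= eps * (h * h))).
  - intros a c h Hh [S1 [S2 [S3 S4]]] H1 H2 H3 H4. replace (boundary_int a c h) with
      (boundary_int a c (h / 2) + boundary_int (a + h / 2) c (h / 2) + boundary_int a (c + h / 2) (h / 2)
       + boundary_int (a + h / 2) (c + h / 2) (h / 2))%C.
    + ctri. eapply Rle_trans; [apply Rplus_le_compat_r, Cmod_triangle|]. eapply Rle_trans; [apply Rplus_le_compat_r, Rplus_le_compat_r, Cmod_triangle|]. nra.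
    + unfold boundary_int. replace (a + h / 2 + h / 2) with (a + h) by field. replace (c + h / 2 + h / 2) with (c + h) by field.
      assert (Ax : forall y, 0 <= y <= 1 -> CInt (gx y) a (a + h) = (CInt (gx y) a (a + h / 2) + CInt (gx y) (a + h / 2) (a + h))%C).
      { intros y Hyy. rewrite CInt_Chasles; try lra; auto. eapply con_sub; [now apply con_gx|lra|lra]. }
      assert (Ay : forall x, 0 <= x <= 1 -> CInt (gy x) c (c + h) = (CInt (gy x) c (c + h / 2) + CInt (gy x) (c + h / 2) (c + h))%C).
      { intros y Hyy. rewrite CInt_Chasles; try lra; auto. eapply con_sub; [now apply con_gy|lra|lra]. }
      rewrite (Ax c), (Ax (c + h)), (Ay (a + h)), (Ay a) by lra. ring.
  (* There are four edges of parameter length [h] with speed at most [M], and points at distance at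
     most [2 M h]; with the constant [eps / (8 M^2)] the total is exactly [eps h^2]. *)
  - intros x y Hxx Hyy. destruct (Hf x y (conj Hxx Hyy)) as [l Hl]. assert (He1 : 0 < eps / (8 * M * M)) by pos. destruct (cder_elim _ _ _ Hl _ He1) as [d [H0 Hd]].
    exists (d / (2 * M)). split; [pos|]. intros a c h Hh [S1 [S2 [S3 S4]]] Ha Hc. assert (Hhd : M * (2 * h) < d).
    { apply Rlt_le_trans with (M * (2 * (d / (2 * M)))); [|right; field; lra]. apply Rmult_lt_compat_l; lra. }
    set (E := eps / (8 * M * M) * (M * (2 * h))). assert (HE0 : 0 <= E) by pos. assert (Near : forall u v, a <= u <= a + h -> c <= v <= c + h ->
       Cmod (f (Phi u v) - f (Phi x y) - l * (Phi u v - Phi x y)) <= E).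
    { intros u v Hu Hv. assert (Hn : Cmod (Phi u v - Phi x y) <= M * (2 * h)).
      { eapply Rle_trans; [apply Lip; split; lra|]. apply Rmult_le_compat_l; [lra|].
        assert (Rabs (u - x) <= h) by (apply Rabs_le; lra). assert (Rabs (v - y) <= h) by (apply Rabs_le; lra). lra. }
      eapply Rle_trans; [apply Hd; lra|]. unfold E. apply Rmult_le_compat_l; lra. }
    assert (EX : forall v, c <= v <= c + h -> _) by
      (intros v Hv; exact (edge_estimate (fun t => Phi t v) (fun t => Phix t v) a (a + h) (Phi x y) l E ltac:(lra)
        ltac:(eapply con_sub; [apply (con_gx v); lra|lra|lra]) ltac:(intros; apply Hx; split; lra)
        ltac:(intros t Ht; apply Cx; split; lra) ltac:(intros; apply Bx; split; lra) ltac:(intros; apply Near; lra) HE0)).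
    assert (EY : forall u, a <= u <= a + h -> _) by
      (intros u Hu; exact (edge_estimate (fun t => Phi u t) (fun t => Phiy u t) c (c + h) (Phi x y) l E ltac:(lra)
        ltac:(eapply con_sub; [apply (con_gy u); lra|lra|lra]) ltac:(intros; apply Hy; split; lra)
        ltac:(intros t Ht; apply Cy; split; lra) ltac:(intros; apply By; split; lra) ltac:(intros; apply Near; lra) HE0)).
    cbv zeta in EX, EY. pose proof (EX c ltac:(lra)) as E1. pose proof (EX (c + h) ltac:(lra)) as E2.
    pose proof (EY (a + h) ltac:(lra)) as E3. pose proof (EY a ltac:(lra)) as E4. clear EX EY.
    set (B := fun w => ((f (Phi x y) - l * Phi x y) * w + l / 2 * (w * w))%C) in *. unfold boundary_int.
    assert (Tri : forall u1 u2 u3 u4 v1 v2 v3 v4 : C, (v1 - v2 + v3 - v4)%C = 0 ->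
      Cmod (u1 - u2 + u3 - u4) <= Cmod (u1 - v1) + Cmod (u2 - v2) + Cmod (u3 - v3) + Cmod (u4 - v4)).
    { intros u1 u2 u3 u4 v1 v2 v3 v4 Hv. replace (u1 - u2 + u3 - u4)%C with ((u1 - v1) - (u2 - v2) + (u3 - v3) - (u4 - v4) + (v1 - v2 + v3 - v4))%C by ring.
      rewrite Hv, Cplus_0_r. ctrim. apply Rplus_le_compat_r. ctri. apply Rplus_le_compat_r. apply Cmod_triangle_minus. }
    refine (Rle_trans _ _ _ (Tri _ _ _ _ (B (Phi (a + h) c) - B (Phi a c))%C
      (B (Phi (a + h) (c + h)) - B (Phi a (c + h)))%C (B (Phi (a + h) (c + h)) - B (Phi (a + h) c))%C
      (B (Phi a (c + h)) - B (Phi a c))%C ltac:(ring)) _).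
    apply Rle_trans with (4 * ((a + h - a) * (E * M))).
    + replace (c + h - c) with (a + h - a) in E3, E4 by ring. set (K := (a + h - a) * (E * M)) in *. replace (4 * K) with (K + K + K + K) by ring.
      apply Rplus_le_compat; [apply Rplus_le_compat; [apply Rplus_le_compat|]|]; [exact E1|exact E2|exact E3|exact E4].
    + unfold E. right. field. lra.
Qed.

Lemma goursat : boundary_int 0 0 1 = 0.
Proof. apply Cmod_zero_eq. apply le_epsilon. intros eps He. rewrite Rplus_0_l. now apply goursat_eps. Qed.
End Goursat.

(** * Circles and Cauchy's integral formula *)

Definition circ (c : C) (r y : R) : C := (c + r * e (RtoC y))%C.

Lemma rder_e (k y : R) : rder (fun t => e (k * t)%R) y (2 * PI * Ci * k * e (k * y)%R)%C.
Proof.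
  apply rder_ext with (fun t => Cexp (2 * PI * Ci * k * RtoC t)%C).
  { intros u. unfold e. f_equal. rewrite RtoC_mult. ring. }
  eapply rder_eq; [|apply (rder_comp Cexp (fun t => (2 * PI * Ci * k * RtoC t)%C)); [apply cder_Cexp|apply rder_scal, rder_RtoC]].
  unfold e. rewrite RtoC_mult. replace (2 * PI * Ci * k * y)%C with (2 * PI * Ci * (k * y))%C by ring. ring.
Qed.

Lemma rder_e1 (y : R) : rder (fun t => e (RtoC t)) y (2 * PI * Ci * e (RtoC y))%C.
Proof.
  pose proof (rder_e 1 y) as H. rewrite Rmult_1_l in H. eapply rder_eq; [|eapply rder_ext; [|exact H]]; [cbv beta; ring|intros u; cbv beta; now rewrite Rmult_1_l].
Qed.

Lemma rder_circ c r y : rder (circ c r) y (r * (2 * PI * Ci * e (RtoC y)))%C.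
Proof. eapply rder_eq; [|apply rder_plus; [apply rder_const|apply rder_scal, rder_e1]]. ring. Qed.

Lemma con_e1 a b : con (fun t => e (RtoC t)) a b.
Proof. eapply con_rder. intros t _. apply rder_e1. Qed.

Lemma con_circ c r a b : con (circ c r) a b.
Proof. eapply con_rder. intros t _. apply rder_circ. Qed.

#[local] Hint Resolve con_circ con_e1 : cx.

Lemma Cmod_circ c r y : 0 < r -> Cmod (circ c r y - c) = r.
Proof. intros Hr. unfold circ. replace (c + r * e y - c)%C with (r * e y)%C by ring. rewrite Cmod_mult, Cmod_e, Cmod_R, Rabs_pos_eq; lra. Qed.

Lemma circ_dist c r y z : 0 < r -> r - Cmod (z - c) <= Cmod (circ c r y - z).
Proof. intros Hr. pose proof (Cmod_circ c r y Hr). pose proof (Cmod_triangle3 (circ c r y) z c). lra. Qed.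

Lemma circ_ne c r y z : 0 < r -> Cmod (z - c) < r -> (circ c r y - z)%C <> 0.
Proof. intros Hr Hz. apply Cmod_gt_0. pose proof (circ_dist c r y z Hr). lra. Qed.

Lemma circ_1 c r : circ c r 1 = circ c r 0.
Proof. unfold circ. f_equal. f_equal. rewrite e_0. apply (e_Z 1). Qed.

Lemma Cmod_2PI : Cmod (2 * PI * Ci) = 2 * PI.
Proof. rewrite !Cmod_mult, Cmod_Ci, !Cmod_R, !Rabs_pos_eq; [ring| |lra]. pose proof PI_RGT_0. lra. Qed.

Lemma two_PI_Ci_nz : (2 * PI * Ci)%C <> 0.
Proof. apply Cmod_gt_0. rewrite Cmod_2PI. pose proof PI_RGT_0. lra. Qed.

(** Cauchy's formula for the constant 1. With [u = w * e (- t)] the integrand is [1 / (1 - u)],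
    whose primitive is [t + Log (1 - u) / (2 PI Ci)]. Since [Cmod u < 1], the logarithm stays in the
    right half plane and returns to its value. *)
Lemma circ_kernel c r z : 0 < r -> Cmod (z - c) < r ->
  CInt (fun y => (circ c r y - c) / (circ c r y - z))%C 0 1 = 1.
Proof.
  intros Hr Hz. set (w := ((z - c) / r)%C). assert (Hr0 : RtoC r <> 0) by (intros E; apply RtoC_inj in E; lra). assert (Hw : Cmod w < 1).
  { unfold w, Cdiv. rewrite Cmod_mult, Cmod_inv, Cmod_R, Rabs_pos_eq by (auto; lra). apply Rmult_lt_reg_r with r; [lra|]. rewrite Rmult_assoc, Rinv_l; lra. }
  set (u := fun t : R => (w * e (-1 * t)%R)%C). assert (Hu : forall t, Cmod (u t) = Cmod w) by (intros t; unfold u; rewrite Cmod_mult, Cmod_e; ring).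
  assert (Hs : forall t, slit (1 - u t)).
  { intros t. left. pose proof (Rabs_fst_le (u t)) as H. rewrite Hu in H. apply Rabs_le_between in H. change (0 < 1 - fst (u t)). lra. }
  set (G := fun t : R => (t + / (2 * PI * Ci) * Log (1 - u t))%C). pose proof two_PI_Ci_nz as Hpi.
  assert (Huder : forall t, rder (fun t => (1 - u t)%C) t (2 * PI * Ci * u t)%C).
  { intros t. eapply rder_eq; [|apply rder_plus; [apply rder_const|apply (rder_ext (fun t => (- w) * e (-1 * t)%R)%C);
      [intros v; unfold u; ring|apply rder_scal, (rder_e (-1))]]].
    unfold u. ring. }
  assert (Hcu : con (fun t => (1 - u t)%C) 0 1) by (eapply con_rder; intros; apply Huder).
  rewrite (CInt_ext _ (fun t => (1 + / (2 * PI * Ci) * (/ (1 - u t) * (2 * PI * Ci * u t)))%C)); [|lra|].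
  - rewrite (CInt_FTC G); [|lra| |].
    + unfold G. assert (E : u 1 = u 0).
      { unfold u. rewrite Rmult_0_r, e_0. rewrite Rmult_1_r. rewrite (e_Z (-1)). ring. }
      rewrite E. ring.
    + intros t _. unfold G. apply rder_plus; [apply rder_RtoC|]. apply rder_scal. apply (rder_comp Log (fun t => (1 - u t)%C)); [apply cder_Log, Hs|cx].
    + apply con_plus; [cx|]. apply con_mult; [cx|]. apply con_mult.
      * apply con_inv; [exact Hcu|]. intros t _. apply slit_nz, Hs.
      * apply con_mult; [cx|]. intros t Ht. eapply (tends_ext (locally t) (fun t => 1 - (1 - u t))%C); [intros; ring|].
        replace (u t) with (1 - (1 - u t))%C by ring. apply tends_minus; [apply _|cx|now apply Hcu].
  - clear G Huder. generalize dependent (2 * PI * Ci)%C. intros K HK t _. pose proof (slit_nz _ (Hs t)) as Hn2. assert (E1 : e (-1 * t)%R = (/ e (RtoC t))%C).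
    { rewrite <- e_opp. f_equal. rewrite RtoC_mult. ring. }
    pose proof (e_nz t) as He. replace (/ K * (/ (1 - u t) * (K * u t)))%C with (/ (1 - u t) * u t)%C by (field; auto).
    assert (E2 : (circ c r t - z)%C = (r * e t * (1 - u t))%C).
    { unfold u. rewrite E1. unfold w, circ. field. auto. }
    rewrite E2. unfold circ. field. cx.
Qed.

Lemma le_all_small (a k : R) (d : R) : 0 < d -> 0 <= k -> (forall t, 0 < t < d -> a <= k * t) -> a <= 0.
Proof.
  intros Hd Hk H. apply le_epsilon. intros eps He. rewrite Rplus_0_l. set (t := Rmin (d / 2) (eps / (k + 1))). assert (0 < eps / (k + 1)) by pos.
  assert (Ht : 0 < t) by pos. pose proof (Rmin_l (d / 2) (eps / (k + 1))). pose proof (Rmin_r (d / 2) (eps / (k + 1))). fold t in H1, H2.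
  eapply Rle_trans; [apply (H t); lra|]. assert (eps / (k + 1) * (k + 1) = eps) by (field; lra). nra.
Qed.

(* Contract the circle to [z] along segments; the difference quotient stays bounded there. *)
Lemma cauchy_formula (f : C -> C) c r z : 0 < r ->
  (forall w, Cmod (w - c) <= r -> exists l, cder f w l) -> Cmod (z - c) < r ->
  f z = CInt (fun y => f (circ c r y) * ((circ c r y - c) / (circ c r y - z)))%C 0 1.
Proof.
  intros Hr Hf Hz. set (g := fun w => ((f w - f z) / (w - z))%C). assert (Hg : forall w, Cmod (w - c) <= r -> w <> z -> exists l, cder g w l).
  { intros w Hw Hne. destruct (Hf w Hw) as [l Hl]. assert (Hn : (w - z)%C <> 0) by (intros E; apply Hne; now apply Ceq_minus).
    eexists. apply (gder_mult (T := C_UniformSpace) (fun w => w) (fun w => f w - f z)%C (fun w => / (w - z))%C); [apply tends_id| |].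
    - apply gder_minus; [apply tends_id|exact Hl|apply gder_const].
    - apply (cder_comp Cinv (fun w => w - z)%C); [now apply cder_inv|].
      apply gder_minus; [apply tends_id|apply (gder_j (T := C_UniformSpace) (fun w => w))|apply gder_const]. }
  (* Differentiability at [z] bounds the quotient [g] by [K] near [z]. A circle shrunk by the factor
     [ep] towards [z] then contributes at most a multiple of [ep]. *)
  destruct (Hf z (Rlt_le _ _ Hz)) as [l Hl]. destruct (cder_elim _ _ _ Hl 1 Rlt_0_1) as [d [H0 Hd]]. set (K := Cmod l + 1).
  assert (HK : forall w, Cmod (w - z) < d -> w <> z -> Cmod (g w) <= K).
  { intros w Hw Hne. assert (Hn : (w - z)%C <> 0) by (intros E; apply Hne; now apply Ceq_minus).
    specialize (Hd w Hw). unfold g, Cdiv. rewrite Cmod_mult, Cmod_inv by exact Hn. pose proof (Cmod_pos _ Hn).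
    apply Rmult_le_reg_r with (Cmod (w - z)); [lra|]. rewrite Rmult_assoc, Rinv_l, Rmult_1_r by lra.
    replace (f w - f z)%C with ((f w - f z - l * (w - z)) + l * (w - z))%C by ring. ctri. rewrite Cmod_mult. unfold K. lra. }
  assert (HK0 : 0 < K) by (unfold K; pose proof (Cmod_ge_0 l); lra). set (ga := circ c r). set (dga := fun y : R => (r * (2 * PI * Ci * e (RtoC y)))%C).
  assert (Hga2 : forall y, Cmod (ga y - z) <= 2 * r).
  { intros y. eapply Rle_trans; [apply (Cmod_triangle3 _ c)|]. unfold ga. rewrite Cmod_circ, (Cmod_minus_sym c z) by exact Hr. lra. }
  assert (Hdga : forall y, Cmod (dga y) = 2 * PI * r).
  { intros y. unfold dga. rewrite Cmod_mult, (Cmod_mult _ (e y)), Cmod_2PI, Cmod_e, Cmod_R, Rabs_pos_eq; lra. }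
  pose proof PI_RGT_0 as HPI. assert (Hcd : con dga 0 1) by (unfold dga; cx). assert (Hga0 : forall y, (ga y - z)%C <> 0) by (intros y; now apply circ_ne).
  assert (Hgp : forall (l0 y : R), 0 < l0 <= 1 -> (z + l0 * (ga y - z))%C <> z /\ exists l', cder g (z + l0 * (ga y - z))%C l').
  { intros l0 y Hl0. assert (E : (z + l0 * (ga y - z))%C <> z).
    { intros E. apply (Cmult_neq_0 l0 (ga y - z)); [|apply Hga0|].
      - intros E2. apply RtoC_inj in E2. lra.
      - replace (l0 * (ga y - z))%C with ((z + l0 * (ga y - z)) - z)%C by ring. rewrite E. ring. }
    split; [exact E|]. apply Hg; [|exact E]. replace (z + l0 * (ga y - z) - c)%C with (RtoC (1 - l0) * (z - c) + l0 * (ga y - c))%C by (rewrite RtoC_minus; ring).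
    ctri. rewrite !Cmod_mult, !Cmod_R, !Rabs_pos_eq by lra. unfold ga. rewrite Cmod_circ by exact Hr. nra. }
  assert (Hmain : CInt (fun y => g (ga y) * dga y)%C 0 1 = 0).
  { apply Cmod_zero_eq. apply (le_all_small _ (K * (2 * PI * r)) (Rmin 1 (d / (2 * r)))).
    { pos. }
    { pos. }
    intros ep Hep. pose proof (Rmin_l 1 (d / (2 * r))). pose proof (Rmin_r 1 (d / (2 * r))). assert (Hep2 : ep * (2 * r) < d).
    { apply Rlt_le_trans with (d / (2 * r) * (2 * r)); [apply Rmult_lt_compat_r; lra|right; field; lra]. }
    (* The deformation starts from the shrunk circle at [x = 0] and ends at the full circle at
       [x = 1]; as [ep > 0], it never meets [z]. *)
    set (lam := fun x : R => (ep + (1 - ep) * x)). assert (Hlam : forall x, 0 <= x <= 1 -> ep <= lam x <= 1) by (intros x Hx; unfold lam; nra).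
    set (Phi := fun x y => (z + lam x * (ga y - z))%C). set (Phix := fun (x : R) y => (RtoC (1 - ep) * (ga y - z))%C). set (Phiy := fun x y => (lam x * dga y)%C).
    set (M := 4 * r + 2 * PI * r). assert (HPr : 0 < PI * r) by nra. assert (Hgl : forall y y', Cmod (ga y - ga y') <= 2 * PI * r * Rabs (y - y')).
    { assert (Hgl0 : forall y y', y <= y' -> Cmod (ga y' - ga y) <= 2 * PI * r * (y' - y)).
      { intros y y' Hyy. rewrite <- (CInt_FTC ga dga); [|exact Hyy|intros; apply rder_circ|unfold dga; cx].
        rewrite Rmult_comm. apply CInt_bound; [exact Hyy|unfold dga; cx|intros; rewrite Hdga; lra]. }
      intros y y'. destruct (Rle_dec y y').
      - rewrite Cmod_minus_sym, Rabs_minus_sym, (Rabs_pos_eq (y' - y)) by lra. apply Hgl0; lra.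
      - rewrite (Rabs_pos_eq (y - y')) by lra. apply Hgl0; lra. }
    assert (HG : boundary_int Phi Phix Phiy g 0 0 1 = 0).
    { apply (goursat Phi Phix Phiy g M).
      - unfold M. nra.
      - intros x y [Hx Hy]. unfold Phi, Phix. apply (rder_ext (fun t => (z + RtoC ep * (ga y - z)) + (RtoC (1 - ep) * (ga y - z)) * RtoC t)%C).
        { intros u. unfold lam. rewrite RtoC_plus, RtoC_mult. ring. }
        eapply rder_eq; [|apply rder_plus; [apply rder_const|apply rder_scal, rder_RtoC]]. ring.
      - intros x y [Hx Hy]. unfold Phi, Phiy. apply (rder_ext (fun t => (z - RtoC (lam x) * z) + RtoC (lam x) * ga t)%C); [intros; ring|].
        eapply rder_eq; [|apply rder_plus; [apply rder_const|exact (rder_scal (RtoC (lam x)) ga y _ (rder_circ c r y))]]. unfold dga. ring.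
      - intros x y [Hx Hy]. unfold Phix. exact (con_const _ 0 1 x Hx).
      - intros x y [Hx Hy]. unfold Phiy. apply (con_mult (fun _ => RtoC (lam x)) dga 0 1); [cx|exact Hcd|exact Hy].
      - intros x y [Hx Hy]. unfold Phix. rewrite Cmod_mult, Cmod_R, Rabs_pos_eq by lra. pose proof (Hga2 y). unfold M. nra.
      - intros x y [Hx Hy]. unfold Phiy. specialize (Hlam x Hx). rewrite Cmod_mult, Cmod_R, Rabs_pos_eq, Hdga by lra. unfold M. nra.
      - intros x y x' y' [Hx Hy] [Hx' Hy']. unfold Phi. replace (z + lam x * (ga y - z) - (z + lam x' * (ga y' - z)))%C
          with (RtoC (lam x - lam x') * (ga y - z) + lam x' * (ga y - ga y'))%C by (rewrite RtoC_minus; ring).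
        ctri. rewrite !Cmod_mult, !Cmod_R. pose proof (Hlam x' Hx'). rewrite (Rabs_pos_eq (lam x')) by lra.
        replace (lam x - lam x') with ((1 - ep) * (x - x')) by (unfold lam; ring). rewrite Rabs_mult, (Rabs_pos_eq (1 - ep)) by lra.
        pose proof (Hgl y y'). pose proof (Rabs_pos (x - x')). pose proof (Cmod_ge_0 (ga y - z)). pose proof (Cmod_ge_0 (ga y - ga y')).
        rewrite Rmult_plus_distr_l. apply Rplus_le_compat.
        + apply Rle_trans with (1 * Rabs (x - x') * (2 * r)); [|unfold M; nra]. apply Rmult_le_compat; auto; [nra|]. nra.
        + apply Rle_trans with (1 * (2 * PI * r * Rabs (y - y'))); [apply Rmult_le_compat; lra|]. unfold M. nra.
      - intros x y [Hx Hy]. specialize (Hlam x Hx). apply Hgp. lra. }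
    (* The two radial edges coincide, because the circle closes up, and cancel. *)
    unfold boundary_int in HG. rewrite !Rplus_0_l in HG. assert (E1 : CInt (fun t => g (Phi t 0) * Phix t 0)%C 0 1 = CInt (fun t => g (Phi t 1) * Phix t 1)%C 0 1).
    { f_equal. extensionality t. unfold Phi, Phix, ga. now rewrite circ_1. }
    rewrite E1 in HG. assert (E2 : CInt (fun t => g (Phi 1 t) * Phiy 1 t)%C 0 1 = CInt (fun y => g (ga y) * dga y)%C 0 1).
    { f_equal. extensionality t. unfold Phi, Phiy, lam. replace (ep + (1 - ep) * 1) with 1 by ring. replace (z + 1 * (ga t - z))%C with (ga t) by ring. ring. }
    rewrite E2 in HG. replace (CInt (fun y => g (ga y) * dga y)%C 0 1) with (CInt (fun t => g (Phi 0%R t) * Phiy 0%R t)%C 0 1).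
    2:{ apply Ceq_minus. rewrite <- HG. apply Ceq_minus in HG.
        set (I1 := CInt (fun y => g (ga y) * dga y)%C 0 1) in *. set (I0 := CInt (fun t => g (Phi 0%R t) * Phiy 0%R t)%C 0 1) in *. apply Ceq_minus in HG.
        transitivity (- (CInt (fun t : R => g (Phi t 1) * Phix t 1) 0 1 - CInt (fun t : R => g (Phi t 1) * Phix t 1) 0 1 + I1 - I0))%C; [ring|]. rewrite HG. ring. }
    eapply Rle_trans; [apply CInt_bound with (M := K * (ep * (2 * PI * r))); [lra| |]|lra].
    - apply (con_mult (fun t => g (Phi 0 t)) (Phiy 0)); [|unfold Phiy; cx]. intros t Ht. apply (tends_comp (locally t) g (Phi 0)).
      + specialize (Hlam 0 ltac:(lra)). destruct (Hgp (lam 0) t ltac:(lra)) as [_ [l' Hl']]. exact (cder_ccont _ _ _ Hl').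
      + unfold Phi. apply (con_plus (fun _ => z) (fun y => lam 0 * (ga y - z))%C 0 1); [cx|unfold ga; cx|exact Ht].
    - intros t Ht. rewrite Cmod_mult. unfold Phiy. rewrite Cmod_mult, Hdga, Cmod_R. replace (lam 0) with ep by (unfold lam; ring). rewrite Rabs_pos_eq by lra.
      apply Rmult_le_compat_r; [nra|]. unfold Phi. replace (lam 0) with ep by (unfold lam; ring). apply HK; [|apply Hgp; lra].
      replace (z + ep * (ga t - z) - z)%C with (ep * (ga t - z))%C by ring. rewrite Cmod_mult, Cmod_R, Rabs_pos_eq by lra. specialize (Hga2 t). nra. }
  assert (Hcf : con (fun y => f (ga y)) 0 1).
  { apply con_comp; [apply con_circ|]. intros t _. destruct (Hf (ga t)) as [l' Hl']; [|now apply cder_ccont in Hl']. unfold ga. rewrite Cmod_circ; lra. }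
  assert (Hck : con (fun y => (ga y - c) / (ga y - z))%C 0 1).
  { apply con_div; [apply con_minus; [apply con_circ|cx]|apply con_minus; [apply con_circ|cx]|]. intros t _. now apply circ_ne. }
  pose proof two_PI_Ci_nz as Hpi. transitivity (f z * CInt (fun y => (ga y - c) / (ga y - z))%C 0 1)%C.
  { unfold ga. rewrite circ_kernel by assumption. ring. }
  rewrite <- CInt_scal by (lra || exact Hck). symmetry. apply Ceq_minus. fold ga. rewrite <- CInt_minus; [|lra|cx|cx].
  assert (Hfin : CInt (fun y => g (ga y) * dga y)%C 0 1 =
    (2 * PI * Ci * CInt (fun t => f (ga t) * ((ga t - c) / (ga t - z)) - f z * ((ga t - c) / (ga t - z)))%C 0 1)%C).
  { rewrite <- CInt_scal; [|lra|].
    - apply CInt_ext; [lra|]. intros t _. unfold g, dga. pose proof (circ_ne c r t z Hr Hz). fold ga in H.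
      replace (ga t - c)%C with (r * e t)%C by (unfold ga, circ; ring). field. auto.
    - cx. }
  rewrite Hmain in Hfin. set (X := CInt (fun t => f (ga t) * ((ga t - c) / (ga t - z)) - f z * ((ga t - c) / (ga t - z)))%C 0 1) in *.
  replace X with (/ (2 * PI * Ci) * (2 * PI * Ci * X))%C by (rewrite Cmult_assoc, Cinv_l by exact Hpi; ring). rewrite <- Hfin. ring.
Qed.

(** The linearisation error of the kernel in [w] is exactly [(w - z)^2] divided by a product of
    three distances, each at least [d]. *)
Lemma cauchy_int_cder (phi : R -> C) c r z : 0 < r -> con phi 0 1 -> Cmod (z - c) < r ->
  exists l, cder (fun w => CInt (fun y => phi y / (circ c r y - w))%C 0 1) z l.
Proof.
  intros Hr Hphi Hz. destruct (con_bounded phi 0 1 Rle_0_1 Hphi) as [M [HM HMb]]. set (d := (r - Cmod (z - c)) / 2). assert (Hd : 0 < d) by pos.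
  assert (Cd : forall w, con (fun y => circ c r y - w)%C 0 1).
  { cx. }
  assert (Hn : forall w, Cmod (w - z) < d -> forall y, d <= Cmod (circ c r y - w)).
  { intros w Hw y. pose proof (circ_dist c r y w Hr). pose proof (Cmod_triangle3 w z c). unfold d in *. lra. }
  assert (Hn0 : forall w, Cmod (w - z) < d -> forall y, (circ c r y - w)%C <> 0).
  { intros w Hw y. apply Cmod_gt_0. pose proof (Hn w Hw y). lra. }
  assert (Hzz : Cmod (z - z) < d) by (replace (z - z)%C with (RtoC 0) by ring; now rewrite Cmod_0).
  exists (CInt (fun y => phi y / ((circ c r y - z) * (circ c r y - z)))%C 0 1). apply cder_intro. intros eps He. exists (Rmin d (eps * (d * d * d) / M)). split.
  { pos. }
  intros w Hw. pose proof (Rmin_l d (eps * (d * d * d) / M)). pose proof (Rmin_r d (eps * (d * d * d) / M)). assert (Hwd : Cmod (w - z) < d) by lra.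
  assert (C1 : forall w, Cmod (w - z) < d -> con (fun y => phi y / (circ c r y - w))%C 0 1).
  { intros v Hv. apply con_div; auto. }
  assert (C2 : con (fun y => phi y / ((circ c r y - z) * (circ c r y - z)))%C 0 1).
  { apply con_div; auto; [cx|]. intros t _. apply Cmult_neq_0; auto. }
  rewrite <- CInt_minus by (auto; lra). rewrite (Cmult_comm _ (w - z)). rewrite <- CInt_scal by (auto; lra). rewrite <- CInt_minus; [|lra|cx|cx].
  eapply Rle_trans; [apply CInt_bound with (M := M * (Cmod (w - z) * Cmod (w - z)) / (d * d * d)); [lra| |]|].
  - cx.
  - intros t Ht. specialize (HMb t Ht). pose proof (Hn w Hwd t) as N1. pose proof (Hn z Hzz t) as N2.
    replace (phi t / (circ c r t - w) - phi t / (circ c r t - z) - (w - z) * (phi t / ((circ c r t - z) * (circ c r t - z))))%C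
      with (phi t * ((w - z) * (w - z)) * / ((circ c r t - w) * (circ c r t - z) * (circ c r t - z)))%C by (field; auto).
    rewrite !Cmod_mult, Cmod_inv by (apply Cmult_neq_0; [apply Cmult_neq_0|]; auto). rewrite !Cmod_mult. unfold Rdiv. apply Rmult_le_compat.
    + pos.
    + pos.
    + nra.
    + apply Rinv_le_contravar; [pos|]. apply Rmult_le_compat; nra.
  - assert (Hq : Cmod (w - z) * M <= eps * (d * d * d)).
    { assert (E : eps * (d * d * d) / M * M = eps * (d * d * d)) by (field; lra). nra. }
    pose proof (Cmod_ge_0 (w - z)). assert (Hd3 : 0 < d * d * d) by pos.
    apply Rmult_le_reg_r with (d * d * d); [exact Hd3|]. unfold Rdiv. rewrite Rminus_0_r, Rmult_1_l, Rmult_assoc, Rinv_l by lra. nra.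
Qed.

Lemma disc_locally c r z : Cmod (z - c) < r -> cnear z (fun w => Cmod (w - c) < r).
Proof. intros H. apply locally_Cmod. exists (r - Cmod (z - c)). split; [lra|]. intros w Hw. pose proof (Cmod_triangle3 w z c). lra. Qed.

Lemma hol_cauchy_int (phi : R -> C) c r z : 0 < r -> con phi 0 1 -> Cmod (z - c) < r ->
  hol (fun w => CInt (fun y => phi y / (circ c r y - w))%C 0 1) z.
Proof. intros Hr Hphi Hz. unfold hol. generalize (disc_locally c r z Hz). apply filter_imp. intros w Hw. now apply cauchy_int_cder. Qed.

Lemma hol_cder f z : hol f z -> exists l, cder f z l.
Proof. intros H. now apply locally_singleton in H. Qed.

Lemma con_hol_circ f c r : 0 < r -> (forall w, Cmod (w - c) <= r -> hol f w) -> con (fun y => f (circ c r y)) 0 1.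
Proof. intros Hr H. apply con_comp; [cx|]. intros t _. apply hol_ccont, H. rewrite Cmod_circ; lra. Qed.

Lemma cauchy_formula_hol f c r z : 0 < r -> (forall w, Cmod (w - c) <= r -> hol f w) -> Cmod (z - c) < r ->
  f z = CInt (fun y => (f (circ c r y) * (circ c r y - c)) / (circ c r y - z))%C 0 1.
Proof.
  intros Hr H Hz. rewrite (cauchy_formula f c r z); auto.
  - f_equal. extensionality y. unfold Cdiv. ring.
  - intros w Hw. apply hol_cder. auto.
Qed.

(** Weierstrass: Cauchy's formula passes to the uniform limit, and a Cauchy integral with continuous
    density is holomorphic. *)
Lemma hol_uniform_lim f c r : 0 < r ->
  (forall eps, 0 < eps -> exists g, (forall w, Cmod (w - c) <= r -> hol g w) /\
     forall w, Cmod (w - c) <= r -> Cmod (f w - g w) <= eps) ->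
  forall z, Cmod (z - c) < r -> hol f z.
Proof.
  intros Hr H z Hz. assert (Hcf : con (fun y => f (circ c r y)) 0 1).
  { intros t Ht eps He. destruct (H (eps / 4)) as [g [G1 G2]]; [lra|]. pose proof (con_hol_circ g c r Hr G1 t Ht (eps / 4) ltac:(lra)) as Hc. revert Hc.
    apply filter_imp. intros y Hy. pose proof (G2 (circ c r y) ltac:(rewrite Cmod_circ; lra)). pose proof (G2 (circ c r t) ltac:(rewrite Cmod_circ; lra)).
    pose proof (Cmod_triangle3 (f (circ c r y)) (g (circ c r y)) (f (circ c r t))). pose proof (Cmod_triangle3 (g (circ c r y)) (g (circ c r t)) (f (circ c r t))).
    rewrite (Cmod_minus_sym (g (circ c r t))) in H3. lra. }
  assert (Hcc : con (fun y => circ c r y - c)%C 0 1) by cx.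
  apply hol_ext_loc with (fun w => CInt (fun y => (f (circ c r y) * (circ c r y - c)) / (circ c r y - w))%C 0 1).
  2:{ apply hol_cauchy_int; auto. cx. }
  generalize (disc_locally c r z Hz). apply filter_imp. intros w Hw. apply Ceq_minus, Cmod_zero_eq. apply (le_all_small _ (1 + r / (r - Cmod (w - c))) 1); [lra| |].
  { assert (0 < r / (r - Cmod (w - c))) by pos. lra. }
  intros ep [Hep _]. destruct (H ep Hep) as [g [G1 G2]]. eapply Rle_trans; [apply (Cmod_triangle3 _ (g w))|]. rewrite Rmult_plus_distr_r, Rmult_1_l, Rplus_comm.
  apply Rplus_le_compat.
  - rewrite Cmod_minus_sym. apply G2. lra.
  - rewrite (cauchy_formula_hol g c r w) by auto. assert (Hcw : con (fun y => circ c r y - w)%C 0 1) by cx. assert (Hcg := con_hol_circ g c r Hr G1).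
    assert (Hnz : forall t, 0 <= t <= 1 -> (circ c r t - w)%C <> 0) by (intros; now apply circ_ne).
    rewrite <- CInt_minus; [|lra|apply con_div; auto; now apply con_mult|apply con_div; auto; now apply con_mult].
    eapply Rle_trans; [apply CInt_bound with (M := r / (r - Cmod (w - c)) * ep); [lra| |]|lra].
    + apply con_minus; apply con_div; auto; now apply con_mult.
    + intros t Ht. specialize (Hnz t Ht). replace (f (circ c r t) * (circ c r t - c) / (circ c r t - w) - g (circ c r t) * (circ c r t - c) / (circ c r t - w))%C
        with ((f (circ c r t) - g (circ c r t)) * (circ c r t - c) * / (circ c r t - w))%C by (field; auto).
      rewrite !Cmod_mult, Cmod_circ, Cmod_inv by auto. pose proof (G2 (circ c r t) ltac:(rewrite Cmod_circ; lra)) as Hg.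
      pose proof (circ_dist c r t w Hr). rewrite Cmod_minus_sym in Hg. replace (r / (r - Cmod (w - c)) * ep) with (ep * r * / (r - Cmod (w - c))) by lra.
      apply Rmult_le_compat.
      * pos.
      * pos.
      * apply Rmult_le_compat_r; [lra|]. rewrite Cmod_minus_sym. exact Hg.
      * apply Rinv_le_contravar; lra.
Qed.

(** Mean value property. It carries a bound from a circle to its centre, also when the method that
    produced the bound breaks down at the centre itself. *)
Lemma hol_mean_bound f c r M : 0 < r -> (forall w, Cmod (w - c) <= r -> hol f w) ->
  (forall t, 0 <= t <= 1 -> Cmod (f (circ c r t)) <= M) -> Cmod (f c) <= M.
Proof.
  intros Hr H HM. rewrite (cauchy_formula_hol f c r c) by (auto; replace (c - c)%C with (RtoC 0) by ring; rewrite Cmod_0; lra).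
  assert (Hnz : forall t, (circ c r t - c)%C <> 0).
  { intros t. apply Cmod_gt_0. rewrite Cmod_circ; lra. }
  rewrite (CInt_ext _ (fun y => f (circ c r y))); [|lra|intros; field; auto]. eapply Rle_trans; [apply CInt_bound with (M := M); [lra|now apply con_hol_circ|]|lra].
  exact HM.
Qed.

Lemma hol_ball f a : hol f a -> exists r, 0 < r /\ forall w, Cmod (w - a) <= r -> hol f w.
Proof.
  intros H. apply hol_locally in H. apply locally_Cmod in H. destruct H as [d [H0 Hd]]. exists (d / 2). split; [lra|]. intros w Hw. apply Hd. lra.
Qed.

(** [g n] is the [n]-th Taylor remainder divided by [(z - a) ^ n], written as a Cauchy integral, so
    [g n a] is the [n]-th coefficient. Keeping these quotients holomorphic makes the division by
    zeros immediate. *)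
Lemma taylor_expansion f a r : 0 < r -> (forall w, Cmod (w - a) <= r -> hol f w) ->
  exists g : nat -> C -> C, (forall z, Cmod (z - a) < r -> g O z = f z) /\
   (forall n z, Cmod (z - a) < r -> hol (g n) z) /\
   (forall n z, Cmod (z - a) < r -> g n z = (g n a + (z - a) * g (S n) z)%C) /\
   exists M, 0 < M /\ forall n z, Cmod (z - a) < r -> Cmod (g n z) <= M / (r - Cmod (z - a)) / r ^ n.
Proof.
  intros Hr H. set (ga := circ a r). assert (Hg0 : forall t, (ga t - a)%C <> 0) by (intros t; apply Cmod_gt_0; unfold ga; rewrite Cmod_circ; lra).
  assert (Hcf := con_hol_circ f a r Hr H). fold ga in Hcf. assert (Hcg : con (fun y => ga y - a)%C 0 1) by (apply con_minus; [apply con_circ|cx]).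
  assert (Hcp : forall n, con (fun y => (/ (ga y - a)) ^ n)%C 0 1).
  { intros n t Ht. apply tends_pow; [apply _|]. apply (con_inv (fun y => ga y - a)%C 0 1); auto. }
  set (phi := fun n y => (f (ga y) * (ga y - a) * (/ (ga y - a)) ^ n)%C). assert (Hphi : forall n, con (phi n) 0 1) by (intros n; apply con_mult; [cx|]; auto).
  assert (Haa : Cmod (a - a) < r) by (replace (a - a)%C with (RtoC 0) by ring; now rewrite Cmod_0).
  assert (Hcz : forall n z, Cmod (z - a) < r -> con (fun y => phi n y / (ga y - z))%C 0 1).
  { intros n z Hz. apply con_div; auto; [apply con_minus; [apply con_circ|cx]|intros; now apply circ_ne]. }
  exists (fun n z => CInt (fun y => phi n y / (ga y - z))%C 0 1). repeat split.
  - intros z Hz. rewrite (cauchy_formula_hol f a r z) by auto. f_equal. extensionality y. unfold phi. simpl. fold ga. now rewrite Cmult_1_r.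
  - intros n z Hz. now apply hol_cauchy_int.
  - intros n z Hz. rewrite <- CInt_scal by (auto; lra). rewrite <- CInt_plus; [|lra|cx|cx].
    apply CInt_ext; [lra|]. intros t _. unfold phi. simpl. pose proof (circ_ne a r t z Hr Hz) as Hn. fold ga in Hn.
    generalize ((/ (ga t - a)) ^ n)%C. intros P. field. auto.
  - destruct (con_bounded _ 0 1 Rle_0_1 Hcf) as [M [HM HMb]]. exists (M * r). split; [nra|]. intros n z Hz.
    eapply Rle_trans; [apply CInt_bound with (M := M * r / (r - Cmod (z - a)) / r ^ n); [lra|auto|]|lra].
    intros t Ht. specialize (HMb t Ht). pose proof (circ_ne a r t z Hr Hz) as Hn. fold ga in Hn.
    unfold phi, Cdiv. rewrite !Cmod_mult, Cmod_pow, !Cmod_inv by auto. unfold ga at 2 3. rewrite Cmod_circ by exact Hr.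
    pose proof (circ_dist a r t z Hr) as Hd. fold ga in Hd. assert (Hrn : 0 < (/ r) ^ n) by pos.
    unfold Rdiv. rewrite <- pow_inv. rewrite (Rmult_assoc (M * r)), (Rmult_comm (/ (r - _))), <- Rmult_assoc. apply Rmult_le_compat.
    + pos.
    + pos.
    + apply Rmult_le_compat_r; [lra|]. apply Rmult_le_compat_r; lra.
    + apply Rinv_le_contravar; lra.
Qed.

Lemma hol_divide f a : hol f a -> f a = 0 ->
  exists g, hol g a /\ cnear a (fun z => f z = ((z - a) * g z)%C).
Proof.
  intros Hf Ha. destruct (hol_ball f a Hf) as [r [Hr H]]. destruct (taylor_expansion f a r Hr H) as [g [G0 [G1 [G2 _]]]].
  assert (Haa : Cmod (a - a) < r) by (replace (a - a)%C with (RtoC 0) by ring; now rewrite Cmod_0).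
  exists (g 1%nat). split; [cx|]. generalize (disc_locally a r a Haa). apply filter_imp. intros z Hz.
  rewrite <- G0 by exact Hz. rewrite (G2 O z Hz), G0, Ha by exact Haa. ring.
Qed.

(** If all coefficients vanish, the geometric bound on the remainders forces [f = 0] near [a];
    otherwise the first nonzero coefficient gives the order of the zero. *)
Lemma hol_zero_dichotomy f a : hol f a ->
  cnear a (fun z => f z = 0) \/
  exists (n : nat) g, hol g a /\ g a <> 0 /\ cnear a (fun z => f z = ((z - a) ^ n * g z)%C).
Proof.
  intros Hf. destruct (hol_ball f a Hf) as [r [Hr H]]. destruct (taylor_expansion f a r Hr H) as [g [G0 [G1 [G2 [M [HM GM]]]]]].
  assert (Haa : Cmod (a - a) < r) by (replace (a - a)%C with (RtoC 0) by ring; now rewrite Cmod_0).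
  assert (Hloc : forall n, (forall k, (k < n)%nat -> g k a = 0) -> forall z, Cmod (z - a) < r -> f z = ((z - a) ^ n * g n z)%C).
  { induction n; intros Hk z Hz.
    - rewrite <- G0 by exact Hz. simpl. ring.
    - rewrite IHn by auto. rewrite (G2 n z Hz), (Hk n) by auto. simpl. ring. }
  destruct (classic (forall n, g n a = 0)) as [Hall|Hex].
  - left. generalize (disc_locally a r a Haa). apply filter_imp. intros z Hz. apply Cmod_zero_eq. set (q := Cmod (z - a) / r). assert (Hq : 0 <= q < 1).
    { unfold q. split; [pos|]. apply Rmult_lt_reg_r with r; [lra|]. unfold Rdiv. rewrite Rmult_assoc, Rinv_l; lra. }
    set (K := M / (r - Cmod (z - a))). assert (HK : 0 < K) by pos. assert (Hb : forall n, Cmod (f z) <= K * q ^ n).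
    { intros n. rewrite (Hloc n) by auto. rewrite Cmod_mult, Cmod_pow. unfold q, Rdiv. rewrite Rpow_mult_distr, pow_inv.
      pose proof (GM n z Hz). fold K in H0. pose proof (pow_le _ n (Cmod_ge_0 (z - a))). unfold Rdiv in *. nra. }
    apply le_epsilon. intros eps He. rewrite Rplus_0_l. destruct (pow_lt_1_zero q) with (y := eps / K) as [n Hn]; [rewrite Rabs_pos_eq; lra|pos|].
    specialize (Hn n (Nat.le_refl n)). eapply Rle_trans; [apply (Hb n)|].
    pose proof (Rle_abs (q ^ n)). apply Rle_trans with (K * (eps / K)); [apply Rmult_le_compat_l; lra|right; field; lra].
  - right. apply not_all_ex_not in Hex. destruct (dec_inh_nat_subset_has_unique_least_element (fun n => g n a <> 0)) as [n [[Hn1 Hn2] _]].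
    { intros n. destruct (Ceq_dec (g n a) 0); [right|left]; auto. }
    { exact Hex. }
    exists n, (g n). split; [cx|]. split; [exact Hn1|]. generalize (disc_locally a r a Haa). apply filter_imp. intros z Hz. apply Hloc; auto.
    intros k Hk. apply NNPP. intros Hne. specialize (Hn2 k Hne). lia.
Qed.

(** * Meromorphic functions and the identity theorem *)

Lemma Cinv_0 : (/ 0)%C = 0.
Proof. unfold Cinv, Rdiv. simpl. ceq. Qed.

Lemma Cminus_nz (w z : C) : w <> z -> (w - z)%C <> 0.
Proof. intros H E. apply H. now apply Ceq_minus. Qed.

(* The pole order [n] may exceed the true one, so that these functions form a field
   (up to values at isolated points). *)
Definition qmero (f : C -> C) (s0 : C) : Prop :=
  exists (n : nat) g, hol g s0 /\ cnear' s0 (fun s => f s = (g s / (s - s0) ^ n)%C).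

Lemma locally'_intro (z : C) (P : C -> Prop) :
  cnear z (fun w => w <> z -> P w) -> cnear' z P.
Proof. auto. Qed.

Lemma locally_locally' (z : C) (P : C -> Prop) :
  cnear z P -> cnear' z P.
Proof. apply filter_le_within. Qed.

Lemma locally'_ne (z : C) : cnear' z (fun w => w <> z).
Proof. apply locally'_intro. apply filter_forall. auto. Qed.

Lemma qmero_hol f s : hol f s -> qmero f s.
Proof. intros H. exists O, f. split; [exact H|]. apply filter_forall. intros w. simpl. field. Qed.

Lemma qmero_ext f g s : cnear' s (fun w => f w = g w) -> qmero f s -> qmero g s.
Proof. intros He [n [h [Hh H]]]. exists n, h. split; [exact Hh|]. generalize (filter_and _ _ He H). apply filter_imp. intros w [<- E]. exact E. Qed.

Lemma qmero_plus f g s : qmero f s -> qmero g s -> qmero (fun w => f w + g w)%C s.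
Proof.
  intros [n [a [Ha Ea]]] [m [b [Hb Eb]]]. exists (n + m)%nat, (fun w => a w * (w - s) ^ m + b w * (w - s) ^ n)%C. split.
  - apply hol_plus; apply hol_mult; auto; apply hol_pow, hol_minus; [cx|cx|cx|cx].
  - generalize (filter_and _ _ (locally'_ne s) (filter_and _ _ Ea Eb)). apply filter_imp. intros w [Hw [-> ->]].
    rewrite Cpow_add_r. pose proof (Cpow_nz _ n (Cminus_nz _ _ Hw)). pose proof (Cpow_nz _ m (Cminus_nz _ _ Hw)). field. auto.
Qed.

Lemma qmero_mult f g s : qmero f s -> qmero g s -> qmero (fun w => f w * g w)%C s.
Proof.
  intros [n [a [Ha Ea]]] [m [b [Hb Eb]]]. exists (n + m)%nat, (fun w => a w * b w)%C. split; [cx|].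
  generalize (filter_and _ _ (locally'_ne s) (filter_and _ _ Ea Eb)). apply filter_imp. intros w [Hw [-> ->]].
  rewrite Cpow_add_r. pose proof (Cpow_nz _ n (Cminus_nz _ _ Hw)). pose proof (Cpow_nz _ m (Cminus_nz _ _ Hw)). field. auto.
Qed.

Lemma qmero_opp f s : qmero f s -> qmero (fun w => - f w)%C s.
Proof.
  intros H. eapply qmero_ext; [|apply (qmero_mult (fun _ => - (1))%C f s); [apply qmero_hol, hol_const|exact H]]. apply filter_forall. intros w. cbv beta. ring.
Qed.

Lemma qmero_minus f g s : qmero f s -> qmero g s -> qmero (fun w => f w - g w)%C s.
Proof. intros. apply qmero_plus; [assumption|now apply qmero_opp]. Qed.

Lemma ccont_ne (g : C -> C) (a b : C) : ccont g a -> g a <> b -> cnear a (fun z => g z <> b).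
Proof. intros Hc Hne. generalize (Hc _ (Cmod_pos _ (Cminus_nz _ _ Hne))). apply filter_imp. intros z Hz E. rewrite E, Cmod_minus_sym in Hz. lra. Qed.

(** Even the zero function has an inverse here, because [/ 0 = 0]. Quotients, for instance by
    [Gamma], thus need no side condition. *)
Lemma qmero_inv f s : qmero f s -> qmero (fun w => / f w)%C s.
Proof.
  intros [n [a [Ha Ea]]]. destruct (hol_zero_dichotomy a s Ha) as [Hz|[k [g [Hg [Hg0 Hgk]]]]].
  - exists O, (fun _ => RtoC 0). split; [cx|]. generalize (filter_and _ _ Ea (locally_locally' _ _ Hz)). apply filter_imp. intros w [-> ->]. unfold Cdiv.
    rewrite Cmult_0_l, Cinv_0. ring.
  - exists k, (fun w => (w - s) ^ n / g w)%C. split.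
    + apply hol_div; auto. apply hol_pow, hol_minus; [cx|cx].
    + generalize (filter_and _ _ (locally'_ne s) (filter_and _ _ Ea (filter_and _ _ (locally_locally' _ _ Hgk)
        (locally_locally' _ _ (ccont_ne g s 0 (hol_ccont _ _ Hg) Hg0))))).
      apply filter_imp. intros w [Hw [-> [-> H]]]. pose proof (Cpow_nz _ n (Cminus_nz _ _ Hw)). pose proof (Cpow_nz _ k (Cminus_nz _ _ Hw)). field. auto.
Qed.

Lemma qmero_div f g s : qmero f s -> qmero g s -> qmero (fun w => f w / g w)%C s.
Proof. intros. apply qmero_mult; [assumption|now apply qmero_inv]. Qed.

Lemma qmero_affine f (u v s : C) : u <> 0 -> qmero f (u * s + v) -> qmero (fun w => f (u * w + v))%C s.
Proof.
  intros Hu [n [g [Hg E]]]. exists n, (fun w => g (u * w + v) / u ^ n)%C. split.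
  - apply hol_div; [|cx|now apply Cpow_nz]. apply (hol_comp g (fun w => u * w + v)%C); [exact Hg|]. cx.
  - apply locally'_Cmod in E. destruct E as [d [H0 Hd]]. apply locally'_Cmod. pose proof (Cmod_pos _ Hu) as Hp. exists (d / Cmod u). split; [pos|].
    intros w Hw Hne. assert (Ed : (u * w + v - (u * s + v))%C = (u * (w - s))%C) by ring. rewrite (Hd (u * w + v)%C).
    + rewrite Ed, Cpow_mult_l. pose proof (Cpow_nz _ n Hu). pose proof (Cpow_nz _ n (Cminus_nz _ _ Hne)). field. auto.
    + rewrite Ed, Cmod_mult. apply Rlt_le_trans with (Cmod u * (d / Cmod u)); [apply Rmult_lt_compat_l; lra|right; field; lra].
    + intros E. apply (Cmult_neq_0 u (w - s)); [exact Hu|now apply Cminus_nz|]. rewrite <- Ed, E. ring.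
Qed.

Lemma qmero_dichotomy f s : qmero f s ->
  cnear' s (fun w => f w = 0) \/ cnear' s (fun w => f w <> 0).
Proof.
  intros [n [a [Ha Ea]]]. destruct (hol_zero_dichotomy a s Ha) as [Hz|[k [g [Hg [Hg0 Hgk]]]]].
  - left. generalize (filter_and _ _ Ea (locally_locally' _ _ Hz)). apply filter_imp. intros w [-> ->]. unfold Cdiv. ring.
  - right. generalize (filter_and _ _ (locally'_ne s) (filter_and _ _ Ea (filter_and _ _ (locally_locally' _ _ Hgk)
        (locally_locally' _ _ (ccont_ne g s 0 (hol_ccont _ _ Hg) Hg0))))).
    apply filter_imp. intros w [Hw [-> [-> H]]]. unfold Cdiv. pose proof (Cpow_nz _ n (Cminus_nz _ _ Hw)). pose proof (Cpow_nz _ k (Cminus_nz _ _ Hw)).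
    apply Cmult_neq_0; [now apply Cmult_neq_0|]. intros E. assert (E2 : ((w - s) ^ n * / (w - s) ^ n)%C = 1) by (now apply Cinv_r). rewrite E, Cmult_0_r in E2.
    apply RtoC_inj in E2. lra.
Qed.

Lemma interval_connected (P : R -> Prop) :
  (forall t, 0 <= t <= 1 -> exists d, 0 < d /\ forall t', 0 <= t' <= 1 -> Rabs (t' - t) < d -> (P t' <-> P t)) ->
  P 0 -> P 1.
Proof.
  intros H H0. set (E := fun x => 0 <= x <= 1 /\ forall t, 0 <= t <= x -> P t). destruct (completeness E) as [m [Hm1 Hm2]].
  - exists 1. intros x [Hx _]. lra.
  - exists 0. split; [lra|]. intros t Ht. replace t with 0 by lra. exact H0.
  - assert (H00 : E 0). { split; [lra|]. intros t Ht. replace t with 0 by lra. exact H0. }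
    assert (Hm : 0 <= m <= 1). { split; [cx|]. apply Hm2. intros x [Hx _]. lra. }
    destruct (H m Hm) as [d [Hd Hdm]]. assert (Hx : exists x, E x /\ m - d < x).
    { apply NNPP. intros Hn. assert (m <= m - d); [|lra]. apply Hm2. intros x Hx. apply Rnot_lt_le. intros Hlt. apply Hn. now exists x. }
    destruct Hx as [x [Hx1 Hx2]]. pose proof (Hm1 x Hx1) as Hxm. destruct Hx1 as [Hx3 Hx4].
    assert (Pm : P m). { apply (Hdm x); [lra| |apply Hx4; lra]. rewrite Rabs_left1; lra. }
    assert (Hall : forall t, 0 <= t <= 1 -> t < m + d -> P t).
    { intros t Ht Htd. destruct (Rle_dec t x); [apply Hx4; lra|]. apply Hdm; auto. apply Rabs_def1; lra. }
    destruct (Rlt_dec 1 (m + d)); [apply Hall; lra|]. assert (m + d / 2 <= m); [|lra]. apply Hm1. split; [lra|]. intros t Ht. apply Hall; lra.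
Qed.

Definition convexC (U : C -> Prop) : Prop :=
  forall p q t, U p -> U q -> 0 <= t <= 1 -> U (p + RtoC t * (q - p))%C.

Lemma convex_halfplane a : convexC (fun s => a < Re s).
Proof. intros [p1 p2] [q1 q2] t Hp Hq Ht. simpl in *. destruct (Rle_dec p1 q1); nra. Qed.

Lemma convex_all : convexC (fun _ => True).
Proof. intros p q t _ _ _. exact I. Qed.

(** By [qmero_dichotomy], vanishing on a punctured neighbourhood is a locally constant property of
    the centre as it moves along the segment from [p] to [q]. *)
Lemma qmero_identity (U : C -> Prop) f p q : convexC U -> (forall s, U s -> qmero f s) ->
  U p -> U q -> cnear' p (fun w => f w = 0) ->
  cnear' q (fun w => f w = 0).
Proof.
  intros HU Hf Hp Hq H0. set (c := fun t : R => (p + RtoC t * (q - p))%C). assert (E0 : c 0 = p) by (unfold c; ring). assert (E1 : c 1 = q) by (unfold c; ring).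
  rewrite <- E1. rewrite <- E0 in H0. revert H0. apply (interval_connected (fun t => cnear' (c t) (fun w => f w = 0))). intros t Ht.
  assert (Spread : forall (Q : C -> Prop), cnear' (c t) Q ->
    exists d, 0 < d /\ forall t', Rabs (t' - t) < d -> cnear' (c t') Q).
  { intros Q HQ. pose proof HQ as HQ'. apply locally'_Cmod in HQ. destruct HQ as [d [Hd0 Hd]]. pose proof (Cmod_ge_0 (q - p)) as Hqp.
    exists (d / (Cmod (q - p) + 1)). split; [pos|]. intros t' Ht'. destruct (Ceq_dec (c t') (c t)) as [E|E]; [now rewrite E|]. assert (Hcd : Cmod (c t' - c t) < d).
    { unfold c. replace (p + t' * (q - p) - (p + t * (q - p)))%C with (RtoC (t' - t) * (q - p))%C by (rewrite RtoC_minus; ring).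
      rewrite Cmod_mult, Cmod_R. apply Rle_lt_trans with (Rabs (t' - t) * (Cmod (q - p) + 1)); [apply Rmult_le_compat_l; [pos|lra]|].
      apply Rlt_le_trans with (d / (Cmod (q - p) + 1) * (Cmod (q - p) + 1)); [apply Rmult_lt_compat_r; lra|right; field; lra]. }
    pose proof (Cmod_pos _ (Cminus_nz _ _ E)) as Hpos. apply locally_locally'. apply locally_Cmod. exists (Rmin (d - Cmod (c t' - c t)) (Cmod (c t' - c t))).
    split; [pos|]. intros w Hw. pose proof (Rmin_l (d - Cmod (c t' - c t)) (Cmod (c t' - c t))). pose proof (Rmin_r (d - Cmod (c t' - c t)) (Cmod (c t' - c t))).
    apply Hd.
    - pose proof (Cmod_triangle3 w (c t') (c t)). lra.
    - intros Ew. subst w. rewrite Cmod_minus_sym in Hw. lra. }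
  destruct (qmero_dichotomy f (c t)) as [Hz|Hnz]; [apply Hf, HU; auto| |].
  - destruct (Spread _ Hz) as [d [Hd0 Hd]]. exists d. split; [exact Hd0|]. intros t' _ Ht'. split; auto.
  - destruct (Spread _ Hnz) as [d [Hd0 Hd]]. exists d. split; [exact Hd0|]. intros t' _ Ht'. split; intros K; exfalso.
    + destruct (filter_ex (F := cnear' (c t')) _ (filter_and _ _ K (Hd t' Ht'))) as [w [W1 W2]]. auto.
    + destruct (filter_ex (F := cnear' (c t)) _ (filter_and _ _ K Hnz)) as [w [W1 W2]]. auto.
Qed.

Lemma qmero_identity_eq (U : C -> Prop) f g p q : convexC U -> (forall s, U s -> qmero f s) -> (forall s, U s -> qmero g s) ->
  U p -> U q -> cnear' p (fun w => f w = g w) ->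
  cnear' q (fun w => f w = g w).
Proof.
  intros HU Hf Hg Hp Hq H. assert (K : cnear' q (fun w => (f w - g w)%C = 0)).
  { apply (qmero_identity U (fun w => f w - g w)%C p q); auto.
    - intros s Hs. apply qmero_minus; auto.
    - revert H. apply filter_imp. intros w ->. ring. }
  revert K. apply filter_imp. intros w Hw. now apply Ceq_minus.
Qed.

Lemma ccont_eq_locally' f g (q : C) : ccont f q -> ccont g q ->
  cnear' q (fun w => f w = g w) -> f q = g q.
Proof.
  intros Hf Hg H. apply (tends_unique (cnear' q) g).
  - apply tends_ext_F with f; [apply _|exact H|]. now apply tends_locally'.
  - now apply tends_locally'.
Qed.

Lemma hol_identity (U : C -> Prop) f g p q : convexC U -> (forall s, U s -> hol f s) -> (forall s, U s -> hol g s) ->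
  U p -> U q -> cnear' p (fun w => f w = g w) -> f q = g q.
Proof.
  intros HU Hf Hg Hp Hq H. apply ccont_eq_locally'; [apply hol_ccont; auto|apply hol_ccont; auto|].
  apply (qmero_identity_eq U f g p q); auto; intros; apply qmero_hol; auto.
Qed.

(** Global form of the division by a zero; the apparent poles at 1 and 2 are removed with it. *)
Lemma entire_divide f a : (forall s, hol f s) -> f a = 0 ->
  exists g, (forall s, hol g s) /\ forall s, f s = ((s - a) * g s)%C.
Proof.
  intros Hf Ha. destruct (hol_divide f a (Hf a) Ha) as [g [Hg Hl]]. set (G := fun s => if Ceq_dec s a then g a else (f s / (s - a))%C). exists G. split.
  - intros s. destruct (Ceq_dec s a) as [E|E].
    + subst s. apply hol_ext_loc with g; [|exact Hg]. revert Hl. apply filter_imp. intros w Hw. unfold G.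
      destruct (Ceq_dec w a) as [E|E]; [now subst|]. rewrite Hw. field. now apply Cminus_nz.
    + apply hol_ext_loc with (fun s => f s / (s - a))%C.
      * apply locally_Cmod. exists (Cmod (s - a)). split; [now apply Cmod_pos, Cminus_nz|]. intros w Hw. unfold G.
        destruct (Ceq_dec w a) as [E2|E2]; auto. subst w. rewrite Cmod_minus_sym in Hw. lra.
      * apply hol_div; [apply Hf|cx|now apply Cminus_nz].
  - intros s. unfold G. destruct (Ceq_dec s a) as [E|E].
    + subst s. rewrite Ha. ring.
    + field. now apply Cminus_nz.
Qed.

Lemma halfplane_locally a s : a < Re s -> cnear s (fun w => a < Re w).
Proof.
  intros H. apply locally_Cmod. exists (Re s - a). split; [lra|]. intros w Hw.
  pose proof (Rabs_fst_le (w - s)) as H1. change (fst (w - s)%C) with (Re w - Re s) in H1. apply Rabs_le_between in H1. lra.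
Qed.

(** Continuations to larger and larger half planes agree by the identity theorem, so they glue. At
    [s] the continuation whose index just exceeds [- Re s] is used; near [s] it can be kept
    fixed. *)
Lemma entire_extension f0 sigma :
  (forall N : nat, exists f, (forall s, - INR N < Re s -> hol f s) /\ forall s, sigma < Re s -> f s = f0 s) ->
  exists F, (forall s, hol F s) /\ forall s, sigma < Re s -> F s = f0 s.
Proof.
  intros H. set (f := fun N => proj1_sig (constructive_indefinite_description _ (H N))).
  assert (Hf : forall N, (forall s, - INR N < Re s -> hol (f N) s) /\ forall s, sigma < Re s -> f N s = f0 s).
  { intros N. exact (proj2_sig (constructive_indefinite_description _ (H N))). }
  clearbody f. set (n := fun s : C => Z.to_nat (up (- Re s))). assert (Hn : forall s, - INR (n s) < Re s).
  { intros s. unfold n. destruct (archimed (- Re s)) as [H1 _]. assert (IZR (up (- Re s)) <= INR (Z.to_nat (up (- Re s)))); [|lra].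
    rewrite INR_IZR_INZ. apply IZR_le. lia. }
  assert (Same : forall N M s, - INR N < Re s -> - INR M < Re s -> f N s = f M s).
  { intros N M s HN HM. set (p := RtoC (Rmax (Rmax (- INR N) (- INR M)) sigma + 1)).
    apply (hol_identity (fun w => Rmax (- INR N) (- INR M) < Re w) (f N) (f M) p s (convex_halfplane _)).
    - intros w Hw. apply Hf. eapply Rle_lt_trans; [apply Rmax_l|exact Hw].
    - intros w Hw. apply Hf. eapply Rle_lt_trans; [apply Rmax_r|exact Hw].
    - simpl. pose proof (Rmax_l (Rmax (- INR N) (- INR M)) sigma). lra.
    - now apply Rmax_lub_lt.
    - apply locally_locally'. assert (Hp : sigma < Re p) by (simpl; pose proof (Rmax_r (Rmax (- INR N) (- INR M)) sigma); lra).
      generalize (halfplane_locally sigma p Hp). apply filter_imp. intros w Hw. rewrite (proj2 (Hf N) w Hw), (proj2 (Hf M) w Hw). reflexivity. }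
  exists (fun s => f (n s) s). split.
  - intros s. apply hol_ext_loc with (f (n s)); [|apply Hf, Hn]. generalize (halfplane_locally _ s (Hn s)). apply filter_imp. cx.
  - intros s Hs. now apply Hf.
Qed.

(** * Unordered sums *)

Definition lsum {A} (f : A -> C) (L : list A) : C := fold_right (fun a acc => f a + acc)%C 0 L.
Definition rsum {A} (g : A -> R) (L : list A) : R := fold_right (fun a acc => g a + acc) 0 L.
Definition rsummable {A} (g : A -> R) : Prop := exists B, forall L, NoDup L -> rsum g L <= B.
Definition summable {A} (f : A -> C) : Prop := rsummable (fun a => Cmod (f a)).

Lemma lsum_app {A} (f : A -> C) L L' : lsum f (L ++ L') = (lsum f L + lsum f L')%C.
Proof. induction L; simpl; [ring|]. rewrite IHL. ring. Qed.
Lemma rsum_app {A} (f : A -> R) L L' : rsum f (L ++ L') = rsum f L + rsum f L'.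
Proof. induction L; simpl; [ring|]. lra. Qed.
Lemma lsum_perm {A} (f : A -> C) L L' : Permutation L L' -> lsum f L = lsum f L'.
Proof. induction 1; simpl; [auto|now f_equal|ring|congruence]. Qed.
Lemma lsum_map {A B} (f : B -> C) (p : A -> B) L : lsum f (map p L) = lsum (fun a => f (p a)) L.
Proof. induction L; simpl; congruence. Qed.
Lemma rsum_map {A B} (f : B -> R) (p : A -> B) L : rsum f (map p L) = rsum (fun a => f (p a)) L.
Proof. induction L; simpl; congruence. Qed.
Lemma rsum_nonneg {A} (g : A -> R) L : (forall a, 0 <= g a) -> 0 <= rsum g L.
Proof. intros H. induction L as [|a L IH]; simpl; [lra|]. specialize (H a). lra. Qed.
Lemma rsum_le {A} (g h : A -> R) L : (forall a, g a <= h a) -> rsum g L <= rsum h L.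
Proof. intros H. induction L as [|a L IH]; simpl; [lra|]. specialize (H a). lra. Qed.
Lemma Cmod_lsum {A} (f : A -> C) L : Cmod (lsum f L) <= rsum (fun a => Cmod (f a)) L.
Proof. induction L as [|a L IH]; simpl; [rewrite Cmod_0; lra|]. ctri. lra. Qed.
Lemma lsum_plus {A} (f g : A -> C) L : lsum (fun a => f a + g a)%C L = (lsum f L + lsum g L)%C.
Proof. induction L; simpl; [ring|]. rewrite IHL. ring. Qed.
Lemma lsum_scal {A} c (f : A -> C) L : lsum (fun a => c * f a)%C L = (c * lsum f L)%C.
Proof. induction L; simpl; [ring|]. rewrite IHL. ring. Qed.
Lemma lsum_RtoC {A} (g : A -> R) L : lsum (fun a => RtoC (g a)) L = RtoC (rsum g L).
Proof. induction L; simpl; auto. now rewrite IHL, RtoC_plus. Qed.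
Lemma rsum_plus {A} (f g : A -> R) L : rsum (fun a => f a + g a) L = rsum f L + rsum g L.
Proof. induction L; simpl; [ring|]. lra. Qed.
Lemma rsum_scal {A} c (f : A -> R) L : rsum (fun a => c * f a) L = c * rsum f L.
Proof. induction L; simpl; [ring|]. lra. Qed.

Lemma incl_split {A} (L0 L : list A) : NoDup L0 -> NoDup L -> incl L0 L ->
  exists L', Permutation L (L0 ++ L').
Proof.
  intros H0. revert L. induction H0 as [|a L0 Ha H0 IH]; intros L HL Hi.
  - exists L. cx.
  - destruct (in_split a L (Hi a (or_introl eq_refl))) as [l1 [l2 ->]]. destruct (IH (l1 ++ l2)) as [L' HL'].
    + now apply NoDup_remove_1 in HL.
    + intros x Hx. assert (Hx2 := Hi x (or_intror Hx)). apply in_app_iff in Hx2. apply in_app_iff. destruct Hx2 as [?|[->|?]]; tauto.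
    + exists L'. simpl. rewrite <- HL'. symmetry. apply Permutation_middle.
Qed.

Lemma nodup_exists {A} (L : list A) : exists L', NoDup L' /\ incl L L' /\ incl L' L.
Proof.
  induction L as [|a L [L' [H1 [H2 H3]]]].
  - exists nil. split; [pos|split; intros x Hx; auto].
  - destruct (classic (In a L')) as [Ha|Ha].
    + exists L'. split; [auto|split].
      * intros x [<-|Hx]; auto.
      * intros x Hx. right. auto.
    + exists (a :: L'). split; [now constructor|split].
      * intros x [<-|Hx]; [now left|right; auto].
      * intros x [<-|Hx]; [now left|right; auto].
Qed.

Lemma rsum_incl {A} (g : A -> R) L L' : (forall a, 0 <= g a) -> NoDup L -> incl L L' -> rsum g L <= rsum g L'.
Proof.
  intros Hg. revert L'. induction L as [|a L IH]; intros L' Hd Hi; simpl.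
  - now apply rsum_nonneg.
  - destruct (in_split a L' (Hi a (or_introl eq_refl))) as [l1 [l2 ->]]. rewrite rsum_app. simpl. inversion Hd; subst. assert (rsum g L <= rsum g (l1 ++ l2)).
    { apply IH; auto. intros x Hx. assert (Hx2 := Hi x (or_intror Hx)). apply in_app_iff in Hx2. apply in_app_iff. destruct Hx2 as [?|[->|?]]; tauto. }
    rewrite rsum_app in H. lra.
Qed.

Lemma rsummable_le {A} (g h : A -> R) : (forall a, g a <= h a) -> rsummable h -> rsummable g.
Proof. intros H [B HB]. exists B. intros L HL. eapply Rle_trans; [now apply rsum_le|auto]. Qed.
Lemma rsummable_plus {A} (g h : A -> R) : rsummable g -> rsummable h -> rsummable (fun a => g a + h a).
Proof. intros [B HB] [B' HB']. exists (B + B'). intros L HL. rewrite rsum_plus. specialize (HB L HL). specialize (HB' L HL). lra. Qed.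
Lemma rsummable_scal {A} c (g : A -> R) : 0 <= c -> rsummable g -> rsummable (fun a => c * g a).
Proof. intros Hc [B HB]. exists (c * B). intros L HL. rewrite rsum_scal. apply Rmult_le_compat_l; auto. Qed.
Lemma rsummable_inj {A B} (g : B -> R) (p : A -> B) : (forall a a', p a = p a' -> a = a') -> rsummable g -> rsummable (fun a => g (p a)).
Proof.
  intros Hp [M HM]. exists M. intros L HL. rewrite <- rsum_map. apply HM.
  clear - Hp HL. induction HL; simpl; constructor; auto. intros Hi. apply in_map_iff in Hi. destruct Hi as [y [E Hy]]. apply Hp in E. now subst.
Qed.

(** Reindexing without an inverse of [p]: preimages are picked one by one for those elements of [LB]
    that have any, and the functions considered vanish at the others. *)
Lemma preimage_list {A B} (p : A -> B) (LB : list B) : NoDup LB ->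
  exists LA, NoDup LA /\ (forall a, In a LA -> In (p a) LB) /\ (forall a, In (p a) LB -> exists a', p a' = p a /\ In a' LA) /\
   (forall f : B -> C, (forall b, (forall a, b <> p a) -> f b = 0) -> lsum f LB = lsum (fun a => f (p a)) LA) /\
   (forall f : B -> R, (forall b, (forall a, b <> p a) -> f b = 0) -> rsum f LB = rsum (fun a => f (p a)) LA).
Proof.
  induction 1 as [|b LB Hb HL [LA [H1 [H2 [H3 [H4 H5]]]]]].
  - exists nil. repeat split; simpl; auto; try constructor; tauto.
  - destruct (classic (exists a, b = p a)) as [[a Ha]|Hn].
    + exists (a :: LA). repeat split.
      * constructor; auto. intros Hi. apply Hb. rewrite Ha. now apply H2.
      * intros x [<-|Hx]; [now left; auto|right; auto].
      * intros x [Hx|Hx]; [exists a; split; [congruence|now left]|]. destruct (H3 x Hx) as [a' [? ?]]. exists a'. split; [auto|now right].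
      * intros f Hf. simpl. rewrite H4 by auto. now rewrite Ha.
      * intros f Hf. simpl. rewrite H5 by auto. now rewrite Ha.
    + exists LA. repeat split; auto.
      * intros x Hx. right. auto.
      * intros x [Hx|Hx]; [exfalso; apply Hn; now exists x|auto].
      * intros f Hf. simpl. rewrite H4 by auto. rewrite Hf; [ring|]. intros a E. apply Hn. now exists a.
      * intros f Hf. simpl. rewrite H5 by auto. rewrite Hf; [ring|]. intros a E. apply Hn. now exists a.
Qed.

Lemma rsummable_image {A B} (g : B -> R) (p : A -> B) : (forall b, (forall a, b <> p a) -> g b = 0) ->
  rsummable (fun a => g (p a)) -> rsummable g.
Proof.
  intros Hz [M HM]. exists M. intros L HL. destruct (preimage_list p L HL) as [LA [H1 [H2 [H3 [H4 H5]]]]]. rewrite H5 by exact Hz. now apply HM.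
Qed.

Lemma rsummable_prod {A B} (g : A -> R) (h : B -> R) : (forall a, 0 <= g a) -> (forall b, 0 <= h b) ->
  rsummable g -> rsummable h -> rsummable (fun p : A * B => g (fst p) * h (snd p)).
Proof.
  intros Hg Hh [M HM] [N HN]. exists (M * N). intros L HL.
  destruct (nodup_exists (map fst L)) as [LA [A1 [A2 A3]]]. destruct (nodup_exists (map snd L)) as [LB [B1 [B2 B3]]].
  apply Rle_trans with (rsum (fun p : A * B => g (fst p) * h (snd p)) (list_prod LA LB)).
  - apply rsum_incl; auto.
    + intros [a b]. simpl. specialize (Hg a). specialize (Hh b). nra.
    + intros [a b] Hi. apply in_prod; [apply A2, (in_map fst _ _ Hi)|apply B2, (in_map snd _ _ Hi)].
  - replace (rsum (fun p : A * B => g (fst p) * h (snd p)) (list_prod LA LB)) with (rsum g LA * rsum h LB).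
    + specialize (HM LA A1). specialize (HN LB B1). pose proof (rsum_nonneg g LA Hg). pose proof (rsum_nonneg h LB Hh). nra.
    + clear. induction LA; simpl; [ring|]. rewrite rsum_app, rsum_map, <- IHLA. simpl. rewrite rsum_scal. ring.
Qed.

Lemma rsummable_tail {A} (g : A -> R) eps : (forall a, 0 <= g a) -> rsummable g -> 0 < eps ->
  exists L0, NoDup L0 /\ forall L, NoDup (L0 ++ L) -> rsum g L <= eps.
Proof.
  intros Hg [B HB] He. destruct (completeness (fun x => exists L, NoDup L /\ x = rsum g L)) as [S [S1 S2]].
  - exists B. intros x [L [HL ->]]. auto.
  - exists 0. exists nil. split; [pos|cx].
  - assert (Hx : exists L, NoDup L /\ S - eps < rsum g L).
    { apply NNPP. intros Hn. assert (S <= S - eps); [|lra]. apply S2. intros x [L [HL ->]]. apply Rnot_lt_le. intros Hlt. apply Hn. exists L. auto. }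
    destruct Hx as [L0 [H0 H1]]. exists L0. split; auto. intros L HL.
    assert (rsum g (L0 ++ L) <= S) by (apply S1; exists (L0 ++ L); auto). rewrite rsum_app in H. lra.
Qed.

Lemma has_sum_unique {A} (f : A -> C) l l' : has_sum f l -> has_sum f l' -> l = l'.
Proof.
  intros H H'. apply Ceq_minus, Cmod_zero_eq, Rnot_lt_le. intros Hlt. assert (H2 : 0 < Cmod (l - l') / 2) by lra.
  destruct (H (mkposreal _ H2)) as [L0 H0]. destruct (H' (mkposreal _ H2)) as [L1 H1]. destruct (nodup_exists (L0 ++ L1)) as [L [HL [HL1 _]]].
  specialize (H0 L HL (fun x Hx => HL1 x (in_or_app _ _ _ (or_introl Hx)))). specialize (H1 L HL (fun x Hx => HL1 x (in_or_app _ _ _ (or_intror Hx)))).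
  simpl in H0, H1. rewrite Cmod_minus_sym in H0. pose proof (Cmod_triangle3 l (fold_right (fun a acc => f a + acc)%C 0 L) l'). lra.
Qed.

Lemma has_sum_ext {A} (f g : A -> C) l : (forall a, f a = g a) -> has_sum f l -> has_sum g l.
Proof. intros H. replace g with f; auto. now apply functional_extensionality. Qed.

Lemma has_sum_plus {A} (f g : A -> C) l m : has_sum f l -> has_sum g m -> has_sum (fun a => f a + g a)%C (l + m)%C.
Proof.
  intros Hf Hg eps. assert (H2 : 0 < eps / 2) by (pose proof (cond_pos eps); lra).
  destruct (Hf (mkposreal _ H2)) as [L0 H0]. destruct (Hg (mkposreal _ H2)) as [L1 H1]. exists (L0 ++ L1). intros L HL Hi.
  specialize (H0 L HL (fun x Hx => Hi x (in_or_app _ _ _ (or_introl Hx)))). specialize (H1 L HL (fun x Hx => Hi x (in_or_app _ _ _ (or_intror Hx)))).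
  change (Cmod (lsum (fun a => f a + g a)%C L - (l + m)) < eps). rewrite lsum_plus.
  change (Cmod (lsum f L - l) < eps / 2) in H0. change (Cmod (lsum g L - m) < eps / 2) in H1.
  replace (lsum f L + lsum g L - (l + m))%C with ((lsum f L - l) + (lsum g L - m))%C by ring. eapply Rle_lt_trans; [apply Cmod_triangle|lra].
Qed.

Lemma has_sum_scal {A} c (f : A -> C) l : has_sum f l -> has_sum (fun a => c * f a)%C (c * l)%C.
Proof.
  intros Hf eps. pose proof (Cmod_ge_0 c). assert (H2 : 0 < eps / (Cmod c + 1)).
  { apply Rdiv_lt_0_compat; [apply cond_pos|lra]. }
  destruct (Hf (mkposreal _ H2)) as [L0 H0]. exists L0. intros L HL Hi. specialize (H0 L HL Hi).
  change (Cmod (lsum (fun a => c * f a)%C L - c * l) < eps). rewrite lsum_scal. change (Cmod (lsum f L - l) < eps / (Cmod c + 1)) in H0.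
  replace (c * lsum f L - c * l)%C with (c * (lsum f L - l))%C by ring. rewrite Cmod_mult.
  apply Rle_lt_trans with ((Cmod c + 1) * Cmod (lsum f L - l)); [apply Rmult_le_compat_r; [pos|lra]|].
  apply Rlt_le_trans with ((Cmod c + 1) * (eps / (Cmod c + 1))); [apply Rmult_lt_compat_l; lra|right; field; lra].
Qed.

Lemma has_sum_zero {A} : has_sum (fun _ : A => RtoC 0) 0.
Proof.
  intros eps. exists nil. intros L _ _. change (Cmod (lsum (fun _ : A => RtoC 0) L - 0) < eps). replace (lsum (fun _ : A => RtoC 0) L) with (RtoC 0).
  - replace (0 - 0)%C with (RtoC 0) by ring. rewrite Cmod_0. apply cond_pos.
  - induction L; simpl; [cx|]. rewrite <- IHL. ring.
Qed.

Lemma has_sum_nonneg {A} (g : A -> R) : (forall a, 0 <= g a) -> rsummable g -> exists l, has_sum (fun a => RtoC (g a)) (RtoC l).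
Proof.
  intros Hg Hs. pose proof Hs as [B HB]. destruct (completeness (fun x => exists L, NoDup L /\ x = rsum g L)) as [S [S1 S2]].
  - exists B. intros x [L [HL ->]]. auto.
  - exists 0. exists nil. split; [pos|cx].
  - exists S. intros eps. assert (Hx : exists L, NoDup L /\ S - eps < rsum g L).
    { apply NNPP. intros Hn. pose proof (cond_pos eps). assert (S <= S - eps); [|lra]. apply S2. intros x [L [HL ->]].
      apply Rnot_lt_le. intros Hlt. apply Hn. exists L. auto. }
    destruct Hx as [L0 [H0 H1]]. exists L0. intros L HL Hi. change (Cmod (lsum (fun a => RtoC (g a)) L - S) < eps). rewrite lsum_RtoC, <- RtoC_minus, Cmod_R.
    assert (rsum g L <= S) by (apply S1; exists L; auto). pose proof (rsum_incl g L0 L Hg H0 Hi). apply Rabs_def1; lra.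
Qed.

(** A real family dominated by [Cmod f] is the difference of the nonnegative summable families
    [Cmod f + u] and [Cmod f]; real and imaginary parts are treated this way. *)
Lemma summable_has_sum {A} (f : A -> C) : summable f -> exists l, has_sum f l.
Proof.
  intros Hs. assert (Part : forall u : A -> R, (forall a, Rabs (u a) <= Cmod (f a)) -> exists l, has_sum (fun a => RtoC (u a)) (RtoC l)).
  { intros u Hu. destruct (has_sum_nonneg (fun a => Cmod (f a) + u a)) as [l1 H1].
    - intros a. specialize (Hu a). apply Rabs_le_between in Hu. lra.
    - apply rsummable_le with (fun a => 2 * Cmod (f a)); [|apply rsummable_scal; [lra|exact Hs]]. intros a. specialize (Hu a). apply Rabs_le_between in Hu. lra.
    - destruct (has_sum_nonneg (fun a => Cmod (f a))) as [l2 H2]; [pos|exact Hs|]. exists (l1 - l2). rewrite RtoC_minus.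
      replace (l1 - l2)%C with (l1 + (- (1)) * l2)%C by ring. eapply has_sum_ext; [|apply has_sum_plus; [exact H1|apply has_sum_scal; exact H2]].
      intros a. cbv beta. rewrite RtoC_plus. ring. }
  destruct (Part (fun a => fst (f a))) as [l1 H1]; [intros; apply Rabs_fst_le|]. destruct (Part (fun a => snd (f a))) as [l2 H2]; [intros; apply Rabs_snd_le|].
  exists (l1 + Ci * l2)%C. eapply has_sum_ext; [|apply has_sum_plus; [exact H1|apply has_sum_scal; exact H2]]. intros a. cbv beta. destruct (f a). ceq.
Qed.

Lemma has_sum_tail_bound {A} (f : A -> C) (g : A -> R) l L0 eps : has_sum f l -> (forall a, Cmod (f a) <= g a) ->
  NoDup L0 -> (forall L, NoDup (L0 ++ L) -> rsum g L <= eps) -> Cmod (l - lsum f L0) <= eps.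
Proof.
  intros Hf Hg Hd Ht. apply le_epsilon. intros e' He'. destruct (Hf (mkposreal _ He')) as [L1 H1]. destruct (nodup_exists (L0 ++ L1)) as [L [HL [HL1 _]]].
  specialize (H1 L HL (fun x Hx => HL1 x (in_or_app _ _ _ (or_intror Hx)))). change (Cmod (lsum f L - l) < e') in H1.
  destruct (incl_split L0 L Hd HL (fun x Hx => HL1 x (in_or_app _ _ _ (or_introl Hx)))) as [L' HP]. rewrite (lsum_perm f _ _ HP), lsum_app in H1.
  assert (HN : NoDup (L0 ++ L')) by (eapply Permutation_NoDup; eauto).
  specialize (Ht L' HN). pose proof (Cmod_lsum f L'). pose proof (rsum_le (fun a => Cmod (f a)) g L' Hg).
  replace (l - lsum f L0)%C with ((lsum f L') - (lsum f L0 + lsum f L' - l))%C by ring. ctrim. lra.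
Qed.

Lemma has_sum_bound {A} (f : A -> C) l B : has_sum f l -> (forall L, NoDup L -> rsum (fun a => Cmod (f a)) L <= B) -> Cmod l <= B.
Proof.
  intros Hf HB. replace l with (l - lsum f nil)%C by (simpl; ring). apply (has_sum_tail_bound f (fun a => Cmod (f a)) l nil); auto.
  - intros; lra.
  - constructor.
Qed.

Lemma has_sum_image {A B} (f : B -> C) (p : A -> B) l : (forall a a', p a = p a' -> a = a') ->
  (forall b, (forall a, b <> p a) -> f b = 0) -> has_sum (fun a => f (p a)) l -> has_sum f l.
Proof.
  intros Hp Hz H eps. destruct (H eps) as [LA0 H0]. exists (map p LA0). intros L HL Hi. destruct (preimage_list p L HL) as [LA [H1 [H2 [H3 [H4 _]]]]].
  change (Cmod (lsum f L - l) < eps). rewrite H4 by exact Hz. apply (H0 LA H1).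
  intros a Ha. destruct (H3 a) as [a' [E Ha']]; [apply Hi, in_map, Ha|]. apply Hp in E. now subst.
Qed.

(** Each row with index in [LA] gets a finite list that approximates its sum within [delta] and also
    contains the entries of [L0] in that row. Covering [L0] is what brings the total close to the
    double sum. *)
Lemma fubini_aux {A B} (f : A * B -> C) (g : A -> C) (L0 : list (A * B)) :
  (forall a, has_sum (fun b => f (a, b)) (g a)) -> forall LA delta, 0 < delta -> NoDup LA ->
  exists L, NoDup L /\ (forall p, In p L -> In (fst p) LA) /\ (forall p, In p L0 -> In (fst p) LA -> In p L) /\
    Cmod (lsum f L - lsum g LA) <= INR (length LA) * delta /\
    rsum (fun a => Cmod (g a)) LA <= rsum (fun p => Cmod (f p)) L + INR (length LA) * delta.
Proof.
  intros Hg LA delta Hd HLA. induction HLA as [|a LA Ha HLA IH].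
  - exists nil. simpl. split; [pos|]. split; [tauto|]. split; [tauto|]. split.
    + replace (0 - 0)%C with (RtoC 0) by ring. rewrite Cmod_0. lra.
    + lra.
  - destruct IH as [L [H1 [H2 [H3 [H4 H5]]]]]. destruct (Hg a (mkposreal _ Hd)) as [B0 HB0]. destruct (nodup_exists (B0 ++ map snd L0)) as [LB [N1 [N2 _]]].
    specialize (HB0 LB N1 (fun x Hx => N2 x (in_or_app _ _ _ (or_introl Hx)))). change (Cmod (lsum (fun b => f (a, b)) LB - g a) < delta) in HB0.
    assert (Hmap : forall (h : A * B -> C), lsum h (map (pair a) LB) = lsum (fun b => h (a, b)) LB) by (intros h; apply lsum_map).
    exists (map (pair a) LB ++ L). split; [|split; [|split; [|split]]].
    + apply NoDup_app.
      * clear - N1. induction N1; simpl; constructor; auto. intros Hi. apply in_map_iff in Hi. destruct Hi as [y [E Hy]]. now inversion E; subst.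
      * exact H1.
      * intros p Hp Hp2. apply in_map_iff in Hp. destruct Hp as [b [<- _]]. apply Ha. apply (H2 _ Hp2).
    + intros p Hp. apply in_app_iff in Hp. destruct Hp as [Hp|Hp].
      * apply in_map_iff in Hp. destruct Hp as [b [<- _]]. now left.
      * right. now apply H2.
    + intros [a' b] Hp [E|E]; apply in_app_iff.
      * left. simpl in E. subst a'. apply in_map. apply N2, in_or_app. right. apply (in_map snd _ _ Hp).
      * cx.
    + rewrite lsum_app, Hmap. cbn [length]. rewrite S_INR. change (lsum g (a :: LA)) with (g a + lsum g LA)%C.
      replace (lsum (fun b => f (a, b)) LB + lsum f L - (g a + lsum g LA))%C
        with ((lsum (fun b => f (a, b)) LB - g a) + (lsum f L - lsum g LA))%C by ring.
      ctri. lra.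
    + rewrite rsum_app, rsum_map. cbn [length]. rewrite S_INR. change (rsum (fun a => Cmod (g a)) (a :: LA)) with (Cmod (g a) + rsum (fun a => Cmod (g a)) LA).
      pose proof (Cmod_lsum (fun b => f (a, b)) LB). pose proof (Cmod_triangle_inv (g a) (lsum (fun b => f (a, b)) LB)). rewrite Cmod_minus_sym in HB0. lra.
Qed.

Lemma has_sum_fubini {A B} (f : A * B -> C) (g : A -> C) l :
  (forall a, has_sum (fun b => f (a, b)) (g a)) -> has_sum f l -> has_sum g l.
Proof.
  intros Hg Hf eps. assert (H2 : 0 < eps / 2) by (pose proof (cond_pos eps); lra). destruct (Hf (mkposreal _ H2)) as [L0 H0]. exists (map fst L0). intros LA HLA Hi.
  assert (Hn : 0 < INR (length LA) + 1) by (pose proof (pos_INR (length LA)); lra).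
  destruct (fubini_aux f g L0 Hg LA (eps / 2 / (INR (length LA) + 1))) as [L [H1 [_ [H3 [H4 _]]]]]; auto.
  { pos. }
  specialize (H0 L H1 (fun p Hp => H3 p Hp (Hi _ (in_map fst _ _ Hp)))). change (Cmod (lsum f L - l) < eps / 2) in H0. change (Cmod (lsum g LA - l) < eps).
  pose proof (Cmod_triangle3 (lsum g LA) (lsum f L) l). rewrite (Cmod_minus_sym (lsum g LA) (lsum f L)) in H.
  assert (INR (length LA) * (eps / 2 / (INR (length LA) + 1)) <= eps / 2); [|lra].
  apply Rle_trans with ((INR (length LA) + 1) * (eps / 2 / (INR (length LA) + 1))); [|right; field; lra]. apply Rmult_le_compat_r; [|lra]. pos.
Qed.

Lemma summable_slice {A B} (f : A * B -> C) a : summable f -> summable (fun b => f (a, b)).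
Proof. apply (rsummable_inj (fun p => Cmod (f p)) (pair a)). intros b b' E. now inversion E. Qed.

Lemma summable_le {A} (f : A -> C) (g : A -> R) : (forall a, Cmod (f a) <= g a) -> rsummable g -> summable f.
Proof. apply rsummable_le. Qed.

Definition Sum {A} (f : A -> C) : C := epsilon (inhabits (RtoC 0)) (has_sum f).

Lemma Sum_correct {A} (f : A -> C) : summable f -> has_sum f (Sum f).
Proof. intros H. apply (epsilon_spec (inhabits (RtoC 0)) (has_sum f)). now apply summable_has_sum. Qed.

Lemma Sum_unique {A} (f : A -> C) l : has_sum f l -> Sum f = l.
Proof. intros H. apply (has_sum_unique f); auto. apply (epsilon_spec (inhabits (RtoC 0)) (has_sum f)). now exists l. Qed.

Lemma hol_lsum {A} (f : A -> C -> C) L s : (forall a, hol (f a) s) -> hol (fun w => lsum (fun a => f a w) L) s.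
Proof. intros H. induction L; simpl; [cx|]. cx. Qed.

(** Weierstrass' M-test: finite partial sums approximate uniformly, and uniform limits are
    holomorphic. *)
Lemma hol_Sum {A} (f : A -> C -> C) (g : A -> R) c r z : 0 < r -> (forall a w, Cmod (w - c) <= r -> hol (f a) w) ->
  (forall a w, Cmod (w - c) <= r -> Cmod (f a w) <= g a) -> rsummable g -> Cmod (z - c) < r ->
  hol (fun w => Sum (fun a => f a w)) z.
Proof.
  intros Hr Hf Hg Hs Hz. apply (hol_uniform_lim _ c r Hr); auto. intros eps He. assert (Hg0 : forall a, 0 <= g a).
  { intros a. eapply Rle_trans; [pos|apply (Hg a z)]. lra. }
  destruct (rsummable_tail g eps Hg0 Hs He) as [L0 [H0 H1]]. exists (fun w => lsum (fun a => f a w) L0). split.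
  - intros w Hw. apply hol_lsum. auto.
  - intros w Hw. apply (has_sum_tail_bound (fun a => f a w) g); auto. apply Sum_correct. apply summable_le with g; auto.
Qed.

Lemma tends_lsum {T A} (F : (T -> Prop) -> Prop) {FF : Filter F} (f : A -> T -> C) (l : A -> C) L :
  (forall a, tends F (f a) (l a)) -> tends F (fun x => lsum (fun a => f a x) L) (lsum l L).
Proof. intros H. induction L; simpl; [cx|]. cx. Qed.

(** Dominated convergence for series: a finite list carries all but [eps / 4] of the majorant, and
    finite sums converge termwise. *)
Lemma tends_Sum {T A} (F : (T -> Prop) -> Prop) {FF : Filter F} (f : A -> T -> C) (l : A -> C) (g : A -> R) :
  (forall a, tends F (f a) (l a)) -> F (fun x => forall a, Cmod (f a x) <= g a) -> (forall a, Cmod (l a) <= g a) ->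
  rsummable g -> tends F (fun x => Sum (fun a => f a x)) (Sum l).
Proof.
  intros Hf Hg Hl Hs eps He. assert (Hg0 : forall a, 0 <= g a) by (intros a; eapply Rle_trans; [pos|apply Hl]).
  destruct (rsummable_tail g (eps / 4) Hg0 Hs) as [L0 [H0 H1]]; [lra|]. assert (He2 : 0 < eps / 4) by lra.
  generalize (filter_and _ _ Hg (tends_lsum F f l L0 Hf _ He2)). apply filter_imp. intros x [X1 X2].
  pose proof (has_sum_tail_bound (fun a => f a x) g _ L0 _ (Sum_correct _ (summable_le _ g X1 Hs)) X1 H0 H1).
  pose proof (has_sum_tail_bound l g _ L0 _ (Sum_correct _ (summable_le _ g Hl Hs)) Hl H0 H1). rewrite Cmod_minus_sym in H2.
  pose proof (Cmod_triangle3 (Sum (fun a => f a x)) (lsum (fun a => f a x) L0) (Sum l)).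
  pose proof (Cmod_triangle3 (lsum (fun a => f a x) L0) (lsum l L0) (Sum l)). lra.
Qed.

Lemma has_sum_nat_telescope (u : nat -> C) l : has_sum (fun n => u n - u (S n))%C l -> tends eventually u 0 -> l = u O.
Proof.
  intros H Hu. assert (E : forall N, lsum (fun n => u n - u (S n))%C (seq 0 N) = (u O - u N)%C).
  { induction N; [simpl; ring|]. rewrite seq_S, lsum_app, IHN. simpl. ring. }
  apply Ceq_minus, Cmod_zero_eq. apply le_epsilon. intros eps He. rewrite Rplus_0_l. assert (He2 : 0 < eps / 2) by lra.
  destruct (H (mkposreal _ He2)) as [L0 H0]. destruct (Hu _ He2) as [N1 H1]. set (N := (N1 + S (list_max L0))%nat).
  specialize (H0 (seq 0 N) (seq_NoDup _ _)). change (incl L0 (seq 0 N) -> Cmod (lsum (fun n => u n - u (S n))%C (seq 0 N) - l) < eps / 2) in H0.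
  rewrite E in H0. specialize (H1 N ltac:(unfold N; lia)). assert (Hi : incl L0 (seq 0 N)).
  { intros x Hx. apply in_seq. assert ((x <= list_max L0)%nat); [|unfold N; lia].
    assert (Hall := proj1 (list_max_le L0 (list_max L0)) (Nat.le_refl _)). rewrite Forall_forall in Hall. now apply Hall. }
  specialize (H0 Hi). replace (l - u O)%C with (- (u O - u N - l) - (u N - 0))%C by ring. ctrim. rewrite Cmod_opp. lra.
Qed.

Lemma seq_Z_cover (L0 : list Z) : exists N, forall x, In x L0 -> (- Z.of_nat N <= x < Z.of_nat N)%Z.
Proof.
  induction L0 as [|a L0 [N HN]]; [exists O; simpl; tauto|]. exists (N + S (Z.to_nat (Z.abs a)))%nat. intros x [<-|Hx]; [lia|]. specialize (HN x Hx). lia.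
Qed.

Lemma has_sum_Z_telescope (u : Z -> C) l : has_sum (fun n => u n - u (n + 1)%Z)%C l ->
  tends eventually (fun n => u (Z.of_nat n)) 0 -> tends eventually (fun n => u (- Z.of_nat n)%Z) 0 -> l = 0.
Proof.
  intros H Hu Hv. set (zs := fun N => map (fun k => (Z.of_nat k - Z.of_nat N)%Z) (seq 0 (2 * N))).
  assert (E0 : forall N M, lsum (fun n => u n - u (n + 1)%Z)%C (map (fun k => (Z.of_nat k - Z.of_nat N)%Z) (seq 0 M)) = (u (- Z.of_nat N)%Z - u (Z.of_nat M - Z.of_nat N)%Z)%C).
  { intros N M. induction M; [simpl; ring|]. rewrite seq_S, map_app, lsum_app, IHM. cbn [lsum fold_right map]. rewrite Nat.add_0_l.
    replace (Z.of_nat (S M) - Z.of_nat N)%Z with (Z.of_nat M - Z.of_nat N + 1)%Z by lia. ring. }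
  assert (E : forall N, lsum (fun n => u n - u (n + 1)%Z)%C (zs N) = (u (- Z.of_nat N)%Z - u (Z.of_nat N))%C).
  { intros N. unfold zs. rewrite E0. do 2 f_equal. f_equal. lia. }
  apply Cmod_zero_eq. apply le_epsilon. intros eps He. rewrite Rplus_0_l. assert (He2 : 0 < eps / 3) by lra.
  destruct (H (mkposreal _ He2)) as [L0 H0]. destruct (Hu _ He2) as [N1 H1]. destruct (Hv _ He2) as [N2 H2]. destruct (seq_Z_cover L0) as [N3 H3].
  set (N := (N1 + N2 + N3)%nat). specialize (H1 N ltac:(unfold N; lia)). specialize (H2 N ltac:(unfold N; lia)).
  assert (H4 : Cmod (lsum (fun n => u n - u (n + 1)%Z)%C (zs N) - l) < eps / 3).
  { apply (H0 (zs N)).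
    - unfold zs. apply FinFun.Injective_map_NoDup; [|apply seq_NoDup]. intros x y. lia.
    - intros x Hx. specialize (H3 x Hx). unfold zs. apply in_map_iff. exists (Z.to_nat (x + Z.of_nat N)). split; [unfold N in *; lia|].
      apply in_seq. unfold N in *. lia. }
  rewrite E in H4. replace l with (- (u (- Z.of_nat N)%Z - u (Z.of_nat N) - l) + (u (- Z.of_nat N)%Z - 0) - (u (Z.of_nat N) - 0))%C by ring.
  ctrim. eapply Rle_trans; [apply Rplus_le_compat_r, Cmod_triangle|]. rewrite Cmod_opp. lra.
Qed.

(** Integral test through the mean value theorem: a term is bounded by an increment of the
    primitive, which telescopes in [rsummable_nat_power]. *)
Lemma pseries_step (x t : R) : 1 < x -> 0 < t ->
  (x - 1) * Rpower (t + 1) (- x) <= Rpower t (1 - x) - Rpower (t + 1) (1 - x).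
Proof.
  intros Hx Ht. destruct (MVT_gen (fun u => Rpower u (1 - x)) t (t + 1) (fun u => (1 - x) * Rpower u (1 - x - 1))) as [c [Hc1 Hc]].
  - intros u Hu. rewrite Rmin_left, Rmax_right in Hu by lra. apply is_derive_Reals. apply derivable_pt_lim_power. lra.
  - intros u Hu. rewrite Rmin_left, Rmax_right in Hu by lra. apply derivable_continuous_pt.
    exists ((1 - x) * Rpower u (1 - x - 1)). apply derivable_pt_lim_power. lra.
  - rewrite Rmin_left, Rmax_right in Hc1 by lra. replace (t + 1 - t) with 1 in Hc by ring. rewrite Rmult_1_r in Hc. replace (1 - x - 1) with (- x) in Hc by ring.
    assert (Rpower (t + 1) (- x) <= Rpower c (- x)).
    { rewrite !Rpower_Ropp. apply Rinv_le_contravar; [pos|]. apply Rle_Rpower_l; lra. }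
    nra.
Qed.

Lemma rsummable_nat_power x : 1 < x -> rsummable (fun n => Rpower (INR n + 1) (- x)).
Proof.
  intros Hx. exists (1 + / (x - 1)).
  assert (Hp : forall N, rsum (fun n => Rpower (INR n + 1) (- x)) (seq 0 (S N)) <= 1 + / (x - 1) - / (x - 1) * Rpower (INR (S N)) (1 - x)).
  { induction N.
    - simpl. rewrite Rplus_0_l. unfold Rpower. rewrite ln_1, !Rmult_0_r, exp_0. lra.
    - rewrite seq_S, rsum_app. rewrite Nat.add_0_l. cbn [rsum fold_right]. rewrite Rplus_0_r.
      pose proof (pseries_step x (INR (S N)) Hx ltac:(apply lt_0_INR; lia)) as H. rewrite (S_INR (S N)). assert (Hi : 0 < / (x - 1)) by pos.
      apply (Rmult_le_compat_l (/ (x - 1))) in H; [|lra]. rewrite <- Rmult_assoc, Rinv_l, Rmult_1_l in H by lra. lra. }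
  intros L HL. assert (Hall := proj1 (list_max_le L (list_max L)) (Nat.le_refl _)). rewrite Forall_forall in Hall.
  eapply Rle_trans; [apply (rsum_incl _ L (seq 0 (S (list_max L))))|].
  - pos.
  - exact HL.
  - intros a Ha. apply in_seq. specialize (Hall a Ha). lia.
  - eapply Rle_trans; [apply Hp|]. assert (0 < / (x - 1) * Rpower (INR (S (list_max L))) (1 - x)); [|lra]. pos.
Qed.

Lemma rsummable_Z_power x : 1 < x -> rsummable (fun k : Z => Rpower (Rabs (IZR k) + 1) (- x)).
Proof.
  intros Hx. set (g := fun k : Z => Rpower (Rabs (IZR k) + 1) (- x)). assert (Hg : forall k, 0 <= g k) by pos.
  apply rsummable_le with (fun k => (if Z_le_dec 0 k then g k else 0) + (if Z_le_dec k 0 then g k else 0)).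
  { intros k. specialize (Hg k). fold (g k). destruct (Z_le_dec 0 k), (Z_le_dec k 0); try lra. lia. }
  apply rsummable_plus.
  - apply (rsummable_image _ Z.of_nat).
    + intros b Hb. destruct (Z_le_dec 0 b); auto. exfalso. apply (Hb (Z.to_nat b)). lia.
    + eapply rsummable_le; [|apply (rsummable_nat_power x Hx)]. intros n. cbv beta. destruct (Z_le_dec 0 (Z.of_nat n)); [|lia].
      unfold g. rewrite <- INR_IZR_INZ, Rabs_pos_eq; [lra|pos].
  - apply (rsummable_image _ (fun n => (- Z.of_nat n)%Z)).
    + intros b Hb. destruct (Z_le_dec b 0); auto. exfalso. apply (Hb (Z.to_nat (- b))). lia.
    + eapply rsummable_le; [|apply (rsummable_nat_power x Hx)]. intros n. cbv beta. destruct (Z_le_dec (- Z.of_nat n) 0); [|lia].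
      unfold g. rewrite opp_IZR, Rabs_Ropp, <- INR_IZR_INZ, Rabs_pos_eq; [lra|pos].
Qed.

(** * Euler-Maclaurin summation *)

Definition shift {T} (a : nat -> T) : nat -> T := fun k => a (S k).

(** The recursion peels off the first term, as in [conv], so that inductions on Cauchy products
    become shifts of sequences. The usual recursion is [dot_S]. *)
Fixpoint dot (a v : nat -> C) (n : nat) : C :=
  match n with O => a O * v O | S m => a O * v O + dot (shift a) (shift v) m end%C.

Fixpoint conv (a b : nat -> C) (n : nat) : C :=
  match n with O => a O * b O | S m => a O * b (S m) + conv (shift a) b m end%C.

Fixpoint asum (a : nat -> C) (n : nat) : R :=
  match n with O => Cmod (a O) | S m => Cmod (a O) + asum (shift a) m end.

Lemma dot_S a v n : dot a v (S n) = (dot a v n + a (S n) * v (S n))%C.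
Proof. revert a v. induction n; intros a v; [cx|]. cbn [dot] in *. rewrite IHn. unfold shift. ring. Qed.

Lemma dot_sum_n a v n : dot a v n = sum_n (G := C_AbelianGroup) (fun k => a k * v k)%C n.
Proof. induction n; [now rewrite sum_O|]. rewrite dot_S, IHn, sum_Sn. reflexivity. Qed.

Lemma dot_plus a b v n : dot (fun k => a k + b k)%C v n = (dot a v n + dot b v n)%C.
Proof. induction n; [simpl; ring|]. rewrite !dot_S, IHn. ring. Qed.

Lemma dot_scal c a v n : dot (fun k => c * a k)%C v n = (c * dot a v n)%C.
Proof. induction n; [simpl; ring|]. rewrite !dot_S, IHn. ring. Qed.

Lemma dot_scal_r c a v n : dot a (fun k => c * v k)%C n = (c * dot a v n)%C.
Proof. induction n; [simpl; ring|]. rewrite !dot_S, IHn. ring. Qed.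

Lemma dot_ext a b v w n : (forall k, (k <= n)%nat -> a k = b k) -> (forall k, (k <= n)%nat -> v k = w k) -> dot a v n = dot b w n.
Proof. induction n; intros Ha Hv; [simpl; now rewrite Ha, Hv by lia|]. rewrite !dot_S, IHn, Ha, Hv by auto with arith. reflexivity. Qed.

Lemma asum_nonneg a n : 0 <= asum a n.
Proof. revert a. induction n; intros a; simpl; [pos|]. pose proof (Cmod_ge_0 (a O)). specialize (IHn (shift a)). lra. Qed.

Lemma dot_bound a v n B : (forall k, (k <= n)%nat -> Cmod (v k) <= B) -> Cmod (dot a v n) <= asum a n * B.
Proof.
  revert a v. induction n; intros a v H; simpl.
  - rewrite Cmod_mult. apply Rmult_le_compat_l; [pos|auto].
  - ctri. rewrite Cmod_mult, Rmult_plus_distr_r. apply Rplus_le_compat.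
    + apply Rmult_le_compat_l; [pos|apply H; lia].
    + apply IHn. intros k Hk. apply H. lia.
Qed.

(* [dot (conv a b) v] is the double sum of [a k * b i * v (k + i)]; this is that
   rearrangement with the inner sums known only approximately. *)
Lemma dot_conv_approx a b (F v : nat -> C) n E :
  (forall k, (k <= n)%nat -> Cmod (F k - dot b (fun i => v (k + i)%nat) (n - k)) <= E) ->
  Cmod (dot a F n - dot (conv a b) v n) <= asum a n * E.
Proof.
  revert a F v. induction n; intros a F v H.
  - simpl. specialize (H O (Nat.le_refl _)). simpl in H. replace (a O * F O - a O * b O * v O)%C with (a O * (F O - b O * v O))%C by ring.
    rewrite Cmod_mult. apply Rmult_le_compat_l; [pos|exact H].
  - cbn [dot asum]. assert (E1 : (conv a b O * v O + dot (shift (conv a b)) (shift v) n)%C =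
       (a O * dot b v (S n) + dot (conv (shift a) b) (shift v) n)%C).
    { transitivity (a O * b O * v O + dot (fun k => a O * shift b k + conv (shift a) b k)%C (shift v) n)%C; [cx|]. rewrite dot_plus, dot_scal. cbn [dot]. ring. }
    rewrite E1. replace (a O * F O + dot (shift a) (shift F) n - (a O * dot b v (S n) + dot (conv (shift a) b) (shift v) n))%C
      with (a O * (F O - dot b v (S n)) + (dot (shift a) (shift F) n - dot (conv (shift a) b) (shift v) n))%C by ring.
    ctri. rewrite Cmod_mult, Rmult_plus_distr_r. apply Rplus_le_compat.
    + apply Rmult_le_compat_l; [pos|]. exact (H O ltac:(lia)).
    + apply IHn. intros k Hk. exact (H (S k) ltac:(lia)).
Qed.

(* Asymptotic expansion at 0, on the punctured neighbourhood where [Cnum] is specified. *)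
Definition asy (f : C -> C) (a : nat -> C) (m : nat) : Prop :=
  exists K r, 0 < r /\ forall w : C, w <> 0 -> Cmod w < r -> Cmod (f w - dot a (fun k => w ^ k)%C m) <= K * Cmod w ^ S m.

Lemma pow_Cmod_le1 (w : C) k : Cmod w <= 1 -> Cmod (w ^ k) <= 1.
Proof. intros H. rewrite Cmod_pow. rewrite <- (pow1 k). apply pow_incr. auto using Cmod_ge_0. Qed.

Lemma asy_plus f g a b m : asy f a m -> asy g b m -> asy (fun w => f w + g w)%C (fun k => a k + b k)%C m.
Proof.
  intros [K [r [Hr H]]] [K' [r' [Hr' H']]]. exists (K + K'), (Rmin r r'). split; [pos|].
  intros w H0 Hw. specialize (H w H0 (Rlt_le_trans _ _ _ Hw (Rmin_l _ _))). specialize (H' w H0 (Rlt_le_trans _ _ _ Hw (Rmin_r _ _))). rewrite dot_plus.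
  replace (f w + g w - (dot a (fun k => w ^ k)%C m + dot b (fun k => w ^ k)%C m))%C with
    ((f w - dot a (fun k => w ^ k)%C m) + (g w - dot b (fun k => w ^ k)%C m))%C by ring.
  ctri. lra.
Qed.

Lemma asy_scal c f a m : asy f a m -> asy (fun w => c * f w)%C (fun k => c * a k)%C m.
Proof.
  intros [K [r [Hr H]]]. exists (Cmod c * K), r. split; auto. intros w H0 Hw. specialize (H w H0 Hw).
  rewrite dot_scal. replace (c * f w - c * dot a (fun k => w ^ k)%C m)%C with (c * (f w - dot a (fun k => w ^ k)%C m))%C by ring.
  rewrite Cmod_mult, Rmult_assoc. apply Rmult_le_compat_l; [pos|exact H].
Qed.

Lemma dot_pow_S a w m : dot a (fun k => w ^ k)%C (S m) = (a O + w * dot (shift a) (fun k => w ^ k)%C m)%C.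
Proof. rewrite <- dot_scal_r. cbn [dot]. f_equal. ring. Qed.

Lemma dot_pow_bound a w m : Cmod w <= 1 -> Cmod (dot a (fun k => w ^ k)%C m) <= asum a m.
Proof. intros H. rewrite <- (Rmult_1_r (asum a m)). apply dot_bound. intros. now apply pow_Cmod_le1. Qed.

(** Splitting off the first coefficient of [a] leaves [w] times the product of the shifted
    polynomial with [b], and this factor supplies the missing power of [w]. *)
Lemma conv_pow_bound a b m : exists K, 0 <= K /\ forall w, Cmod w <= 1 ->
  Cmod (dot a (fun k => w ^ k)%C m * dot b (fun k => w ^ k)%C m - dot (conv a b) (fun k => w ^ k)%C m) <= K * Cmod w ^ S m.
Proof.
  revert a. induction m; intros a.
  - exists 0. split; [lra|]. intros w _. simpl. replace (a O * 1 * (b O * 1) - a O * b O * 1)%C with (RtoC 0) by ring. rewrite Cmod_0. lra.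
  - destruct (IHm (shift a)) as [K [HK IH]]. exists (K + asum (shift a) m * Cmod (b (S m))).
    split. { pose proof (asum_nonneg (shift a) m). pose proof (Cmod_ge_0 (b (S m))). nra. }
    intros w Hw. specialize (IH w Hw). set (P := fun k => (w ^ k)%C) in *.
    assert (E1 : dot (conv a b) P (S m) = (a O * dot b P (S m) + w * dot (conv (shift a) b) P m)%C).
    { unfold P. rewrite !dot_pow_S. transitivity (a O * b O + w * dot (fun k => a O * shift b k + conv (shift a) b k)%C P m)%C; [cx|].
      rewrite dot_plus, dot_scal. unfold P. ring. }
    rewrite E1. unfold P at 1. rewrite dot_pow_S. fold P. rewrite (dot_S b P m) . replace ((a O + w * dot (shift a) P m) * (dot b P m + b (S m) * P (S m)) -
        (a O * (dot b P m + b (S m) * P (S m)) + w * dot (conv (shift a) b) P m))%C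
     with (w * (dot (shift a) P m * dot b P m - dot (conv (shift a) b) P m) + w * (dot (shift a) P m * b (S m) * P (S m)))%C by ring.
    ctri. rewrite !Cmod_mult. replace (Cmod (P (S m))) with (Cmod w ^ S m) by (unfold P; now rewrite Cmod_pow).
    change (Cmod w ^ S (S m)) with (Cmod w * Cmod w ^ S m).
    pose proof (Cmod_ge_0 w). pose proof (pow_le _ (S m) H). pose proof (dot_pow_bound (shift a) w m Hw). fold P in H1. pose proof (Cmod_ge_0 (b (S m))).
    rewrite Rmult_plus_distr_r. apply Rplus_le_compat.
    + nra.
    + apply Rle_trans with (Cmod w * (asum (shift a) m * Cmod (b (S m)) * Cmod w ^ S m)); [|lra].
      apply Rmult_le_compat_l; auto. apply Rmult_le_compat_r; auto. apply Rmult_le_compat_r; auto.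
Qed.

Lemma asy_mult f g a b m : asy f a m -> asy g b m -> asy (fun w => f w * g w)%C (conv a b) m.
Proof.
  intros [K [r [Hr H]]] [K' [r' [Hr' H']]]. destruct (conv_pow_bound a b m) as [K2 [HK2 H2]]. set (K1 := Rmax K 0). set (K1' := Rmax K' 0).
  exists (K1 * (asum b m + K1') + asum a m * K1' + K2), (Rmin 1 (Rmin r r')). split; [pos|].
  intros w H0 Hw. pose proof (Rmin_l 1 (Rmin r r')). pose proof (Rmin_r 1 (Rmin r r')). pose proof (Rmin_l r r'). pose proof (Rmin_r r r').
  specialize (H w H0 ltac:(lra)). specialize (H' w H0 ltac:(lra)). specialize (H2 w ltac:(lra)). set (P := fun k => (w ^ k)%C) in *.
  assert (Hw1 : Cmod w <= 1) by lra. pose proof (dot_pow_bound a w m Hw1) as Ba. pose proof (dot_pow_bound b w m Hw1) as Bb. fold P in Ba, Bb.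
  pose proof (pow_le _ (S m) (Cmod_ge_0 w)) as Hp. set (W := Cmod w ^ S m) in *. assert (HW1 : W <= 1). { unfold W. rewrite <- Cmod_pow. now apply pow_Cmod_le1. }
  assert (HKw : K * W <= K1 * W) by (apply Rmult_le_compat_r; auto; apply Rmax_l).
  assert (HKw' : K' * W <= K1' * W) by (apply Rmult_le_compat_r; auto; apply Rmax_l). assert (K1p' : 0 <= K1') by apply Rmax_r.
  replace (f w * g w - dot (conv a b) P m)%C with
   ((f w - dot a P m) * (dot b P m + (g w - dot b P m)) + dot a P m * (g w - dot b P m) + (dot a P m * dot b P m - dot (conv a b) P m))%C by ring.
  ctri. eapply Rle_trans; [apply Rplus_le_compat_r, Cmod_triangle|]. rewrite !Cmod_mult.
  rewrite !Rmult_plus_distr_r. apply Rplus_le_compat; [apply Rplus_le_compat|exact H2].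
  - replace (K1 * (asum b m + K1') * W) with ((K1 * W) * (asum b m + K1')) by ring. apply Rmult_le_compat; try apply Cmod_ge_0; [lra|]. ctri. nra.
  - rewrite Rmult_assoc. apply Rmult_le_compat; try apply Cmod_ge_0; auto. lra.
Qed.

(** Letting [w] tend to 0 kills the constant coefficient; division by [w] then lowers the degree. *)
Lemma dot_small_zero d m K r : 0 < r -> (forall w : C, w <> 0 -> Cmod w < r -> Cmod (dot d (fun k => w ^ k)%C m) <= K * Cmod w ^ S m) ->
  forall k, (k <= m)%nat -> d k = 0.
Proof.
  revert d. induction m; intros d Hr H k Hk.
  - replace k with O by lia. apply Cmod_zero_eq. apply (le_all_small _ (Rmax K 0) (Rmin 1 r)).
    + pos.
    + apply Rmax_r.
    + intros t Ht. pose proof (Rmin_r 1 r). assert (Ht0 : RtoC t <> 0) by (intros E; apply RtoC_inj in E; lra).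
      specialize (H t Ht0). rewrite Cmod_R, Rabs_pos_eq in H by lra. specialize (H ltac:(lra)). simpl in H.
      rewrite !Cmult_1_r, Rmult_1_r in H. pose proof (Rmax_l K 0). nra.
  - assert (Hd0 : d O = 0).
    { apply Cmod_zero_eq. apply (le_all_small _ (asum (shift d) m + Rmax K 0) (Rmin 1 r)).
      + pos.
      + pose proof (asum_nonneg (shift d) m). pose proof (Rmax_r K 0). lra.
      + intros t Ht. pose proof (Rmin_r 1 r). pose proof (Rmin_l 1 r). assert (Ht0 : RtoC t <> 0) by (intros E; apply RtoC_inj in E; lra).
        assert (Ht1 : Cmod t = t) by (rewrite Cmod_R, Rabs_pos_eq; lra). specialize (H t Ht0 ltac:(lra)). rewrite dot_pow_S in H. rewrite Ht1 in H.
        pose proof (dot_pow_bound (shift d) t m ltac:(lra)) as Hb. pose proof (Cmod_triangle_inv (d O) (- (t * dot (shift d) (fun k => t ^ k) m)))%C as T.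
        replace (d O - - (t * dot (shift d) (fun k => t ^ k) m))%C with (d O + t * dot (shift d) (fun k => t ^ k) m)%C in T by ring.
        rewrite Cmod_opp, Cmod_mult, Ht1 in T.
        assert (t ^ S (S m) <= t). { change (t * t ^ S m <= t). assert (t ^ S m <= 1); [rewrite <- (pow1 (S m)); apply pow_incr; lra|nra]. }
        pose proof (pow_le t (S (S m)) ltac:(lra)). pose proof (Rmax_l K 0). pose proof (Rmax_r K 0). nra. }
    destruct k as [|k]; [exact Hd0|]. apply (IHm (shift d) Hr); [|lia]. intros w Hw Hwr. specialize (H w Hw Hwr). rewrite dot_pow_S, Hd0, Cplus_0_l, Cmod_mult in H.
    pose proof (Cmod_pos w Hw). apply Rmult_le_reg_l with (Cmod w); [lra|]. eapply Rle_trans; [exact H|]. simpl; lra.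
Qed.

Lemma asy_unique f g a b m : (exists r, 0 < r /\ forall w : C, w <> 0 -> Cmod w < r -> f w = g w) ->
  asy f a m -> asy g b m -> forall k, (k <= m)%nat -> a k = b k.
Proof.
  intros [r0 [Hr0 H0]] [K [r [Hr H]]] [K' [r' [Hr' H']]] k Hk. apply Ceq_minus.
  apply (dot_small_zero (fun k => a k + (- (1)) * b k)%C m (K + K') (Rmin r0 (Rmin r r'))) in Hk.
  - rewrite <- Hk. ring.
  - pos.
  - intros w Hw Hwr. pose proof (Rmin_l r0 (Rmin r r')). pose proof (Rmin_r r0 (Rmin r r')). pose proof (Rmin_l r r'). pose proof (Rmin_r r r').
    specialize (H w Hw ltac:(lra)). specialize (H' w Hw ltac:(lra)). rewrite H0 in H by (auto; lra). rewrite dot_plus, dot_scal. rewrite Rmult_plus_distr_r.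
    replace (dot a (fun k => w ^ k) m + - (1) * dot b (fun k => w ^ k) m)%C with
      ((g w - dot b (fun k => w ^ k) m) - (g w - dot a (fun k => w ^ k) m))%C by ring.
    ctrim. lra.
Qed.

(** * Taylor's formula and the generating function of the C_k *)

Definition expc (t : C) (k : nat) : C := (t ^ k / INR (fact k))%C.

Lemma fact_nz k : RtoC (INR (fact k)) <> 0.
Proof. intros E. apply RtoC_inj in E. now apply INR_fact_neq_0 in E. Qed.

Lemma rder_pow_fact (k : nat) t : rder (fun t => expc (RtoC t) (S k)) t (expc (RtoC t) k).
Proof.
  assert (H : forall n, rder (fun t => RtoC t ^ S n)%C t (INR (S n) * RtoC t ^ n)%C).
  { induction n.
    - eapply rder_eq; [|eapply rder_ext; [|apply rder_RtoC]]; [simpl; ring|intros; simpl; ring].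
    - eapply rder_eq; [|eapply rder_ext; [|apply rder_mult; [apply rder_RtoC|exact IHn]]].
      + rewrite (S_INR (S n)), RtoC_plus. simpl. ring.
      + cx. }
  eapply rder_eq; [|eapply rder_ext; [|apply (rder_scal (/ INR (fact (S k)))%C), (H k)]].
  - unfold expc. rewrite fact_simpl, mult_INR, RtoC_mult. pose proof (fact_nz k).
    assert (RtoC (INR (S k)) <> 0) by (intros E; apply RtoC_inj in E; now apply (not_0_INR (S k)) in E). field. auto.
  - intros u. unfold expc, Cdiv. ring.
Qed.

Lemma rder_dot v n t : rder (fun t => dot (expc (RtoC t)) v (S n)) t (dot (expc (RtoC t)) (shift v) n).
Proof.
  induction n.
  - eapply rder_eq; [|eapply rder_ext; [|apply rder_plus; [apply (rder_const (v O))|apply (rder_scal (v 1%nat)), (rder_pow_fact 0)]]].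
    + simpl. unfold shift. ring.
    + intros u. simpl. unfold shift, expc. simpl. field.
  - eapply rder_eq; [|eapply rder_ext; [|apply rder_plus; [exact IHn|apply (rder_scal (v (S (S n)))), (rder_pow_fact (S n))]]].
    + rewrite (dot_S _ _ n). unfold shift. ring.
    + intros u. cbv beta. rewrite (dot_S _ _ (S n)). ring.
Qed.

(** Repeated integration of the last derivative over [[0, t]] with [t <= 1]. The factorial in the
    remainder is given away, since only the order of the error matters. *)
Lemma taylor_segment (u : nat -> R -> C) n M :
  (forall k t, (k <= n)%nat -> 0 <= t <= 1 -> rder (u k) t (u (S k) t)) ->
  con (u (S n)) 0 1 -> (forall t, 0 <= t <= 1 -> Cmod (u (S n) t) <= M) ->
  forall t, 0 <= t <= 1 -> Cmod (u O t - dot (expc (RtoC t)) (fun k => u k 0) n) <= M.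
Proof.
  assert (Step : forall (w dw : R -> C) t, 0 <= M -> 0 <= t <= 1 -> w 0 = RtoC 0 -> (forall s, 0 <= s <= 1 -> rder w s (dw s)) ->
     con dw 0 1 -> (forall s, 0 <= s <= 1 -> Cmod (dw s) <= M) -> Cmod (w t) <= M).
  { intros w dw t HM Ht H0 Hw Hc Hb. replace (w t) with (w t - w 0)%C by (rewrite H0; ring).
    rewrite <- (CInt_FTC w dw); [|lra|intros; apply Hw; lra|eapply con_sub; eauto; lra].
    eapply Rle_trans; [apply CInt_bound with (M := M); [lra|eapply con_sub; eauto; lra|intros; apply Hb; lra]|]. nra. }
  revert u. induction n; intros u Hu Hc Hb t Ht.
  - assert (HM : 0 <= M) by (eapply Rle_trans; [pos|apply (Hb 0); lra]). apply (Step (fun t => u O t - dot (expc (RtoC t)) (fun k => u k 0) O)%C (u 1%nat)); auto.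
    + simpl. unfold expc. simpl. field.
    + intros s Hs. eapply rder_eq; [|eapply rder_ext; [|apply rder_plus; [apply (Hu O s); auto; lra|apply (rder_const (- u O 0%R)%C)]]].
      * ring.
      * intros v. simpl. unfold expc. simpl. field.
  - assert (HM : 0 <= M) by (eapply Rle_trans; [pos|apply (Hb 0); lra]).
    assert (Hder : forall s, 0 <= s <= 1 -> rder (fun t => u O t - dot (expc (RtoC t)) (fun k => u k 0) (S n))%C s
       (u 1%nat s - dot (expc (RtoC s)) (fun k => shift u k 0) n)%C).
    { intros s Hs. eapply rder_eq; [|eapply rder_ext; [|apply rder_plus; [apply (Hu O s); [lia|lra]|apply (rder_scal (- (1))%C), (rder_dot (fun k => u k 0) n)]]].
      - cbv beta. unfold shift. ring.
      - intros v. cbv beta. ring. }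
    apply (Step (fun t => u O t - dot (expc (RtoC t)) (fun k => u k 0) (S n))%C (fun s => u 1%nat s - dot (expc (RtoC s)) (fun k => shift u k 0) n)%C); auto.
    + cbn [dot]. assert (E : dot (shift (expc 0)) (shift (fun k => u k 0)) n = 0).
      { clear. generalize (shift (fun k => u k 0)). intros v. assert (H : forall m, dot (shift (expc 0)) v m = 0).
        { induction m; [simpl; unfold shift, expc; simpl; unfold Cdiv; ring|]. rewrite dot_S, IHm. unfold shift, expc. rewrite Cpow_S. unfold Cdiv. ring. }
        apply H. }
      rewrite E. unfold expc. simpl. field.
    + intros s Hs. apply con_minus with (a := 0) (b := 1); auto.
      * eapply con_rder. intros v Hv. apply (Hu 1%nat); auto. lia.
      * destruct n.
        -- eapply con_rder. intros v Hv. eapply rder_ext; [|apply (rder_const (shift u 0%nat 0))]. intros x. simpl. unfold expc. simpl. field.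
        -- eapply con_rder. intros v Hv. apply rder_dot.
    + intros s Hs. apply (IHn (shift u)); auto. intros k v Hk Hv. unfold shift. apply Hu; auto. lia.
Qed.

Lemma rder_line (b h : C) t : rder (fun t => b - RtoC t * h)%C t (- h)%C.
Proof.
  eapply rder_eq; [|eapply rder_ext; [|apply rder_plus; [apply (rder_const b)|apply (rder_scal (- h)%C), rder_RtoC]]].
  - ring.
  - intros u. cbv beta. ring.
Qed.

Lemma asy_exp (t : C) m : asy (fun w => Cexp (t * w)) (expc t) m.
Proof.
  exists (Cmod t ^ S m * exp (Cmod t)), 1. split; [lra|]. intros w _ Hw. set (u := fun (k : nat) (s : R) => ((t * w) ^ k * Cexp ((t * w) * RtoC s))%C).
  assert (Hu : forall k s, rder (u k) s (u (S k) s)).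
  { intros k s. unfold u. eapply rder_eq; [|apply rder_scal, (rder_comp Cexp (fun s => (t * w) * RtoC s)%C); [apply cder_Cexp|apply rder_scal, rder_RtoC]].
    rewrite Cpow_S. ring. }
  assert (Hb : forall s, 0 <= s <= 1 -> Cmod (u (S m) s) <= Cmod t ^ S m * exp (Cmod t) * Cmod w ^ S m).
  { intros s Hs. unfold u. rewrite Cmod_mult, Cmod_pow, Cmod_mult, Rpow_mult_distr, Cmod_Cexp.
    rewrite (Rmult_assoc (Cmod t ^ S m) (exp _)), (Rmult_comm (exp (Cmod t))), <- Rmult_assoc. apply Rmult_le_compat_l; [pos|]. assert (Re (t * w * s) <= Cmod t).
    { eapply Rle_trans; [apply Rle_abs|]. eapply Rle_trans; [apply re_le_Cmod|]. rewrite !Cmod_mult, Cmod_R, Rabs_pos_eq by lra.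
      pose proof (Cmod_ge_0 t). pose proof (Cmod_ge_0 w).
      apply Rle_trans with (Cmod t * 1 * 1); [|lra]. apply Rmult_le_compat; try lra; [nra|]. apply Rmult_le_compat_l; lra. }
    destruct (Rle_lt_or_eq_dec _ _ H) as [H1|H1]; [left; now apply exp_increasing|right; now rewrite H1]. }
  pose proof (taylor_segment u m _ (fun k s _ _ => Hu k s) (con_rder _ _ 0 1 (fun s _ => Hu (S m) s)) Hb 1 ltac:(lra)) as H. replace (Cexp (t * w)) with (u O 1).
  2:{ unfold u. simpl. rewrite Cmult_1_l, Cmult_1_r. reflexivity. }
  replace (dot (expc t) (fun k => w ^ k)%C m) with (dot (expc 1) (fun k => u k 0) m); [exact H|]. clear. induction m.
  - unfold u, expc. simpl. rewrite Cmult_0_r, Cexp_0. field.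
  - rewrite !dot_S, IHm. f_equal. unfold u, expc. rewrite Cmult_0_r, Cexp_0, Cpow_1_l, Cpow_mult_l. unfold Cdiv. ring.
Qed.

Definition gen (X : C) (kappa : R) (w : C) : C := (w * e (X * kappa) * Cexp (X * w) / (e kappa * Cexp w - 1))%C.
Definition gam (X : C) (kappa : R) (k : nat) : C := (Cnum k X kappa / INR (fact k))%C.

Lemma Cminus_0_r (z : C) : (z - 0)%C = z.
Proof. ring. Qed.

Lemma hol_minus_id a z : hol (fun w => w - a)%C z.
Proof. cx. Qed.

(** If [e kappa = 1], the denominator vanishes at 0 with the nonzero derivative [e kappa], and the
    factor [w] of the numerator cancels this simple zero. *)
Lemma gen_hol (X : C) (kappa : R) : exists g, hol g 0 /\ cnear' (RtoC 0) (fun w => gen X kappa w = g w).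
Proof.
  assert (HD : forall z, hol (fun w => e kappa * Cexp w - 1)%C z).
  { cx. }
  assert (HE : forall z, hol (fun w => e (X * kappa) * Cexp (X * w))%C z).
  { cx. }
  destruct (Ceq_dec (e kappa * Cexp 0 - 1) 0) as [E|E].
  - destruct (hol_divide _ 0 (HD 0) E) as [g [Hg Hl]]. assert (Hg0 : g 0 <> 0).
    { intros E0. assert (Hd1 : cder (fun w => e kappa * Cexp w - 1)%C 0 (e kappa * Cexp 0)%C).
      { eapply gder_eq; [|apply gder_minus; [apply tends_id|apply gder_mult; [apply tends_id|apply gder_const|apply cder_Cexp]|apply gder_const]]. cbv beta. ring. }
      assert (Hd2 : tends (cnear' (RtoC 0)) g (e kappa * Cexp 0)%C).
      { destruct Hd1 as [p [P1 [P2 P3]]]. apply tends_ext_F with p; [apply _| |now apply tends_locally'].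
        generalize (filter_and _ _ (locally'_ne 0) (locally_locally' _ _ Hl)). apply filter_imp. intros w [Hw Hw2].
        specialize (P3 w). rewrite Hw2 in P3. rewrite E in P3. rewrite Cplus_0_l in P3.
        assert (Hn := Cminus_nz _ _ Hw). replace (p w) with (p w * (w - 0) * / (w - 0))%C by (rewrite <- Cmult_assoc, Cinv_r by exact Hn; ring).
        rewrite <- P3, (Cmult_comm (w - 0)), <- Cmult_assoc, Cinv_r by exact Hn. ring. }
      assert (Hd3 := tends_locally' _ _ _ (hol_ccont _ _ Hg)). pose proof (tends_unique _ _ _ _ Hd2 Hd3) as H.
      rewrite E0, Cexp_0, Cmult_1_r in H. now apply (e_nz kappa). }
    exists (fun w => e (X * kappa) * Cexp (X * w) / g w)%C. split; [now apply hol_div|].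
    generalize (filter_and _ _ (locally'_ne 0) (filter_and _ _ (locally_locally' _ _ Hl) (locally_locally' _ _ (ccont_ne g 0 0 (hol_ccont _ _ Hg) Hg0)))).
    apply filter_imp. intros w [Hw [H1 H2]]. unfold gen. rewrite H1. assert (Hn := Cminus_nz _ _ Hw). rewrite Cminus_0_r. rewrite Cminus_0_r in Hn. field. auto.
  - exists (gen X kappa). split; [|apply filter_forall; auto]. unfold gen. apply hol_div; auto. cx.
Qed.

Lemma pow_n_Cpow (w : C) k : pow_n (K := C_AbsRing) w k = (w ^ k)%C.
Proof. cx. Qed.

Lemma is_pseries_dot a w l : is_pseries (K := C_AbsRing) (V := C_NormedModule) a w l <->
  tends eventually (dot a (fun k => w ^ k)%C) l.
Proof.
  unfold is_pseries, is_series. assert (E : forall n, sum_n (fun k => scal (pow_n (K := C_AbsRing) w k) (a k)) n = dot a (fun k => w ^ k)%C n).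
  { intros n. rewrite dot_sum_n. change (@sum_n (AbsRing.AbelianGroup C_AbsRing)) with (@sum_n C_AbelianGroup).
    apply (sum_n_ext (G := C_AbelianGroup)). intros k. rewrite pow_n_Cpow. apply Cmult_comm. }
  rewrite tends_filterlim by apply _. split; apply filterlim_ext; intros n; now rewrite E.
Qed.

Lemma hol_pseries g : hol g 0 -> exists a r, 0 < r /\ forall w, Cmod w < r ->
  is_pseries (K := C_AbsRing) (V := C_NormedModule) a w (g w).
Proof.
  intros Hg. destruct (hol_ball g 0 Hg) as [r [Hr H]]. destruct (taylor_expansion g 0 r Hr H) as [t [T0 [T1 [T2 [M [HM TM]]]]]].
  exists (fun k => t k 0), r. split; [exact Hr|]. intros w Hw. apply is_pseries_dot. assert (Hw0 : Cmod (w - 0) < r) by (now replace (w - 0)%C with w by ring).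
  assert (E : forall n, g w = (dot (fun k => t k 0) (fun k => w ^ k) n + w ^ S n * t (S n) w)%C).
  { induction n.
    - rewrite <- T0 by exact Hw0. rewrite (T2 O w Hw0). simpl. ring.
    - rewrite IHn, dot_S. rewrite (T2 (S n) w Hw0). simpl. ring. }
  set (q := Cmod w / r). assert (Hq : 0 <= q < 1).
  { unfold q. split; [pos|]. apply Rmult_lt_reg_r with r; [lra|]. unfold Rdiv. rewrite Rmult_assoc, Rinv_l; lra. }
  replace (w - 0)%C with w in Hw0 by ring. set (K := M / (r - Cmod w)). assert (HK : 0 < K) by pos.
  intros eps He. destruct (pow_lt_1_zero q) with (y := eps / K) as [n0 Hn0]; [rewrite Rabs_pos_eq; lra|pos|].
  exists n0. intros n Hn. specialize (Hn0 (S n) ltac:(lia)). rewrite (E n).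
  replace (dot (fun k => t k 0) (fun k => w ^ k) n - (dot (fun k => t k 0) (fun k => w ^ k) n + w ^ S n * t (S n) w))%C with (- (w ^ S n * t (S n) w))%C by ring.
  rewrite Cmod_opp, Cmod_mult, Cmod_pow. assert (Hw1 : Cmod (w - 0) < r) by (now replace (w - 0)%C with w by ring).
  pose proof (TM (S n) w Hw1) as HT. replace (w - 0)%C with w in HT by ring. fold K in HT. rewrite Rabs_pos_eq in Hn0 by pos.
  assert (Ek : K * (eps / K) = eps) by (field; lra). eapply Rle_lt_trans; [apply Rmult_le_compat_l; [pos|exact HT]|].
  replace (Cmod w ^ S n * (K / r ^ S n)) with (K * q ^ S n).
  - nra.
  - unfold q, Rdiv. rewrite Rpow_mult_distr, pow_inv. ring.
Qed.

(** Makes the [epsilon] in [Cnum] meaningful: the Taylor series of the holomorphic extension of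
    [gen], multiplied by factorials, is a possible choice. *)
Lemma gam_series (X : C) (kappa : R) : exists r, 0 < r /\ forall w : C, w <> 0 -> Cmod w < r ->
  is_pseries (K := C_AbsRing) (V := C_NormedModule) (gam X kappa) w (gen X kappa w).
Proof.
  assert (H : cnear' (RtoC 0) (fun w => is_pseries (K := C_AbsRing) (V := C_NormedModule) (gam X kappa) w (gen X kappa w))).
  { apply (epsilon_spec (inhabits (fun _ => RtoC 0)) (fun c : nat -> C =>
      cnear' (RtoC 0) (fun w : C =>
      is_pseries (K := C_AbsRing) (V := C_NormedModule)
        (fun k => c k / INR (fact k))%C w
        (w * e (X * kappa) * Cexp (X * w) / (e kappa * Cexp w - 1))%C))).
    destruct (gen_hol X kappa) as [g [Hg Hl]]. destruct (hol_pseries g Hg) as [a [r [Hr Ha]]].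
    exists (fun k => a k * INR (fact k))%C. apply locally'_Cmod in Hl. destruct Hl as [d [Hd Hl]].
    apply locally'_Cmod. exists (Rmin d r). split; [pos|]. intros w Hw Hw0.
    fold (gen X kappa w). rewrite Hl; [|eapply Rlt_le_trans; [exact Hw|apply Rmin_l]|exact Hw0]. replace (fun k => (a k * INR (fact k) / INR (fact k))%C) with a.
    - apply Ha. replace w with (w - 0)%C by ring. eapply Rlt_le_trans; [exact Hw|apply Rmin_r].
    - extensionality k. unfold Cdiv. rewrite <- Cmult_assoc, Cinv_r by apply fact_nz. now rewrite Cmult_1_r. }
  apply locally'_Cmod in H. destruct H as [d [Hd H]]. exists d. split; auto. intros w Hw Hwd. apply H; auto. now replace (w - 0)%C with w by ring.
Qed.

(** Convergence at the radius [r / 2] bounds the terms there, so on half that radius the tail is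
    dominated by a geometric series with ratio at most 1/2. *)
Lemma asy_pseries f a m : (exists r, 0 < r /\ forall w : C, w <> 0 -> Cmod w < r ->
  is_pseries (K := C_AbsRing) (V := C_NormedModule) a w (f w)) -> asy f a m.
Proof.
  intros [r [Hr H]]. set (w0 := RtoC (r / 2)). assert (Hw0 : Cmod w0 = r / 2) by (unfold w0; rewrite Cmod_R, Rabs_pos_eq; lra).
  assert (Hw00 : w0 <> 0) by (apply Cmod_gt_0; lra). pose proof (proj1 (is_pseries_dot _ _ _) (H w0 Hw00 ltac:(lra))) as Hs.
  destruct (filterlim_bounded (V := C_R_NormedModule) (dot a (fun k => w0 ^ k)%C)) as [B HB].
  { exists (f w0). apply (tends_filterlim eventually). exact Hs. }
  assert (Hterm : forall k, Cmod (a (S k)) * (r / 2) ^ S k <= 2 * B).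
  { intros k. rewrite <- Hw0, <- Cmod_pow, <- Cmod_mult.
    replace (a (S k) * w0 ^ S k)%C with (dot a (fun k => w0 ^ k)%C (S k) - dot a (fun k => w0 ^ k)%C k)%C by (rewrite dot_S; ring).
    pose proof (HB (S k)) as B1. pose proof (HB k) as B2. rewrite norm_C_R in B1, B2. ctrim. lra. }
  assert (HB0 : 0 <= B). { pose proof (HB O) as B1. rewrite norm_C_R in B1. pose proof (Cmod_ge_0 (dot a (fun k => w0 ^ k)%C 0)). lra. }
  exists (4 * B / (r / 2) ^ S m), (r / 4). split; [lra|]. intros w Hw Hwr. pose proof (proj1 (is_pseries_dot _ _ _) (H w Hw ltac:(lra))) as Hl.
  set (q := Cmod w / (r / 2)). assert (Hq : 0 <= q <= 1 / 2).
  { unfold q. split; [pos|]. apply Rmult_le_reg_r with (r / 2); [lra|]. unfold Rdiv at 1. rewrite Rmult_assoc, Rinv_l; lra. }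
  replace (4 * B / (r / 2) ^ S m * Cmod w ^ S m) with (4 * B * q ^ S m) by (unfold q, Rdiv; rewrite Rpow_mult_distr, pow_inv; ring).
  assert (Hqm : 0 <= q ^ S m) by pos.
  assert (Hpart : forall j, Cmod (dot a (fun k => w ^ k)%C (m + j) - dot a (fun k => w ^ k)%C m) <= 2 * B * q ^ S m * (2 - 2 * (1 / 2) ^ j)).
  { induction j.
    - rewrite Nat.add_0_r. replace (dot a (fun k => w ^ k)%C m - dot a (fun k => w ^ k)%C m)%C with (RtoC 0) by ring. rewrite Cmod_0. simpl. lra.
    - rewrite Nat.add_succ_r, dot_S. replace (dot a (fun k => w ^ k) (m + j) + a (S (m + j)) * w ^ S (m + j) - dot a (fun k => w ^ k) m)%C with
        ((dot a (fun k => w ^ k) (m + j) - dot a (fun k => w ^ k) m) + a (S (m + j)) * w ^ S (m + j))%C by ring.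
      ctri. assert (Cmod (a (S (m + j)) * w ^ S (m + j)) <= 2 * B * q ^ S m * (1 / 2) ^ j).
      { rewrite Cmod_mult, Cmod_pow. replace (Cmod w ^ S (m + j)) with ((r / 2) ^ S (m + j) * (q ^ S m * q ^ j)).
        - rewrite <- !Rmult_assoc. rewrite (Rmult_assoc _ (q ^ S m)). rewrite (Rmult_assoc (2 * B)). apply Rmult_le_compat; [pos| |cx|].
          + pos.
          + apply Rmult_le_compat_l; auto. apply pow_incr; lra.
        - rewrite <- pow_add. replace (S m + j)%nat with (S (m + j)) by lia. rewrite <- Rpow_mult_distr. f_equal. unfold q. field. lra. }
      change ((1 / 2) ^ S j) with (1 / 2 * (1 / 2) ^ j). lra. }
  apply (tends_le eventually (fun n => (dot a (fun k => w ^ k)%C n - dot a (fun k => w ^ k)%C m)%C)).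
  - cx.
  - exists m. intros n Hn. replace n with (m + (n - m))%nat by lia. eapply Rle_trans; [cx|].
    assert (0 <= (1 / 2) ^ (n - m)) by pos. assert (0 <= B * q ^ S m) by nra. nra.
Qed.

(** * The difference equation and its defect *)

Definition rhs_coef (x nu : R) (k : nat) : C := match k with O => 0 | S j => e (x * nu) * expc x j end%C.

(** Comparison of coefficients in [(e nu * Cexp w - 1) * gen x nu w = w * e (x * nu) * Cexp (x *
    w)]. This recursion is the only property of the C_k behind the Euler-Maclaurin step. *)
Lemma gam_conv (x nu : R) m : (e nu * conv (gam x nu) (expc 1) m - gam x nu m)%C = rhs_coef x nu m.
Proof.
  assert (Hu : asy (gen x nu) (gam x nu) m) by (apply asy_pseries, gam_series). pose proof (asy_mult _ _ _ _ m Hu (asy_exp 1 m)) as H1.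
  pose proof (asy_plus _ _ _ _ m (asy_scal (e nu) _ _ m H1) (asy_scal (- (1))%C _ _ m Hu)) as H2.
  assert (H3 : asy (fun w => w * (e (x * nu) * Cexp (x * w)))%C (rhs_coef x nu) m).
  { pose proof (asy_scal (e (x * nu)) _ _ m (asy_exp x m)) as [K [r [Hr H]]]. destruct m as [|m].
    - exists (K + asum (fun k => e (x * nu) * expc x k)%C 0), (Rmin r 1). split; [pos|]. intros w Hw Hwr.
      pose proof (Rmin_l r 1). pose proof (Rmin_r r 1). specialize (H w Hw ltac:(lra)).
      cbn [dot rhs_coef]. rewrite Cmult_0_l. unfold Cminus. rewrite Copp_0, Cplus_0_r, Cmod_mult. rewrite pow_1, Rmult_comm. apply Rmult_le_compat_r; [pos|].
      set (D := dot (fun k => e (x * nu) * expc x k)%C (fun k => w ^ k)%C 0) in *.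
      replace (e (x * nu) * Cexp (x * w))%C with ((e (x * nu) * Cexp (x * w) - D) + D)%C by ring.
      ctri. pose proof (dot_pow_bound (fun k => e (x * nu) * expc x k)%C w 0 ltac:(lra)) as HD1. fold D in HD1. rewrite pow_1 in H. pose proof (Cmod_ge_0 w).
      destruct (Rle_dec 0 K); [nra|]. pose proof (Cmod_ge_0 (e (x * nu) * Cexp (x * w) - D)). pose proof (Cmod_pos w Hw). nra.
    - pose proof (asy_scal (e (x * nu)) _ _ m (asy_exp x m)) as [K' [r' [Hr' H']]].
      exists K', r'. split; auto. intros w Hw Hwr. specialize (H' w Hw Hwr). rewrite dot_pow_S. cbn [rhs_coef]. rewrite Cplus_0_l.
      change (shift (rhs_coef x nu)) with (fun k => e (x * nu) * expc x k)%C.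
      replace (w * (e (x * nu) * Cexp (x * w)) - w * dot (fun k => e (x * nu) * expc x k) (fun k => w ^ k) m)%C
        with (w * (e (x * nu) * Cexp (x * w) - dot (fun k => e (x * nu) * expc x k) (fun k => w ^ k) m))%C by ring.
      rewrite Cmod_mult. replace (K' * Cmod w ^ S (S m)) with (Cmod w * (K' * Cmod w ^ S m)) by (simpl; ring). apply Rmult_le_compat_l; [pos|exact H']. }
  assert (Hun := fun H => asy_unique _ _ _ _ m H H2 H3 m (Nat.le_refl m)). cbv beta in Hun. rewrite <- Hun; [ring|]. destruct (gen_hol x nu) as [g [Hg Hl]].
  (* The denominator must not vanish identically near 0. Otherwise, by the identity theorem,
     [e nu * Cexp w = 1] for all [w], which is contradictory at [w = 0] and [w = PI * Ci]. *)
  assert (Hd : cnear' (RtoC 0) (fun w => (e nu * Cexp w - 1)%C <> 0)).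
  { assert (HD : forall z, hol (fun w => e nu * Cexp w - 1)%C z).
    { cx. }
    destruct (qmero_dichotomy (fun w => e nu * Cexp w - 1)%C 0 (qmero_hol _ _ (HD 0))) as [Hz|Hz]; [exfalso|exact Hz].
    assert (E : (e nu * Cexp 0 - 1)%C = 0) by (apply (hol_identity (fun _ => True) (fun w => e nu * Cexp w - 1)%C (fun _ => 0) 0 0); auto using convex_all, hol_const).
    assert (E2 : (e nu * Cexp (PI * Ci) - 1)%C = 0) by (apply (hol_identity (fun _ => True) (fun w => e nu * Cexp w - 1)%C (fun _ => 0) 0 (PI * Ci)%C); auto using convex_all, hol_const).
    rewrite Cexp_0 in E. assert (E3 : Cexp (PI * Ci) = (- (1))%C).
    { unfold Cexp. simpl. replace (PI * 0 - 0 * 1) with 0 by ring. replace (PI * 1 + 0 * 0) with PI by ring. rewrite exp_0, cos_PI, sin_PI. ceq. }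
    rewrite E3 in E2. apply Ceq_minus in E. rewrite Cmult_1_r in E. rewrite E in E2.
    assert (E4 : RtoC (-2) = 0) by (rewrite <- E2; ceq). apply RtoC_inj in E4. lra. }
  apply locally'_Cmod in Hd. destruct Hd as [r [Hr Hd]]. exists r. split; [exact Hr|]. intros w Hw Hwr.
  specialize (Hd w ltac:(now replace (w - 0)%C with w by ring) Hw). unfold gen. rewrite Cmult_1_l. field. exact Hd.
Qed.

(** The Pochhammer symbol as a polynomial, free of the poles that its definition through [Gamma]
    has. *)
Fixpoint rf (p : C) (k : nat) : C := match k with O => 1 | S j => rf p j * (p + INR j) end%C.
(* With [p = s - 1], the terms of G in the header; [Phi h p (b - t h) (S k)] is the [t]-derivative of [Phi h p (b - t h) k]. *)
Definition Phi (h p b : C) (k : nat) : C := (rf p k * h ^ k * cpow b (- p - INR k))%C.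

Lemma rder_Phi h p b k t : slit (b - RtoC t * h) -> rder (fun t => Phi h p (b - RtoC t * h) k) t (Phi h p (b - RtoC t * h) (S k)).
Proof.
  intros Hs. unfold Phi.
  eapply rder_eq; [|apply rder_scal, (rder_comp (fun z => cpow z (- p - INR k)) (fun t => b - RtoC t * h)%C); [now apply cder_cpow_base|apply rder_line]].
  rewrite S_INR, RtoC_plus. cbn [rf Cpow]. replace (- p - (INR k + 1))%C with (- p - INR k - 1)%C by ring. ring.
Qed.

(** The amount by which the truncated expansion misses the difference equation solved by the full
    formal series; [Phi h p (b - x h) 1] is [(s - 1) h] times a power of the lattice point when
    [p = s - 1]. *)
Definition em_defect (x nu : R) (N : nat) (h p b : C) : C :=
  (e nu * dot (gam x nu) (Phi h p (b - h)) N - dot (gam x nu) (Phi h p b) N - e (x * nu) * Phi h p (b - x * h) 1)%C.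

(** Every [Phi] at [b - h] and at [b - x h] is expanded at [b] by Taylor's formula along the
    segment. The shift by [h] multiplies the coefficients [gam] with those of the exponential, and
    [gam_conv] cancels all orders up to [n + 1]; what remains are Taylor errors of order [n + 2]. *)
Lemma em_step (x nu : R) n : 0 <= x <= 1 -> exists K, 0 <= K /\ forall (h p b : C) (E : R),
  (forall t, 0 <= t <= 1 -> slit (b - RtoC t * h)) ->
  (forall t, 0 <= t <= 1 -> Cmod (Phi h p (b - RtoC t * h) (S (S n))) <= E) ->
  Cmod (em_defect x nu (S n) h p b) <= K * E.
Proof.
  intros Hx. exists (asum (gam x nu) (S n) + 1). split. { pose proof (asum_nonneg (gam x nu) (S n)). lra. }
  intros h p b E Hs HE. assert (Hder : forall k t, 0 <= t <= 1 -> rder (fun t => Phi h p (b - RtoC t * h) k) t (Phi h p (b - RtoC t * h) (S k))).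
  { intros k t Ht. now apply rder_Phi, Hs. }
  assert (Hcon : forall k, con (fun t => Phi h p (b - RtoC t * h) k) 0 1) by (intros k; eapply con_rder; intros; now apply Hder).
  assert (HT : forall k i t, (k + i = S n)%nat -> 0 <= t <= 1 ->
    Cmod (Phi h p (b - RtoC t * h) k - dot (expc (RtoC t)) (fun j => Phi h p b (k + j)) i) <= E).
  { intros k i t Hki Ht. pose proof (taylor_segment (fun j t => Phi h p (b - RtoC t * h) (k + j)) i E) as T. cbv beta in T.
    replace (k + S i)%nat with (S (S n)) in T by lia.
    specialize (T ltac:(intros j u _ Hu; replace (k + S j)%nat with (S (k + j)) by lia; now apply Hder) (Hcon _) HE t Ht). rewrite Nat.add_0_r in T.
    replace (fun j => Phi h p b (k + j)) with (fun j => Phi h p (b - 0%R * h)%C (k + j)); [exact T|]. extensionality j. f_equal. ring. }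
  unfold em_defect. pose proof (dot_conv_approx (gam x nu) (expc 1) (Phi h p (b - h)) (Phi h p b) (S n) E) as H1.
  assert (H1' : forall k, (k <= S n)%nat -> Cmod (Phi h p (b - h) k - dot (expc 1) (fun i => Phi h p b (k + i)) (S n - k)) <= E).
  { intros k Hk. pose proof (HT k (S n - k)%nat 1 ltac:(lia) ltac:(lra)) as H. replace (b - 1 * h)%C with (b - h)%C in H by ring. exact H. }
  specialize (H1 H1'). pose proof (HT 1%nat n x ltac:(lia) Hx) as H2.
  assert (E1 : dot (fun m => e nu * conv (gam x nu) (expc 1) m + (- (1)) * gam x nu m)%C (Phi h p b) (S n) =
    (e (x * nu) * dot (expc x) (fun j => Phi h p b (1 + j)) n)%C).
  { rewrite (dot_ext _ (rhs_coef x nu) _ (Phi h p b)); auto.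
    - cbn [dot rhs_coef]. change (shift (rhs_coef x nu)) with (fun k => e (x * nu) * expc x k)%C. rewrite dot_scal.
      change (shift (Phi h p b)) with (fun j => Phi h p b (1 + j)). ring.
    - intros k _. rewrite <- gam_conv. ring. }
  rewrite dot_plus, !dot_scal in E1. set (S1 := dot (gam x nu) (Phi h p (b - h)) (S n)) in *. set (S2 := dot (conv (gam x nu) (expc 1)) (Phi h p b) (S n)) in *.
  set (S3 := dot (gam x nu) (Phi h p b) (S n)) in *. set (S4 := dot (expc x) (fun j => Phi h p b (1 + j)) n) in *.
  replace (e nu * S1 - S3 - e (x * nu) * Phi h p (b - x * h) 1)%C with
    (e nu * (S1 - S2) - e (x * nu) * (Phi h p (b - x * h) 1 - S4) + (e nu * S2 + - (1) * S3 - e (x * nu) * S4))%C by ring.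
  rewrite E1. replace (e (x * nu) * S4 - e (x * nu) * S4)%C with (RtoC 0) by ring. rewrite Cplus_0_r. ctrim. rewrite !Cmod_mult, Cmod_e, <- RtoC_mult, Cmod_e. lra.
Qed.

Lemma Rpower_le_base (a b k : R) : 0 < a <= b -> k <= 0 -> Rpower b k <= Rpower a k.
Proof. intros H Hk. replace k with (- - k) by ring. rewrite !(Rpower_Ropp _ (- k)). apply Rinv_le_contravar; [pos|]. apply Rle_Rpower_l; lra. Qed.

Lemma exp_le_mono x y : x <= y -> exp x <= exp y.
Proof. intros [H|H]; [left; now apply exp_increasing|right; now rewrite H]. Qed.

Lemma cpow_lower z w lam : 0 < lam <= Cmod z -> Re w <= 0 ->
  Cmod (cpow z w) <= Rpower lam (Re w) * exp (PI * Rabs (Im w)).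
Proof. intros H Hw. eapply Rle_trans; [apply Cmod_cpow_le|]. apply Rmult_le_compat_r; [pos|]. now apply Rpower_le_base. Qed.

Lemma rf_bound S k : exists K, 0 <= K /\ forall p, Cmod p <= S -> Cmod (rf p k) <= K.
Proof.
  induction k as [|k [K [HK IH]]].
  - exists 1. split; [lra|]. intros p _. simpl. rewrite Cmod_1. lra.
  - exists (K * (Rabs S + INR k)). split; [apply Rmult_le_pos; [exact HK|]; pose proof (Rabs_pos S); pose proof (pos_INR k); lra|].
    intros p Hp. cbn [rf]. rewrite Cmod_mult. apply Rmult_le_compat; try apply Cmod_ge_0; auto.
    ctri. rewrite Cmod_R, (Rabs_pos_eq (INR k)) by apply pos_INR. pose proof (Rle_abs S). lra.
Qed.

(** The bound is in terms of a lower bound [lam] for [Cmod b], so that one [lam] can serve a whole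
    segment. *)
Lemma Phi_bound S k : exists K, 0 <= K /\ forall h p b lam, 0 < lam <= Cmod b -> Cmod p <= S -> 0 <= Re p + INR k ->
  Cmod (Phi h p b k) <= K * Cmod h ^ k * Rpower lam (- (Re p + INR k)).
Proof.
  destruct (rf_bound S k) as [K [HK HKb]]. exists (K * exp (PI * S)). split; [pos|]. intros h p b lam Hl Hp Hk. unfold Phi. rewrite !Cmod_mult, Cmod_pow.
  assert (Hre : Re (- p - INR k) = - (Re p + INR k)) by (simpl; unfold Re; ring). assert (Him : Im (- p - INR k) = - Im p) by (simpl; unfold Im; ring).
  pose proof (cpow_lower b (- p - INR k) lam Hl) as H. rewrite Hre, Him, Rabs_Ropp in H. specialize (H ltac:(lra)).
  assert (Hexp : exp (PI * Rabs (Im p)) <= exp (PI * S)).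
  { apply exp_le_mono. apply Rmult_le_compat_l; [left; apply PI_RGT_0|]. eapply Rle_trans; [apply Rabs_snd_le|exact Hp]. }
  replace (K * exp (PI * S) * Cmod h ^ k * Rpower lam (- (Re p + INR k))) with ((K * Cmod h ^ k) * (Rpower lam (- (Re p + INR k)) * exp (PI * S))) by ring.
  apply Rmult_le_compat.
  - pos.
  - apply Cmod_ge_0.
  - apply Rmult_le_compat_r; [pos|cx].
  - eapply Rle_trans; [exact H|]. apply Rmult_le_compat_l; [pos|exact Hexp].
Qed.

Lemma em_defect_bound (x nu : R) n S : 0 <= x <= 1 -> exists K, 0 <= K /\ forall (h p b : C) lam, 0 < lam ->
  (forall t, 0 <= t <= 1 -> slit (b - RtoC t * h) /\ lam <= Cmod (b - RtoC t * h)) -> Cmod p <= S ->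
  0 <= Re p + INR (n + 2) ->
  Cmod (em_defect x nu (n + 1) h p b) <= K * Cmod h ^ (n + 2) * Rpower lam (- (Re p + INR (n + 2))).
Proof.
  intros Hx. destruct (em_step x nu n Hx) as [K1 [HK1 H1]]. destruct (Phi_bound S (n + 2)) as [K2 [HK2 H2]].
  exists (K1 * K2). split; [pos|]. intros h p b lam Hl Hb Hp Hn. replace (n + 1)%nat with (Datatypes.S n) by lia.
  eapply Rle_trans; [apply H1 with (E := K2 * Cmod h ^ (n + 2) * Rpower lam (- (Re p + INR (n + 2))))|lra].
  - intros t Ht. now apply Hb.
  - intros t Ht. replace (Datatypes.S (Datatypes.S n)) with (n + 2)%nat by lia. apply H2; auto. split; auto. now apply Hb.
Qed.

Lemma hol_rf (f : C -> C) k s : hol f s -> hol (fun s => rf (f s) k) s.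
Proof. intros H. induction k; simpl; [cx|]. cx. Qed.

Lemma hol_Phi (f : C -> C) h b k s : hol f s -> hol (fun s => Phi h (f s) b k) s.
Proof. intros H. unfold Phi. apply hol_mult; [apply hol_mult; [now apply hol_rf|cx]|]. cx. Qed.

Lemma hol_dot (a : nat -> C) (v : nat -> C -> C) n s : (forall k, hol (v k) s) -> hol (fun w => dot a (fun k => v k w) n) s.
Proof.
  intros H. induction n; [simpl; apply hol_mult; [cx|apply H]|]. apply hol_ext_loc with (fun w => dot a (fun k => v k w) n + a (S n) * v (S n) w)%C.
  - apply filter_forall. intros w. now rewrite dot_S.
  - cx.
Qed.

Lemma hol_G (f : C -> C) x nu h b n s : hol f s -> hol (fun s => dot (gam x nu) (Phi h (f s) b) n) s.
Proof. intros H. apply (hol_dot (gam x nu) (fun k s => Phi h (f s) b k)). intros k. now apply hol_Phi. Qed.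

Lemma hol_em_defect (f : C -> C) x nu h b n s : hol f s -> hol (fun s => em_defect x nu n h (f s) b) s.
Proof.
  intros H. unfold em_defect. apply hol_minus; [apply hol_minus|].
  - apply hol_mult; [cx|now apply hol_G].
  - now apply hol_G.
  - apply hol_mult; [cx|now apply hol_Phi].
Qed.

(** * Sums along half lines and their continuation *)

Definition good (c : R) (b h : C) : Prop := 0 < c /\ forall t, 0 <= t -> slit (b + RtoC t * h) /\ c * (1 + t) <= Cmod (b + RtoC t * h).

(* The half line [b + (m + 1 - x) h], its defects, and the entire function that continues [(s - 1) h] times its sum. *)
Definition Zterm (x nu : R) (b h s : C) (m : nat) : C :=
  (e (- (INR m + 1 - x) * nu)%R * cpow (b + RtoC (INR m + 1 - x) * h) (- s))%C.
Definition Dterm (x nu : R) (n : nat) (b h s : C) (m : nat) : C :=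
  (e (- (INR m + 1) * nu)%R * em_defect x nu (n + 1) h (s - 1) (b + RtoC (INR m + 1) * h))%C.
Definition Gval (x nu : R) (n : nat) (h s b : C) : C := dot (gam x nu) (Phi h (s - 1) b) (n + 1).
Definition Hsum (x nu : R) (n : nat) (b h s : C) : C := (Gval x nu n h s b - Sum (Dterm x nu n b h s))%C.

(** The phases [e (- m nu)] absorb the factor [e nu] of the difference equation, so the defect based
    at the point with index [m + 1] is the telescoping error between [m] and [m + 1]. *)
Lemma em_telescope x nu n b h s m :
  (e (- INR m * nu)%R * Gval x nu n h s (b + RtoC (INR m) * h) -
   e (- INR (S m) * nu)%R * Gval x nu n h s (b + RtoC (INR (S m)) * h))%C =
  ((s - 1) * h * Zterm x nu b h s m + Dterm x nu n b h s m)%C.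
Proof.
  unfold Dterm, em_defect, Zterm, Gval. rewrite S_INR. replace (b + RtoC (INR m + 1) * h - h)%C with (b + RtoC (INR m) * h)%C by (rewrite RtoC_plus; ring).
  replace (b + RtoC (INR m + 1) * h - x * h)%C with (b + RtoC (INR m + 1 - x) * h)%C by (rewrite RtoC_minus; ring).
  assert (E1 : e (- INR m * nu)%R = (e (- (INR m + 1) * nu)%R * e nu)%C).
  { rewrite <- e_plus, <- RtoC_plus. f_equal. f_equal. ring. }
  assert (E2 : e (- (INR m + 1 - x) * nu)%R = (e (- (INR m + 1) * nu)%R * e (x * nu))%C).
  { rewrite <- RtoC_mult, <- e_plus, <- RtoC_plus. f_equal. f_equal. ring. }
  rewrite E1, E2. assert (E3 : forall z, Phi h (s - 1) z 1 = ((s - 1) * h * cpow z (- s))%C).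
  { intros z. unfold Phi. cbn [rf Cpow]. change (INR 0) with 0. change (INR 1) with 1. replace (- (s - 1) - 1)%C with (- s)%C by ring. ring. }
  rewrite E3. ring.
Qed.

Lemma Rpower_tends_0 c k : 0 < c -> 0 < k -> filterlim (fun n => Rpower (c * (1 + INR n)) (- k)) eventually (locally 0).
Proof.
  intros Hc Hk P HP. apply locally_R in HP. destruct HP as [d [Hd HdP]]. unfold filtermap. set (B := Rpower (/ d) (/ k) / c).
  destruct (archimed B) as [HB _]. exists (Z.to_nat (up B)). intros n Hn. assert (HnB : B < INR n).
  { eapply Rlt_le_trans; [exact HB|]. rewrite INR_IZR_INZ. apply IZR_le. lia. }
  apply HdP. rewrite Rminus_0_r, Rabs_pos_eq by pos. rewrite Rpower_Ropp. rewrite <- (Rinv_inv d). apply Rinv_lt_contravar.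
  - pos.
  - replace (/ d) with (Rpower (Rpower (/ d) (/ k)) k).
    + apply Rlt_Rpower_l; [exact Hk|]. split; [pos|]. replace (Rpower (/ d) (/ k)) with (c * B) by (unfold B; field; lra). apply Rmult_lt_compat_l; lra.
    + rewrite Rpower_mult, Rinv_l, Rpower_1; [auto|pos|lra].
Qed.

Lemma tends_dot_0 {T} (F : (T -> Prop) -> Prop) {FF : Filter F} (a : nat -> C) (v : nat -> T -> C) n :
  (forall k, tends F (v k) 0) -> tends F (fun x => dot a (fun k => v k x) n) 0.
Proof.
  intros H. induction n.
  - simpl. replace (RtoC 0) with (a O * 0)%C by ring. cx.
  - apply tends_ext with (fun x => dot a (fun k => v k x) n + a (S n) * v (S n) x)%C; [apply _|intros; now rewrite dot_S|].
    replace (RtoC 0) with (0 + a (S n) * 0)%C by ring. cx.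
Qed.

Lemma Gval_tends_0 x nu n h s (b : nat -> C) (ph : nat -> R) c : 0 < c -> (forall m, c * (1 + INR m) <= Cmod (b m)) -> 1 < Re s ->
  tends eventually (fun m => e (ph m)%R * Gval x nu n h s (b m))%C 0.
Proof.
  intros Hc Hb Hs. assert (H : tends eventually (fun m => Gval x nu n h s (b m)) 0).
  { unfold Gval. apply (tends_dot_0 eventually (gam x nu) (fun k m => Phi h (s - 1) (b m) k)). intros k. destruct (Phi_bound (Cmod (s - 1)) k) as [K [HK HKb]].
    assert (Hk : 0 < Re (s - 1) + INR k). { pose proof (pos_INR k). simpl. unfold Re in *. lra. }
    apply (tends_0_bound _ _ (fun m => (K * Cmod h ^ k) * Rpower (c * (1 + INR m)) (- (Re (s - 1) + INR k)))).
    - apply filter_forall. intros m. rewrite Cminus_0_r. apply HKb; [|lra|lra]. split; [|apply Hb]. pose proof (pos_INR m). nra.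
    - replace 0 with ((K * Cmod h ^ k) * 0) by ring. apply (filterlim_comp _ _ _ _ (fun y => (K * Cmod h ^ k) * y) _ (locally 0)); [now apply Rpower_tends_0|].
      apply (continuous_scal_r (K := R_AbsRing) (V := R_NormedModule)). apply continuous_id. }
  intros eps He. generalize (H eps He). apply filter_imp. intros m Hm. rewrite Cminus_0_r in *. now rewrite Cmod_mult, Cmod_e, Rmult_1_l.
Qed.

Section HalfLine.
Variables (x nu c : R) (b h : C).
Hypothesis Hx : 0 <= x <= 1.
Hypothesis Hg : good c b h.

Lemma good_c_pos : 0 < c.
Proof. apply Hg. Qed.

Lemma good_seg m t : 0 <= t <= 1 -> slit (b + RtoC (INR m + 1) * h - RtoC t * h) /\
  c * (1 + INR m) <= Cmod (b + RtoC (INR m + 1) * h - RtoC t * h).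
Proof.
  intros Ht. replace (b + RtoC (INR m + 1) * h - RtoC t * h)%C with (b + RtoC (INR m + 1 - t) * h)%C by (rewrite RtoC_minus; ring).
  pose proof (pos_INR m). destruct Hg as [Hc Hgt]. destruct (Hgt (INR m + 1 - t)) as [H1 H2]; [lra|]. split; auto. nra.
Qed.

End HalfLine.

(** One constant for all [b] with the same [c]: the starting point moves in [Hsum_tends]. *)
Lemma Dterm_bound_unif x nu c h n S k : 0 <= x <= 1 -> 0 < c -> 0 <= k -> exists K, 0 <= K /\ forall b s m, good c b h -> Cmod (s - 1) <= S -> k <= Re s + INR n + 1 ->
  Cmod (Dterm x nu n b h s m) <= K * Rpower (INR m + 1) (- k).
Proof.
  intros Hx Hc Hk. destruct (em_defect_bound x nu n S Hx) as [K [HK HKb]]. exists (K * Cmod h ^ (n + 2) * exp (Rabs (ln c) * (S + INR (n + 2)))). split. { pos. }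
  intros b s m Hg Hs Hks. unfold Dterm. rewrite Cmod_mult, Cmod_e, Rmult_1_l.
  assert (Hre : Re (s - 1) + INR (n + 2) = Re s + INR n + 1) by (rewrite plus_INR; simpl; unfold Re; ring). pose proof (pos_INR m) as Hm.
  eapply Rle_trans; [apply (HKb h (s - 1)%C _ (c * (1 + INR m)))|].
  - nra.
  - intros t Ht. now apply (good_seg c b h).
  - exact Hs.
  - lra.
  - rewrite (Rmult_assoc (K * _)). apply Rmult_le_compat_l; [pos|]. rewrite <- Rpower_mult_distr by lra. apply Rmult_le_compat; try (left; apply exp_pos).
    + unfold Rpower. apply exp_le_mono. eapply Rle_trans; [apply Rle_abs|]. rewrite Rabs_mult, Rmult_comm. apply Rmult_le_compat_l; [pos|].
      rewrite Rabs_Ropp. rtri. apply Rplus_le_compat.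
      * eapply Rle_trans; [apply re_le_Cmod|exact Hs].
      * rewrite Rabs_pos_eq; [lra|pos].
    + rewrite Rplus_comm. apply Rle_Rpower; lra.
Qed.

Section HalfLine.
Variables (x nu c : R) (b h : C).
Hypothesis Hx : 0 <= x <= 1.
Hypothesis Hg : good c b h.

Lemma Dterm_bound n S k : 0 <= k -> exists K, 0 <= K /\ forall s m, Cmod (s - 1) <= S -> k <= Re s + INR n + 1 ->
  Cmod (Dterm x nu n b h s m) <= K * Rpower (INR m + 1) (- k).
Proof. intros Hk. destruct (Dterm_bound_unif x nu c h n S k Hx (proj1 Hg) Hk) as [K [HK H]]. exists K. cx. Qed.

Lemma Zterm_bound S k : 0 <= k -> exists K, 0 <= K /\ forall s m, Cmod s <= S -> k <= Re s ->
  Cmod (Zterm x nu b h s m) <= K * Rpower (INR m + 1) (- k).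
Proof.
  intros Hk. pose proof (good_c_pos c b h Hg) as Hc. exists (exp (Rabs (ln c) * S) * exp (PI * S)). split; [pos|].
  intros s m Hs Hks. unfold Zterm. rewrite Cmod_mult, Cmod_e, Rmult_1_l. pose proof (pos_INR m) as Hm.
  assert (Hlow : 0 < c * (1 + INR m) <= Cmod (b + RtoC (INR m + 1 - x) * h)).
  { split; [nra|]. destruct Hg as [_ Hgt]. destruct (Hgt (INR m + 1 - x)) as [_ H2]; [lra|]. nra. }
  assert (Hre : Re (- s) = - Re s) by reflexivity. assert (Him : Im (- s) = - Im s) by reflexivity.
  eapply Rle_trans; [apply (cpow_lower _ (- s) (c * (1 + INR m)) Hlow); rewrite Hre; lra|]. rewrite Hre, Him, Rabs_Ropp. rewrite <- Rpower_mult_distr by lra.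
  replace (exp (Rabs (ln c) * S) * exp (PI * S) * Rpower (INR m + 1) (- k)) with (exp (Rabs (ln c) * S) * Rpower (INR m + 1) (- k) * exp (PI * S)) by ring.
  apply Rmult_le_compat; [pos|pos| |].
  - apply Rmult_le_compat; try (left; apply exp_pos).
    + unfold Rpower. apply exp_le_mono. eapply Rle_trans; [apply Rle_abs|]. rewrite Rabs_mult, Rmult_comm, Rabs_Ropp.
      apply Rmult_le_compat_l; [pos|]. eapply Rle_trans; [apply re_le_Cmod|exact Hs].
    + rewrite Rplus_comm. apply Rle_Rpower; lra.
  - apply exp_le_mono. apply Rmult_le_compat_l; [left; apply PI_RGT_0|]. eapply Rle_trans; [apply Rabs_snd_le|exact Hs].
Qed.

Lemma Zterm_summable s : 1 < Re s -> summable (Zterm x nu b h s).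
Proof.
  intros Hs. destruct (Zterm_bound (Cmod s) (Re s)) as [K [HK HKb]]; [lra|].
  apply summable_le with (fun m => K * Rpower (INR m + 1) (- Re s)); [intros; apply HKb; lra|]. apply rsummable_scal; auto. now apply rsummable_nat_power.
Qed.

Lemma Dterm_summable n s : - INR n < Re s -> summable (Dterm x nu n b h s).
Proof.
  intros Hs. destruct (Dterm_bound n (Cmod (s - 1)) (Re s + INR n + 1)) as [K [HK HKb]]; [lra|].
  apply summable_le with (fun m => K * Rpower (INR m + 1) (- (Re s + INR n + 1))); [intros; apply HKb; lra|].
  apply rsummable_scal; auto. apply rsummable_nat_power. lra.
Qed.

Lemma Hsum_eq n s : 1 < Re s -> Hsum x nu n b h s = ((s - 1) * h * Sum (Zterm x nu b h s))%C.
Proof.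
  intros Hs. pose proof (pos_INR n). pose proof (Sum_correct _ (Zterm_summable s Hs)) as H1. pose proof (Sum_correct _ (Dterm_summable n s ltac:(lra))) as H2.
  pose proof (has_sum_plus _ _ _ _ (has_sum_scal ((s - 1) * h)%C _ _ H1) H2) as H3.
  set (u := fun m => (e (- INR m * nu)%R * Gval x nu n h s (b + RtoC (INR m) * h))%C).
  assert (H4 := has_sum_ext _ (fun m => u m - u (S m))%C _ (fun m => eq_sym (em_telescope x nu n b h s m)) H3). apply has_sum_nat_telescope in H4.
  - unfold u in H4. unfold Hsum. simpl INR in H4. rewrite Ropp_0, Rmult_0_l, e_0, Cmult_0_l, Cplus_0_r, Cmult_1_l in H4. rewrite <- H4. ring.
  - unfold u. apply (Gval_tends_0 x nu n h s (fun m => b + RtoC (INR m) * h)%C (fun m => - INR m * nu) c (good_c_pos c b h Hg)); [|exact Hs].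
    intros m. destruct Hg as [_ Hgt]. apply Hgt. apply pos_INR.
Qed.

Lemma Hsum_hol n s : - INR n < Re s -> hol (Hsum x nu n b h) s.
Proof.
  intros Hs. unfold Hsum. apply hol_minus; [unfold Gval; apply (hol_G (fun s => s - 1)%C), hol_minus_id|]. set (r := (Re s + INR n) / 2). assert (Hr : 0 < r) by pos.
  destruct (Dterm_bound n (Cmod (s - 1) + r) (1 + r)) as [K [HK HKb]]; [lra|].
  apply (hol_Sum (fun m s => Dterm x nu n b h s m) (fun m => K * Rpower (INR m + 1) (- (1 + r))) s r s Hr).
  - intros m w _. unfold Dterm. apply hol_mult; [cx|]. apply (hol_em_defect (fun s => s - 1)%C), hol_minus_id.
  - intros m w Hw. apply HKb.
    + pose proof (Cmod_triangle3 w s 1). lra.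
    + pose proof (Rabs_fst_le (w - s)) as H1. change (fst (w - s)%C) with (Re w - Re s) in H1. apply Rabs_le_between in H1. unfold r in *. lra.
  - apply rsummable_scal; auto. apply rsummable_nat_power. lra.
  - replace (s - s)%C with (RtoC 0) by ring. now rewrite Cmod_0.
Qed.

Lemma halfline_entire : exists F, (forall s, hol F s) /\ forall s, 1 < Re s -> F s = ((s - 1) * h * Sum (Zterm x nu b h s))%C.
Proof. apply entire_extension. intros N. exists (Hsum x nu N b h). split; [apply Hsum_hol|apply Hsum_eq]. Qed.

End HalfLine.

(** * The Lerch zeta function *)

(** [up] is the least integer strictly above its argument, hence the first [k] with [k > - gamma],
    also for integral [gamma]. *)
Definition first_index (gamma : R) : Z := up (- gamma).
Definition first_point (gamma : R) : R := gamma + IZR (first_index gamma).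

Lemma first_point_bounds gamma : 0 < first_point gamma <= 1.
Proof. unfold first_point, first_index. destruct (archimed (- gamma)). lra. Qed.

Lemma good_real a : 0 < a -> good (Rmin a 1) (RtoC a) 1.
Proof.
  intros Ha. split; [pos|]. intros t Ht. pose proof (Rmin_l a 1). pose proof (Rmin_r a 1).
  replace (a + t * 1)%C with (RtoC (a + t)) by (rewrite RtoC_plus; ring). split.
  - left. simpl. lra.
  - rewrite Cmod_R, Rabs_pos_eq by lra. nra.
Qed.

Lemma positive_index gamma k : - gamma < IZR k -> exists n, k = (first_index gamma + Z.of_nat n)%Z.
Proof.
  intros H. exists (Z.to_nat (k - first_index gamma)). assert (first_index gamma <= k)%Z; [|lia]. unfold first_index. destruct (archimed (- gamma)) as [H1 H2].
  assert (IZR (up (- gamma)) < IZR k + 1) by lra. rewrite <- plus_IZR in H0. apply lt_IZR in H0. lia.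
Qed.

Lemma first_index_pos gamma n : - gamma < IZR (first_index gamma + Z.of_nat n).
Proof. rewrite plus_IZR, <- INR_IZR_INZ. unfold first_index. destruct (archimed (- gamma)) as [H1 H2]. pose proof (pos_INR n). lra. Qed.

Lemma first_index_point gamma n : gamma + IZR (first_index gamma + Z.of_nat n) = first_point gamma + INR n.
Proof. rewrite plus_IZR, <- INR_IZR_INZ. unfold first_point. ring. Qed.

(** With [x = 1] the offset [m + 1 - x] is [m], so psi is a half line sum with [h = 1] that starts
    at the first point; its phase runs opposite to that of [Zterm], hence [- kappa]. *)
Lemma psi_term_nat s gamma kappa n :
  psi_term s gamma kappa (first_index gamma + Z.of_nat n) =
  (e (first_point gamma * kappa)%R * Zterm 1 (- kappa) (first_point gamma) 1 s n)%C.
Proof.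
  unfold psi_term. destruct (Rlt_dec _ _) as [H|H]; [|exfalso; apply H, first_index_pos].
  rewrite first_index_point. unfold Zterm. replace (INR n + 1 - 1) with (INR n) by ring. rewrite Cmult_assoc, <- e_plus, <- RtoC_plus. f_equal.
  - f_equal. f_equal. ring.
  - f_equal. rewrite RtoC_plus. ring.
Qed.

Lemma psi_term_image (T : Type) (f : Z -> T) (z : T) gamma :
  (forall k, ~ (- gamma < IZR k) -> f k = z) ->
  forall k, (forall n, k <> (first_index gamma + Z.of_nat n)%Z) -> f k = z.
Proof. intros H k Hk. apply H. intros Hlt. destruct (positive_index gamma k Hlt) as [n Hn]. now apply (Hk n). Qed.

Lemma psi_exists gamma kappa : exists Psi, (forall s, hol Psi s) /\
  forall s, 1 < Re s -> has_sum (psi_term s gamma kappa) (Psi s / (s - 1))%C.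
Proof.
  pose proof (first_point_bounds gamma) as Ha. set (a := first_point gamma) in *. pose proof (good_real a (proj1 Ha)) as Hg.
  destruct (halfline_entire 1 (- kappa) _ (RtoC a) 1 ltac:(lra) Hg) as [F [HF1 HF2]]. exists (fun s => e (a * kappa)%R * F s)%C. split.
  - cx.
  - intros s Hs. rewrite HF2 by exact Hs. apply (has_sum_image _ (fun n => (first_index gamma + Z.of_nat n)%Z)).
    + intros n m. lia.
    + apply psi_term_image. intros k Hk. unfold psi_term. destruct (Rlt_dec _ _); [lra|cx].
    + eapply has_sum_ext; [intros n; symmetry; apply psi_term_nat|]. fold a. assert (Hs1 : (s - 1)%C <> 0).
      { apply Cminus_nz. intros E. subst s. simpl in Hs. lra. }
      replace (e (a * kappa)%R * ((s - 1) * 1 * Sum (Zterm 1 (- kappa) a 1 s)) / (s - 1))%C with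
        (e (a * kappa)%R * Sum (Zterm 1 (- kappa) a 1 s))%C by (field; exact Hs1).
      apply has_sum_scal. apply Sum_correct. now apply (Zterm_summable 1 (- kappa) _ (RtoC a) 1 ltac:(lra) Hg).
Qed.

Lemma qmero_meromorphic f : meromorphic f -> forall s, qmero f s.
Proof.
  intros H s. destruct (H s) as [Hh|[n [g [_ [Hg [_ Hl]]]]]].
  - apply qmero_hol. now apply hol_holomorphic_at.
  - exists n, g. split; [now apply hol_holomorphic_at|exact Hl].
Qed.

Lemma qmero_simple_quot Psi a s : (forall s, hol Psi s) -> qmero (fun s => Psi s / (s - a))%C s.
Proof. intros H. apply qmero_div; apply qmero_hol; [apply H|cx]. Qed.

(** [pole_at] asks for a nonzero leading coefficient, so if [Psi a = 0] the factor has to be divided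
    out and the function is holomorphic instead. *)
Lemma meromorphic_simple_quot Psi (a : C) : (forall s, hol Psi s) ->
  exists f, meromorphic f /\ forall s : C, s <> a -> f s = (Psi s / (s - a))%C.
Proof.
  intros H. destruct (Ceq_dec (Psi a) 0) as [E|E].
  - destruct (entire_divide Psi a H E) as [g [Hg1 Hg2]]. exists g. split.
    + intros s. left. now apply hol_holomorphic_at.
    + intros s Hs. rewrite Hg2. field. now apply Cminus_nz.
  - exists (fun s => Psi s / (s - a))%C. split; [|auto]. intros s. destruct (Ceq_dec s a) as [E2|E2].
    + right. subst s. exists 1%nat, Psi. split; [lia|]. split; [now apply hol_holomorphic_at|]. split; [exact E|].
      apply filter_forall. intros w. simpl. now rewrite Cmult_1_r.
    + left. apply hol_holomorphic_at. apply hol_div; [apply H|cx|now apply Cminus_nz].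
Qed.

(** The value chosen for psi at a pole is arbitrary, therefore psi is compared with
    [Psi s / (s - 1)] on punctured neighbourhoods only. *)
Lemma psi_spec gamma kappa : exists Psi, (forall s, hol Psi s) /\
  (forall s, 1 < Re s -> has_sum (psi_term s gamma kappa) (Psi s / (s - 1))%C) /\
  forall s, cnear' s (fun w => psi w gamma kappa = (Psi w / (w - 1))%C).
Proof.
  destruct (psi_exists gamma kappa) as [Psi [H1 H2]]. exists Psi. split; [exact H1|]. split; [exact H2|]. assert (Hc : meromorphic (psi_continuation gamma kappa) /\
    forall r : C, (1 < Re r)%R -> has_sum (psi_term r gamma kappa) (psi_continuation gamma kappa r)).
  { apply (epsilon_spec (inhabits (fun _ => RtoC 0)) (fun f =>
      meromorphic f /\ forall r : C, (1 < Re r)%R -> has_sum (psi_term r gamma kappa) (f r))).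
    destruct (meromorphic_simple_quot Psi 1 H1) as [f [Hf1 Hf2]]. exists f. split; [exact Hf1|].
    intros r Hr. rewrite Hf2; [cx|]. intros E. subst r. simpl in Hr. lra. }
  destruct Hc as [Hm Hs]. intros s. apply (qmero_identity_eq (fun _ => True) (psi_continuation gamma kappa) (fun w => Psi w / (w - 1))%C 2 s convex_all); auto.
  - intros w _. now apply qmero_meromorphic.
  - intros w _. now apply qmero_simple_quot.
  - apply locally_locally'. generalize (halfplane_locally 1 2 ltac:(simpl; lra)). apply filter_imp. intros w Hw.
    apply (has_sum_unique (psi_term w gamma kappa)); auto.
Qed.

Lemma nat_above (r : R) : exists m : nat, r <= INR m.
Proof. exists (Z.to_nat (up r)). destruct (archimed r) as [H _]. rewrite INR_IZR_INZ. apply Rle_trans with (IZR (up r)); [lra|]. apply IZR_le. lia. Qed.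

Lemma INR1_infty : filterlim (fun n => INR n + 1) eventually (Rbar_locally p_infty).
Proof. intros P [M HP]. destruct (nat_above M) as [N HN]. exists N. intros n Hn. apply HP. apply le_INR in Hn. lra. Qed.

Lemma inv_INR_at_right : filterlim (fun n => / (INR n + 1)) eventually (at_right 0).
Proof.
  intros P HP. unfold at_right, within in HP. apply locally_R in HP. destruct HP as [d [Hd HP]].
  destruct (nat_above (/ d)) as [N HN]. exists N. intros n Hn. apply le_INR in Hn. pose proof (Rinv_0_lt_compat _ Hd).
  assert (Hi : 0 < / (INR n + 1)) by (apply Rinv_0_lt_compat; lra). apply HP; [|exact Hi]. rewrite Rminus_0_r, Rabs_pos_eq by lra.
  rewrite <- (Rinv_inv d). apply Rinv_lt_contravar; [pos|lra].
Qed.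

(** * The Gamma function *)

Lemma CInt_bound_primitive (g : R -> C) (H dH : R -> R) a b : a <= b -> con g a b ->
  (forall t, a <= t <= b -> is_derive H t (dH t)) -> (forall t, a <= t <= b -> continuous dH t) ->
  (forall t, a <= t <= b -> Cmod (g t) <= dH t) -> Cmod (CInt g a b) <= H b - H a.
Proof.
  intros Hab Hg Hd Hc Hb. rewrite <- norm_C_R. apply (norm_RInt_le (V := C_R_NormedModule) g dH a b (CInt g a b) (H b - H a) Hab).
  - intros t Ht. rewrite norm_C_R. now apply Hb.
  - now apply CInt_is.
  - apply (is_RInt_derive (V := R_CompleteNormedModule) H dH); rewrite Rmin_left, Rmax_right by exact Hab; auto.
Qed.

Section Improper.
Variables (g : R -> C) (E1 E2 : R -> R).
Hypothesis Hg : forall t, 0 < t -> rcont g t.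
Hypothesis B1 : forall a b, 0 < a <= b -> b <= 1 -> Cmod (CInt g a b) <= E1 b.
Hypothesis B2 : forall a b, 1 <= a <= b -> Cmod (CInt g a b) <= E2 a.
Hypothesis L1 : filterlim E1 (at_right 0) (locally 0).
Hypothesis L2 : filterlim E2 (Rbar_locally p_infty) (locally 0).

Lemma con_pos a b : 0 < a -> con g a b.
Proof. intros Ha t Ht. apply Hg. lra. Qed.

Lemma improper_compare a b a' b' : 0 < a' <= a -> a <= 1 -> 1 <= b <= b' ->
  Cmod (CInt g a' b' - CInt g a b) <= E1 a + E2 b.
Proof.
  intros Ha Ha1 Hb. rewrite <- (CInt_Chasles g a' a b') by (try lra; apply con_pos; lra). rewrite <- (CInt_Chasles g a b b') by (try lra; apply con_pos; lra).
  replace (CInt g a' a + (CInt g a b + CInt g b b') - CInt g a b)%C with (CInt g a' a + CInt g b b')%C by ring.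
  ctri. apply Rplus_le_compat; [apply B1|apply B2]; lra.
Qed.

Lemma improper_seq_small eps : 0 < eps -> exists N, forall n, (N <= n)%nat -> E1 (/ (INR n + 1)) + E2 (INR n + 1) < eps.
Proof.
  intros He. assert (He2 : 0 < eps / 2) by lra. assert (X1 : at_right 0 (fun t => Rabs (E1 t - 0) < eps / 2)).
  { apply (L1 (fun y => Rabs (y - 0) < eps / 2)). apply locally_R. exists (eps / 2). auto. }
  assert (X2 : Rbar_locally p_infty (fun t => Rabs (E2 t - 0) < eps / 2)).
  { apply (L2 (fun y => Rabs (y - 0) < eps / 2)). apply locally_R. exists (eps / 2). auto. }
  destruct (inv_INR_at_right _ X1) as [N1 HN1]. destruct (INR1_infty _ X2) as [N2 HN2]. exists (N1 + N2)%nat. intros n Hn.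
  specialize (HN1 n ltac:(lia)). specialize (HN2 n ltac:(lia)). rewrite !Rminus_0_r in *.
  pose proof (Rle_abs (E1 (/ (INR n + 1)))). pose proof (Rle_abs (E2 (INR n + 1))). lra.
Qed.

Definition improper_seq (n : nat) : C := CInt g (/ (INR n + 1)) (INR n + 1).

Lemma inv_INR_bounds n : 0 < / (INR n + 1) <= 1.
Proof. pose proof (pos_INR n). split; [pos|]. rewrite <- Rinv_1 at 2. apply Rinv_le_contravar; lra. Qed.

Lemma improper_seq_cauchy n m : (n <= m)%nat -> Cmod (improper_seq m - improper_seq n) <= E1 (/ (INR n + 1)) + E2 (INR n + 1).
Proof.
  intros H. apply le_INR in H. pose proof (inv_INR_bounds n). pose proof (inv_INR_bounds m). pose proof (pos_INR n).
  apply improper_compare; try lra. split; [lra|]. apply Rinv_le_contravar; lra.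
Qed.

(** The truncations form a Cauchy sequence. The explicit error [E1 a + E2 b] is kept because it
    becomes uniform in the parameters of the integrand and so transports holomorphy to the limit. *)
Lemma improper_exists : exists l, tends eventually improper_seq l /\
  (forall a b, 0 < a <= 1 -> 1 <= b -> Cmod (l - CInt g a b) <= E1 a + E2 b) /\
  is_RInt_gen (V := C_R_NormedModule) g (at_right 0) (Rbar_locally p_infty) l.
Proof.
  assert (Hcauchy : exists l, tends eventually improper_seq l).
  { assert (Hex : exists l : CompleteNormedModule.CompleteSpace _ C_R_CompleteNormedModule, filterlim improper_seq eventually (locally l)).
    { apply (filterlim_locally_cauchy (U := CompleteNormedModule.CompleteSpace _ C_R_CompleteNormedModule)). intros eps.
      assert (He : 0 < eps / 2) by (pose proof (cond_pos eps); lra). destruct (improper_seq_small (eps / 2) He) as [N HN].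
      exists (fun n => (N <= n)%nat). split; [exists N; auto|].
      assert (HB : forall u v, (N <= u)%nat -> (u <= v)%nat -> Cmod (improper_seq v - improper_seq u) < eps / 2).
      { intros u v Hu Huv. eapply Rle_lt_trans; [apply improper_seq_cauchy; exact Huv|]. now apply HN. }
      intros u v Hu Hv. apply (norm_compat1 (V := C_R_NormedModule)). rewrite norm_C_R. change (Cmod (improper_seq v - improper_seq u) < eps).
      destruct (Nat.le_ge_cases u v).
      - specialize (HB u v Hu H). lra.
      - specialize (HB v u Hv H). rewrite Cmod_minus_sym. lra. }
    destruct Hex as [l Hl]. exists l. apply (proj2 (tends_filterlim eventually improper_seq l)). exact Hl. }
  destruct Hcauchy as [l Hl]. exists l. split; [exact Hl|]. assert (Hb : forall a b, 0 < a <= 1 -> 1 <= b -> Cmod (l - CInt g a b) <= E1 a + E2 b).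
  { intros a b Ha Hb. apply (tends_le eventually (fun n => improper_seq n - CInt g a b)%C).
    - cx.
    - destruct (archimed (Rmax b (/ a))) as [HN _]. exists (Z.to_nat (up (Rmax b (/ a)))). intros n Hn. assert (Hn2 : Rmax b (/ a) < INR n).
      { eapply Rlt_le_trans; [exact HN|]. rewrite INR_IZR_INZ. apply IZR_le. lia. }
      pose proof (Rmax_l b (/ a)). pose proof (Rmax_r b (/ a)). pose proof (inv_INR_bounds n). apply improper_compare; try lra. split; [lra|].
      rewrite <- (Rinv_inv a). apply Rinv_le_contravar; [pos|lra]. }
  split; [exact Hb|]. unfold is_RInt_gen. intros P HP. apply locally_Cmod in HP. destruct HP as [eps [He HP]]. assert (He2 : 0 < eps / 2) by lra.
  assert (X1 : at_right 0 (fun t => Rabs (E1 t - 0) < eps / 2)).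
  { apply (L1 (fun y => Rabs (y - 0) < eps / 2)). apply locally_R. exists (eps / 2). auto. }
  assert (X1' : at_right 0 (fun t => 0 < t <= 1)).
  { unfold at_right, within. apply locally_R. exists 1. split; [lra|]. intros y Hy Hy0. rewrite Rminus_0_r in Hy. pose proof (Rle_abs y). lra. }
  assert (X2 : Rbar_locally p_infty (fun t => Rabs (E2 t - 0) < eps / 2)).
  { apply (L2 (fun y => Rabs (y - 0) < eps / 2)). apply locally_R. exists (eps / 2). auto. }
  assert (X2' : Rbar_locally p_infty (fun t => 1 <= t)) by (exists 1; intros; lra). unfold filtermapi.
  apply (Filter_prod _ _ _ _ _ (filter_and _ _ X1 X1') (filter_and _ _ X2 X2')). intros a b [Ha1 Ha2] [Hb1 Hb2]. exists (CInt g a b). simpl. split.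
  - apply CInt_is; [lra|]. apply con_pos. lra.
  - apply HP. rewrite Cmod_minus_sym. eapply Rle_lt_trans; [cx|]. rewrite Rminus_0_r in *. pose proof (Rle_abs (E1 a)). pose proof (Rle_abs (E2 b)). lra.
Qed.
End Improper.

Definition euler_fn (s w : C) (t : R) : C := (cpow (RtoC t) (s - 1) * Cexp (- (w * RtoC t)))%C.

Lemma euler_fn_rcont s w t : 0 < t -> rcont (euler_fn s w) t.
Proof.
  intros Ht. assert (H1 : rder (fun u => cpow (RtoC u) (s - 1)) t (((s - 1) * cpow (RtoC t) (s - 1 - 1)) * 1)%C).
  { apply (rder_comp (fun z => cpow z (s - 1)) RtoC); [|apply rder_RtoC]. apply cder_cpow_base. left. exact Ht. }
  assert (H2 : rder (fun u => Cexp (- w * RtoC u)%C) t (Cexp (- w * RtoC t) * (- w * 1))%C).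
  { apply (rder_comp Cexp (fun u => - w * RtoC u)%C); [apply cder_Cexp|apply rder_scal, rder_RtoC]. }
  eapply rder_rcont. eapply rder_ext; [|apply (rder_mult _ _ t _ _ H1 H2)]. intros u. unfold euler_fn. f_equal. f_equal. ring.
Qed.

Lemma Cmod_euler_fn s w t : 0 < t -> Cmod (euler_fn s w t) = Rpower t (Re s - 1) * exp (- (Re w * t)).
Proof. intros Ht. unfold euler_fn. rewrite Cmod_mult, Cmod_cpow_pos, Cmod_Cexp by exact Ht. f_equal. f_equal. simpl. unfold Re. ring. Qed.

(** The inequality [y <= exp y] at [y = x t / (2 m)], raised to the power [m]; the case [m = 0],
    where this [y] has no meaning, is separate. *)
Lemma Rpower_exp_bound m x t : 0 < x -> 0 <= t -> t ^ m <= (2 * INR m / x) ^ m * exp (x * t / 2).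
Proof.
  intros Hx Ht. destruct m as [|m].
  - simpl. rewrite Rmult_1_l. rewrite <- exp_0. apply exp_le_mono. pos.
  - assert (Hm : 0 < INR (S m)) by (apply lt_0_INR; lia).
    assert (H1 : x * t / 2 / INR (S m) <= exp (x * t / 2 / INR (S m))) by (pose proof (exp_ineq1_le (x * t / 2 / INR (S m))); lra).
    assert (H0 : 0 <= x * t / 2 / INR (S m)).
    { pos. }
    pose proof (pow_incr _ _ (S m) (conj H0 H1)) as H2. assert (H3 : exp (x * t / 2 / INR (S m)) ^ S m = exp (x * t / 2)).
    { rewrite <- Rpower_pow by apply exp_pos. unfold Rpower. rewrite ln_exp. f_equal. field. lra. }
    rewrite H3 in H2. replace (t ^ S m) with ((2 * INR (S m) / x) ^ S m * (x * t / 2 / INR (S m)) ^ S m).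
    + apply Rmult_le_compat_l; [|exact H2]. pos.
    + rewrite <- Rpow_mult_distr. f_equal. field. lra.
Qed.

(** [tail0] and [tail_inf] are the exact integrals of the majorants [t^(k-1)] over [[0, t]] and
    [(2m/x)^m exp (- x t / 2)] over [[t, oo)]. *)
Definition tail0 (k : R) (t : R) : R := / k * Rpower t k.
Definition tail_inf (m : nat) (x t : R) : R := (2 * INR m / x) ^ m * (2 / x) * exp (- (x * t / 2)).

Lemma euler_bound0 s w k a b : 0 < k <= Re s -> 0 <= Re w -> 0 < a <= b -> b <= 1 -> Cmod (CInt (euler_fn s w) a b) <= tail0 k b.
Proof.
  intros Hk Hw Ha Hb. apply Rle_trans with (tail0 k b - tail0 k a).
  - apply (CInt_bound_primitive _ (tail0 k) (fun t => Rpower t (k - 1))); [lra|intros t Ht; apply euler_fn_rcont; lra| | |].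
    + intros t Ht. unfold tail0. replace (Rpower t (k - 1)) with (/ k * (k * Rpower t (k - 1))) by (field; lra).
      apply (is_derive_scal (fun t => Rpower t k)). apply is_derive_Reals. apply derivable_pt_lim_power. lra.
    + intros t Ht. apply continuity_pt_filterlim. apply derivable_continuous_pt. exists ((k - 1) * Rpower t (k - 1 - 1)). apply derivable_pt_lim_power. lra.
    + intros t Ht. rewrite Cmod_euler_fn by lra. rewrite <- (Rmult_1_r (Rpower t (k - 1))). apply Rmult_le_compat; try (left; apply exp_pos).
      * unfold Rpower. apply exp_le_mono. assert (ln t <= 0) by (rewrite <- ln_1; apply ln_le; lra). nra.
      * rewrite <- exp_0. apply exp_le_mono. nra.
  - assert (0 <= tail0 k a); [|lra]. pos.
Qed.

Lemma euler_bound_inf s w m x a b : Re s <= INR m + 1 -> 0 < x <= Re w -> 1 <= a <= b -> Cmod (CInt (euler_fn s w) a b) <= tail_inf m x a.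
Proof.
  intros Hm Hw Ha. apply Rle_trans with (- tail_inf m x b - - tail_inf m x a).
  - apply (CInt_bound_primitive _ (fun t => - tail_inf m x t) (fun t => (2 * INR m / x) ^ m * exp (- (x * t / 2))));
      [lra|intros t Ht; apply euler_fn_rcont; lra| | |].
    + intros t Ht. unfold tail_inf. generalize ((2 * INR m / x) ^ m). intros K. auto_derive; [exact I|].
      replace (x * t * / 2) with (x * t / 2) by reflexivity. generalize (exp (- (x * t / 2))). intros. field. lra.
    + intros t Ht. apply (continuous_scal_r (V := R_NormedModule) ((2 * INR m / x) ^ m) (fun t => exp (- (x * t / 2)))).
      apply (ex_derive_continuous (V := R_NormedModule)). auto_derive. exact I.
    + intros t Ht. rewrite Cmod_euler_fn by lra. apply Rle_trans with (t ^ m * exp (- (x * t))).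
      * apply Rmult_le_compat; try (left; apply exp_pos).
        -- rewrite <- Rpower_pow by lra. apply Rle_Rpower; lra.
        -- apply exp_le_mono. nra.
      * replace (exp (- (x * t / 2))) with (exp (x * t / 2) * exp (- (x * t))) by (rewrite <- exp_plus; f_equal; field).
        rewrite <- Rmult_assoc. apply Rmult_le_compat_r; [pos|]. apply Rpower_exp_bound; lra.
  - assert (0 <= tail_inf m x b); [|lra]. pos.
Qed.

Lemma tail0_lim k : 0 < k -> filterlim (tail0 k) (at_right 0) (locally 0).
Proof.
  intros Hk P HP. apply locally_R in HP. destruct HP as [d [Hd HdP]]. unfold filtermap, at_right, within. apply locally_R.
  exists (Rpower (k * d) (/ k)). split; [pos|]. intros t Ht Ht0. rewrite Rminus_0_r, Rabs_pos_eq in Ht by lra. apply HdP. assert (Hp : 0 < tail0 k t) by pos.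
  rewrite Rminus_0_r, Rabs_pos_eq by lra. unfold tail0. apply Rmult_lt_reg_l with k; [exact Hk|]. rewrite <- Rmult_assoc, Rinv_r, Rmult_1_l by lra.
  replace (k * d) with (Rpower (Rpower (k * d) (/ k)) k).
  - apply Rlt_Rpower_l; lra.
  - rewrite Rpower_mult, Rinv_l, Rpower_1; [auto|nra|lra].
Qed.

Lemma tail_inf_lim m x : 0 < x -> filterlim (tail_inf m x) (Rbar_locally p_infty) (locally 0).
Proof.
  intros Hx. unfold tail_inf. apply (filterlim_ext (fun t => ((2 * INR m / x) ^ m * (2 / x)) * exp (- (x / 2 * t)))).
  { intros t. f_equal. f_equal. field. }
  replace 0 with ((2 * INR m / x) ^ m * (2 / x) * 0) by ring.
  apply (filterlim_comp _ _ _ (fun t => exp (- (x / 2 * t))) (fun y => (2 * INR m / x) ^ m * (2 / x) * y) _ (locally 0)).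
  2:{ apply (continuous_scal_r (V := R_NormedModule) _ (fun y => y)). apply continuous_id. }
  intros P HP. apply locally_R in HP. destruct HP as [d [Hd HdP]]. unfold filtermap. exists (2 / x * (/ d)). intros t Ht.
  apply HdP. rewrite Rminus_0_r, Rabs_pos_eq by pos. assert (H1 : / d < x / 2 * t).
  { apply Rmult_lt_reg_l with (2 / x); [pos|]. eapply Rlt_le_trans; [exact Ht|]. right. field. lra. }
  rewrite exp_Ropp. rewrite <- (Rinv_inv d). apply Rinv_lt_contravar.
  - pos.
  - eapply Rlt_trans; [exact H1|]. pose proof (exp_ineq1_le (x / 2 * t)). lra.
Qed.

Lemma euler_exists s w : 0 < Re s -> 0 < Re w -> exists l, tends eventually (improper_seq (euler_fn s w)) l /\
  (forall k m x a b, 0 < k <= Re s -> Re s <= INR m + 1 -> 0 < x <= Re w -> 0 < a <= 1 -> 1 <= b ->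
     Cmod (l - CInt (euler_fn s w) a b) <= tail0 k a + tail_inf m x b) /\
  is_RInt_gen (V := C_R_NormedModule) (euler_fn s w) (at_right 0) (Rbar_locally p_infty) l.
Proof.
  intros Hs Hw. assert (Hex : forall k m x, 0 < k <= Re s -> Re s <= INR m + 1 -> 0 < x <= Re w -> exists l, tends eventually (improper_seq (euler_fn s w)) l /\
    (forall a b, 0 < a <= 1 -> 1 <= b -> Cmod (l - CInt (euler_fn s w) a b) <= tail0 k a + tail_inf m x b) /\
    is_RInt_gen (V := C_R_NormedModule) (euler_fn s w) (at_right 0) (Rbar_locally p_infty) l).
  { intros k m x Hk Hm Hx. apply improper_exists.
    - intros t Ht. now apply euler_fn_rcont.
    - intros a b Ha Hb. apply euler_bound0; auto; lra.
    - intros a b Ha. now apply euler_bound_inf.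
    - apply tail0_lim. lra.
    - apply tail_inf_lim. lra. }
  destruct (nat_above (Re s)) as [m0 Hm0]. destruct (Hex (Re s) m0 (Re w) ltac:(lra) ltac:(lra) ltac:(lra)) as [l [H1 [H2 H3]]].
  exists l. split; [exact H1|]. split; [|exact H3]. intros k m x a b Hk Hm Hx. destruct (Hex k m x Hk Hm Hx) as [l' [H1' [H2' _]]].
  rewrite (tends_unique _ _ _ _ H1 H1'). apply H2'.
Qed.

(* The truncations to [1/(n+1), n+1] replace the improper integral. *)
Definition euler (s w : C) : C := epsilon (inhabits (RtoC 0)) (fun l => tends eventually (improper_seq (euler_fn s w)) l).

Lemma euler_spec s w : 0 < Re s -> 0 < Re w -> tends eventually (improper_seq (euler_fn s w)) (euler s w) /\
  (forall k m x a b, 0 < k <= Re s -> Re s <= INR m + 1 -> 0 < x <= Re w -> 0 < a <= 1 -> 1 <= b ->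
     Cmod (euler s w - CInt (euler_fn s w) a b) <= tail0 k a + tail_inf m x b) /\
  is_RInt_gen (V := C_R_NormedModule) (euler_fn s w) (at_right 0) (Rbar_locally p_infty) (euler s w).
Proof.
  intros Hs Hw. destruct (euler_exists s w Hs Hw) as [l [H1 [H2 H3]]]. assert (E : euler s w = l).
  { apply (tends_unique eventually (improper_seq (euler_fn s w))); [|exact H1].
    apply (epsilon_spec (inhabits (RtoC 0)) (fun l => tends eventually (improper_seq (euler_fn s w)) l)). now exists l. }
  rewrite E. auto.
Qed.

(** One lemma for both parameters of Euler's integral: as a function of [w] the exponent is [- t],
    as a function of [s] it is [ln t]. *)
Lemma exp_int_cder (g l : R -> C) a b p : a <= b -> con g a b -> con l a b ->
  exists d, cder (fun p => CInt (fun t => g t * Cexp (p * l t))%C a b) p d.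
Proof.
  intros Hab Hg Hl. destruct (con_bounded l a b Hab Hl) as [L [HL HLb]]. assert (Hexp : forall q, con (fun t => Cexp (q * l t)) a b).
  { intros q. apply con_comp; [cx|]. intros t _. apply ccont_Cexp. }
  assert (Hgp : forall q, con (fun t => g t * Cexp (q * l t))%C a b) by cx. destruct (con_bounded _ a b Hab (Hgp p)) as [M [HM HMb]].
  set (dg := fun t => (g t * Cexp (p * l t) * l t)%C). assert (Hdg : con dg a b) by (apply con_mult; auto). exists (CInt dg a b). apply cder_intro. intros eps He.
  set (K := M * (10 * L * L) * (b - a) + 1). assert (HK : 0 < K).
  { unfold K. assert (0 <= M * (10 * L * L) * (b - a)); [|lra]. pos. }
  (* The first radius keeps the increment of the exponent below 1/2, as [Cexp_second_order]
     requires. *)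
  exists (Rmin (/ (2 * L)) (eps / K)). split.
  { pos. }
  intros q Hq. pose proof (Rmin_l (/ (2 * L)) (eps / K)). pose proof (Rmin_r (/ (2 * L)) (eps / K)).
  rewrite <- CInt_minus by auto. rewrite (Cmult_comm _ (q - p)). rewrite <- CInt_scal by auto. rewrite <- CInt_minus; [|exact Hab|cx|cx].
  eapply Rle_trans; [apply CInt_bound with (M := M * (10 * (Cmod (q - p) * L * (Cmod (q - p) * L)))); [exact Hab| |]|].
  - cx.
  - intros t Ht. unfold dg. replace (g t * Cexp (q * l t) - g t * Cexp (p * l t) - (q - p) * (g t * Cexp (p * l t) * l t))%C with
      ((g t * Cexp (p * l t)) * (Cexp ((q - p) * l t) - 1 - (q - p) * l t))%C.
    + rewrite Cmod_mult. specialize (HMb t Ht). specialize (HLb t Ht).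
      assert (Hs : Cmod ((q - p) * l t) <= Cmod (q - p) * L) by (rewrite Cmod_mult; apply Rmult_le_compat_l; [pos|exact HLb]).
      assert (Hs2 : Cmod (q - p) * L <= 1 / 2).
      { apply Rle_trans with (/ (2 * L) * L); [apply Rmult_le_compat_r; lra|right; field; lra]. }
      apply Rmult_le_compat; try apply Cmod_ge_0; auto. eapply Rle_trans; [apply Cexp_second_order; lra|]. pose proof (Cmod_ge_0 ((q - p) * l t)). nra.
    + replace (q * l t)%C with (p * l t + (q - p) * l t)%C by ring. rewrite Cexp_plus. ring.
  - pose proof (Cmod_ge_0 (q - p)).
    replace ((b - a) * (M * (10 * (Cmod (q - p) * L * (Cmod (q - p) * L))))) with ((M * (10 * L * L) * (b - a)) * Cmod (q - p) * Cmod (q - p)) by ring.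
    apply Rmult_le_compat_r; [lra|]. apply Rle_trans with (K * Cmod (q - p)); [apply Rmult_le_compat_r; unfold K; lra|].
    apply Rle_trans with (K * (eps / K)); [apply Rmult_le_compat_l; lra|right; field; lra].
Qed.

Lemma exp_int_hol (g l : R -> C) a b p : a <= b -> con g a b -> con l a b ->
  hol (fun p => CInt (fun t => g t * Cexp (p * l t))%C a b) p.
Proof. intros Hab Hg Hl. unfold hol. apply filter_forall. intros q. now apply exp_int_cder. Qed.

Lemma con_cpow_RtoC a b p : 0 < a -> con (fun t => cpow (RtoC t) p) a b.
Proof.
  intros Ha. eapply con_rder. intros t Ht. apply (rder_comp (fun z => cpow z p) RtoC); [|apply rder_RtoC]. apply cder_cpow_base. left. simpl. lra.
Qed.

Lemma con_RtoC a b : con RtoC a b.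
Proof. intros t _. apply tends_RtoC. Qed.

Lemma euler_fn_hol_w s a b w : 0 < a <= b -> hol (fun w => CInt (euler_fn s w) a b) w.
Proof.
  intros Ha. apply hol_ext_loc with (fun w => CInt (fun t => cpow (RtoC t) (s - 1) * Cexp (w * (- RtoC t)))%C a b).
  - apply filter_forall. intros v. f_equal. extensionality t. unfold euler_fn. f_equal. f_equal. ring.
  - apply exp_int_hol; [lra|now apply con_cpow_RtoC|]. apply con_opp, con_RtoC.
Qed.

Lemma con_ln a b : 0 < a -> con (fun t => RtoC (ln t)) a b.
Proof.
  intros Ha t Ht. apply (tends_ext_F (locally t) (fun t => Log (RtoC t))).
  - apply locally_R. exists (a / 2). split; [lra|]. intros y Hy. apply Log_pos. apply Rabs_def2 in Hy. lra.
  - rewrite <- Log_pos by lra. apply (tends_comp (locally t) Log RtoC); [|apply tends_RtoC]. apply ccont_Log. left. simpl. lra.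
Qed.

Lemma euler_fn_hol_s w a b s : 0 < a <= b -> hol (fun s => CInt (euler_fn s w) a b) s.
Proof.
  intros Ha. apply hol_ext_loc with (fun s => CInt (fun t => Cexp (- (w * RtoC t)) * Cexp ((s - 1) * RtoC (ln t)))%C a b).
  - apply filter_forall. intros v. apply CInt_ext; [lra|]. intros t Ht. unfold euler_fn. rewrite cpow_pos by lra. ring.
  - apply (hol_comp (fun p => CInt (fun t => Cexp (- (w * RtoC t)) * Cexp (p * RtoC (ln t)))%C a b) (fun s => s - 1)%C); [|cx].
    apply exp_int_hol; [lra| |apply con_ln; lra]. apply con_comp; [apply con_opp, con_mult; [cx|apply con_RtoC]|]. intros t _. apply ccont_Cexp.
Qed.

Lemma Re_ball s w r : Cmod (w - s) <= r -> Re s - r <= Re w <= Re s + r.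
Proof. intros H. pose proof (Rabs_fst_le (w - s)) as H1. change (fst (w - s)%C) with (Re w - Re s) in H1. apply Rabs_le_between in H1. lra. Qed.

Lemma tails_small k m x eps : 0 < k -> 0 < x -> 0 < eps -> exists a b, 0 < a <= 1 /\ 1 <= b /\ tail0 k a + tail_inf m x b <= eps.
Proof.
  intros Hk Hx He. destruct (improper_seq_small _ _ (tail0_lim k Hk) (tail_inf_lim m x Hx) eps He) as [N HN].
  exists (/ (INR N + 1)), (INR N + 1). pose proof (inv_INR_bounds N). pose proof (pos_INR N). repeat split; try lra. left. apply HN. lia.
Qed.

Lemma euler_hol_s w s : 0 < Re w -> 0 < Re s -> hol (fun s => euler s w) s.
Proof.
  intros Hw Hs. set (r := Re s / 2). assert (Hr : 0 < r) by pos. destruct (nat_above (2 * Re s)) as [m Hm].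
  apply (hol_uniform_lim _ s r Hr); [|replace (s - s)%C with (RtoC 0) by ring; now rewrite Cmod_0].
  intros eps He. destruct (tails_small r m (Re w) eps Hr Hw He) as [a [b [Ha [Hb Hab]]]].
  exists (fun s => CInt (euler_fn s w) a b). split; [intros; apply euler_fn_hol_s; lra|].
  intros v Hv. apply Re_ball in Hv. unfold r in *. eapply Rle_trans; [|exact Hab]. apply euler_spec; lra.
Qed.

Lemma euler_hol_w w s : 0 < Re w -> 0 < Re s -> hol (euler s) w.
Proof.
  intros Hw Hs. set (r := Re w / 2). assert (Hr : 0 < r) by pos. destruct (nat_above (Re s)) as [m Hm].
  apply (hol_uniform_lim _ w r Hr); [|replace (w - w)%C with (RtoC 0) by ring; now rewrite Cmod_0].
  intros eps He. destruct (tails_small (Re s) m r eps Hs Hr He) as [a [b [Ha [Hb Hab]]]].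
  exists (fun w => CInt (euler_fn s w) a b). split; [intros; apply euler_fn_hol_w; lra|].
  intros v Hv. apply Re_ball in Hv. unfold r in *. eapply Rle_trans; [|exact Hab]. apply euler_spec; lra.
Qed.

Lemma euler_fn_scaling s (w a b : R) : 0 < w -> 0 < a <= b ->
  CInt (euler_fn s w) a b = (cpow w (- s) * CInt (euler_fn s 1) (w * a) (w * b))%C.
Proof.
  intros Hw Ha. assert (Hc : con (euler_fn s 1) (w * a) (w * b)).
  { intros t Ht. apply euler_fn_rcont. assert (0 < w * a) by nra. lra. }
  assert (Hab : w * a <= w * b) by nra. pose proof (CInt_is _ _ _ Hab Hc) as H.
  replace (w * a) with (w * a + 0) in H by ring. replace (w * b) with (w * b + 0) in H by ring.
  apply (is_RInt_comp_lin (V := C_R_NormedModule)) in H. apply CInt_eq in H.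
  replace (w * a + 0) with (w * a) in H by ring. replace (w * b + 0) with (w * b) in H by ring. rewrite <- H. rewrite <- CInt_scal; [|lra|].
  - apply CInt_ext; [lra|]. intros t Ht. unfold euler_fn. change (scal w (cpow (RtoC (w * t + 0)) (s - 1) * Cexp (- (1 * RtoC (w * t + 0))))%C) with
      ((w * fst (cpow (RtoC (w * t + 0)) (s - 1) * Cexp (- (1 * RtoC (w * t + 0))))%C, w * snd (cpow (RtoC (w * t + 0)) (s - 1) * Cexp (- (1 * RtoC (w * t + 0))))%C) : C).
    rewrite Rplus_0_r. set (Z := (cpow (RtoC (w * t)) (s - 1) * Cexp (- (1 * RtoC (w * t))))%C). replace ((w * fst Z, w * snd Z) : C) with (RtoC w * Z)%C by (ceq).
    unfold Z. rewrite !cpow_pos by (try nra; lra). rewrite ln_mult by lra. assert (Ew : RtoC w = Cexp (RtoC (ln w))) by (rewrite Cexp_R, exp_ln; auto).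
    rewrite Ew at 2. rewrite <- !Cexp_plus. rewrite RtoC_plus, RtoC_mult. f_equal. ring.
  - intros t Ht. assert (Hr : rcont (fun y => euler_fn s 1 (w * y + 0)) t).
    {
      intros eps He. pose proof (euler_fn_rcont s 1 (w * t + 0) ltac:(nra) eps He) as Hq. apply locally_R in Hq. destruct Hq as [d [Hd Hq]].
      apply locally_R. exists (d / w). split; [pos|]. intros y Hy. apply Hq.
      replace (w * y + 0 - (w * t + 0)) with (w * (y - t)) by ring. rewrite Rabs_mult, (Rabs_pos_eq w) by lra.
      apply Rlt_le_trans with (w * (d / w)); [now apply Rmult_lt_compat_l|right; field; lra]. }
    apply (tends_ext (locally t) (fun y => RtoC w * euler_fn s 1 (w * y + 0))%C).
    { intros y. apply injective_projections; simpl; unfold scal; simpl; unfold mult; simpl; ring. }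
    match goal with |- tends _ _ ?l => replace l with (RtoC w * euler_fn s 1 (w * t + 0))%C end;
      [|apply injective_projections; simpl; unfold scal; simpl; unfold mult; simpl; ring].
    cx.
Qed.

Lemma euler_real s (w : R) : 0 < Re s -> 0 < w -> euler s w = (cpow w (- s) * euler s 1)%C.
Proof.
  intros Hs Hw. apply Ceq_minus, Cmod_zero_eq. apply le_epsilon. intros eps He. rewrite Rplus_0_l. destruct (nat_above (Re s)) as [m Hm].
  pose proof (Cmod_pos _ (cpow_nz w (- s))) as HK. set (K := Cmod (cpow w (- s))) in *. set (eps' := Rmin (eps / 2) (eps / (2 * K))). assert (He' : 0 < eps') by pos.
  (* small enough for both the original and the rescaled truncation *)
  assert (X : exists a b, 0 < a <= 1 /\ 1 <= b /\ w * a <= 1 /\ 1 <= w * b /\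
     tail0 (Re s) a + tail_inf m w b <= eps' /\ tail0 (Re s) (w * a) + tail_inf m 1 (w * b) <= eps').
  { destruct (improper_seq_small _ _ (tail0_lim (Re s) Hs) (tail_inf_lim m w Hw) eps' He') as [N1 H1].
    assert (L0 : filterlim (fun t => tail0 (Re s) (w * t)) (at_right 0) (locally 0)).
    { apply (filterlim_comp _ _ _ (fun t => w * t) (tail0 (Re s)) _ (at_right 0)); [|now apply tail0_lim].
      intros P HP. unfold filtermap, at_right, within in *. apply locally_R in HP. destruct HP as [d [Hd HP]].
      apply locally_R. exists (d / w). split; [pos|]. intros y Hy Hy0. apply HP; [|nra]. rewrite Rminus_0_r in *. rewrite Rabs_mult, (Rabs_pos_eq w) by lra.
      apply Rlt_le_trans with (w * (d / w)); [now apply Rmult_lt_compat_l|right; field; lra]. }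
    assert (Li : filterlim (fun t => tail_inf m 1 (w * t)) (Rbar_locally p_infty) (locally 0)).
    { apply (filterlim_comp _ _ _ (fun t => w * t) (tail_inf m 1) _ (Rbar_locally p_infty)); [|apply tail_inf_lim; lra].
      intros P [M HP]. exists (M / w). intros y Hy. apply HP. apply Rmult_lt_reg_l with (/ w); [pos|]. rewrite <- Rmult_assoc, Rinv_l, Rmult_1_l by lra. lra. }
    destruct (improper_seq_small _ _ L0 Li eps' He') as [N2 H2].
    destruct (nat_above (Rmax w (/ w))) as [N3 H3]. pose proof (Rmax_l w (/ w)). pose proof (Rmax_r w (/ w)).
    set (N := (N1 + N2 + N3)%nat). specialize (H1 N ltac:(unfold N; lia)). specialize (H2 N ltac:(unfold N; lia)).
    assert (HN : INR N3 <= INR N) by (apply le_INR; unfold N; lia). pose proof (inv_INR_bounds N). exists (/ (INR N + 1)), (INR N + 1). repeat split; try lra.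
    - apply Rmult_le_reg_r with (INR N + 1); [lra|]. rewrite Rmult_assoc, Rinv_l; lra.
    - apply Rmult_le_reg_l with (/ w); [pos|]. rewrite <- Rmult_assoc, Rinv_l; lra. }
  destruct X as [a [b [Ha [Hb [Ha2 [Hb2 [X1 X2]]]]]]]. destruct (euler_spec s w Hs Hw) as [_ [Q1 _]]. destruct (euler_spec s 1 Hs ltac:(simpl; lra)) as [_ [Q2 _]].
  specialize (Q1 (Re s) m w a b ltac:(lra) ltac:(lra) ltac:(simpl; lra) Ha Hb).
  specialize (Q2 (Re s) m 1 (w * a) (w * b) ltac:(lra) ltac:(lra) ltac:(simpl; lra) ltac:(nra) Hb2). rewrite (euler_fn_scaling s w a b Hw) in Q1 by lra.
  set (I := CInt (euler_fn s 1) (w * a) (w * b)) in *.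
  replace (euler s w - cpow w (- s) * euler s 1)%C with ((euler s w - cpow w (- s) * I) - cpow w (- s) * (euler s 1 - I))%C by ring.
  ctrim. rewrite Cmod_mult. fold K. pose proof (Rmin_l (eps / 2) (eps / (2 * K))). pose proof (Rmin_r (eps / 2) (eps / (2 * K))). fold eps' in H, H0.
  assert (K * Cmod (euler s 1 - I) <= K * (eps / (2 * K))) by (apply Rmult_le_compat_l; lra).
  replace (K * (eps / (2 * K))) with (eps / 2) in H1 by (field; lra). lra.
Qed.

(** For real [w] this is a substitution. The positive reals accumulate at 1, so the dichotomy for
    the difference of both sides leaves only identical vanishing near 1, and the identity theorem in
    [w] does the rest. *)
Lemma euler_gamma s w : 0 < Re s -> 0 < Re w -> euler s w = (cpow w (- s) * euler s 1)%C.
Proof.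
  intros Hs Hw. assert (H1 : forall v, 0 < Re v -> hol (euler s) v) by (intros; now apply euler_hol_w).
  assert (H2 : forall v, 0 < Re v -> hol (fun w => cpow w (- s) * euler s 1)%C v).
  { intros v Hv. apply hol_mult; [|apply hol_const]. apply hol_cpow_base; [now left|cx]. }
  apply (hol_identity (fun v => 0 < Re v) (euler s) (fun w => cpow w (- s) * euler s 1)%C 1 w (convex_halfplane 0)); auto; [simpl; lra|].
  destruct (qmero_dichotomy (fun w => euler s w - cpow w (- s) * euler s 1)%C 1) as [Hz|Hz].
  - apply qmero_hol. apply hol_minus; [apply H1|apply H2]; simpl; lra.
  - revert Hz. apply filter_imp. intros v Hv. now apply Ceq_minus.
  - exfalso. apply locally'_Cmod in Hz. destruct Hz as [d [Hd Hz]]. apply (Hz (RtoC (1 + d / 2))).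
    + replace (RtoC (1 + d / 2) - 1)%C with (RtoC (d / 2)) by (rewrite RtoC_plus; ring). rewrite Cmod_R, Rabs_pos_eq; lra.
    + intros E. apply RtoC_inj in E. lra.
    + apply (proj1 (Ceq_minus _ _)). apply euler_real; auto; lra.
Qed.

Definition gamma_bd (s : C) (t : R) : C := (cpow (RtoC t) s * Cexp (- RtoC t))%C.

Lemma gamma_bd_step s n : (s * improper_seq (euler_fn s 1) n - improper_seq (euler_fn (s + 1) 1) n)%C =
  (gamma_bd s (INR n + 1) - gamma_bd s (/ (INR n + 1)))%C.
Proof.
  assert (Hder : forall t, 0 < t -> rder (gamma_bd s) t (s * euler_fn s 1 t - euler_fn (s + 1) 1 t)%C).
  { intros t Ht. unfold gamma_bd. eapply rder_eq; [|apply rder_mult; [apply (rder_comp (fun z => cpow z s) RtoC); [apply cder_cpow_base; now left|apply rder_RtoC]|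
      eapply rder_ext; [|apply (rder_comp Cexp (fun u => - (1) * RtoC u)%C); [apply cder_Cexp|apply rder_scal, rder_RtoC]]]].
    - unfold euler_fn. replace (s + 1 - 1)%C with s by ring. replace (- (1) * t)%C with (- (1 * t))%C by ring. replace (- RtoC t)%C with (- (1 * RtoC t))%C by ring. ring.
    - intros u. cbv beta. f_equal. ring. }
  unfold improper_seq. pose proof (inv_INR_bounds n). pose proof (pos_INR n).
  assert (C1 : forall s, con (euler_fn s 1) (/ (INR n + 1)) (INR n + 1)) by (intros s' t Ht; apply euler_fn_rcont; lra).
  rewrite <- CInt_scal by (auto; lra). rewrite <- CInt_minus; [|lra|cx|auto]. apply (CInt_FTC (gamma_bd s)); [lra|intros; apply Hder; lra|cx].
Qed.

Lemma gamma_bd_inf s : tends eventually (fun n => gamma_bd s (INR n + 1)) 0.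
Proof.
  destruct (nat_above (Re s)) as [m Hm]. apply (tends_0_bound _ _ (fun n => tail_inf m 1 (INR n + 1))).
  - apply filter_forall. intros n. rewrite Cminus_0_r. unfold gamma_bd. pose proof (pos_INR n).
    rewrite Cmod_mult, Cmod_cpow_pos, Cmod_Cexp by lra. unfold tail_inf. simpl Re. apply Rle_trans with ((INR n + 1) ^ m * exp (- (INR n + 1))).
    + apply Rmult_le_compat_r; [pos|]. rewrite <- Rpower_pow by lra. apply Rle_Rpower; lra.
    + apply Rle_trans with ((2 * INR m / 1) ^ m * exp (1 * (INR n + 1) / 2) * exp (- (INR n + 1))).
      * apply Rmult_le_compat_r; [pos|]. apply Rpower_exp_bound; lra.
      * rewrite Rmult_assoc, <- exp_plus. replace (1 * (INR n + 1) / 2 + - (INR n + 1)) with (- (1 * (INR n + 1) / 2)) by field.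
        rewrite Rmult_assoc. apply Rmult_le_compat_l; [pos|]. pose proof (exp_pos (- (1 * (INR n + 1) / 2))). lra.
  - apply (filterlim_comp _ _ _ (fun n => INR n + 1) (tail_inf m 1) _ (Rbar_locally p_infty)); [apply INR1_infty|apply tail_inf_lim; lra].
Qed.

Lemma euler_shift s : 0 < Re s -> euler (s + 1) 1 = (s * euler s 1)%C.
Proof.
  intros Hs. assert (Hs1 : 0 < Re (s + 1)) by (simpl; unfold Re in *; lra).
  destruct (euler_spec s 1 Hs ltac:(simpl; lra)) as [T1 _]. destruct (euler_spec (s + 1) 1 Hs1 ltac:(simpl; lra)) as [T2 _]. symmetry. apply (proj2 (Ceq_minus _ _)).
  apply (tends_unique eventually (fun n => s * improper_seq (euler_fn s 1) n - improper_seq (euler_fn (s + 1) 1) n)%C); [cx|].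
  eapply tends_ext; [apply _|intros n; symmetry; apply gamma_bd_step|]. replace (RtoC 0) with (0 - 0)%C by ring. apply tends_minus; [apply _|apply gamma_bd_inf|].
  apply (tends_0_bound _ _ (fun n => Re s * tail0 (Re s) (/ (INR n + 1)))).
  - apply filter_forall. intros n. rewrite Cminus_0_r. unfold gamma_bd. pose proof (inv_INR_bounds n).
    rewrite Cmod_mult, Cmod_cpow_pos, Cmod_Cexp by lra. unfold tail0. rewrite <- Rmult_assoc, Rinv_r, Rmult_1_l by lra. rewrite <- (Rmult_1_r (Rpower _ _)) at 2.
    apply Rmult_le_compat_l; [pos|]. apply Rle_trans with (exp 0); [apply exp_le_mono; simpl; lra|rewrite exp_0; lra].
  - replace 0 with (Re s * 0) by ring. apply (filterlim_comp _ _ _ (fun n => tail0 (Re s) (/ (INR n + 1))) (fun y => Re s * y) _ (locally 0)).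
    + apply (filterlim_comp _ _ _ (fun n => / (INR n + 1)) (tail0 (Re s)) _ (at_right 0)); [apply inv_INR_at_right|now apply tail0_lim].
    + apply (continuous_scal_r (V := R_NormedModule) (Re s) (fun y => y)). apply continuous_id.
Qed.

(** Integration by parts in the degenerate case [s = 0]: the truncated integral of [exp (- t) / t]
    is multiplied by 0, and only boundary terms remain. *)
Lemma euler_1 : euler 1 1 = 1.
Proof.
  destruct (euler_spec 1 1 ltac:(simpl; lra) ltac:(simpl; lra)) as [T1 _]. apply (tends_unique eventually (improper_seq (euler_fn 1 1)) _ _ T1).
  apply (tends_ext eventually (fun n => Cexp (- RtoC (/ (INR n + 1))) - gamma_bd 0 (INR n + 1))%C).
  { intros n. pose proof (gamma_bd_step 0 n) as E. replace (0 + 1)%C with (RtoC 1) in E by ring.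
    replace (Cexp (- RtoC (/ (INR n + 1)))) with (gamma_bd 0 (/ (INR n + 1))) by (unfold gamma_bd; rewrite cpow_0; ring).
    replace (improper_seq (euler_fn 1 1) n) with (- (0 * improper_seq (euler_fn 0 1) n - improper_seq (euler_fn 1 1) n))%C by ring. rewrite E. ring. }
  replace (RtoC 1) with (Cexp (- RtoC 0) - 0)%C by (rewrite Copp_0, Cexp_0; ring). apply tends_minus; [apply _| |apply gamma_bd_inf].
  apply (tends_comp eventually Cexp); [apply ccont_Cexp|]. apply tends_opp; [apply _|].
  intros eps He. exact (inv_INR_at_right _ (filter_le_within _ _ (tends_RtoC 0 eps He))).
Qed.

(* [Gamma] on [- n < Re s], up to poles. *)
Definition gamma_shifted (n : nat) (s : C) : C := (euler (s + INR n) 1 / rf s n)%C.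

Lemma rf_nz s n : (forall k, (k < n)%nat -> (s + INR k)%C <> 0) -> rf s n <> 0.
Proof.
  induction n; intros H; simpl.
  - intros E. apply RtoC_inj in E. lra.
  - apply Cmult_neq_0; [cx|cx].
Qed.

Lemma gamma_shifted_S n s : - INR n < Re s -> (s + INR n)%C <> 0 -> gamma_shifted (S n) s = gamma_shifted n s.
Proof.
  intros Hs Hn. unfold gamma_shifted. rewrite S_INR, RtoC_plus. replace (s + (INR n + 1))%C with ((s + INR n) + 1)%C by ring.
  rewrite euler_shift by (simpl; unfold Re in *; lra). cbn [rf]. destruct (Ceq_dec (rf s n) 0) as [E|E].
  - rewrite E. rewrite Cmult_0_l. unfold Cdiv. rewrite Cinv_0. ring.
  - field. auto.
Qed.

Lemma gamma_shifted_add n k s : - INR n < Re s -> gamma_shifted (n + k) s = gamma_shifted n s.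
Proof.
  intros Hs. induction k; [now rewrite Nat.add_0_r|]. rewrite Nat.add_succ_r. assert (INR n <= INR (n + k)) by (apply le_INR; lia).
  rewrite gamma_shifted_S; [exact IHk|lra|]. intros E. apply (f_equal Re) in E. simpl in E. unfold Re in *. lra.
Qed.

Lemma hol_shift_euler n s : - INR n < Re s -> hol (fun s => euler (s + INR n) 1) s.
Proof.
  intros Hs. apply (hol_comp (fun s => euler s 1) (fun s => s + INR n)%C).
  - apply euler_hol_s; simpl; unfold Re in *; lra.
  - cx.
Qed.

Lemma gamma_exists : exists f, meromorphic f /\ forall s, 0 < Re s -> f s = euler s 1.
Proof.
  set (n := fun s : C => Z.to_nat (up (- Re s))). assert (Hn : forall s, - INR (n s) < Re s).
  { intros s. unfold n. destruct (archimed (- Re s)) as [H1 _]. assert (IZR (up (- Re s)) <= INR (Z.to_nat (up (- Re s)))); [|lra].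
    rewrite INR_IZR_INZ. apply IZR_le. lia. }
  assert (Same : forall N s, - INR N < Re s -> gamma_shifted (n s) s = gamma_shifted N s).
  { intros N s H. destruct (Nat.le_ge_cases (n s) N) as [L|L].
    - replace N with (n s + (N - n s))%nat by lia. symmetry. apply gamma_shifted_add, Hn.
    - replace (n s) with (N + (n s - N))%nat by lia. now apply gamma_shifted_add. }
  exists (fun s => gamma_shifted (n s) s). split.
  - intros s0. destruct (classic (exists k : nat, (s0 + INR k)%C = 0)) as [[k Hk]|Hk].
    (* At [s0 = - k] the factor [s + k] is the only one of [rf s (S k)] that vanishes, and the
       numerator there is [euler 1 1 = 1], so the pole is simple and genuine. *)
    + right. exists 1%nat, (fun s => euler (s + INR (S k)) 1 / rf s k)%C.
      assert (Hs0 : s0 = (- INR k)%C). { replace s0 with ((s0 + INR k) - INR k)%C by ring. rewrite Hk. ring. }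
      assert (Hre : - INR (S k) < Re s0). { rewrite Hs0, S_INR. simpl. lra. }
      assert (Hrf : rf s0 k <> 0).
      { apply rf_nz. intros j Hj E. rewrite Hs0 in E. apply lt_INR in Hj. apply (f_equal Re) in E. simpl in E. lra. }
      split; [lia|]. split; [|split].
      * apply hol_holomorphic_at. apply hol_div; [now apply hol_shift_euler|apply (hol_rf (fun s => s)), hol_id|exact Hrf].
      * unfold Cdiv. apply Cmult_neq_0.
        -- rewrite Hs0, S_INR. replace (- INR k + RtoC (INR k + 1))%C with (RtoC 1) by (rewrite RtoC_plus; ring).
           rewrite euler_1. intros E. apply RtoC_inj in E. lra.
        -- intros E. assert (E2 : (rf s0 k * / rf s0 k)%C = 1) by now apply Cinv_r. rewrite E, Cmult_0_r in E2. apply RtoC_inj in E2. lra.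
      * generalize (filter_and _ _ (locally'_ne s0) (filter_and _ _ (locally_locally' _ _ (halfplane_locally _ _ Hre))
           (locally_locally' _ _ (ccont_ne (fun s => rf s k) s0 0 (hol_ccont _ _ (hol_rf (fun s => s) k s0 (hol_id s0))) Hrf)))).
        apply filter_imp. intros w [Hw [Hw2 Hw3]]. rewrite (Same (S k) w Hw2). unfold gamma_shifted. cbn [rf Cpow].
        rewrite Cmult_1_r. assert (Hws : (w - s0)%C <> 0) by now apply Cminus_nz.
        rewrite Hs0 in *. replace (w - - INR k)%C with (w + INR k)%C in * by ring. field. auto.
    + left. apply hol_holomorphic_at. apply hol_ext_loc with (gamma_shifted (n s0)).
      * generalize (halfplane_locally _ _ (Hn s0)). apply filter_imp. intros w Hw. symmetry. now apply Same.
      * unfold gamma_shifted. apply hol_div; [apply hol_shift_euler, Hn|apply (hol_rf (fun s => s)), hol_id|]. apply rf_nz. intros j _ E. apply Hk. now exists j.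
  - intros s Hs. rewrite (Same O s ltac:(simpl; lra)). unfold gamma_shifted. simpl. rewrite Cplus_0_r. field.
Qed.

Lemma gamma_integrand s t : euler_fn s 1 t = (RtoC (exp (- t)) * cpow (RtoC t) (s - 1))%C.
Proof. unfold euler_fn. rewrite Cmult_1_l, <- RtoC_opp, Cexp_R. ring. Qed.

Lemma Gamma_spec : meromorphic Gamma /\ forall s, 0 < Re s -> Gamma s = euler s 1.
Proof.
  assert (H : meromorphic Gamma /\ forall s : C, (0 < Re s)%R ->
      is_RInt_gen (V := C_R_NormedModule)
        (fun t : R => RtoC (exp (- t)) * cpow (RtoC t) (s - 1))%C
        (at_right 0) (Rbar_locally p_infty) (Gamma s)).
  { unfold Gamma. apply epsilon_spec. destruct gamma_exists as [f [Hf1 Hf2]]. exists f. split; [exact Hf1|].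
    intros s Hs. rewrite Hf2 by exact Hs. destruct (euler_spec s 1 Hs ltac:(simpl; lra)) as [_ [_ H]].
    replace (fun t : R => RtoC (exp (- t)) * cpow (RtoC t) (s - 1))%C with (euler_fn s 1); [exact H|]. extensionality t. apply gamma_integrand. }
  destruct H as [H1 H2]. split; [exact H1|]. intros s Hs. pose proof (H2 s Hs) as G1. destruct (euler_spec s 1 Hs ltac:(simpl; lra)) as [_ [_ G2]].
  replace (fun t : R => RtoC (exp (- t)) * cpow (RtoC t) (s - 1))%C with (euler_fn s 1) in G1.
  - apply (is_RInt_gen_unique (V := C_R_CompleteNormedModule)) in G1. apply (is_RInt_gen_unique (V := C_R_CompleteNormedModule)) in G2. rewrite <- G1. exact G2.
  - extensionality t. apply gamma_integrand.
Qed.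

Lemma Gamma_qmero s : qmero Gamma s.
Proof. apply qmero_meromorphic, Gamma_spec. Qed.

Lemma qmero_shift f (v s : C) : qmero f (s + v) -> qmero (fun w => f (w + v))%C s.
Proof.
  intros H. eapply qmero_ext; [|apply (qmero_affine f 1 v s); [intros E; apply RtoC_inj in E; lra|now rewrite Cmult_1_l]].
  apply filter_forall. intros w. cbv beta. now rewrite Cmult_1_l.
Qed.

Lemma Gamma_shift (s : C) : cnear' s (fun w => Gamma (w + 1) = (w * Gamma w)%C).
Proof.
  apply (qmero_identity_eq (fun _ => True) (fun w => Gamma (w + 1)) (fun w => w * Gamma w)%C 1 s convex_all); auto.
  - intros w _. apply qmero_shift, Gamma_qmero.
  - intros w _. apply qmero_mult; [apply qmero_hol, hol_id|apply Gamma_qmero].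
  - apply locally_locally'. generalize (halfplane_locally 0 1 ltac:(simpl; lra)). apply filter_imp. intros w Hw.
    destruct Gamma_spec as [_ G]. rewrite !G; [now apply euler_shift|exact Hw|simpl; unfold Re in *; lra].
Qed.

(** Vanishing around one point would spread by the identity theorem to 1, against [euler_1].
    Nonvanishing off isolated points suffices to divide by [Gamma] in identities that are continued
    afterwards. *)
Lemma Gamma_nz (s : C) : cnear' s (fun w => Gamma w <> 0).
Proof.
  destruct (qmero_dichotomy Gamma s (Gamma_qmero s)) as [H|H]; [exfalso|exact H]. assert (H1 : cnear' (RtoC 1) (fun w => Gamma w = 0)).
  { apply (qmero_identity (fun _ => True) Gamma s 1 convex_all); auto. intros w _. apply Gamma_qmero. }
  assert (E : euler 1 1 = 0).
  { apply (hol_identity (fun s => 0 < Re s) (fun s => euler s 1) (fun _ => 0) 1 1 (convex_halfplane 0)); try (simpl; lra).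
    - intros w Hw. apply euler_hol_s; auto. simpl. lra.
    - cx.
    - generalize (filter_and _ _ H1 (locally_locally' _ _ (halfplane_locally 0 1 ltac:(simpl; lra)))). apply filter_imp.
      intros w [W1 W2]. rewrite <- W1. symmetry. now apply Gamma_spec. }
  rewrite euler_1 in E. apply RtoC_inj in E. lra.
Qed.

Lemma locally'_shift (P : C -> Prop) (v s : C) : cnear' (s + v)%C P ->
  cnear' s (fun w => P (w + v)%C).
Proof.
  intros H. apply locally'_Cmod in H. destruct H as [d [Hd H]]. apply locally'_Cmod. exists d. split; [exact Hd|]. intros w Hw Hne. apply H.
  - now replace (w + v - (s + v))%C with (w - s)%C by ring.
  - intros E. apply Hne. replace w with (w + v - v)%C by ring. rewrite E. ring.
Qed.

Lemma poch_nat (s : C) n : cnear' s (fun w => poch w (Z.of_nat n) = rf w n).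
Proof.
  assert (H : cnear' s (fun w => Gamma (w + INR n) = (rf w n * Gamma w)%C)).
  { induction n.
    - apply filter_forall. intros w. simpl. rewrite Cplus_0_r. ring.
    - generalize (filter_and _ _ IHn (locally'_shift _ (INR n) s (Gamma_shift (s + INR n)))). apply filter_imp. intros w [W1 W2].
      rewrite S_INR, RtoC_plus. replace (w + (INR n + 1))%C with (w + INR n + 1)%C by ring. rewrite W2, W1. cbn [rf]. ring. }
  generalize (filter_and _ _ H (Gamma_nz s)). apply filter_imp. intros w [W1 W2]. unfold poch. rewrite <- INR_IZR_INZ, W1. field. exact W2.
Qed.

Lemma poch_m1 (s : C) : cnear' s (fun w => poch w (-1) = (/ (w - 1))%C).
Proof.
  generalize (filter_and _ _ (locally'_shift _ (- (1))%C s (Gamma_shift (s + - (1)))) (Gamma_nz s)).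
  apply filter_imp. intros w [W1 W2]. unfold poch. replace (RtoC (IZR (-1))) with (- (1))%C by (rewrite <- RtoC_opp; reflexivity).
  assert (Ew : forall v : C, (v + - (1) + 1)%C = v) by (intros; ring). rewrite Ew in W1. rewrite W1 in *.
  assert ((w + - (1))%C <> 0) by (intros E; apply W2; rewrite E; ring). assert (Gamma (w + - (1)) <> 0) by (intros E; apply W2; rewrite E; ring).
  change (w - 1)%C with (w + - (1))%C. generalize dependent (w + - (1))%C. intros v _ H1 H2 H3. field. auto.
Qed.

(** * Integration of series *)

Lemma con_lsum {A} (f : A -> R -> C) L a b : (forall k, con (f k) a b) -> con (fun t => lsum (fun k => f k t) L) a b.
Proof. intros H. induction L; simpl; [cx|]. cx. Qed.

Lemma CInt_lsum {A} (f : A -> R -> C) L a b : a <= b -> (forall k, con (f k) a b) ->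
  CInt (fun t => lsum (fun k => f k t) L) a b = lsum (fun k => CInt (f k) a b) L.
Proof.
  intros Hab H. induction L; simpl.
  - rewrite CInt_const. ring.
  - rewrite <- IHL. apply CInt_plus; auto. now apply con_lsum.
Qed.

(** The majorant is asked for on a slightly larger interval because [rcont] is two-sided continuity,
    at the end points too. *)
Lemma con_Sum {A} (f : A -> R -> C) (g : A -> R) a b d : 0 < d -> (forall k, con (f k) a b) ->
  (forall k t, a - d <= t <= b + d -> Cmod (f k t) <= g k) -> rsummable g -> con (fun t => Sum (fun k => f k t)) a b.
Proof.
  intros Hd Hf Hb Hs t Ht. apply (tends_Sum (locally t) f (fun k => f k t) g); auto.
  - intros k. now apply Hf.
  - apply locally_R. exists d. split; [exact Hd|]. intros y Hy k. apply Hb. apply Rabs_def2 in Hy. lra.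
  - intros k. apply Hb. lra.
Qed.

Lemma CInt_Sum {A} (f : A -> R -> C) (g : A -> R) a b d : 0 < d -> a <= b -> (forall k, con (f k) a b) ->
  (forall k t, a - d <= t <= b + d -> Cmod (f k t) <= g k) -> rsummable g ->
  CInt (fun t => Sum (fun k => f k t)) a b = Sum (fun k => CInt (f k) a b).
Proof.
  intros Hd Hab Hf Hb Hs. pose proof (con_Sum f g a b d Hd Hf Hb Hs) as Hc.
  assert (Hg0 : forall k, 0 <= g k) by (intros k; eapply Rle_trans; [pos|apply (Hb k a); lra]). symmetry. apply Sum_unique. intros eps.
  assert (He : 0 < eps / (b - a + 1) / 2).
  { pose proof (cond_pos eps). pos. }
  destruct (rsummable_tail g _ Hg0 Hs He) as [L0 [H0 H1]]. exists L0. intros L HL Hi.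
  change (Cmod (lsum (fun k => CInt (f k) a b) L - CInt (fun t => Sum (fun k => f k t)) a b) < eps).
  rewrite <- CInt_lsum by auto. rewrite <- CInt_minus; [|exact Hab|now apply con_lsum|exact Hc].
  eapply Rle_lt_trans; [apply CInt_bound with (M := eps / (b - a + 1) / 2); [exact Hab| |]|].
  - apply con_minus; [now apply con_lsum|exact Hc].
  - intros t Ht. rewrite Cmod_minus_sym. assert (Hbt : forall k, Cmod (f k t) <= g k) by (intros; apply Hb; lra).
    apply (has_sum_tail_bound (fun k => f k t) g); auto.
    + apply Sum_correct. now apply summable_le with g.
    + intros L' HL'. apply H1. destruct (incl_split L0 L H0 HL Hi) as [L'' HP]. assert (HN : NoDup ((L0 ++ L'') ++ L')).
      { eapply Permutation.Permutation_NoDup; [|exact HL']. now apply Permutation.Permutation_app_tail. }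
      apply NoDup_app; auto.
      * apply NoDup_app_remove_l in HN. exact HN.
      * intros x Hx Hx2. rewrite <- app_assoc in HN. clear - HN Hx Hx2. induction L0; [cx|]. simpl in HN. inversion HN; subst. destruct Hx as [<-|Hx]; [|cx].
        apply H1. rewrite !in_app_iff. auto.
  - pose proof (cond_pos eps). assert (E : (b - a + 1) * (eps / (b - a + 1) / 2) = eps / 2) by (field; lra). lra.
Qed.

Lemma has_sum_nat_lim (f : nat -> C) l : has_sum f l -> tends eventually (fun N => lsum f (seq 0 N)) l.
Proof.
  intros H eps He. destruct (H (mkposreal _ He)) as [L0 H0]. exists (S (list_max L0)). intros N HN. apply (H0 (seq 0 N) (seq_NoDup _ _)). intros x Hx. apply in_seq.
  assert (Hall := proj1 (list_max_le L0 (list_max L0)) (Nat.le_refl _)). rewrite Forall_forall in Hall. specialize (Hall x Hx). lia.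
Qed.

(** * The Lipschitz formula *)

Lemma rcont_e_mul k t : rcont (fun t => e (k * t)%R) t.
Proof. eapply rder_rcont, rder_e. Qed.

Lemma con_e_mul k a b : con (fun t => e (k * t)%R) a b.
Proof. intros t _. apply rcont_e_mul. Qed.

#[local] Hint Resolve con_e_mul : cx.

Lemma CInt_bound_real (g : R -> C) (u : R -> R) a b : a <= b -> con g a b -> (forall t, a <= t <= b -> continuous u t) ->
  (forall t, a <= t <= b -> Cmod (g t) <= u t) -> Cmod (CInt g a b) <= RInt u a b.
Proof.
  intros Hab Hg Hu Hb. rewrite <- norm_C_R. apply (norm_RInt_le (V := C_R_NormedModule) g u a b (CInt g a b) (RInt u a b) Hab).
  - intros t Ht. rewrite norm_C_R. now apply Hb.
  - now apply CInt_is.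
  - apply (RInt_correct (V := R_CompleteNormedModule)). apply (ex_RInt_continuous (V := R_CompleteNormedModule)). rewrite Rmin_left, Rmax_right by exact Hab. auto.
Qed.

(* Test against [cos^(2 N) (pi (t - v))], a trigonometric polynomial concentrating at [v]. *)
Lemma fourier_unique (g : R -> C) : con g 0 1 -> (forall n : Z, CInt (fun t => g t * e (IZR n * t)%R)%C 0 1 = 0) ->
  forall v, 0 < v < 1 -> g v = 0.
Proof.
  intros Hg Hn v Hv. set (c := fun t => (1 + cos (2 * PI * (t - v))) / 2).
  assert (Hc01 : forall t, 0 <= c t <= 1) by (intros t; unfold c; pose proof (COS_bound (2 * PI * (t - v))); lra). assert (Hcc : forall t, continuous c t).
  { intros t. unfold c. apply (ex_derive_continuous (V := R_NormedModule)). auto_derive. exact I. }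
  assert (HcE : forall t, RtoC (c t) = (/ 2 + / 4 * e (- v)%R * e (1 * t)%R + / 4 * e (RtoC v) * e (-1 * t)%R)%C).
  { intros t. rewrite <- !Cmult_assoc, <- !e_plus, <- !RtoC_plus. rewrite !e_R. unfold c. replace (2 * PI * (- v + 1 * t)) with (2 * PI * (t - v)) by ring.
    replace (2 * PI * (v + -1 * t)) with (- (2 * PI * (t - v))) by ring. rewrite cos_neg, sin_neg. apply injective_projections; simpl; field. }
  assert (Hcc2 : forall N, con (fun t => RtoC (c t) ^ N)%C 0 1).
  { intros N t _. apply tends_pow; [apply _|]. intros eps He. pose proof (Hcc t (fun y => Rabs (y - c t) < eps)) as H.
    assert (HL : locally (c t) (fun y => Rabs (y - c t) < eps)) by (apply locally_R; exists eps; auto).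
    specialize (H HL). unfold filtermap in H. revert H. apply filter_imp. intros y Hy. now rewrite <- RtoC_minus, Cmod_R. }
  (* Multiplication by [c t] replaces the frequency [n] by a combination of [n - 1], [n] and
     [n + 1], so [g] stays orthogonal to all powers of [c]. *)
  assert (Hvan : forall N (n : Z), CInt (fun t => g t * RtoC (c t) ^ N * e (IZR n * t)%R)%C 0 1 = 0).
  { induction N; intros n.
    - rewrite <- (Hn n). f_equal. extensionality t. simpl. ring.
    - assert (C1 : forall n, con (fun t => g t * RtoC (c t) ^ N * e (IZR n * t)%R)%C 0 1).
      { cx. }
      transitivity (CInt (fun t => / 2 * (g t * RtoC (c t) ^ N * e (IZR n * t)%R) +
        (/ 4 * e (- v)%R * (g t * RtoC (c t) ^ N * e (IZR (n + 1) * t)%R) +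
         / 4 * e (RtoC v) * (g t * RtoC (c t) ^ N * e (IZR (n - 1) * t)%R)))%C 0 1).
      { f_equal. extensionality t. rewrite Cpow_S, HcE. assert (Ea : e (IZR (n + 1) * t)%R = (e (IZR n * t)%R * e (1 * t)%R)%C).
        { rewrite <- e_plus, <- RtoC_plus, plus_IZR. f_equal. f_equal. ring. }
        assert (Eb : e (IZR (n - 1) * t)%R = (e (IZR n * t)%R * e (-1 * t)%R)%C).
        { rewrite <- e_plus, <- RtoC_plus, minus_IZR. f_equal. f_equal. ring. }
        rewrite Ea, Eb. ring. }
      rewrite CInt_plus; [|lra|cx|cx]. rewrite CInt_plus; [|lra|cx|cx]. rewrite !CInt_scal by (auto; lra). rewrite !IHN. ring. }
  destruct (con_bounded g 0 1 Rle_0_1 Hg) as [G [HG HGb]]. apply Cmod_zero_eq. apply le_epsilon. intros eta0 Heta. rewrite Rplus_0_l. set (eta := eta0 / 2).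
  assert (He : 0 < eta) by pos. pose proof (Hg v ltac:(lra) eta He) as Hcont. apply locally_R in Hcont. destruct Hcont as [d0 [Hd0 Hcont]].
  set (d := Rmin (d0 / 2) (Rmin v (1 - v) / 2)). assert (Hd : 0 < d) by pos.
  assert (Hdd0 : d < d0) by (unfold d; pose proof (Rmin_l (d0 / 2) (Rmin v (1 - v) / 2)); lra). assert (Hdv : d <= v / 2 /\ d <= (1 - v) / 2).
  { unfold d. pose proof (Rmin_r (d0 / 2) (Rmin v (1 - v) / 2)). pose proof (Rmin_l v (1 - v)). pose proof (Rmin_r v (1 - v)). lra. }
  (* [c1] bounds [c] at distance more than [d] from [v], and [c2 > c1] bounds it below at distance
     up to [d / 2]. The mass [J N] is at least [d c2^N], which beats the contribution [c1^N] of the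
     far points. *)
  pose proof PI_RGT_0 as Hpi. set (c1 := (1 + cos (2 * PI * d)) / 2). set (c2 := (1 + cos (2 * PI * (d / 2))) / 2). assert (Hc12 : c1 < c2).
  { unfold c1, c2. assert (cos (2 * PI * d) < cos (2 * PI * (d / 2))); [|lra]. apply cos_decreasing_1; nra. }
  assert (Hc1 : 0 <= c1) by (unfold c1; pose proof (COS_bound (2 * PI * d)); lra). assert (Hcos_even : forall u, cos (2 * PI * u) = cos (2 * PI * Rabs u)).
  { intros u. unfold Rabs. destruct (Rcase_abs u); [rewrite <- cos_neg; f_equal; ring|cx]. }
  assert (Hfar : forall t, 0 <= t <= 1 -> d < Rabs (t - v) -> c t <= c1).
  { intros t Ht Hdt. unfold c, c1. rewrite Hcos_even. assert (Hu : Rabs (t - v) <= 1 - d) by (apply Rabs_le; lra). set (u := Rabs (t - v)) in *.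
    assert (cos (2 * PI * u) <= cos (2 * PI * d)); [|lra]. destruct (Rle_dec u (1 / 2)).
    - apply cos_decr_1; nra.
    - replace (cos (2 * PI * u)) with (cos (2 * PI * (1 - u))).
      + apply cos_decr_1; nra.
      + replace (2 * PI * (1 - u)) with (- (2 * PI * u) + 2 * INR 1 * PI) by (simpl; ring). rewrite cos_period, cos_neg. reflexivity. }
  assert (Hnear : forall t, Rabs (t - v) <= d / 2 -> c2 <= c t).
  { intros t Hdt. unfold c, c2. rewrite (Hcos_even (t - v)). pose proof (Rabs_pos (t - v)).
    assert (cos (2 * PI * (d / 2)) <= cos (2 * PI * Rabs (t - v))); [|lra]. apply cos_decr_1; nra. }
  assert (HcN : forall N t, continuous (fun t => c t ^ N) t).
  { intros N t. induction N; simpl; [apply continuous_const|]. apply (continuous_mult (K := R_AbsRing)); [apply Hcc|exact IHN]. }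
  assert (HexN : forall N a b, ex_RInt (fun t => c t ^ N) a b).
  { intros N a b. apply (ex_RInt_continuous (V := R_CompleteNormedModule)). cx. }
  set (J := fun N : nat => (RInt (fun t => c t ^ N) 0 1) : R). assert (Main : forall N, Cmod (g v) * J N <= eta * J N + 2 * G * c1 ^ N).
  { intros N. assert (E1 : CInt (fun t => (g v - g t) * RtoC (c t) ^ N)%C 0 1 = (g v * RtoC (J N))%C).
    { assert (E0 : CInt (fun t => g t * RtoC (c t) ^ N)%C 0 1 = 0).
      { rewrite <- (Hvan N 0%Z). f_equal. extensionality t. rewrite Rmult_0_l, e_0. ring. }
      transitivity (CInt (fun t => g v * RtoC (c t) ^ N - g t * RtoC (c t) ^ N)%C 0 1).
      { f_equal. extensionality t. ring. }
      rewrite CInt_minus, E0, CInt_scal; auto; try lra.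
      - replace (CInt (fun t => RtoC (c t) ^ N)%C 0 1) with (RtoC (J N)); [ring|].
        symmetry. apply CInt_eq. apply (is_RInt_ext (V := C_R_NormedModule) (fun t => (c t ^ N, 0) : C)).
        + intros t _. rewrite <- RtoC_pow. reflexivity.
        + apply (is_RInt_fct_extend_pair (U := R_NormedModule) (V := R_NormedModule)).
          * apply (RInt_correct (V := R_CompleteNormedModule)), HexN.
          * pose proof (is_RInt_const (V := R_NormedModule) 0 1 0) as K0.
            match type of K0 with is_RInt _ _ _ ?l => assert (E9 : l = 0) by (unfold scal; simpl; unfold mult; simpl; ring); rewrite E9 in K0 end. exact K0.
      - cx.
      - cx. }
    assert (E2 : Cmod (g v) * J N = Cmod (CInt (fun t => (g v - g t) * RtoC (c t) ^ N)%C 0 1)).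
    { rewrite E1, Cmod_mult, Cmod_R. f_equal. symmetry. apply Rabs_pos_eq. unfold J. apply RInt_ge_0; [lra|apply HexN|]. intros t _. apply pow_le, Hc01. }
    rewrite E2. eapply Rle_trans; [apply (CInt_bound_real _ (fun t => eta * c t ^ N + 2 * G * c1 ^ N)); [lra| | |]|].
    - cx.
    - intros t _. apply (continuous_plus (V := R_NormedModule)); [|apply continuous_const].
      apply (continuous_scal_r (V := R_NormedModule) eta (fun t => c t ^ N)), HcN.
    - intros t Ht. rewrite Cmod_mult, <- RtoC_pow, Cmod_R, Rabs_pos_eq by (apply pow_le, Hc01).
      pose proof (pow_le (c t) N (proj1 (Hc01 t))). pose proof (pow_le c1 N Hc1). destruct (Rle_dec (Rabs (t - v)) d) as [Hdt|Hdt].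
      + specialize (Hcont t ltac:(lra)). rewrite Cmod_minus_sym in Hcont. nra.
      + assert (c t ^ N <= c1 ^ N) by (apply pow_incr; split; [apply Hc01|apply Hfar; lra]). assert (Cmod (g v - g t) <= 2 * G).
        { ctrim. pose proof (HGb v ltac:(lra)). pose proof (HGb t Ht). lra. }
        nra.
    - unfold J. rewrite (RInt_plus (V := R_CompleteNormedModule) (fun t => eta * c t ^ N) (fun _ => 2 * G * c1 ^ N)).
      + pose proof (RInt_scal (V := R_CompleteNormedModule) (fun t => c t ^ N) 0 1 eta (HexN N 0 1)) as ES.
        change (RInt (fun t => eta * c t ^ N) 0 1 = eta * RInt (fun t => c t ^ N) 0 1) in ES. rewrite ES.
        rewrite RInt_const. unfold plus, scal; simpl; unfold mult; simpl. lra.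
      + apply (ex_RInt_scal (V := R_NormedModule) (fun t => c t ^ N)). apply HexN.
      + apply ex_RInt_const. }
  assert (Low : forall N, d * c2 ^ N <= J N).
  { intros N. unfold J. rewrite <- (RInt_Chasles (V := R_CompleteNormedModule) (fun t => c t ^ N) 0 (v - d / 2) 1) by apply HexN.
    rewrite <- (RInt_Chasles (V := R_CompleteNormedModule) (fun t => c t ^ N) (v - d / 2) (v + d / 2) 1) by apply HexN.
    assert (P1 : 0 <= RInt (fun t => c t ^ N) 0 (v - d / 2)) by (apply RInt_ge_0; [lra|apply HexN|intros; apply pow_le, Hc01]).
    assert (P2 : 0 <= RInt (fun t => c t ^ N) (v + d / 2) 1) by (apply RInt_ge_0; [lra|apply HexN|intros; apply pow_le, Hc01]).
    assert (P3 : RInt (fun _ => c2 ^ N) (v - d / 2) (v + d / 2) <= RInt (fun t => c t ^ N) (v - d / 2) (v + d / 2)).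
    { apply RInt_le; [lra|apply ex_RInt_const|apply HexN|]. intros t Ht. apply pow_incr. split; [lra|]. apply Hnear. apply Rabs_le. lra. }
    rewrite RInt_const in P3. unfold scal in P3; simpl in P3; unfold mult in P3; simpl in P3. unfold plus; simpl. lra. }
  assert (Hc2p : 0 < c2) by lra. destruct (pow_lt_1_zero (c1 / c2)) with (y := eta * d / (2 * G)) as [N HN].
  { rewrite Rabs_pos_eq; [|pos]. apply Rmult_lt_reg_r with c2; [lra|]. unfold Rdiv. rewrite Rmult_assoc, Rinv_l; lra. }
  { pos. }
  specialize (HN N (Nat.le_refl N)). specialize (Main N). specialize (Low N). assert (Hc2N : 0 < c2 ^ N) by now apply pow_lt.
  assert (Hfin : 2 * G * c1 ^ N <= eta * (d * c2 ^ N)).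
  { pose proof (Rle_abs ((c1 / c2) ^ N)). assert (Hq : (c1 / c2) ^ N < eta * d / (2 * G)) by lra. unfold Rdiv in Hq at 1. rewrite Rpow_mult_distr, pow_inv in Hq.
    apply (Rmult_lt_compat_r (c2 ^ N * (2 * G))) in Hq; [|nra]. replace (c1 ^ N * / c2 ^ N * (c2 ^ N * (2 * G))) with (2 * G * c1 ^ N) in Hq by (field; lra).
    replace (eta * d / (2 * G) * (c2 ^ N * (2 * G))) with (eta * (d * c2 ^ N)) in Hq by (field; lra). lra. }
  set (I := J N) in *. assert (HI : 0 < I) by nra. assert (eta * (d * c2 ^ N) <= eta * I) by (apply Rmult_le_compat_l; lra).
  apply Rmult_le_reg_r with I; [exact HI|]. unfold eta in *. lra.
Qed.

Lemma CInt_shift (f : R -> C) a b v : a <= b -> con f (a + v) (b + v) -> CInt (fun t => f (t + v)) a b = CInt f (a + v) (b + v).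
Proof.
  intros Hab Hc. pose proof (CInt_is f (a + v) (b + v) ltac:(lra) Hc) as H.
  replace (a + v) with (1 * a + v) in H at 1 by ring. replace (b + v) with (1 * b + v) in H at 1 by ring.
  apply (is_RInt_comp_lin (V := C_R_NormedModule)) in H. apply CInt_eq in H. rewrite <- H. f_equal. extensionality t. rewrite Rmult_1_l.
  apply injective_projections; simpl; unfold scal; simpl; unfold mult; simpl; ring.
Qed.

Lemma has_sum_single {A} (f : A -> C) a : (forall b, b <> a -> f b = 0) -> has_sum f (f a).
Proof.
  intros H. apply (has_sum_image f (fun _ : unit => a)).
  - intros [] []. reflexivity.
  - intros b Hb. apply H. apply (Hb tt).
  - intros eps. exists (tt :: nil). intros L HL Hi. assert (E : L = tt :: nil).
    { destruct L as [|[] L]; [exfalso; apply (Hi tt); now left|]. inversion HL; subst. destruct L as [|[] L]; auto. exfalso. apply H2. now left. }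
    subst L. simpl. replace (f a + 0 - f a)%C with (RtoC 0) by ring. rewrite Cmod_0. apply cond_pos.
Qed.

Definition hfn (s w : C) (t : R) : C := if Rle_dec t 0 then 0 else euler_fn s (2 * PI * w) t.

Lemma hfn_pos s w t : 0 < t -> hfn s w t = euler_fn s (2 * PI * w) t.
Proof. intros H. unfold hfn. destruct (Rle_dec t 0); [lra|cx]. Qed.

Lemma Re_2PI w : Re (2 * PI * w) = 2 * PI * Re w.
Proof. simpl. unfold Re. ring. Qed.

Section Poisson.
Variables (s w : C).
Hypothesis Hs : 2 < Re s.
Hypothesis Hw : 0 < Re w.

Let x := 2 * PI * Re w.
Lemma x_pos : 0 < x.
Proof. unfold x. pose proof PI_RGT_0. nra. Qed.

Lemma Cmod_hfn t : 0 < t -> Cmod (hfn s w t) = Rpower t (Re s - 1) * exp (- (x * t)).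
Proof. intros Ht. rewrite hfn_pos by exact Ht. rewrite Cmod_euler_fn by exact Ht. now rewrite Re_2PI. Qed.

(** From [2 < Re s] one has [t^(Re s - 1) <= t] on [(0, 1]]; this makes the cut-off function
    continuous at 0. *)
Lemma hfn_small t : t <= 1 -> Cmod (hfn s w t) <= Rabs t.
Proof.
  intros Ht. destruct (Rle_dec t 0) as [H|H].
  - unfold hfn. destruct (Rle_dec t 0); [|lra]. rewrite Cmod_0. apply Rabs_pos.
  - rewrite Cmod_hfn, Rabs_pos_eq by lra. pose proof x_pos. apply Rle_trans with (Rpower t 1 * 1); [|rewrite Rpower_1; lra].
    apply Rmult_le_compat; try (left; apply exp_pos).
    + unfold Rpower. apply exp_le_mono. assert (ln t <= 0) by (rewrite <- ln_1; apply ln_le; lra). nra.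
    + apply Rle_trans with (exp 0); [apply exp_le_mono; nra|rewrite exp_0; lra].
Qed.

Lemma hfn_rcont t : rcont (hfn s w) t.
Proof.
  destruct (Rtotal_order t 0) as [H|[H|H]].
  - apply (tends_ext_F (locally t) (fun _ => RtoC 0)).
    + apply locally_R. exists (- t). split; [lra|]. intros y Hy. apply Rabs_def2 in Hy. unfold hfn. destruct (Rle_dec y 0); [auto|lra].
    + unfold hfn. destruct (Rle_dec t 0); [|lra]. cx.
  - subst t. assert (E0 : hfn s w 0 = 0) by (unfold hfn; destruct (Rle_dec 0 0); [auto|lra]).
    unfold rcont. rewrite E0. intros eps He. apply locally_R. exists (Rmin 1 eps). split; [pos|]. intros y Hy.
    pose proof (Rmin_l 1 eps). pose proof (Rmin_r 1 eps). rewrite Rminus_0_r in Hy. rewrite Cminus_0_r.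
    eapply Rle_lt_trans; [apply hfn_small|]; pose proof (Rle_abs y); lra.
  - apply (tends_ext_F (locally t) (euler_fn s (2 * PI * w))).
    + apply locally_R. exists t. split; [lra|]. intros y Hy. apply Rabs_def2 in Hy. symmetry. apply hfn_pos. lra.
    + rewrite hfn_pos by exact H. now apply euler_fn_rcont.
Qed.

Lemma hfn_decay : exists K, 0 <= K /\ forall t, 0 < t -> Cmod (hfn s w t) <= K * Rpower (1 + t) (- (2)).
Proof.
  destruct (nat_above (Re s - 1)) as [m Hm]. pose proof x_pos as Hx. set (C0 := (2 * INR (m + 2) / x) ^ (m + 2)). exists (C0 * exp (x / 2)). assert (HC0 : 0 <= C0).
  { pos. }
  split; [pos|]. intros t Ht. rewrite Cmod_hfn by exact Ht. apply Rle_trans with ((1 + t) ^ m * exp (- (x * t))).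
  { apply Rmult_le_compat_r; [pos|]. rewrite <- Rpower_pow by lra.
    apply Rle_trans with (Rpower (1 + t) (Re s - 1)); [apply Rle_Rpower_l; lra|apply Rle_Rpower; lra]. }
  pose proof (Rpower_exp_bound (m + 2) x (1 + t) Hx ltac:(lra)) as H. fold C0 in H. rewrite pow_add in H. assert (Hp2 : 0 < (1 + t) ^ 2) by nra.
  rewrite Rpower_Ropp. replace 2 with (INR 2) by reflexivity. rewrite Rpower_pow by lra.
  apply Rmult_le_reg_r with ((1 + t) ^ 2); [exact Hp2|]. rewrite (Rmult_assoc _ (/ _)), Rinv_l, Rmult_1_r by lra.
  replace ((1 + t) ^ m * exp (- (x * t)) * (1 + t) ^ 2) with ((1 + t) ^ m * (1 + t) ^ 2 * exp (- (x * t))) by ring.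
  apply Rle_trans with (C0 * exp (x * (1 + t) / 2) * exp (- (x * t))); [apply Rmult_le_compat_r; [pos|exact H]|].
  rewrite Rmult_assoc, <- exp_plus. apply Rmult_le_compat_l; [exact HC0|]. apply exp_le_mono. pose proof (Rmult_lt_0_compat _ _ Hx Ht) as Hxt. simpl; lra.
Qed.

(** The interval exceeds [[0, 1]] by 1/2 on both sides, the margin used in [con_Sum] and
    [CInt_Sum]. *)
Lemma hfn_unif : exists K, 0 <= K /\ forall (k : nat) t, - (1 / 2) <= t <= 3 / 2 ->
  Cmod (hfn s w (t + INR k)) <= K * Rpower (INR k + 1) (- (2)).
Proof.
  destruct hfn_decay as [K [HK H]]. exists (K * Rpower (1 / 2) (- (2))). split; [pos|].
  intros k t Ht. pose proof (pos_INR k) as Hk. destruct (Rle_dec (t + INR k) 0) as [L|L].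
  - unfold hfn. destruct (Rle_dec (t + INR k) 0); [|lra]. rewrite Cmod_0. pos.
  - eapply Rle_trans; [apply H; lra|]. rewrite Rmult_assoc. apply Rmult_le_compat_l; [exact HK|].
    rewrite Rpower_mult_distr by lra. apply Rpower_le_base; [|lra]. lra.
Qed.

(** Turns the Fourier coefficients of the periodisation into Euler integrals at the shifted points
    [w + Ci * n]. *)
Lemma hfn_twist n t : (hfn s w t * e (IZR (- n) * t)%R)%C = hfn s (w + Ci * IZR n) t.
Proof.
  unfold hfn. destruct (Rle_dec t 0); [ring|]. unfold euler_fn, e. rewrite <- Cmult_assoc, <- Cexp_plus. f_equal. f_equal.
  rewrite RtoC_mult, opp_IZR, RtoC_opp. ring.
Qed.
End Poisson.

Lemma euler_partial s w : 2 < Re s -> 0 < Re w ->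
  tends eventually (fun N => CInt (hfn s w) 0 (INR N)) (euler s (2 * PI * w)).
Proof.
  intros Hs Hw. pose proof (x_pos w Hw) as Hx. destruct (nat_above (Re s)) as [m Hm]. assert (Hre : Re (2 * PI * w) = 2 * PI * Re w) by apply Re_2PI.
  destruct (euler_spec s (2 * PI * w) ltac:(lra) ltac:(rewrite Hre; exact Hx)) as [_ [HB _]]. set (x := 2 * PI * Re w) in *.
  assert (Hcon : forall a b, con (hfn s w) a b) by (intros a b t _; now apply hfn_rcont).
  assert (Hbound : forall N, (1 <= N)%nat -> Cmod (euler s (2 * PI * w) - CInt (hfn s w) 0 (INR N)) <= tail_inf m x (INR N)).
  { intros N HN. apply le_INR in HN. simpl in HN. apply le_epsilon. intros eps He. assert (He2 : 0 < eps / 2) by lra.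
    pose proof (tail0_lim (Re s) ltac:(lra) (fun y => Rabs (y - 0) < eps / 2)) as HT. unfold filtermap, at_right, within in HT.
    assert (HL : locally 0 (fun y => Rabs (y - 0) < eps / 2)) by (apply locally_R; exists (eps / 2); auto).
    specialize (HT HL). apply locally_R in HT. destruct HT as [d [Hd HT]]. set (a := Rmin (d / 2) (Rmin 1 (eps / 2))). assert (Ha : 0 < a) by pos.
    assert (Ha1 : a <= d / 2 /\ a <= 1 /\ a <= eps / 2).
    { unfold a. pose proof (Rmin_l (d / 2) (Rmin 1 (eps / 2))). pose proof (Rmin_r (d / 2) (Rmin 1 (eps / 2))).
      pose proof (Rmin_l 1 (eps / 2)). pose proof (Rmin_r 1 (eps / 2)). lra. }
    specialize (HT a ltac:(rewrite Rminus_0_r, Rabs_pos_eq; lra) Ha). rewrite Rminus_0_r in HT. apply Rabs_def2 in HT.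
    specialize (HB (Re s) m x a (INR N) ltac:(lra) ltac:(lra) ltac:(rewrite Hre; lra) ltac:(lra) HN). rewrite <- (CInt_Chasles (hfn s w) 0 a (INR N)) by (auto; lra).
    assert (E : CInt (hfn s w) a (INR N) = CInt (euler_fn s (2 * PI * w)) a (INR N)).
    { apply CInt_ext; [lra|]. intros t Ht. apply hfn_pos. lra. }
    rewrite E. assert (HB0 : Cmod (CInt (hfn s w) 0 a) <= a).
    { eapply Rle_trans; [apply CInt_bound with (M := 1); [lra|auto|]|lra]. intros t Ht. eapply Rle_trans; [apply hfn_small; auto; lra|]. rewrite Rabs_pos_eq; lra. }
    replace (euler s (2 * PI * w) - (CInt (hfn s w) 0 a + CInt (euler_fn s (2 * PI * w)) a (INR N)))%C with
      ((euler s (2 * PI * w) - CInt (euler_fn s (2 * PI * w)) a (INR N)) - CInt (hfn s w) 0 a)%C by ring.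
    ctrim. lra. }
  apply (tends_0_bound _ _ (fun N => tail_inf m x (INR N))).
  - exists 1%nat. intros N HN. rewrite Cmod_minus_sym. cx.
  - apply (filterlim_comp _ _ _ INR (tail_inf m x) _ (Rbar_locally p_infty)); [|now apply tail_inf_lim]. apply is_lim_seq_INR.
Qed.

Lemma shift_lower (w : C) : 0 < Re w -> exists c, 0 < c /\ forall n : Z, c * (Rabs (IZR n) + 1) <= Cmod (w + Ci * IZR n).
Proof.
  intros Hw. set (K := Rmax ((1 + Rabs (Im w)) / Re w) 1). assert (HK : 1 <= K) by apply Rmax_r. assert (HK2 : 1 + Rabs (Im w) <= K * Re w).
  { apply Rle_trans with ((1 + Rabs (Im w)) / Re w * Re w); [right; field; lra|]. apply Rmult_le_compat_r; [lra|apply Rmax_l]. }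
  exists (/ (2 * K)). split; [pos|]. intros n. pose proof (Rabs_fst_le (w + Ci * IZR n)) as H1. pose proof (Rabs_snd_le (w + Ci * IZR n)) as H2.
  replace (fst (w + Ci * IZR n)%C) with (Re w) in H1 by (simpl; unfold Re; ring).
  replace (snd (w + Ci * IZR n)%C) with (IZR n + Im w) in H2 by (simpl; unfold Im; ring). rewrite (Rabs_pos_eq (Re w)) in H1 by lra.
  assert (H3 : Rabs (IZR n) <= Rabs (IZR n + Im w) + Rabs (Im w)).
  { replace (IZR n) with ((IZR n + Im w) - Im w) at 1 by ring. rtri. rewrite Rabs_Ropp. lra. }
  apply Rmult_le_reg_l with (2 * K); [lra|]. rewrite <- Rmult_assoc, Rinv_r, Rmult_1_l by lra. nra.
Qed.

Lemma orthogonality (k : Z) : CInt (fun t => e (IZR k * t)%R) 0 1 = if Z.eq_dec k 0 then 1 else 0.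
Proof.
  destruct (Z.eq_dec k 0) as [->|H].
  - rewrite (CInt_ext _ (fun _ => RtoC 1)); [rewrite CInt_const; rewrite Rminus_0_r; ring|lra|]. intros t _. now rewrite Rmult_0_l, e_0.
  - assert (Hk : RtoC (IZR k) <> 0) by (intros E; apply RtoC_inj in E; apply H; now apply eq_IZR).
    pose proof two_PI_Ci_nz as Hpi. set (K := (2 * PI * Ci * IZR k)%C). assert (HK : K <> 0) by now apply Cmult_neq_0.
    rewrite (CInt_ext _ (fun t => / K * (K * e (IZR k * t)%R))%C); [|lra|intros; field; exact HK]. rewrite CInt_scal; [|lra|cx].
    rewrite (CInt_FTC (fun t => e (IZR k * t)%R)); [|lra|intros; apply rder_e|cx]. rewrite Rmult_0_r, Rmult_1_r, e_0, e_Z. ring.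
Qed.

Section Lipschitz.
Variables (s w : C).
Hypothesis Hs : 2 < Re s.
Hypothesis Hw : 0 < Re w.
Let coef (n : Z) : C := euler s (2 * PI * (w + Ci * IZR n)).
Let Hper (v : R) : C := Sum (fun k : nat => hfn s w (v + INR k)).
Let Bser (v : R) : C := Sum (fun n : Z => coef n * e (IZR n * v)%R)%C.

Lemma Re_shift n : Re (w + Ci * IZR n) = Re w.
Proof. simpl. unfold Re. ring. Qed.

Lemma con_Hper : con Hper 0 1.
Proof.
  destruct (hfn_unif s w Hs Hw) as [K [HK H]].
  apply (con_Sum (fun (k : nat) v => hfn s w (v + INR k)) (fun k => K * Rpower (INR k + 1) (- (2))) 0 1 (1 / 2)); [lra| | |].
  - intros k t _. intros eps He. pose proof (hfn_rcont s w Hs Hw (t + INR k) eps He) as Hc. apply locally_R in Hc. destruct Hc as [d [Hd Hc]].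
    apply locally_R. exists d. split; auto. intros y Hy. apply Hc. now replace (y + INR k - (t + INR k)) with (y - t) by ring.
  - intros k t Ht. apply H. lra.
  - apply rsummable_scal; auto. apply rsummable_nat_power. lra.
Qed.

Lemma coef_bound : exists K, 0 <= K /\ forall n, Cmod (coef n) <= K * Rpower (Rabs (IZR n) + 1) (- Re s).
Proof.
  destruct (shift_lower w Hw) as [c [Hc Hcn]]. pose proof PI_RGT_0 as Hpi. exists (Rpower (2 * PI * c) (- Re s) * exp (PI * Rabs (Im s)) * Cmod (euler s 1)).
  split; [pos|]. intros n. unfold coef. pose proof (Rabs_pos (IZR n)). assert (H2p : 0 < 2 * PI * c) by pos.
  rewrite euler_gamma; [|lra|rewrite Re_2PI, Re_shift; apply Rmult_lt_0_compat; lra]. rewrite Cmod_mult.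
  replace (Rpower (2 * PI * c) (- Re s) * exp (PI * Rabs (Im s)) * Cmod (euler s 1) * Rpower (Rabs (IZR n) + 1) (- Re s)) with
    ((Rpower (2 * PI * c) (- Re s) * Rpower (Rabs (IZR n) + 1) (- Re s)) * exp (PI * Rabs (Im s)) * Cmod (euler s 1)) by ring.
  apply Rmult_le_compat_r; [pos|]. rewrite Rpower_mult_distr by lra.
  assert (Hre : Re (- s) = - Re s) by reflexivity. assert (Him : Im (- s) = - Im s) by reflexivity.
  rewrite <- Hre, <- (Rabs_Ropp (Im s)), <- Him. apply cpow_lower; [|lra]. split; [nra|].
  rewrite !Cmod_mult, !Cmod_R, (Rabs_pos_eq 2), (Rabs_pos_eq PI) by lra. specialize (Hcn n). nra.
Qed.

Lemma coef_rsummable : exists g, rsummable g /\ forall n, Cmod (coef n) <= g n.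
Proof.
  destruct coef_bound as [K [HK H]]. exists (fun n => K * Rpower (Rabs (IZR n) + 1) (- Re s)). split; [|exact H].
  apply rsummable_scal; auto. apply rsummable_Z_power. lra.
Qed.

Lemma con_Bser : con Bser 0 1.
Proof.
  destruct coef_rsummable as [g [Hg H]]. apply (con_Sum (fun (n : Z) v => coef n * e (IZR n * v)%R)%C g 0 1 1); [lra| | |exact Hg].
  - cx.
  - intros n t _. rewrite Cmod_mult, Cmod_e, Rmult_1_r. apply H.
Qed.

(** The character is invariant under integral shifts, so the termwise integrals over [[0, 1]] are
    those of one function over [[k, k + 1]], and they add up to the integral over the half line. *)
Lemma Hper_coef n : CInt (fun t => Hper t * e (IZR (- n) * t)%R)%C 0 1 = coef n.
Proof.
  destruct (hfn_unif s w Hs Hw) as [K [HK H]]. set (g := fun k : nat => K * Rpower (INR k + 1) (- (2))).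
  assert (Hgs : rsummable g) by (apply rsummable_scal; auto; apply rsummable_nat_power; lra). assert (Hsn : 0 < Re (w + Ci * IZR n)) by (rewrite Re_shift; exact Hw).
  rewrite (CInt_ext _ (fun t => Sum (fun k : nat => hfn s w (t + INR k) * e (IZR (- n) * t)%R)%C)); [|lra|].
  2:{ intros t Ht. symmetry. apply Sum_unique. unfold Hper. rewrite Cmult_comm.
      eapply has_sum_ext; [intros k; apply Cmult_comm|]. apply has_sum_scal. apply Sum_correct. apply summable_le with g; auto. intros k. apply H. lra. }
  assert (Hck : forall k : nat, con (fun t => hfn s w (t + INR k)) 0 1).
  { intros k t _ eps He. pose proof (hfn_rcont s w Hs Hw (t + INR k) eps He) as Hc. apply locally_R in Hc. destruct Hc as [d [Hd Hc]].
    apply locally_R. exists d. split; auto. intros y Hy. apply Hc. now replace (y + INR k - (t + INR k)) with (y - t) by ring. }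
  rewrite (CInt_Sum (fun (k : nat) t => hfn s w (t + INR k) * e (IZR (- n) * t)%R)%C g 0 1 (1 / 2)); [|lra|lra| | |exact Hgs].
  2:{ cx. }
  2:{ intros k t Ht. rewrite Cmod_mult, Cmod_e, Rmult_1_r. apply H. lra. }
  assert (Hcn : forall a b, con (hfn s (w + Ci * IZR n)) a b) by (intros a b t _; now apply hfn_rcont).
  assert (Ek : forall k : nat, CInt (fun t => hfn s w (t + INR k) * e (IZR (- n) * t)%R)%C 0 1 = CInt (hfn s (w + Ci * IZR n)) (INR k) (INR (S k))).
  { intros k. rewrite S_INR. transitivity (CInt (hfn s (w + Ci * IZR n)) (0 + INR k) (1 + INR k)); [|f_equal; ring].
    rewrite <- CInt_shift by (try lra; apply Hcn). apply CInt_ext; [lra|]. intros t _. rewrite <- hfn_twist. f_equal.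
    replace (IZR (- n) * (t + INR k)) with (IZR (- n) * t + IZR (- n * Z.of_nat k)) by (rewrite mult_IZR, <- INR_IZR_INZ; ring). now rewrite e_plus_Z. }
  apply (tends_unique eventually (fun N => CInt (hfn s (w + Ci * IZR n)) 0 (INR N))); [|now apply euler_partial].
  assert (HS : summable (fun k : nat => CInt (fun t => hfn s w (t + INR k) * e (IZR (- n) * t)%R)%C 0 1)).
  { apply summable_le with g; auto. intros k. eapply Rle_trans; [apply CInt_bound with (M := g k); [lra| |]|lra].
    - cx.
    - intros t Ht. rewrite Cmod_mult, Cmod_e, Rmult_1_r. apply H. lra. }
  eapply tends_ext; [apply _| |apply (has_sum_nat_lim _ _ (Sum_correct _ HS))]. intros N. cbv beta. induction N.
  - simpl. unfold CInt. rewrite RInt_point. reflexivity.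
  - rewrite seq_S, lsum_app, IHN. simpl plus. cbn [lsum fold_right]. rewrite Nat.add_0_l, Ek, Cplus_0_r. apply CInt_Chasles; auto; [pos|rewrite S_INR; lra].
Qed.

Lemma Bser_coef n : CInt (fun t => Bser t * e (IZR (- n) * t)%R)%C 0 1 = coef n.
Proof.
  destruct coef_rsummable as [g [Hg H]]. rewrite (CInt_ext _ (fun t => Sum (fun k : Z => coef k * e (IZR (k - n) * t)%R)%C)); [|lra|].
  2:{ intros t Ht. symmetry. apply Sum_unique. unfold Bser. rewrite Cmult_comm.
      eapply has_sum_ext; [|apply has_sum_scal, Sum_correct].
      - intros k. cbv beta. rewrite minus_IZR. replace ((IZR k - IZR n) * t) with (IZR k * t + IZR (- n) * t) by (rewrite opp_IZR; ring).
        rewrite RtoC_plus, e_plus. ring.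
      - apply summable_le with g; auto. intros k. rewrite Cmod_mult, Cmod_e, Rmult_1_r. apply H. }
  rewrite (CInt_Sum (fun (k : Z) t => coef k * e (IZR (k - n) * t)%R)%C g 0 1 1); [|lra|lra| | |exact Hg].
  2:{ cx. }
  2:{ intros k t Ht. rewrite Cmod_mult, Cmod_e, Rmult_1_r. apply H. }
  apply Sum_unique. assert (Ek : forall k, CInt (fun t => coef k * e (IZR (k - n) * t)%R)%C 0 1 = (coef k * if Z.eq_dec (k - n) 0 then 1 else 0)%C).
  { intros k. rewrite CInt_scal; [|lra|cx]. now rewrite orthogonality. }
  assert (En : coef n = CInt (fun t => coef n * e (IZR (n - n) * t)%R)%C 0 1).
  { rewrite Ek. destruct (Z.eq_dec (n - n) 0); [ring|lia]. }
  rewrite En. apply (has_sum_single (fun k => CInt (fun t => coef k * e (IZR (k - n) * t)%R)%C 0 1) n).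
  intros k Hk. rewrite Ek. destruct (Z.eq_dec (k - n) 0); [lia|ring].
Qed.

Lemma lipschitz_formula v : 0 < v <= 1 ->
  Sum (fun k : nat => euler_fn s (2 * PI * w) (v + INR k)) =
  Sum (fun n : Z => euler s (2 * PI * (w + Ci * IZR n)) * e (IZR n * v)%R)%C.
Proof.
  intros Hv. set (g := fun t => (Hper t - Bser t)%C). assert (Hg : con g 0 1) by (apply con_minus; [apply con_Hper|apply con_Bser]).
  assert (Hz : forall v, 0 < v < 1 -> g v = 0).
  { apply fourier_unique; [exact Hg|]. intros n. transitivity (CInt (fun t => Hper t * e (IZR (- - n) * t)%R - Bser t * e (IZR (- - n) * t)%R)%C 0 1).
    - f_equal. extensionality t. unfold g. rewrite Z.opp_involutive. ring.
    - rewrite CInt_minus; [|lra|apply con_mult; [apply con_Hper|cx]|apply con_mult; [apply con_Bser|cx]]. rewrite Hper_coef, Bser_coef. ring. }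
  (* [fourier_unique] covers the open interval; the end point [v = 1], which occurs for integral
     [nu], is reached by continuity. *)
  assert (Hgv : g v = 0).
  { destruct (Rlt_dec v 1) as [H1|H1]; [apply Hz; lra|]. replace v with 1 by lra.
    apply Cmod_zero_eq, Rnot_lt_le. intros Hlt. specialize (Hg 1 ltac:(lra) _ Hlt). apply locally_R in Hg. destruct Hg as [d [Hd Hg]].
    set (y := 1 - Rmin (d / 2) (1 / 2)). pose proof (Rmin_l (d / 2) (1 / 2)). pose proof (Rmin_r (d / 2) (1 / 2)). assert (0 < Rmin (d / 2) (1 / 2)) by pos.
    specialize (Hg y ltac:(unfold y; apply Rabs_def1; lra)). rewrite (Hz y) in Hg by (unfold y; lra). rewrite Cmod_minus_sym, Cminus_0_r in Hg. lra. }
  unfold g in Hgv. apply (proj2 (Ceq_minus _ _)) in Hgv. transitivity (Hper v); [|exact Hgv]. unfold Hper.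
  f_equal. extensionality k. symmetry. apply hfn_pos. pose proof (pos_INR k). lra.
Qed.
End Lipschitz.

(** * Splitting sums over the integers; rules for powers *)

Lemma delta_int (x : R) (k : Z) : x = IZR k -> delta x = 1.
Proof. intros H. unfold delta. destruct (excluded_middle_informative _) as [_|N]; auto. exfalso. apply N. now exists k. Qed.

Lemma delta_non (x : R) : (forall k : Z, x <> IZR k) -> delta x = 0.
Proof. intros H. unfold delta. destruct (excluded_middle_informative _) as [[k Hk]|_]; auto. exfalso. now apply (H k). Qed.

(** Positive and negative values of [gamma + n] give one half line each. The value 0 occurs exactly
    for integral [gamma], and this is the source of both delta factors of the theorem. *)
Lemma has_sum_Z_split (gamma : R) (f : Z -> C) P N c :
  has_sum (fun m : nat => f (first_index gamma + Z.of_nat m)%Z) P ->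
  has_sum (fun m : nat => f (- (first_index (- gamma) + Z.of_nat m))%Z) N ->
  (forall n, gamma + IZR n = 0 -> f n = c) ->
  has_sum f (P + N + delta gamma * c)%C.
Proof.
  intros HP HN Hc. set (fp := fun n => if Rlt_dec 0 (gamma + IZR n) then f n else 0%C). set (fm := fun n => if Rlt_dec (gamma + IZR n) 0 then f n else 0%C).
  set (fz := fun n => if Req_dec_T (gamma + IZR n) 0 then f n else 0%C). assert (Hfp : has_sum fp P).
  { apply (has_sum_image _ (fun m => (first_index gamma + Z.of_nat m)%Z)).
    - intros a b. lia.
    - apply psi_term_image. intros k Hk. unfold fp. destruct (Rlt_dec _ _); [lra|cx].
    - eapply has_sum_ext; [|exact HP]. intros m. unfold fp. pose proof (first_index_pos gamma m). destruct (Rlt_dec _ _); [cx|lra]. }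
  assert (Hfm : has_sum fm N).
  { apply (has_sum_image _ (fun m => (- (first_index (- gamma) + Z.of_nat m))%Z)).
    - intros a b. lia.
    - intros k Hk. unfold fm. destruct (Rlt_dec _ _) as [H|H]; [|cx].
      exfalso. destruct (positive_index (- gamma) (- k)) as [n Hn]; [rewrite opp_IZR; lra|]. apply (Hk n). lia.
    - eapply has_sum_ext; [|exact HN]. intros m. unfold fm. pose proof (first_index_pos (- gamma) m). rewrite opp_IZR. destruct (Rlt_dec _ _); [cx|lra]. }
  assert (Hfz : has_sum fz (delta gamma * c)%C).
  { destruct (classic (exists k : Z, gamma = IZR k)) as [[k Hk]|Hk].
    - rewrite (delta_int gamma k Hk), Cmult_1_l. assert (E : c = fz (- k)%Z).
      { unfold fz. destruct (Req_dec_T _ _) as [H|H]; [now rewrite Hc|]. rewrite opp_IZR in H. lra. }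
      rewrite E. apply has_sum_single. intros b Hb. unfold fz. destruct (Req_dec_T _ _) as [H|H]; [|cx]. exfalso. apply Hb. apply eq_IZR. rewrite opp_IZR. lra.
    - rewrite delta_non; [|intros k E; apply Hk; now exists k]. rewrite Cmult_0_l.
      eapply has_sum_ext; [|apply has_sum_zero]. intros n. unfold fz. destruct (Req_dec_T _ _) as [H|H]; [|cx].
      exfalso. apply Hk. exists (- n)%Z. rewrite opp_IZR. lra. }
  eapply has_sum_ext; [|apply (has_sum_plus _ _ _ _ (has_sum_plus _ _ _ _ Hfp Hfm) Hfz)]. intros n. unfold fp, fm, fz. cbv beta.
  destruct (Rlt_dec 0 _), (Rlt_dec _ 0), (Req_dec_T _ _); try lra; try ring.
Qed.

Lemma Log_mult (u z : C) : u <> 0 -> z <> 0 -> - PI < arg_p u + arg_p z <= PI -> Log (u * z) = (Log u + Log z)%C.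
Proof. intros Hu Hz H. apply Log_unique; [exact H|]. now rewrite Cexp_plus, !Cexp_Log. Qed.

Lemma cpow_mult (u z w : C) : u <> 0 -> z <> 0 -> - PI < arg_p u + arg_p z <= PI -> cpow (u * z) w = (cpow u w * cpow z w)%C.
Proof. intros Hu Hz H. rewrite !cpow_Log, Log_mult, <- Cexp_plus by auto. f_equal. ring. Qed.

Lemma arg_p_pos (x : R) : 0 < x -> arg_p x = 0.
Proof. intros H. pose proof (Log_pos x H) as E. apply (f_equal snd) in E. exact E. Qed.

Lemma RtoC_nz (x : R) : x <> 0 -> RtoC x <> 0.
Proof. intros H E. apply RtoC_inj in E. contradiction. Qed.

Lemma arg_p_gt (z : C) : z <> 0 -> - PI < arg_p z.
Proof.
  intros Hz. destruct (arg_p_bound z) as [H _]. destruct H as [H|H]; [exact H|].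
  destruct (arg_p_spec z Hz) as [_ H2]. rewrite <- H, sin_neg, sin_PI in H2. pose proof PI_RGT_0.
  unfold arg_p in H. pose proof (acos_bound (Re z / Cmod z)). destruct (Rle_dec 0 (Im z)); lra.
Qed.

Lemma cpow_scale (a : R) (z w : C) : 0 < a -> z <> 0 -> cpow (a * z) w = (cpow a w * cpow z w)%C.
Proof.
  intros Ha Hz. apply cpow_mult; [apply RtoC_nz; lra|exact Hz|]. rewrite arg_p_pos by exact Ha. pose proof (arg_p_bound z). pose proof (arg_p_gt z Hz). lra.
Qed.

Lemma Cmod_Ci : Cmod Ci = 1.
Proof. unfold Cmod. simpl. replace (0 * (0 * 1) + 1 * (1 * 1)) with 1 by ring. apply sqrt_1. Qed.

Lemma Ci_nz : Ci <> 0.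
Proof. intros E. apply (f_equal snd) in E. simpl in E. lra. Qed.

Lemma arg_p_Ci : arg_p Ci = PI / 2.
Proof. pose proof PI_RGT_0. apply arg_p_unique; [apply Ci_nz|lra| |]; rewrite Cmod_Ci, ?cos_PI2, ?sin_PI2; simpl; ring. Qed.

Lemma arg_p_mCi : arg_p (- Ci) = - (PI / 2).
Proof.
  pose proof PI_RGT_0. apply arg_p_unique; [intros E; apply (f_equal snd) in E; simpl in E; lra|lra| |];
    rewrite Cmod_opp, Cmod_Ci, ?cos_neg, ?sin_neg, ?cos_PI2, ?sin_PI2; simpl; ring.
Qed.

Lemma cpow_Ci (w : C) : cpow Ci w = Cexp (PI * Ci * w / 2).
Proof. rewrite cpow_Log. unfold Log. rewrite Cmod_Ci, arg_p_Ci, ln_1. f_equal. apply injective_projections; simpl; field. Qed.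

Lemma cpow_mCi (w : C) : cpow (- Ci) w = Cexp (- (PI * Ci * w / 2)).
Proof. rewrite cpow_Log. unfold Log. rewrite Cmod_opp, Cmod_Ci, arg_p_mCi, ln_1. f_equal. apply injective_projections; simpl; field. Qed.

(** * The functional equation *)

(** The directions of the two half lines into which the vertical line of points
    [rho + Ci * (beta + n)] falls. *)
Definition vertical (i : C) : Prop := i = Ci \/ i = (- Ci)%C.

Lemma vertical_nz i : vertical i -> i <> 0.
Proof. intros [-> | ->] E; apply (f_equal snd) in E; simpl in E; lra. Qed.

Lemma good_vertical i (rho y : R) : vertical i -> 0 <= rho -> 0 < y -> good (Rmin y 1) (rho + i * y) i.
Proof.
  intros Hi Hr Hy. split; [pos|]. intros t Ht. pose proof (Rmin_l y 1). pose proof (Rmin_r y 1). set (z := (rho + i * y + t * i)%C).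
  assert (E : Rabs (Im z) = y + t).
  { destruct Hi as [-> | ->].
    - replace (Im z) with (y + t) by (unfold z; simpl; unfold Im; simpl; ring). apply Rabs_pos_eq. lra.
    - replace (Im z) with (- (y + t)) by (unfold z; simpl; unfold Im; simpl; ring). rewrite Rabs_Ropp. apply Rabs_pos_eq. lra. }
  split.
  - right. intros E0. rewrite E0, Rabs_R0 in E. lra.
  - eapply Rle_trans; [|apply Rabs_snd_le]. change (snd z) with (Im z). rewrite E. nra.
Qed.

Section Kernel.
Variables (v beta : R).
Hypothesis Hv : 0 < v <= 1.
Let wv (rho : R) : C := (2 * PI * (rho + Ci * beta))%C.

Lemma wv_Re rho : Re (wv rho) = 2 * PI * rho.
Proof. simpl; lra. Qed.

Lemma kernel_bound M rho : 0 < rho -> exists K, 0 <= K /\ forall s k, Rabs (Re s - 1) <= M ->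
  Cmod (euler_fn s (wv rho) (v + INR k)) <= K * Rpower (INR k + 1) (- (2)).
Proof.
  intros Hr. pose proof PI_RGT_0 as Hpi. set (x := 2 * PI * rho). assert (Hx : 0 < x) by pos.
  destruct (nat_above (Rmax M 0)) as [m Hm]. pose proof (Rmax_l M 0) as HM. pose proof (Rmax_r M 0) as HM0. set (C0 := (2 * INR (m + 2) / x) ^ (m + 2)).
  assert (HC0 : 0 <= C0).
  { pos. }
  exists (Rpower (/ v) (INR m) * C0 * exp x). split; [pos|]. intros s k Hs. pose proof (pos_INR k) as Hk. rewrite Cmod_euler_fn by lra. rewrite wv_Re. fold x.
  assert (Hiv : 1 <= / v) by (rewrite <- Rinv_1; apply Rinv_le_contravar; lra).
  assert (H1 : Rpower (v + INR k) (Re s - 1) <= Rpower (/ v) (INR m) * (INR k + 1) ^ m).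
  { rewrite <- Rpower_pow, Rpower_mult_distr by lra. unfold Rpower. apply exp_le_mono. apply Rle_trans with (Rabs (ln (v + INR k)) * INR m).
    - rewrite Rmult_comm. eapply Rle_trans; [apply Rle_abs|]. rewrite Rabs_mult. apply Rmult_le_compat_l; [pos|lra].
    - rewrite Rmult_comm. apply Rmult_le_compat_l; [lra|]. unfold Rabs. destruct (Rcase_abs (ln (v + INR k))).
      + rewrite <- ln_Rinv by lra. apply ln_le; [pos|]. apply Rle_trans with (/ v); [apply Rinv_le_contravar; lra|]. nra.
      + apply ln_le; [lra|]. nra. }
  pose proof (Rpower_exp_bound (m + 2) x (INR k + 1) Hx ltac:(lra)) as H2. fold C0 in H2. rewrite pow_add in H2. assert (Hp2 : 0 < (INR k + 1) ^ 2) by nra.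
  rewrite Rpower_Ropp. replace (Rpower (INR k + 1) 2) with ((INR k + 1) ^ 2) by (rewrite <- Rpower_pow by lra; reflexivity).
  apply Rmult_le_reg_r with ((INR k + 1) ^ 2); [exact Hp2|]. rewrite (Rmult_assoc _ (/ _)), Rinv_l, Rmult_1_r by lra.
  apply Rle_trans with (Rpower (/ v) (INR m) * ((INR k + 1) ^ m * (INR k + 1) ^ 2) * exp (- (x * (v + INR k)))).
  { replace (Rpower (v + INR k) (Re s - 1) * exp (- (x * (v + INR k))) * (INR k + 1) ^ 2) with
      (Rpower (v + INR k) (Re s - 1) * ((INR k + 1) ^ 2 * exp (- (x * (v + INR k))))) by ring.
    replace (Rpower (/ v) (INR m) * ((INR k + 1) ^ m * (INR k + 1) ^ 2) * exp (- (x * (v + INR k)))) with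
      (Rpower (/ v) (INR m) * (INR k + 1) ^ m * ((INR k + 1) ^ 2 * exp (- (x * (v + INR k))))) by ring.
    apply Rmult_le_compat_r; [|exact H1]. pos. }
  rewrite !Rmult_assoc. apply Rmult_le_compat_l; [pos|]. rewrite <- Rmult_assoc.
  apply Rle_trans with (C0 * exp (x * (INR k + 1) / 2) * exp (- (x * (v + INR k)))); [apply Rmult_le_compat_r; [pos|exact H2]|].
  rewrite Rmult_assoc, <- exp_plus. apply Rmult_le_compat_l; [exact HC0|]. apply exp_le_mono. nra.
Qed.

Lemma kernel_hol rho s : 0 < rho -> hol (fun s => Sum (fun k : nat => euler_fn s (wv rho) (v + INR k))) s.
Proof.
  intros Hr. destruct (kernel_bound (Rabs (Re s - 1) + 1) rho Hr) as [K [HK H]].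
  apply (hol_Sum (fun (k : nat) s => euler_fn s (wv rho) (v + INR k)) (fun k => K * Rpower (INR k + 1) (- (2))) s 1 s).
  - lra.
  - intros k w _. unfold euler_fn. cx.
  - intros k w Hw. apply H. pose proof (Rabs_fst_le (w - s)) as H1. change (fst (w - s)%C) with (Re w - Re s) in H1.
    replace (Re w - 1) with ((Re s - 1) + (Re w - Re s)) by ring. rtri. lra.
  - apply rsummable_scal; auto. apply rsummable_nat_power. lra.
  - replace (s - s)%C with (RtoC 0) by ring. rewrite Cmod_0. lra.
Qed.

(** For [Re s < 0] the powers alone converge absolutely, so the exponential damping may be removed
    by dominated convergence. *)
Lemma kernel_lim s : Re s < 0 ->
  tends (at_right 0) (fun rho => Sum (fun k : nat => euler_fn s (wv rho) (v + INR k)))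
    (Sum (fun k : nat => euler_fn s (wv 0) (v + INR k))).
Proof.
  intros Hs. assert (Hb : forall rho (k : nat), 0 <= rho -> Cmod (euler_fn s (wv rho) (v + INR k)) <= Rpower v (Re s - 1) * Rpower (INR k + 1) (- (1 - Re s))).
  { intros rho k Hr. pose proof (pos_INR k) as Hk. rewrite Cmod_euler_fn by lra. rewrite wv_Re.
    replace (- (1 - Re s)) with (Re s - 1) by ring. rewrite Rpower_mult_distr by lra.
    rewrite <- (Rmult_1_r (Rpower (v * _) _)). apply Rmult_le_compat; try (left; apply exp_pos).
    - apply Rpower_le_base; [|lra]. split; [nra|]. nra.
    - rewrite <- exp_0. apply exp_le_mono. pose proof PI_RGT_0.
      pose proof (Rmult_le_pos (2 * PI * rho) (v + INR k) ltac:(apply Rmult_le_pos; lra) ltac:(lra)). lra. }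
  apply (tends_Sum (at_right 0) (fun (k : nat) rho => euler_fn s (wv rho) (v + INR k)) _ (fun k => Rpower v (Re s - 1) * Rpower (INR k + 1) (- (1 - Re s)))).
  - intros k. unfold euler_fn. apply tends_mult; [apply _|cx|]. apply (tends_comp (at_right 0) Cexp); [apply ccont_Cexp|].
    apply tends_opp; [apply _|]. apply tends_mult; [apply _| |cx]. unfold wv. apply tends_mult; [apply _|cx|]. apply tends_plus; [apply _| |cx].
    intros eps He. apply filter_le_within. now apply tends_RtoC.
  - exists (mkposreal 1 Rlt_0_1). intros rho _ Hr k. apply Hb. lra.
  - intros k. apply Hb. lra.
  - apply rsummable_scal; [pos|]. apply rsummable_nat_power. lra.
Qed.
End Kernel.

Lemma tends_dot {T} (F : (T -> Prop) -> Prop) {FF : Filter F} (a : nat -> C) (v : nat -> T -> C) (l : nat -> C) n :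
  (forall k, tends F (v k) (l k)) -> tends F (fun x => dot a (fun k => v k x) n) (dot a l n).
Proof.
  intros H. induction n.
  - simpl. cx.
  - rewrite dot_S. apply tends_ext with (fun x => dot a (fun k => v k x) n + a (S n) * v (S n) x)%C; [apply _|intros; now rewrite dot_S|]. cx.
Qed.

Lemma tends_Phi {T} (F : (T -> Prop) -> Prop) {FF : Filter F} h p k (b : T -> C) (b0 : C) : slit b0 -> tends F b b0 ->
  tends F (fun r => Phi h p (b r) k) (Phi h p b0 k).
Proof.
  intros Hb H. unfold Phi. apply tends_mult; [apply _|cx|].
  apply (tends_comp F (fun z => cpow z (- p - INR k))); [|exact H]. apply hol_ccont. apply (hol_cpow_base (fun z => z)); [exact Hb|cx].
Qed.

Lemma Hsum_tends {T} (F : (T -> Prop) -> Prop) {FF : Filter F} x nu c h n s (b : T -> C) (b0 : C) : 0 <= x <= 1 ->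
  - INR n < Re s -> good c b0 h -> F (fun r => good c (b r) h) -> tends F b b0 ->
  tends F (fun r => Hsum x nu n (b r) h s) (Hsum x nu n b0 h s).
Proof.
  intros Hx Hs Hg0 Hg Hb. assert (Hsl : forall t, 0 <= t -> slit (b0 + RtoC t * h)) by (intros t Ht; now apply Hg0).
  assert (Hsh : forall a, tends F (fun r => b r + a)%C (b0 + a)%C).
  { cx. }
  assert (HG : forall a, slit (b0 + a) -> tends F (fun r => dot (gam x nu) (Phi h (s - 1) (b r + a)) (n + 1)) (dot (gam x nu) (Phi h (s - 1) (b0 + a)) (n + 1))).
  { intros a Ha. apply (tends_dot F (gam x nu) (fun k r => Phi h (s - 1) (b r + a)%C k)). intros k. apply tends_Phi; [apply _|exact Ha|apply Hsh]. }
  unfold Hsum. apply tends_minus; [apply _| |].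
  - unfold Gval. replace b0 with (b0 + 0)%C by ring. eapply tends_ext; [apply _| |apply (HG (RtoC 0))].
    + intros r. cbv beta. now rewrite Cplus_0_r.
    + pose proof (Hsl 0 ltac:(lra)) as H. now rewrite Cmult_0_l in H.
  - destruct (Dterm_bound_unif x nu c h n (Cmod (s - 1)) (Re s + INR n + 1) Hx (proj1 Hg0) ltac:(lra)) as [K [HK HKb]].
    apply (tends_Sum F (fun (m : nat) r => Dterm x nu n (b r) h s m) _ (fun m => K * Rpower (INR m + 1) (- (Re s + INR n + 1)))).
    + intros m. unfold Dterm. apply tends_mult; [apply _|cx|]. unfold em_defect. pose proof (pos_INR m) as Hm.
      assert (E : forall z : C, (z + (INR m + 1)%R * h - h)%C = (z + INR m * h)%C) by (intros z; rewrite RtoC_plus; ring).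
      assert (E2 : forall z : C, (z + (INR m + 1)%R * h - x * h)%C = (z + (INR m + 1 - x)%R * h)%C) by (intros z; rewrite (RtoC_minus (INR m + 1)); ring).
      apply tends_minus; [apply _|apply tends_minus; [apply _| |]|].
      * apply tends_mult; [apply _|cx|]. rewrite E. eapply tends_ext; [apply _| |cx]. intros r. cbv beta. now rewrite E.
      * apply HG. apply Hsl. lra.
      * apply tends_mult; [apply _|cx|]. rewrite E2. eapply tends_ext; [apply _| |apply tends_Phi; [apply _| |apply Hsh]].
        -- intros r. cbv beta. now rewrite E2.
        -- apply Hsl. lra.
    + revert Hg. apply filter_imp. intros r Hr m. apply HKb; auto; lra.
    + intros m. apply HKb; auto; lra.
    + apply rsummable_scal; auto. apply rsummable_nat_power. lra.
Qed.

Lemma psi_term_sum s gamma kappa l : 1 < Re s -> has_sum (psi_term s gamma kappa) l ->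
  has_sum (fun m : nat => psi_term s gamma kappa (first_index gamma + Z.of_nat m)) l.
Proof.
  intros Hs Hl. pose proof (first_point_bounds gamma) as Ha. assert (H01 : 0 <= 1 <= 1) by lra.
  pose proof (Sum_correct _ (Zterm_summable 1 (- kappa) _ _ _ H01 (good_real _ (proj1 Ha)) s Hs)) as H. apply (has_sum_scal (e (first_point gamma * kappa)%R)) in H.
  apply (has_sum_ext _ _ _ (fun m => eq_sym (psi_term_nat s gamma kappa m))) in H.
  pose proof (has_sum_image (psi_term s gamma kappa) (fun m : nat => (first_index gamma + Z.of_nat m)%Z) _ ltac:(intros a b; cbv beta; lia)
    ltac:(apply psi_term_image; intros k Hk; unfold psi_term; destruct (Rlt_dec _ _); [lra|cx]) H) as H2.
  now rewrite (has_sum_unique _ _ _ Hl H2).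
Qed.

Section Vertical.
Variables (i : C) (gamma kappa : R).
Hypothesis Hi : vertical i.
Let y := first_point gamma.
Definition Zv (rho : R) (s : C) : nat -> C := Zterm 1 (- kappa) (rho + i * y) i s.
(** Order 2 of the expansion continues the half line sums to [Re s > - 2], which leaves a strip to
    the left of [Re s = - 1]. *)
Definition Hv (rho : R) (s : C) : C := Hsum 1 (- kappa) 2 (rho + i * y) i s.

Lemma good_v rho : 0 <= rho -> good (Rmin y 1) (rho + i * y) i.
Proof. intros H. apply good_vertical; [exact Hi|exact H|apply first_point_bounds]. Qed.

Lemma Zv_summable rho s : 0 <= rho -> 1 < Re s -> summable (Zv rho s).
Proof. intros Hr Hs. apply (Zterm_summable 1 (- kappa) _ _ _ ltac:(lra) (good_v rho Hr)). exact Hs. Qed.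

Lemma Hv_eq rho s : 0 <= rho -> 1 < Re s -> Hv rho s = ((s - 1) * i * Sum (Zv rho s))%C.
Proof. intros Hr Hs. apply (Hsum_eq 1 (- kappa) _ _ _ ltac:(lra) (good_v rho Hr)). exact Hs. Qed.

Lemma Hv_hol rho s : 0 <= rho -> - INR 2 < Re s -> hol (Hv rho) s.
Proof. intros Hr Hs. apply (Hsum_hol 1 (- kappa) _ _ _ ltac:(lra) (good_v rho Hr)). exact Hs. Qed.

Lemma Hv_tends s : - INR 2 < Re s -> tends (at_right 0) (fun rho => Hv rho s) (Hv 0 s).
Proof.
  intros Hs. unfold Hv. apply (Hsum_tends (at_right 0) 1 (- kappa) (Rmin y 1)); [lra|exact Hs|apply good_v; lra| |].
  - exists (mkposreal 1 Rlt_0_1). intros rho _ Hr. apply good_v. lra.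
  - apply tends_plus; [apply _| |cx]. intros eps He. apply filter_le_within. now apply tends_RtoC.
Qed.

Lemma minus_1_nz (s : C) : 1 < Re s -> (s - 1)%C <> 0.
Proof. intros Hs. apply Cminus_nz. intros E. rewrite E in Hs. simpl in Hs. lra. Qed.

(** At [rho = 0] the half line consists of positive multiples of [i], whose powers split off
    [cpow i (- s)], and the series of psi remains. This is compared for [Re s > 1] and continued. *)
Lemma Hv_0 Psi s : (forall s, hol Psi s) -> (forall s, 1 < Re s -> has_sum (psi_term s gamma kappa) (Psi s / (s - 1))%C) ->
  - INR 2 < Re s -> (e (y * kappa)%R / i * Hv 0 s)%C = (cpow i (- s) * Psi s)%C.
Proof.
  intros HP HPs Hs. pose proof (first_point_bounds gamma) as Hy. fold y in Hy. pose proof (vertical_nz i Hi) as Hi0.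
  apply (hol_identity (fun s => - INR 2 < Re s) (fun s => e (y * kappa)%R / i * Hv 0 s)%C
    (fun s => cpow i (- s) * Psi s)%C 2 s); [apply convex_halfplane| | | |exact Hs|].
  - intros w Hw. apply hol_mult; [cx|apply Hv_hol; [lra|exact Hw]].
  - cx.
  - simpl. lra.
  - apply locally_locally'. generalize (halfplane_locally 1 2 ltac:(simpl; lra)). apply filter_imp. intros w Hw.
    rewrite Hv_eq by lra. pose proof (minus_1_nz w Hw) as Hw1. assert (E : (e (y * kappa)%R * Sum (Zv 0 w))%C = (cpow i (- w) * (Psi w / (w - 1)))%C).
    { apply (has_sum_unique (fun m => e (y * kappa)%R * Zv 0 w m)%C).
      - apply has_sum_scal, Sum_correct, Zv_summable; [lra|exact Hw].
      - eapply has_sum_ext; [|apply has_sum_scal, (psi_term_sum _ _ _ _ Hw (HPs w Hw))]. intros m. cbv beta. rewrite psi_term_nat. fold y. unfold Zv, Zterm.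
        replace (INR m + 1 - 1) with (INR m) by ring. replace (y + INR m * 1)%C with (RtoC (y + INR m)) by (rewrite RtoC_plus; ring).
        replace (0 + i * y + INR m * i)%C with (RtoC (y + INR m) * i)%C by (rewrite RtoC_plus; ring).
        rewrite cpow_scale by (auto; pose proof (pos_INR m); lra). ring. }
    transitivity ((w - 1) * (e (y * kappa)%R * Sum (Zv 0 w)))%C.
    + revert Hi0. generalize (Sum (Zv 0 w)) (e (y * kappa)%R). generalize (w : C) i. intros u ii A B Hii. field. exact Hii.
    + rewrite E. revert Hw1. generalize (cpow i (- w)) (Psi w). generalize (w : C). intros u A B Hu. field. exact Hu.
Qed.
End Vertical.

Lemma vertical_up : vertical Ci.
Proof. now left. Qed.
Lemma vertical_down : vertical (- Ci)%C.
Proof. now right. Qed.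

Lemma euler_shift_2 s : 0 < Re s -> euler (s + INR 2) 1 = (s * (s + 1) * euler s 1)%C.
Proof.
  intros Hs. replace (s + INR 2)%C with (s + 1 + 1)%C.
  - rewrite !euler_shift; [ring|exact Hs|simpl; unfold Re in *; lra].
  - change (INR 2) with (1 + 1). rewrite RtoC_plus. ring.
Qed.

Lemma hol_Cexp_lin (c : C) s : hol (fun s => Cexp (c * s / 2)) s.
Proof. apply (hol_Cexp (fun s => c * s / 2)%C). apply (hol_mult (fun s => c * s)%C (fun _ => / 2)%C); cx. Qed.

Lemma hol_Cexp_mlin (c : C) s : hol (fun s => Cexp (- (c * s / 2))) s.
Proof. apply (hol_Cexp (fun s => - (c * s / 2))%C). apply hol_opp. apply (hol_mult (fun s => c * s)%C (fun _ => / 2)%C); cx. Qed.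

Section FunctionalEquation.
Variables (beta nu : R).
Let v := first_point nu.
Let y1 := first_point beta.
Let y2 := first_point (- beta).
Let Zp := Zv Ci beta nu.
Let Zm := Zv (- Ci) (- beta) (- nu).
Let Hp := Hv Ci beta nu.
Let Hm := Hv (- Ci) (- beta) (- nu).
Let Ker (rho : R) (s : C) : C := Sum (fun k : nat => euler_fn s (2 * PI * (rho + Ci * beta)) (v + INR k)).

(** The Lipschitz formula with its right side sorted by the sign of [beta + n]: upward half line,
    downward half line, and the single term [rho^(-s)] if [beta] is an integer. *)
Lemma lipschitz_split s rho : 2 < Re s -> 0 < rho ->
  (e (beta * nu)%R * Ker rho s)%C =
  (euler s 1 * cpow (RtoC (2 * PI)) (- s) * (e (y1 * nu)%R * Sum (Zp rho s) + e (y2 * - nu)%R * Sum (Zm rho s) + delta beta * cpow (RtoC rho) (- s)))%C.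
Proof.
  intros Hs Hr. pose proof (first_point_bounds nu) as Hv. pose proof (first_point_bounds beta) as Hy1. pose proof (first_point_bounds (- beta)) as Hy2.
  fold v in Hv. fold y1 in Hy1. fold y2 in Hy2. pose proof PI_RGT_0 as Hpi.
  set (g := fun n : Z => (e ((beta + IZR n) * nu)%R * cpow (rho + Ci * RtoC (beta + IZR n)) (- s))%C).
  assert (Hg : has_sum g (e (y1 * nu)%R * Sum (Zp rho s) + e (y2 * - nu)%R * Sum (Zm rho s) + delta beta * cpow (RtoC rho) (- s))%C).
  { apply (has_sum_Z_split beta).
    - eapply has_sum_ext; [|apply has_sum_scal, Sum_correct, (Zv_summable Ci beta nu vertical_up); lra].
      intros m. unfold g, Zp, Zv, Zterm. rewrite first_index_point. fold y1.
      replace (INR m + 1 - 1) with (INR m) by ring. rewrite Cmult_assoc, <- e_plus, <- RtoC_plus. f_equal.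
      + f_equal. f_equal. ring.
      + f_equal. rewrite RtoC_plus. ring.
    - eapply has_sum_ext; [|apply has_sum_scal, Sum_correct, (Zv_summable (- Ci) (- beta) (- nu) vertical_down); lra]. intros m. unfold g, Zm, Zv, Zterm. fold y2.
      replace (beta + IZR (- (first_index (- beta) + Z.of_nat m))) with (- (y2 + INR m)) by (unfold y2; rewrite <- first_index_point, opp_IZR; ring).
      replace (INR m + 1 - 1) with (INR m) by ring. rewrite Cmult_assoc, <- e_plus, <- RtoC_plus. f_equal.
      + f_equal. f_equal. ring.
      + f_equal. rewrite RtoC_opp, RtoC_plus. ring.
    - intros n Hn. unfold g. rewrite Hn, Rmult_0_l, e_0, Cmult_0_r, Cplus_0_r. ring. }
  unfold Ker. rewrite lipschitz_formula; [|exact Hs|simpl; unfold Re; simpl; lra|exact Hv].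
  rewrite (Sum_unique _ (e (- (beta * nu))%R * (euler s 1 * cpow (RtoC (2 * PI)) (- s)) *
    (e (y1 * nu)%R * Sum (Zp rho s) + e (y2 * - nu)%R * Sum (Zm rho s) + delta beta * cpow (RtoC rho) (- s)))%C).
  - rewrite !Cmult_assoc, <- e_plus, <- RtoC_plus. replace (beta * nu + - (beta * nu)) with 0 by ring. rewrite e_0. ring.
  - eapply has_sum_ext; [|apply has_sum_scal, Hg]. intros n. cbv beta. unfold g.
    replace (rho + Ci * beta + Ci * IZR n)%C with (rho + Ci * RtoC (beta + IZR n))%C by (rewrite RtoC_plus; ring). set (z := (rho + Ci * RtoC (beta + IZR n))%C).
    assert (Hz : Re z = rho) by (unfold z; simpl; unfold Re; simpl; ring). assert (Hz0 : z <> 0) by (intros E; rewrite E in Hz; simpl in Hz; lra).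
    rewrite (euler_gamma s (2 * PI * z)); [|lra|rewrite Re_2PI, Hz; apply Rmult_lt_0_compat; lra]. rewrite <- RtoC_mult, cpow_scale by (auto; lra).
    assert (E : e (IZR n * v)%R = (e (- (beta * nu))%R * e ((beta + IZR n) * nu)%R)%C).
    { rewrite <- e_plus, <- RtoC_plus. unfold v, first_point.
      replace (IZR n * (nu + IZR (first_index nu))) with (- (beta * nu) + (beta + IZR n) * nu + IZR (n * first_index nu)) by (rewrite mult_IZR; ring).
      now rewrite e_plus_Z. }
    rewrite E. ring.
Qed.

(** The factor [s - 1] clears the normalisation of [Hv], and [s * (s + 1)] turns [euler s 1] into
    [euler (s + 2) 1]; both sides become holomorphic for [Re s > - 2]. *)
Lemma continued_split s rho : - INR 2 < Re s -> 0 < rho ->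
  (s * (s + 1) * (s - 1) * (e (beta * nu)%R * Ker rho s))%C =
  (euler (s + INR 2) 1 * cpow (RtoC (2 * PI)) (- s) * (e (y1 * nu)%R / Ci * Hp rho s + e (y2 * - nu)%R / - Ci * Hm rho s +
     delta beta * (s - 1) * cpow (RtoC rho) (- s)))%C.
Proof.
  intros Hs Hr. apply (hol_identity (fun s => - INR 2 < Re s)
    (fun s => s * (s + 1) * (s - 1) * (e (beta * nu)%R * Ker rho s))%C
    (fun s => euler (s + INR 2) 1 * cpow (RtoC (2 * PI)) (- s) * (e (y1 * nu)%R / Ci * Hp rho s + e (y2 * - nu)%R / - Ci * Hm rho s +
     delta beta * (s - 1) * cpow (RtoC rho) (- s)))%C 3 s); [apply convex_halfplane| | | |exact Hs|].
  - intros w Hw. apply hol_mult; [|apply hol_mult; [cx|]].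
    + cx.
    + unfold Ker. apply kernel_hol; [apply first_point_bounds|exact Hr].
  - intros w Hw. apply hol_mult; [apply hol_mult; [now apply hol_shift_euler|cx]|]. apply hol_plus; [apply hol_plus|].
    + apply hol_mult; [cx|apply (Hv_hol Ci beta nu vertical_up); [lra|exact Hw]].
    + apply hol_mult; [cx|apply (Hv_hol (- Ci) (- beta) (- nu) vertical_down); [lra|exact Hw]].
    + cx.
  - simpl. lra.
  - apply locally_locally'. generalize (halfplane_locally 2 3 ltac:(simpl; lra)). apply filter_imp. intros w Hw.
    unfold Hp, Hm. rewrite lipschitz_split, !Hv_eq, euler_shift_2 by (auto using vertical_up, vertical_down; lra). fold Zp Zm. pose proof Ci_nz as Hci.
    generalize (Sum (Zp rho w)) (Sum (Zm rho w)). intros A B. revert Hci. generalize Ci. generalize (w : C). intros u ii Hii. field. exact Hii.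
Qed.

Variables Psi1 Psi2 Psi3 : C -> C.
Hypothesis HP1 : forall s, hol Psi1 s.
Hypothesis HP1s : forall s, 1 < Re s -> has_sum (psi_term s beta nu) (Psi1 s / (s - 1))%C.
Hypothesis HP2 : forall s, hol Psi2 s.
Hypothesis HP2s : forall s, 1 < Re s -> has_sum (psi_term s (- beta) (- nu)) (Psi2 s / (s - 1))%C.
Hypothesis HP3 : forall s, hol Psi3 s.
Hypothesis HP3s : forall s, 1 < Re s -> has_sum (psi_term s nu (- beta)) (Psi3 s / (s - 1))%C.

Lemma Ker_0 s : Re s < 0 -> Ker 0 s = (Psi3 (1 - s) / - s)%C.
Proof.
  intros Hs. assert (Hs' : 1 < Re (1 - s)) by (simpl; unfold Re in *; lra). unfold Ker. apply Sum_unique. pose proof (psi_term_sum _ _ _ _ Hs' (HP3s _ Hs')) as H.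
  replace (1 - s - 1)%C with (- s)%C in H by ring. eapply has_sum_ext; [|exact H]. intros m. cbv beta.
  unfold psi_term. destruct (Rlt_dec _ _) as [_|N]; [|exfalso; apply N, first_index_pos]. rewrite first_index_point. fold v. unfold euler_fn, e.
  replace (- (1 - s))%C with (s - 1)%C by ring. rewrite Cmult_comm. f_equal. f_equal. rewrite RtoC_mult, RtoC_opp. ring.
Qed.

(* Limit [rho -> 0] of [continued_split], in a strip where the left side still converges. *)
Lemma core_identity s : - INR 2 < Re s ->
  (- ((s + 1) * (s - 1) * (e (beta * nu)%R * Psi3 (1 - s))))%C =
  (euler (s + INR 2) 1 * cpow (RtoC (2 * PI)) (- s) * (Cexp (- (PI * Ci * s / 2)) * Psi1 s + Cexp (PI * Ci * s / 2) * Psi2 s))%C.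
Proof.
  intros Hs. apply (hol_identity (fun s => - INR 2 < Re s) (fun s => - ((s + 1) * (s - 1) * (e (beta * nu)%R * Psi3 (1 - s))))%C
    (fun s => euler (s + INR 2) 1 * cpow (RtoC (2 * PI)) (- s) * (Cexp (- (PI * Ci * s / 2)) * Psi1 s + Cexp (PI * Ci * s / 2) * Psi2 s))%C
    (RtoC (- (3 / 2))) s); [apply convex_halfplane| | | |exact Hs|].
  - intros w Hw. apply hol_opp, hol_mult; [cx|]. apply hol_mult; [cx|]. apply (hol_comp Psi3 (fun s => 1 - s)%C); [apply HP3|]. cx.
  - intros w Hw. apply hol_mult; [apply hol_mult; [now apply hol_shift_euler|cx]|]. apply hol_plus; apply hol_mult; auto; [apply hol_Cexp_mlin|apply hol_Cexp_lin].
  - simpl. lra.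
  (* The comparison takes place around -3/2: [Re w > - 2] is the range of the continued half lines,
     and [Re w < - 1] gives convergence at [rho = 0] on the left. *)
  - apply locally_locally'. assert (HL : cnear (RtoC (- (3 / 2))) (fun w : C => - INR 2 < Re w < -1)).
    { apply locally_Cmod. exists (1 / 2). split; [lra|]. intros w Hw. pose proof (Rabs_fst_le (w - RtoC (- (3 / 2)))) as H1.
      change (fst (w - RtoC (- (3 / 2)))%C) with (Re w - - (3 / 2)) in H1. apply Rabs_le_between in H1. simpl; lra. }
    revert HL. apply filter_imp. intros w [Hw1 Hw2]. assert (Hw0 : w <> RtoC 0) by (intros E; rewrite E in Hw2; simpl in Hw2; lra).
    transitivity (w * (w + 1) * (w - 1) * (e (beta * nu)%R * Ker 0 w))%C.
    { rewrite Ker_0 by lra. revert Hw0. generalize (w : C). intros u Hu. field. exact Hu. }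
    pose proof (Hv_0 Ci beta nu vertical_up Psi1 w HP1 HP1s Hw1) as E1. pose proof (Hv_0 (- Ci) (- beta) (- nu) vertical_down Psi2 w HP2 HP2s Hw1) as E2.
    rewrite cpow_Ci in E1. rewrite cpow_mCi in E2. replace (PI * Ci * - w / 2)%C with (- (PI * Ci * w / 2))%C in E1 by (unfold Cdiv; ring).
    replace (- (PI * Ci * - w / 2))%C with (PI * Ci * w / 2)%C in E2 by (unfold Cdiv; ring). rewrite <- E1, <- E2. fold y1 y2 Hp Hm.
    replace (e (y1 * nu)%R / Ci * Hp 0 w + e (y2 * - nu)%R / - Ci * Hm 0 w)%C with
      (e (y1 * nu)%R / Ci * Hp 0 w + e (y2 * - nu)%R / - Ci * Hm 0 w + delta beta * (w - 1) * 0)%C by ring.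
    pose proof (first_point_bounds beta) as Hy1. pose proof (first_point_bounds (- beta)) as Hy2. fold y1 in Hy1. fold y2 in Hy2.
    apply (tends_unique (at_right 0) (fun rho => w * (w + 1) * (w - 1) * (e (beta * nu)%R * Ker rho w))%C).
    + apply tends_mult; [apply _|cx|]. apply tends_mult; [apply _|cx|]. unfold Ker. apply kernel_lim; [apply first_point_bounds|lra].
    + apply (tends_ext_F (at_right 0) (fun rho => euler (w + INR 2) 1 * cpow (RtoC (2 * PI)) (- w) *
        (e (y1 * nu)%R / Ci * Hp rho w + e (y2 * - nu)%R / - Ci * Hm rho w + delta beta * (w - 1) * cpow (RtoC rho) (- w)))%C).
      { exists (mkposreal 1 Rlt_0_1). intros rho _ Hr. symmetry. now apply continued_split. }
      assert (HR : tends (at_right 0) RtoC (RtoC 0)).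
      { intros eps He. apply filter_le_within. now apply tends_RtoC. }
      apply tends_mult; [apply _|cx|]. apply tends_plus; [apply _|apply tends_plus; [apply _| |]|]; (apply tends_mult; [apply _|cx|]).
      * apply (Hv_tends Ci beta nu vertical_up w Hw1).
      * apply (Hv_tends (- Ci) (- beta) (- nu) vertical_down w Hw1).
      (* For [Re w < - 1] and [rho < 1] the term that comes from [beta + n = 0] is at most [rho], so
         it disappears in the limit. *)
      * apply (tends_0_bound (at_right 0) _ (fun rho => rho)).
        -- exists (mkposreal 1 Rlt_0_1). intros rho Hb Hr. change (Rabs (rho - 0) < 1) in Hb. apply Rabs_def2 in Hb.
           rewrite Cminus_0_r, Cmod_cpow_pos by exact Hr. rewrite <- (Rpower_1 rho) at 2 by exact Hr.
           change (Re (- w)) with (- Re w). unfold Rpower. apply exp_le_mono. assert (ln rho <= 0) by (rewrite <- ln_1; apply ln_le; lra). nra.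
        -- intros P HP. now apply filter_le_within.
Qed.
End FunctionalEquation.

Lemma removable_value f B s : hol B s -> cnear' s (fun w => f w = B w) -> has_value f s (B s).
Proof.
  intros HB H. apply has_value_tends. apply (tends_ext_F _ B).
  - revert H. apply filter_imp. cx.
  - apply tends_locally'. now apply hol_ccont.
Qed.

Lemma C_lim_value f s l : has_value f s l -> C_lim f s = l.
Proof. intros H. apply is_C_lim_unique. exact H. Qed.

Lemma locally'_reflect (s : C) (P : C -> Prop) : cnear' (1 - s)%C P ->
  cnear' s (fun w => P (1 - w)%C).
Proof.
  intros H. apply locally'_Cmod in H. destruct H as [d [Hd H]]. apply locally'_Cmod. exists d. split; [exact Hd|]. intros w Hw Hne. apply H.
  - replace (1 - w - (1 - s))%C with (- (w - s))%C by ring. now rewrite Cmod_opp.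
  - intros E. apply Hne. replace w with (1 - (1 - w))%C by ring. rewrite E. ring.
Qed.

(** [N] is [(s - 1)] times the left expression. [core_identity] at [s = 1] gives [N 1 = 0], that is,
    the two poles of psi cancel, and [B = N / (s - 1)] is entire. For the right expression,
    [core_identity] is solved for [B] near 2 and the result is continued. *)
Lemma calB2_spec beta nu : exists B, (forall s, hol B s) /\
  (forall s, cnear' s (fun w => calB2_left beta nu w = B w)) /\
  (forall s, cnear' s (fun w => calB2_right beta nu w = B w)).
Proof.
  destruct (psi_spec beta nu) as [Psi1 [H1 [S1 L1]]]. destruct (psi_spec (- beta) (- nu)) as [Psi2 [H2 [S2 L2]]].
  destruct (psi_spec nu (- beta)) as [Psi3 [H3 [S3 L3]]]. pose proof (core_identity beta nu Psi1 Psi2 Psi3 H1 S1 H2 S2 H3 S3) as HC.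
  set (N := fun s => (Cexp (- (PI * Ci * s / 2)) * Psi1 s + Cexp (PI * Ci * s / 2) * Psi2 s)%C) in *. assert (HN : forall s, hol N s).
  { intros s. apply hol_plus; apply hol_mult; auto; [apply hol_Cexp_mlin|apply hol_Cexp_lin]. }
  assert (HN1 : N 1 = 0).
  { pose proof (HC 1 ltac:(simpl; lra)) as E. change (N 1) with (Cexp (- (PI * Ci * 1 / 2)) * Psi1 1 + Cexp (PI * Ci * 1 / 2) * Psi2 1)%C.
    rewrite euler_shift_2, euler_1 in E by (simpl; lra). pose proof (cpow_nz (RtoC (2 * PI)) (- (1))) as Hnz.
    set (X := (Cexp (- (PI * Ci * 1 / 2)) * Psi1 1 + Cexp (PI * Ci * 1 / 2) * Psi2 1)%C) in *. generalize dependent (cpow (RtoC (2 * PI)) (- (1))).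
    intros q Hq Hqz. destruct (Ceq_dec X 0) as [|HX]; [auto|]. exfalso. assert (E2 : (2 * q * X)%C = 0).
    { transitivity (1 * (1 + 1) * 1 * q * X)%C; [ring|]. rewrite <- Hq. ring. }
    apply (Cmult_neq_0 _ _ (Cmult_neq_0 2 q (RtoC_nz 2 ltac:(lra)) Hqz) HX E2). }
  destruct (entire_divide N 1 HN HN1) as [B [HB1 HB2]]. exists B. split; [exact HB1|]. split.
  - intros s. assert (Hne : cnear' s (fun w : C => w <> RtoC 1)).
    { destruct (Ceq_dec s 1) as [->|Hs]; [apply locally'_ne|]. apply locally_locally'. apply (ccont_ne (fun z => z)); [apply hol_ccont, hol_id|exact Hs]. }
    generalize (filter_and _ _ (filter_and _ _ (L1 s) (L2 s)) Hne). apply filter_imp. intros w [[E1 E2] Hw]. unfold calB2_left. rewrite E1, E2.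
    transitivity (N w / (w - 1))%C; [unfold N; unfold Cdiv; ring|]. rewrite HB2.
    apply Cminus_nz in Hw. revert Hw. generalize (B w). generalize (w : C). intros u b Hu. field. exact Hu.
  - intros s. assert (L3' : forall s, cnear' s (fun w => calB2_right beta nu w =
      (e (beta * nu)%R * (cpow (RtoC (2 * PI)) w / Gamma w) * (Psi3 (1 - w) / - w))%C)).
    { intros t. generalize (locally'_reflect t _ (L3 (1 - t)%C)). apply filter_imp. intros w E. unfold calB2_right. rewrite E. f_equal. f_equal. ring. }
    assert (Hq : forall s, qmero (fun w => e (beta * nu)%R * (cpow (RtoC (2 * PI)) w / Gamma w) * (Psi3 (1 - w) / - w))%C s).
    { intros t. apply qmero_mult; [apply qmero_mult; [apply qmero_hol, hol_const|]|].
      - apply qmero_div; [|apply Gamma_qmero]. apply qmero_hol. cx.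
      - apply qmero_div; apply qmero_hol; [apply (hol_comp Psi3 (fun s => 1 - s)%C); [apply H3|cx]|cx]. }
    apply (qmero_identity_eq (fun _ => True) (calB2_right beta nu) B 2 s convex_all); auto.
    + intros t _. eapply qmero_ext; [|cx]. generalize (L3' t). apply filter_imp. cx.
    + intros t _. now apply qmero_hol.
    + generalize (filter_and _ _ (filter_and _ _ (L3' (RtoC 2)) (Gamma_nz (RtoC 2))) (locally_locally' _ _ (halfplane_locally 1 (RtoC 2) ltac:(simpl; lra)))).
      apply filter_imp. intros w [[E Hg] Hw]. rewrite E.
      pose proof (HC w ltac:(simpl; simpl in Hw; lra)) as HCw. change (Cexp (- (PI * Ci * w / 2)) * Psi1 w + Cexp (PI * Ci * w / 2) * Psi2 w)%C with (N w) in HCw. rewrite HB2, euler_shift_2 in HCw by lra.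
      rewrite <- (proj2 Gamma_spec) in HCw by lra. rewrite cpow_opp in HCw. pose proof (cpow_nz (RtoC (2 * PI)) w) as Hc. pose proof (minus_1_nz w Hw) as Hw1.
      assert (Hw0 : w <> RtoC 0) by (intros E0; rewrite E0 in Hw; simpl in Hw; lra). assert (Hw2 : (w + 1)%C <> RtoC 0).
      { intros E0. apply (f_equal Re) in E0. simpl in E0. unfold Re in *. lra. }
      revert Hg Hw1 Hw0 Hw2 Hc HCw. generalize (B w) (Gamma w) (cpow (RtoC (2 * PI)) w) (e (beta * nu)%R) (Psi3 (1 - w)%C). generalize (w : C).
      intros u b g c ee p Hg Hu1 Hu0 Hu2 Hc HE. assert (HE2 : (ee * p)%C = (- (u * g * / c * b))%C).
      { transitivity (- (- ((u + 1) * (u - 1) * (ee * p))) / ((u + 1) * (u - 1)))%C; [field; auto|]. rewrite HE. field; auto. }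
      transitivity ((ee * p) * c / (g * - u))%C; [field; auto|]. rewrite HE2. field; auto.
Qed.

Lemma calB2_value B beta nu : (forall s, hol B s) ->
  (forall s, cnear' s (fun w => calB2_left beta nu w = B w)) -> forall s, calB2 s beta nu = B s.
Proof. intros HB HL s. apply C_lim_value. apply removable_value; auto. Qed.

(** Multiplying B_2 of [(alpha, mu)] by [Cexp (PI * Ci * s / 2)] and that of [(- alpha, - mu)] by
    the inverse factor makes the coefficients of [psi s alpha mu] equal. The difference is [2 Ci
    Csin (PI * s) * psi s (- alpha) (- mu)], and half of it is B_1. *)
Lemma calB1_spec alpha mu : exists B, (forall s, hol B s) /\
  (forall s, cnear' s (fun w => calB1_left alpha mu w = B w)) /\
  (forall s, cnear' s (fun w => calB1_right alpha mu w = B w)).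
Proof.
  destruct (calB2_spec alpha mu) as [B1 [H1 [L1 R1]]]. destruct (calB2_spec (- alpha) (- mu)) as [B2 [H2 [L2 R2]]].
  exists (fun s => (Cexp (PI * Ci * s / 2) * B1 s - Cexp (- (PI * Ci * s / 2)) * B2 s) * / 2)%C. split; [|split].
  - intros s. apply hol_mult; [|cx]. apply hol_minus; apply hol_mult; auto; [apply hol_Cexp_lin|apply hol_Cexp_mlin].
  - intros s. generalize (filter_and _ _ (L1 s) (L2 s)). apply filter_imp. intros w [<- <-]. unfold calB1_left, calB2_left. rewrite !Ropp_involutive.
    assert (E : Csin (PI * w) = ((Cexp (PI * Ci * w / 2) * Cexp (PI * Ci * w / 2) - Cexp (- (PI * Ci * w / 2)) * Cexp (- (PI * Ci * w / 2))) / (2 * Ci))%C).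
    { unfold Csin. rewrite <- !Cexp_plus. f_equal. f_equal; f_equal; [|f_equal]; field. }
    rewrite E. pose proof Ci_nz as Hc. revert Hc.
    generalize (Cexp (PI * Ci * w / 2)) (Cexp (- (PI * Ci * w / 2))) (psi w (- alpha) (- mu)) (psi w alpha mu). generalize Ci. intros i a b p q Hi. field. exact Hi.
  - intros s. generalize (filter_and _ _ (R1 s) (R2 s)). apply filter_imp. intros w [<- <-].
    unfold calB1_right, calB2_right. rewrite !Ropp_involutive. replace (- alpha * - mu) with (alpha * mu) by ring.
    assert (E1 : Cexp (PI * Ci * (1 - w) / 2) = (Ci * Cexp (- (PI * Ci * w / 2)))%C).
    { replace (PI * Ci * (1 - w) / 2)%C with (PI * Ci * 1 / 2 + - (PI * Ci * w / 2))%C by field.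
      rewrite Cexp_plus. f_equal. rewrite <- cpow_Ci. apply cpow_1. apply Ci_nz. }
    assert (E2 : Cexp (- (PI * Ci * (1 - w) / 2)) = (- Ci * Cexp (PI * Ci * w / 2))%C).
    { replace (- (PI * Ci * (1 - w) / 2))%C with (- (PI * Ci * 1 / 2) + (PI * Ci * w / 2))%C by field.
      rewrite Cexp_plus. f_equal. rewrite <- cpow_mCi. apply cpow_1. intros E. apply (f_equal snd) in E. simpl in E. lra. }
    rewrite E1, E2. unfold Cdiv. replace (/ (2 * Gamma w))%C with (/ 2 * / Gamma w)%C.
    2:{ destruct (Ceq_dec (Gamma w) 0) as [->|Hg]; [rewrite Cmult_0_r, Cinv_0; ring|]. field. exact Hg. }
    unfold Cdiv. rewrite ?Cinv_mult. assert (Ei : (Ci * Ci)%C = (- (1))%C) by (ceq).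
    revert Ei. generalize (/ Gamma w)%C (cpow (RtoC (2 * PI)) w) (e (alpha * mu)%R) (psi (1 - w) mu (- alpha)) (psi (1 - w) (- mu) alpha).
    generalize (Cexp (PI * Ci * w * / 2)) (Cexp (- (PI * Ci * w * / 2))). generalize (/ 2)%C. generalize Ci. intros i h a b g c ee p q Ei.
    transitivity (ee * c * h * g * ((i * i) * b * q - (i * i) * a * p))%C; [ring|]. rewrite Ei. ring.
Qed.

Lemma Cmod_Sum_le {A} (f : A -> C) (g : A -> R) M : (forall a, Cmod (f a) <= g a) -> (forall L, NoDup L -> rsum g L <= M) -> Cmod (Sum f) <= M.
Proof.
  intros H HM. apply (has_sum_bound f (Sum f) M).
  - apply Sum_correct. apply summable_le with g; auto. now exists M.
  - intros L HL. eapply Rle_trans; [apply rsum_le, H|cx].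
Qed.

(** * The lattice sum *)

Section Family.
Context {A : Type}.
Variables (x nu : R) (n : nat) (q : R) (W : A -> R).
Hypothesis Hx : 0 <= x <= 1.
Hypothesis Hq : 0 < q.
Hypothesis HW : forall i, 1 <= W i.
Hypothesis HWs : rsummable (fun i => Rpower (W i) (- (2))).

(* [W] is the weight whose inverse square is summable; the lower bound is the one of the header. *)
Definition family (h : C) (phi b : A -> C) : Prop :=
  (forall i, Cmod (phi i) = 1) /\
  forall i t, 0 <= t <= 1 -> slit (b i - RtoC t * h) /\ Rpower (q * Cmod h * W i) (1 / 2) <= Cmod (b i - RtoC t * h).

Definition defect (h : C) (phi b : A -> C) (s : C) (i : A) : C := (phi i * em_defect x nu (n + 1) h (s - 1) (b i))%C.

(** The factor [|h|^(n+2)] of a defect competes with [lam^(-(Re s + n + 1))], where [lam] is the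
    square root of [q |h| W]; half of the powers of [h] is lost. The condition [3 - n <= s0] makes
    the exponent of [W] at most -2, and since [q |h| <= 1] the worst power of [h] occurs at
    [Re s = s1]. *)
Lemma defect_bound S s0 s1 : 3 - INR n <= s0 ->
  exists K, 0 <= K /\ forall h phi b, 0 < Cmod h -> q * Cmod h <= 1 -> family h phi b ->
    forall s i, Cmod (s - 1) <= S -> s0 <= Re s <= s1 ->
    Cmod (defect h phi b s i) <= K * Rpower (Cmod h) (INR n + 2 - (s1 + INR n + 1) / 2) * Rpower (W i) (- (2)).
Proof.
  intros Hs0. destruct (em_defect_bound x nu n S Hx) as [K [HK H]]. exists (K * Rpower q (- ((s1 + INR n + 1) / 2))). split; [pos|].
  intros h phi b Hh Hqh [Hphi Hf] s i HS Hs. unfold defect. rewrite Cmod_mult, Hphi, Rmult_1_l. set (lam := Rpower (q * Cmod h * W i) (1 / 2)).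
  assert (Hre : Re (s - 1) + INR (n + 2) = Re s + INR n + 1) by (rewrite plus_INR; simpl; unfold Re; ring). specialize (HW i). assert (Hqh0 : 0 < q * Cmod h) by pos.
  eapply Rle_trans; [apply (H h (s - 1)%C (b i) lam)|].
  - apply exp_pos.
  - cx.
  - exact HS.
  - lra.
  - rewrite Hre. set (M := Re s + INR n + 1). assert (E1 : Cmod h ^ (n + 2) = Rpower (Cmod h) (INR n + 2)).
    { rewrite <- Rpower_pow by exact Hh. f_equal. rewrite plus_INR. reflexivity. }
    assert (E2 : Rpower lam (- M) = Rpower (q * Cmod h) (- (M / 2)) * Rpower (W i) (- (M / 2))).
    { unfold lam. rewrite Rpower_mult, Rpower_mult_distr by lra. f_equal. field. }
    assert (E3 : Rpower (q * Cmod h) (- (M / 2)) <= Rpower (q * Cmod h) (- ((s1 + INR n + 1) / 2))).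
    { unfold Rpower. apply exp_le_mono. assert (ln (q * Cmod h) <= 0) by (rewrite <- ln_1; apply ln_le; lra).
      assert (0 <= ((s1 + INR n + 1) / 2 - M / 2)) by (unfold M; lra). nra. }
    assert (E4 : Rpower (W i) (- (M / 2)) <= Rpower (W i) (- (2))) by (apply Rle_Rpower; unfold M; lra).
    rewrite E1, E2. rewrite <- (Rpower_mult_distr q (Cmod h) (- ((s1 + INR n + 1) / 2))) in E3 by lra.
    replace (INR n + 2 - (s1 + INR n + 1) / 2) with ((INR n + 2) + - ((s1 + INR n + 1) / 2)) by ring. rewrite (Rpower_plus (INR n + 2) (- ((s1 + INR n + 1) / 2))).
    set (u := Rpower (Cmod h) (INR n + 2)) in *.
    replace (K * Rpower q (- ((s1 + INR n + 1) / 2)) * (u * Rpower (Cmod h) (- ((s1 + INR n + 1) / 2))) * Rpower (W i) (- (2))) with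
      (K * u * (Rpower q (- ((s1 + INR n + 1) / 2)) * Rpower (Cmod h) (- ((s1 + INR n + 1) / 2)) * Rpower (W i) (- (2)))) by ring.
    apply Rmult_le_compat_l; [pos|]. apply Rmult_le_compat; try (left; apply exp_pos); auto.
Qed.

Lemma defect_summable h phi b s : 0 < Cmod h -> q * Cmod h <= 1 -> family h phi b -> 3 - INR n <= Re s -> summable (defect h phi b s).
Proof.
  intros Hh Hqh Hf Hs. destruct (defect_bound (Cmod (s - 1)) (Re s) (Re s) Hs) as [K [HK H]].
  eapply summable_le; [intros i; apply H; auto; lra|]. apply rsummable_scal; [|exact HWs]. pos.
Qed.

Lemma defect_sum_bound S s0 s1 : 3 - INR n <= s0 ->
  exists K, 0 <= K /\ forall h phi b, 0 < Cmod h -> q * Cmod h <= 1 -> family h phi b ->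
    forall s, Cmod (s - 1) <= S -> s0 <= Re s <= s1 ->
    Cmod (Sum (defect h phi b s)) <= K * Rpower (Cmod h) (INR n + 2 - (s1 + INR n + 1) / 2).
Proof.
  intros Hs0. destruct (defect_bound S s0 s1 Hs0) as [K [HK H]]. destruct HWs as [M HM].
  assert (HM0 : 0 <= M). { apply (Rle_trans _ (rsum (fun i => Rpower (W i) (- (2))) nil)); [simpl; lra|apply HM; constructor]. }
  exists (K * M). split; [pos|]. intros h phi b Hh Hqh Hf s HS Hs. set (P := Rpower (Cmod h) (INR n + 2 - (s1 + INR n + 1) / 2)) in *.
  apply (Cmod_Sum_le _ (fun i => (K * P) * Rpower (W i) (- (2)))); [cx|]. intros L HL. rewrite rsum_scal. replace (K * M * P) with (K * P * M) by ring.
  apply Rmult_le_compat_l; [pos|cx].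
Qed.

Lemma defect_sum_hol h phi b s : 0 < Cmod h -> q * Cmod h <= 1 -> family h phi b -> 3 - INR n < Re s ->
  hol (fun s => Sum (defect h phi b s)) s.
Proof.
  intros Hh Hqh Hf Hs. set (r := (Re s - (3 - INR n)) / 2). assert (Hr : 0 < r) by pos.
  destruct (defect_bound (Cmod (s - 1) + r) (Re s - r) (Re s + r) ltac:(unfold r; lra)) as [K [HK H]]. apply (hol_Sum (fun i s => defect h phi b s i)
    (fun i => K * Rpower (Cmod h) (INR n + 2 - (Re s + r + INR n + 1) / 2) * Rpower (W i) (- (2))) s r s Hr).
  - intros i w _. unfold defect. apply hol_mult; [cx|]. apply (hol_em_defect (fun s => s - 1)%C), hol_minus_id.
  - intros i w Hw. apply H; auto.
    + pose proof (Cmod_triangle3 w s 1). lra.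
    + pose proof (Rabs_fst_le (w - s)) as H1. change (fst (w - s)%C) with (Re w - Re s) in H1. apply Rabs_le_between in H1. lra.
  - apply rsummable_scal; [|exact HWs]. pos.
  - replace (s - s)%C with (RtoC 0) by ring. rewrite Cmod_0. lra.
Qed.

End Family.

(* At p = 0 only [gam 0] survives in the defect, and [(e nu - 1) * gam 0 = 0]. *)
Lemma em_defect_0 x nu n h b : em_defect x nu n h 0 b = 0.
Proof.
  assert (Hrf : forall k, rf 0 (S k) = 0).
  { induction k; [simpl; ring|]. change (rf 0 (S (S k))) with (rf 0 (S k) * (0 + INR (S k)))%C. rewrite IHk. ring. }
  assert (Hd : forall b, dot (gam x nu) (Phi h 0 b) n = gam x nu O).
  { intros b'. induction n.
    - cbn [dot]. unfold Phi. cbn [rf Cpow]. replace (- 0 - INR 0)%C with (RtoC 0) by (simpl; ring). rewrite cpow_0. ring.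
    - rewrite dot_S, IHn. unfold Phi. rewrite Hrf. ring. }
  pose proof (gam_conv x nu 0) as H. cbn [conv rhs_coef] in H. assert (E1 : expc 1 0 = 1). { unfold expc. simpl. field. }
  rewrite E1 in H. unfold em_defect. rewrite !Hd. unfold Phi. rewrite Hrf. etransitivity; [|exact H]. ring.
Qed.

(** * Geometry of the sector *)

Definition sector (kap : R) (tau : C) : Prop := 0 < Cmod tau /\ kap * Cmod tau <= Re tau.

(** The real part divided by the modulus is the cosine of the argument, at least
    [cos (PI / 2 - eta) = sin eta]. *)
Lemma arg_sector tau eta : 0 < eta < PI / 2 -> 0 < Cmod tau -> Rabs (arg_p tau) <= PI / 2 - eta -> sector (sin eta) tau.
Proof.
  intros He Ht Ha. split; [exact Ht|]. assert (Hn : tau <> 0) by (intros E; rewrite E, Cmod_0 in Ht; lra).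
  destruct (arg_p_spec tau Hn) as [H _]. rewrite <- H, Rmult_comm. apply Rmult_le_compat_l; [lra|]. rewrite <- cos_shift.
  assert (E : cos (arg_p tau) = cos (Rabs (arg_p tau))).
  { unfold Rabs. destruct (Rcase_abs _); [now rewrite cos_neg|cx]. }
  rewrite E. pose proof (Rabs_pos (arg_p tau)). apply cos_decr_1; lra.
Qed.

Section Sector.
Variables (kap : R) (tau : C).
Hypothesis Hk : 0 < kap.
Hypothesis Ht : sector kap tau.
Let h : C := (Ci * tau)%C.

Lemma Cmod_h : Cmod h = Cmod tau.
Proof. unfold h. rewrite Cmod_mult, Cmod_Ci. ring. Qed.

Lemma Re_tau_pos : 0 < Re tau.
Proof. destruct Ht as [H1 H2]. nra. Qed.

Lemma base_Im (a y : R) : Im (a + y * h)%C = y * Re tau.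
Proof. unfold h. simpl. unfold Im, Re. simpl. ring. Qed.

(** The imaginary part [y Re tau] controls [kap |h| |y|], and the triangle inequality then controls
    [|a|] by the modulus plus [|h| |y|]. Adding [kap] times the second bound to twice the first
    gives the constant [kap / (kap + 2)]. *)
Lemma sector_lower (a y : R) : kap / (kap + 2) * (Rabs a + Cmod h * Rabs y) <= Cmod (a + y * h)%C.
Proof.
  destruct Ht as [H1 H2]. rewrite Cmod_h. assert (E1 : kap * (Cmod tau * Rabs y) <= Cmod (a + y * h)%C).
  { eapply Rle_trans; [|apply Rabs_snd_le]. change (snd (a + y * h)%C) with (Im (a + y * h)%C). rewrite base_Im, Rabs_mult.
    rewrite (Rabs_pos_eq (Re tau)) by (left; apply Re_tau_pos). pose proof (Rabs_pos y). nra. }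
  assert (E2 : Rabs a <= Cmod (a + y * h)%C + Cmod tau * Rabs y).
  { rewrite <- (Cmod_R a). replace (RtoC a) with ((a + y * h) - y * h)%C by ring. ctrim.
    rewrite Cmod_mult, Cmod_h, Cmod_R. replace (a + y * h - y * h + y * h)%C with (a + y * h)%C by ring. lra. }
  apply Rmult_le_reg_l with (kap + 2); [lra|].
  replace ((kap + 2) * (kap / (kap + 2) * (Rabs a + Cmod tau * Rabs y))) with (kap * (Rabs a + Cmod tau * Rabs y)) by (field; lra). nra.
Qed.

Lemma base_slit (a y : R) : 0 < a \/ y <> 0 -> slit (a + y * h)%C.
Proof.
  intros H. destruct (Req_dec_T y 0) as [E|E].
  - destruct H as [H|H]; [|lra]. left. subst y. simpl. lra.
  - right. rewrite base_Im. apply Rmult_integral_contrapositive_currified; [exact E|]. apply Rgt_not_eq, Re_tau_pos.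
Qed.

Lemma good_base a : 0 < a -> good (kap / (kap + 2) * Rmin a (Cmod h)) (RtoC a) h.
Proof.
  intros Ha. pose proof (Rmin_l a (Cmod h)). pose proof (Rmin_r a (Cmod h)). destruct Ht as [H1 _]. assert (Hc : 0 < kap / (kap + 2)) by pos. split.
  - apply Rmult_lt_0_compat; [exact Hc|]. apply Rmin_pos; [exact Ha|]. now rewrite Cmod_h.
  - intros t Htt. split; [apply base_slit; now left|]. eapply Rle_trans; [|apply sector_lower].
    rewrite Rmult_assoc. apply Rmult_le_compat_l; [lra|]. rewrite !Rabs_pos_eq by lra. nra.
Qed.

(* AM-GM; [y] may fall short of the weight [j1] by a bounded amount, absorbed for small [h]. *)
Lemma weight_lower (a0 a y k1 j1 : R) : 0 < a0 -> 1 <= k1 -> 1 <= j1 -> a0 * k1 <= a -> Cmod h * (j1 - Rabs y) <= a / 2 + Cmod h * j1 / 2 ->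
  Rpower (((kap / (kap + 2)) ^ 2 * a0) * Cmod h * (k1 * j1)) (1 / 2) <= Cmod (a + y * h)%C.
Proof.
  intros Ha0 Hk1 Hj1 Ha Hy. destruct Ht as [H1 _]. rewrite <- Cmod_h in H1. set (c := kap / (kap + 2)). assert (Hc : 0 < c) by pos. assert (Ha' : 0 < a) by nra.
  assert (Hu : 0 < Cmod h * j1) by nra. apply Rle_trans with (c * ((a + Cmod h * j1) / 2)).
  - assert (HX : 0 < c * ((a + Cmod h * j1) / 2)) by pos. assert (E : c * ((a + Cmod h * j1) / 2) = Rpower ((c * ((a + Cmod h * j1) / 2)) ^ 2) (1 / 2)).
    { rewrite <- Rpower_pow, Rpower_mult by exact HX. replace (INR 2 * (1 / 2)) with 1 by (simpl; field). now rewrite Rpower_1. }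
    rewrite E. apply Rle_Rpower_l; [lra|]. split.
    + pos.
    + apply Rle_trans with (c ^ 2 * (a * (Cmod h * j1))).
      * replace (c ^ 2 * a0 * Cmod h * (k1 * j1)) with (c ^ 2 * ((a0 * k1) * (Cmod h * j1))) by ring. apply Rmult_le_compat_l; [pos|]. apply Rmult_le_compat_r; lra.
      * rewrite Rpow_mult_distr. apply Rmult_le_compat_l; [pos|]. pose proof (pow2_ge_0 (a - Cmod h * j1)). nra.
  - eapply Rle_trans; [|apply sector_lower]. fold c. apply Rmult_le_compat_l; [lra|]. rewrite (Rabs_pos_eq a) by lra. lra.
Qed.
End Sector.

Lemma point_lower (gamma : R) : exists c, 0 < c /\ forall m : Z, gamma + IZR m <> 0 -> c * (Rabs (IZR m) + 1) <= Rabs (gamma + IZR m).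
Proof.
  pose proof (first_point_bounds gamma) as H1. pose proof (first_point_bounds (- gamma)) as H2.
  set (d := Rmin (first_point gamma) (first_point (- gamma))). assert (Hd : 0 < d) by pos. pose proof (Rabs_pos gamma) as Hg.
  assert (Hm : forall m : Z, gamma + IZR m <> 0 -> d <= Rabs (gamma + IZR m)).
  { intros m Hm. destruct (Rtotal_order 0 (gamma + IZR m)) as [H|[H|H]]; [|lra|].
    - destruct (positive_index gamma m ltac:(lra)) as [n ->]. rewrite first_index_point, Rabs_pos_eq by (pose proof (pos_INR n); lra).
      pose proof (pos_INR n). pose proof (Rmin_l (first_point gamma) (first_point (- gamma))). unfold d. lra.
    - destruct (positive_index (- gamma) (- m)) as [n Hn]; [rewrite opp_IZR; lra|]. pose proof (first_index_point (- gamma) n) as E. rewrite <- Hn, opp_IZR in E.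
      rewrite <- Rabs_Ropp. replace (- (gamma + IZR m)) with (- gamma + - IZR m) by ring. rewrite E, Rabs_pos_eq by lra.
      pose proof (pos_INR n). pose proof (Rmin_r (first_point gamma) (first_point (- gamma))). unfold d. lra. }
  exists (d / (d + Rabs gamma + 1)). split; [pos|]. intros m Hne. specialize (Hm m Hne). assert (Ht : Rabs (IZR m) <= Rabs (gamma + IZR m) + Rabs gamma).
  { replace (IZR m) with ((gamma + IZR m) - gamma) at 1 by ring. rtri. rewrite Rabs_Ropp. lra. }
  apply Rmult_le_reg_l with (d + Rabs gamma + 1); [lra|].
  replace ((d + Rabs gamma + 1) * (d / (d + Rabs gamma + 1) * (Rabs (IZR m) + 1))) with (d * (Rabs (IZR m) + 1)) by (field; lra). nra.
Qed.

Lemma arg_m_bound (z : C) : Rabs (arg_m z) <= PI.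
Proof. unfold arg_m. pose proof (acos_bound (Re z / Cmod z)). apply Rabs_le. destruct (Rlt_dec 0 (Im z)); lra. Qed.

Lemma arg_m_slit (z : C) : slit z -> arg_m z = arg_p z.
Proof.
  intros H. unfold arg_m, arg_p. destruct (Rlt_dec 0 (Im z)), (Rle_dec 0 (Im z)); try lra; try reflexivity.
  assert (E : Im z = 0) by lra. destruct H as [H|H]; [|lra]. assert (Ez : z = RtoC (Re z)) by (apply injective_projections; [cx|exact E]).
  assert (Er : Re z / Cmod z = 1). { rewrite Ez at 2. rewrite Cmod_R, Rabs_pos_eq by lra. field. lra. }
  rewrite Er, acos_1. ring.
Qed.

Lemma Log_neg (w : C) : Im w < 0 -> Log (- w) = (Log w + PI * Ci)%C.
Proof.
  intros H. assert (Hw : w <> 0) by (intros E; rewrite E in H; simpl in H; lra). pose proof (arg_p_gt w Hw) as Hg. assert (Hneg : arg_p w <= 0).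
  { unfold arg_p. pose proof (acos_bound (Re w / Cmod w)). destruct (Rle_dec 0 (Im w)); lra. }
  apply Log_unique.
  - simpl; lra.
  - rewrite Cexp_plus, Cexp_Log by exact Hw. assert (E : Cexp (PI * Ci) = (- (1))%C).
    { assert (E1 : Re (PI * Ci) = 0) by (simpl; unfold Re; simpl; ring). assert (E2 : Im (PI * Ci) = PI) by (simpl; unfold Im; simpl; ring).
      unfold Cexp. rewrite E1, E2, exp_0, cos_PI, sin_PI. ceq. }
    rewrite E. ring.
Qed.

Lemma cpow_neg_lower (w u : C) : Im w < 0 -> cpow (- w) u = (Cexp (PI * Ci * u) * cpow w u)%C.
Proof. intros H. rewrite !cpow_Log, Log_neg, <- Cexp_plus by exact H. f_equal. ring. Qed.

Lemma cpow_neg_upper (w u : C) : 0 < Im w -> cpow (- w) u = (Cexp (- (PI * Ci * u)) * cpow w u)%C.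
Proof.
  intros H. pose proof (cpow_neg_lower (- w) u) as E. replace (- - w)%C with w in E by ring. rewrite E.
  - rewrite Cmult_assoc, <- Cexp_plus. replace (- (PI * Ci * u) + PI * Ci * u)%C with (RtoC 0) by ring. rewrite Cexp_0. ring.
  - simpl. unfold Im in *. lra.
Qed.

(** On the negative axis the two conventions for the argument differ, and the mean of the two
    factors is what [F_avg] sees there. *)
Lemma cpow_arg_neg_real (a : R) (u : C) : 0 < a ->
  cpow_arg arg_p (- a)%C u = (Cexp (PI * Ci * u) * cpow a u)%C /\ cpow_arg arg_m (- a)%C u = (Cexp (- (PI * Ci * u)) * cpow a u)%C.
Proof.
  intros Ha. assert (Hm : Cmod (- a) = a) by (rewrite Cmod_opp, Cmod_R, Rabs_pos_eq; lra).
  assert (Hi : Im (- a)%C = 0) by (simpl; unfold Im; simpl; ring). assert (Hr : Re (- a)%C = - a) by reflexivity.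
  assert (Hq : Re (- a)%C / Cmod (- a) = - (1)) by (rewrite Hm, Hr; field; lra). assert (Hac : acos (- (1)) = PI) by (rewrite acos_opp, acos_1; ring).
  rewrite !cpow_pos by exact Ha. unfold cpow_arg. rewrite Hm. rewrite <- !Cexp_plus. split; f_equal.
  - unfold arg_p. rewrite Hi, Hq, Hac. destruct (Rle_dec 0 0); [|lra]. ceq.
  - unfold arg_m. rewrite Hi, Hq, Hac. destruct (Rlt_dec 0 0); [lra|]. ceq.
Qed.

Lemma Cmod_cpow_arg_le arg (z w : C) : Rabs (arg z) <= PI -> 0 < Cmod z -> Cmod (cpow_arg arg z w) <= Rpower (Cmod z) (Re w) * exp (PI * Rabs (Im w)).
Proof.
  intros Ha Hz. unfold cpow_arg. rewrite Cmod_Cexp. unfold Rpower. rewrite <- exp_plus. apply exp_le_mono.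
  change (Re (w * (ln (Cmod z), arg z))) with (Re w * ln (Cmod z) - Im w * arg z). apply Rplus_le_compat_l.
  eapply Rle_trans; [apply Rle_abs|]. rewrite Rabs_Ropp, Rabs_mult, Rmult_comm. apply Rmult_le_compat_r; [pos|exact Ha].
Qed.

Definition Eterm (beta nu : R) (h s : C) (a : R) (n : Z) : C :=
  (e ((beta + IZR n) * nu)%R * cpow (a + RtoC (beta + IZR n) * h) (- s))%C.

Section Lattice.
Variables (kap : R) (tau : C).
Hypothesis Hk : 0 < kap.
Hypothesis Ht : sector kap tau.
Let h : C := (Ci * tau)%C.

Lemma base_zero (a y : R) : (a + y * h)%C = 0 -> a = 0 /\ y = 0.
Proof.
  intros E. pose proof (sector_lower kap tau Hk Ht a y) as H. fold h in H. rewrite E, Cmod_0 in H. assert (Hc : 0 < kap / (kap + 2)) by pos.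
  assert (Hh : 0 < Cmod h) by (unfold h; rewrite Cmod_h; apply Ht). pose proof (Rabs_pos a). pose proof (Rabs_pos y).
  assert (Ha : Rabs a + Cmod h * Rabs y <= 0) by nra. assert (0 <= Cmod h * Rabs y) by nra. assert (Ey : Rabs y = 0) by nra.
  split; [destruct (Req_dec_T a 0) as [|N]|destruct (Req_dec_T y 0) as [|N]]; auto; apply Rabs_no_R0 in N; lra.
Qed.

Lemma weight_base alpha beta : exists K, 0 < K /\ forall m n : Z, (RtoC (alpha + IZR m) + RtoC (beta + IZR n) * h)%C <> 0 ->
  (Rabs (IZR m) + 1) * (Rabs (IZR n) + 1) <= K * Cmod (RtoC (alpha + IZR m) + RtoC (beta + IZR n) * h)%C ^ 2.
Proof.
  destruct (point_lower alpha) as [ca [Hca Ha]]. destruct (point_lower beta) as [cb [Hcb Hb]]. assert (Hh : 0 < Cmod h) by (unfold h; rewrite Cmod_h; apply Ht).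
  set (c := kap / (kap + 2)). assert (Hc : 0 < c) by pos. pose proof (Rabs_pos alpha) as Pa. pose proof (Rabs_pos beta) as Pb.
  set (U := (Rabs beta + 2) / ca). set (V := (Rabs alpha + 2) / cb). assert (HU : 0 < U) by pos. assert (HV : 0 < V) by pos.
  set (T := U + 1 + (V + 1) / Cmod h). assert (HT : 0 < (V + 1) / Cmod h) by pos. assert (Hsh : forall g j, Rabs (IZR j) <= Rabs (g + IZR j) + Rabs g).
  { intros g j. replace (IZR j) with ((g + IZR j) - g) at 1 by ring. rtri. rewrite Rabs_Ropp. lra. }
  assert (Hpt : forall k w x u, 0 < k -> 0 <= u -> 0 <= w -> k * (u + 1) <= x -> u + 1 + (w + 1) <= (w + 2) / k * x).
  { intros k w x u Hk' Hu Hw Hx. apply Rle_trans with ((w + 2) / k * (k * (u + 1))); [|apply Rmult_le_compat_l; [pos|exact Hx]].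
    replace ((w + 2) / k * (k * (u + 1))) with ((w + 2) * (u + 1)) by (field; lra). nra. }
  exists (T ^ 2 / c ^ 2). split; [assert (0 < T) by (unfold T; lra); pos|]. intros m n Hne.
  pose proof (Hsh alpha m) as Sm. pose proof (Hsh beta n) as Sn. specialize (Ha m). specialize (Hb n).
  set (a := alpha + IZR m) in *. set (y := beta + IZR n) in *. set (B := Cmod (a + y * h)%C).
  assert (HB : c * (Rabs a + Cmod h * Rabs y) <= B) by apply (sector_lower kap tau Hk Ht).
  pose proof (Rabs_pos (IZR m)) as Pm. pose proof (Rabs_pos (IZR n)) as Pn. pose proof (Rabs_pos a) as Qa. pose proof (Rabs_pos y) as Qy.
  assert (Hs : Rabs (IZR m) + 1 + (Rabs (IZR n) + 1) <= T * (Rabs a + Cmod h * Rabs y)).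
  { apply Rle_trans with ((U + 1) * Rabs a + (V + 1) * Rabs y).
    - destruct (Req_dec_T a 0) as [Ea|Ea].
      + assert (Ey : y <> 0) by (intros Ey; apply Hne; rewrite Ea, Ey; ring).
        pose proof (Hpt cb (Rabs alpha) _ _ Hcb Pn Pa (Hb Ey)) as H. fold V in H. rewrite Ea, Rabs_R0 in *. lra.
      + pose proof (Hpt ca (Rabs beta) _ _ Hca Pm Pb (Ha Ea)) as H. fold U in H. pose proof (Rmult_le_pos V (Rabs y)). lra.
    - unfold T. replace ((U + 1) * Rabs a + (V + 1) * Rabs y) with ((U + 1) * Rabs a + (V + 1) / Cmod h * (Cmod h * Rabs y)) by (field; lra).
      pose proof (Rmult_le_pos (Cmod h) (Rabs y)). nra. }
  set (S := Rabs a + Cmod h * Rabs y) in *. apply Rle_trans with ((T * S) ^ 2); [nra|]. replace ((T * S) ^ 2) with (T ^ 2 / c ^ 2 * (c * S) ^ 2) by (field; lra).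
  apply Rmult_le_compat_l; [unfold T; pos|]. apply pow_incr. split; [|exact HB]. apply Rmult_le_pos; [lra|].
  unfold S. pose proof (Rmult_le_pos (Cmod h) (Rabs y)). lra.
Qed.

Lemma lattice_power_bound alpha beta s : 0 <= Re s -> exists K, 0 <= K /\ forall arg, (forall z, Rabs (arg z) <= PI) -> forall m n : Z,
  (RtoC (alpha + IZR m) + RtoC (beta + IZR n) * h)%C <> 0 ->
  Cmod (cpow_arg arg (RtoC (alpha + IZR m) + RtoC (beta + IZR n) * h) (- s)) <=
  K * (Rpower (Rabs (IZR m) + 1) (- (Re s / 2)) * Rpower (Rabs (IZR n) + 1) (- (Re s / 2))).
Proof.
  intros Hs. destruct (weight_base alpha beta) as [K [HK H]]. exists (exp (PI * Rabs (Im s)) * Rpower (/ K) (- (Re s / 2))). split; [pos|].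
  intros arg Harg m n Hne. specialize (H m n Hne). pose proof (Cmod_pos _ Hne) as Hp. set (B := Cmod _) in *.
  eapply Rle_trans; [apply Cmod_cpow_arg_le; [apply Harg|exact Hp]|]. fold B.
  change (Re (- s)) with (- Re s). change (Im (- s)) with (- Im s). rewrite Rabs_Ropp, Rmult_comm, Rmult_assoc. apply Rmult_le_compat_l; [pos|].
  pose proof (Rabs_pos (IZR m)). pose proof (Rabs_pos (IZR n)). assert (HiK : 0 < / K) by now apply Rinv_0_lt_compat.
  rewrite !Rpower_mult_distr; [|exact HiK|nra|lra|lra]. replace (Rpower B (- Re s)) with (Rpower (B ^ 2) (- (Re s / 2))).
  - apply Rpower_le_base; [|lra]. split; [pos|]. apply Rmult_le_reg_l with K; [exact HK|]. rewrite <- Rmult_assoc, Rinv_r, Rmult_1_l by lra. exact H.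
  - rewrite <- Rpower_pow, Rpower_mult by exact Hp. f_equal. simpl. field.
Qed.

Lemma F_term_summable arg alpha beta mu nu s : (forall z, Rabs (arg z) <= PI) -> 2 < Re s -> summable (F_term arg s alpha beta mu nu h).
Proof.
  intros Harg Hs. destruct (lattice_power_bound alpha beta s ltac:(lra)) as [K [HK H]].
  apply summable_le with (fun p : Z * Z => K * (Rpower (Rabs (IZR (fst p)) + 1) (- (Re s / 2)) * Rpower (Rabs (IZR (snd p)) + 1) (- (Re s / 2)))).
  - intros [m n]. unfold F_term. cbn [fst snd]. destruct (Ceq_dec _ _) as [E|E].
    + rewrite Cmod_0. pos.
    + rewrite Cmod_mult, Cmod_e, Rmult_1_l. now apply H.
  - apply rsummable_scal; [exact HK|]. apply (rsummable_prod (fun m => Rpower (Rabs (IZR m) + 1) (- (Re s / 2))) (fun n => Rpower (Rabs (IZR n) + 1) (- (Re s / 2)))).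
    1, 2: intros; left; apply exp_pos. all: apply rsummable_Z_power; lra.
Qed.

Lemma Eterm_summable alpha beta nu s m : 2 < Re s -> 0 < alpha + IZR m -> summable (Eterm beta nu h s (alpha + IZR m)).
Proof.
  intros Hs Ha. destruct (lattice_power_bound alpha beta s ltac:(lra)) as [K [HK H]].
  apply summable_le with (fun n : Z => (K * Rpower (Rabs (IZR m) + 1) (- (Re s / 2))) * Rpower (Rabs (IZR n) + 1) (- (Re s / 2))).
  - intros n. unfold Eterm. rewrite Cmod_mult, Cmod_e, Rmult_1_l, Rmult_assoc.
    apply (H arg_p); [intros z; apply Rabs_le, arg_p_bound|]. intros E. apply base_zero in E. lra.
  - apply rsummable_scal; [pos|]. apply rsummable_Z_power. lra.
Qed.
End Lattice.

(** * The lattice sum row by row *)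

Section Split.
Variables (kap : R) (tau : C) (alpha beta mu nu : R) (s : C).
Hypothesis Hk : 0 < kap.
Hypothesis Ht : sector kap tau.
Hypothesis Hs : 2 < Re s.
Let h : C := (Ci * tau)%C.

(** The mean of both branches; at nonzero points it differs from the principal power only on the
    negative real axis. *)
Definition F_avg (p : Z * Z) : C := ((F_term arg_p s alpha beta mu nu h p + F_term arg_m s alpha beta mu nu h p) * / 2)%C.

Lemma F_term_nonzero arg m n : (RtoC (alpha + IZR m) + RtoC (beta + IZR n) * h)%C <> 0 ->
  F_term arg s alpha beta mu nu h (m, n) =
  (e ((alpha + IZR m) * mu + (beta + IZR n) * nu)%R * cpow_arg arg (RtoC (alpha + IZR m) + RtoC (beta + IZR n) * h) (- s))%C.
Proof. intros H. unfold F_term. destruct (Ceq_dec _ _) as [E|E]; [contradiction|cx]. Qed.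

Lemma F_avg_slit m n : slit (RtoC (alpha + IZR m) + RtoC (beta + IZR n) * h)%C ->
  F_avg (m, n) = (e ((alpha + IZR m) * mu + (beta + IZR n) * nu)%R * cpow (RtoC (alpha + IZR m) + RtoC (beta + IZR n) * h) (- s))%C.
Proof.
  intros H. pose proof (slit_nz _ H) as Hn. unfold F_avg. rewrite !F_term_nonzero by exact Hn.
  assert (E : cpow_arg arg_m (RtoC (alpha + IZR m) + RtoC (beta + IZR n) * h) (- s) = cpow (RtoC (alpha + IZR m) + RtoC (beta + IZR n) * h) (- s)).
  { unfold cpow, cpow_arg. now rewrite arg_m_slit. }
  rewrite E. fold cpow. field.
Qed.

Lemma F_avg_summable : summable F_avg.
Proof.
  destruct (F_term_summable kap tau Hk Ht arg_p alpha beta mu nu s ltac:(intros z; apply Rabs_le, arg_p_bound) Hs) as [M HM].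
  destruct (F_term_summable kap tau Hk Ht arg_m alpha beta mu nu s arg_m_bound Hs) as [M' HM'].
  eapply summable_le with (g := fun p => (Cmod (F_term arg_p s alpha beta mu nu h p) + Cmod (F_term arg_m s alpha beta mu nu h p))).
  - intros p. unfold F_avg. rewrite Cmod_mult. rewrite Cmod_inv by (apply RtoC_nz; lra). rewrite Cmod_R, Rabs_pos_eq by lra.
    pose proof (Cmod_triangle (F_term arg_p s alpha beta mu nu h p) (F_term arg_m s alpha beta mu nu h p)).
    pose proof (Cmod_ge_0 (F_term arg_p s alpha beta mu nu h p + F_term arg_m s alpha beta mu nu h p)). lra.
  - apply rsummable_plus; [now exists M|now exists M'].
Qed.

Lemma slice_right k : Sum (fun n => F_avg (first_index alpha + Z.of_nat k, n)%Z) =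
  (e ((first_point alpha + INR k) * mu)%R * Sum (Eterm beta nu h s (first_point alpha + INR k)))%C.
Proof.
  pose proof (first_point_bounds alpha) as Ha. pose proof (pos_INR k) as Hkk. apply Sum_unique. eapply has_sum_ext; [|apply has_sum_scal, Sum_correct].
  - intros n. cbv beta. rewrite F_avg_slit; rewrite first_index_point.
    + unfold Eterm. rewrite (RtoC_plus (_ * mu)), e_plus. ring.
    + apply (base_slit kap tau Hk Ht). left. lra.
  - rewrite <- first_index_point. apply (Eterm_summable kap tau Hk Ht); [exact Hs|]. rewrite first_index_point. lra.
Qed.

Lemma Csin_exp : (2 * Ci * Csin (PI * s))%C = (Cexp (PI * Ci * s) - Cexp (- (PI * Ci * s)))%C.
Proof.
  unfold Csin. replace (Ci * (PI * s))%C with (PI * Ci * s)%C by ring. pose proof Ci_nz as H. revert H.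
  generalize (Cexp (PI * Ci * s)) (Cexp (- (PI * Ci * s))). generalize Ci. intros i a b H. field. exact H.
Qed.

(** The half line in [slice_left] starts at this point, which is how the fractional part of [beta]
    enters as the argument of the C_k. *)
Lemma frac_part_point : first_point (- beta) = 1 - frac_part beta.
Proof. unfold first_point, first_index, frac_part, Int_part. rewrite Ropp_involutive, minus_IZR. ring. Qed.

Lemma frac_bounds : 0 <= frac_part beta <= 1.
Proof. destruct (base_fp beta). lra. Qed.

(** After [n] is replaced by [- n] the points are [- (a + y h)] with [a > 0]. Taking out the sign
    gives [exp (- PI i s)] for [y < 0] and [exp (PI i s)] for [y > 0], and the mean of both for
    [y = 0]. Relative to [exp (- PI i s)] on the full line, this is an excess of [2 i sin (PI s)] on
    the half line [y > 0] and of half that amount at [y = 0], the source of the B_1 term. *)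
Lemma slice_left k (a := first_point (- alpha) + INR k) : Sum (fun n => F_avg (- (first_index (- alpha) + Z.of_nat k), n)%Z) =
  (e (a * - mu)%R * (Cexp (- (PI * Ci * s)) * Sum (Eterm (- beta) (- nu) h s a) +
     2 * Ci * Csin (PI * s) * Sum (Zterm (frac_part beta) nu a h s) + delta beta * (Ci * Csin (PI * s) * cpow a (- s))))%C.
Proof.
  pose proof (first_point_bounds (- alpha)) as Hb. pose proof (pos_INR k) as Hkk. assert (Ha : 0 < a) by (unfold a; lra).
  set (m := (- (first_index (- alpha) + Z.of_nat k))%Z). assert (Em : alpha + IZR m = - a) by (unfold m, a; rewrite opp_IZR, <- first_index_point; ring).
  set (t := Eterm (- beta) (- nu) h s a). set (f2 := fun n => if Rlt_dec 0 (- beta + IZR n) then (2 * Ci * Csin (PI * s) * t n)%C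
                      else if Req_dec_T (- beta + IZR n) 0 then (Ci * Csin (PI * s) * t n)%C else 0%C).
  assert (Hpt : forall n, F_avg (m, - n)%Z = (e (a * - mu)%R * (Cexp (- (PI * Ci * s)) * t n + f2 n))%C).
  { intros n. set (y := - beta + IZR n). assert (Ey : beta + IZR (- n) = - y) by (unfold y; rewrite opp_IZR; ring).
    assert (Eb : (RtoC (alpha + IZR m) + RtoC (beta + IZR (- n)) * h)%C = (- (a + y * h))%C) by (rewrite Em, Ey, !RtoC_opp; ring).
    assert (Ee : e ((alpha + IZR m) * mu + (beta + IZR (- n)) * nu)%R = (e (a * - mu)%R * e (y * - nu)%R)%C).
    { rewrite Em, Ey, <- e_plus, <- RtoC_plus. f_equal. f_equal. ring. }
    assert (Etn : t n = (e (y * - nu)%R * cpow (a + y * h) (- s))%C) by reflexivity.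
    assert (HIm : Im (a + y * h)%C = y * Re tau) by apply base_Im. pose proof (Re_tau_pos kap tau Hk Ht) as HRe.
    unfold f2. fold y. destruct (Rlt_dec 0 y) as [H|H]; [|destruct (Req_dec_T y 0) as [H0|H0]].
    - rewrite F_avg_slit; rewrite Eb.
      + rewrite Ee, Etn, cpow_neg_upper by (rewrite HIm; nra). replace (- (PI * Ci * - s))%C with (PI * Ci * s)%C by ring. rewrite Csin_exp. ring.
      + right. change (Im (- (a + y * h))%C) with (- Im (a + y * h)%C). rewrite HIm. nra.
    - assert (Hne : (RtoC (alpha + IZR m) + RtoC (beta + IZR (- n)) * h)%C <> 0).
      { rewrite Eb, H0. intros E. apply (f_equal Re) in E. simpl in E. lra. }
      unfold F_avg. rewrite !F_term_nonzero by exact Hne. rewrite Eb, Ee, Etn, H0.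
      replace (a + 0 * h)%C with (RtoC a) by ring. destruct (cpow_arg_neg_real a (- s) Ha) as [-> ->].
      replace (- (PI * Ci * - s))%C with (PI * Ci * s)%C by ring. replace (PI * Ci * - s)%C with (- (PI * Ci * s))%C by ring.
      transitivity (e (a * - mu)%R * (Cexp (- (PI * Ci * s)) * (e (0 * - nu)%R * cpow a (- s)) + (2 * Ci * Csin (PI * s)) * / 2 * (e (0 * - nu)%R * cpow a (- s))))%C.
      + rewrite Csin_exp. field.
      + field.
    - rewrite F_avg_slit; rewrite Eb.
      + rewrite Ee, Etn, cpow_neg_lower by (rewrite HIm; nra). replace (PI * Ci * - s)%C with (- (PI * Ci * s))%C by ring. ring.
      + right. change (Im (- (a + y * h))%C) with (- Im (a + y * h)%C). rewrite HIm. nra. }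
  apply Sum_unique. apply (has_sum_image _ (fun n => (- n)%Z)); [intros; lia|intros b Hbn; exfalso; apply (Hbn (- b)%Z); lia|].
  eapply has_sum_ext; [intros n; symmetry; apply Hpt|]. apply has_sum_scal. rewrite <- Cplus_assoc. apply has_sum_plus.
  - apply has_sum_scal, Sum_correct. unfold t, a. rewrite <- first_index_point. apply (Eterm_summable kap tau Hk Ht); [exact Hs|]. rewrite first_index_point. cx.
  - replace (2 * Ci * Csin (PI * s) * Sum (Zterm (frac_part beta) nu a h s) + delta beta * (Ci * Csin (PI * s) * cpow a (- s)))%C with
      (2 * Ci * Csin (PI * s) * Sum (Zterm (frac_part beta) nu a h s) + 0 + delta (- beta) * (Ci * Csin (PI * s) * cpow a (- s)))%C.
    2:{ replace (delta (- beta)) with (delta beta); [ring|]. unfold delta.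
        destruct (excluded_middle_informative _) as [[j Hj]|N], (excluded_middle_informative _) as [[j' Hj']|N']; auto; exfalso.
        - apply N'. exists (- j)%Z. rewrite opp_IZR. lra.
        - apply N. exists (- j')%Z. rewrite opp_IZR. lra. }
    apply has_sum_Z_split.
    + eapply has_sum_ext; [|apply has_sum_scal, Sum_correct].
      * intros j. cbv beta. pose proof (first_index_pos (- beta) j) as Hj. unfold f2. destruct (Rlt_dec _ _) as [_|N]; [|lra].
        unfold t, Eterm, Zterm. rewrite first_index_point, frac_part_point. f_equal.
        replace (1 - frac_part beta + INR j) with (INR j + 1 - frac_part beta) by ring. f_equal. f_equal. f_equal. ring.
      * apply (Zterm_summable _ nu _ _ _ frac_bounds (good_base kap tau Hk Ht a Ha)). lra.
    + eapply has_sum_ext; [|apply has_sum_zero]. intros j. cbv beta. pose proof (first_index_pos (- - beta) j) as Hj.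
      unfold f2. rewrite opp_IZR. destruct (Rlt_dec _ _) as [N|_]; [lra|]. destruct (Req_dec_T _ _); [lra|cx].
    + intros n Hn. unfold f2. rewrite Hn. destruct (Rlt_dec 0 0); [lra|]. destruct (Req_dec_T 0 0); [|lra].
      unfold t, Eterm. rewrite Hn, Rmult_0_l, e_0, Cmult_0_l, Cplus_0_r. ring.
Qed.

Lemma slice_zero P1 P2 m : has_sum (psi_term s beta nu) P1 -> has_sum (psi_term s (- beta) (- nu)) P2 -> alpha + IZR m = 0 ->
  Sum (fun n => F_avg (m, n)) = (cpow tau (- s) * (Cexp (- (PI * Ci * s / 2)) * P1 + Cexp (PI * Ci * s / 2) * P2))%C.
Proof.
  intros H1 H2 Hm. pose proof (Re_tau_pos kap tau Hk Ht) as HRe. assert (Ht0 : tau <> 0) by (intros E; rewrite E in HRe; simpl in HRe; lra).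
  (* In the right half plane the argument of [tau] can be added to [PI / 2] or [- PI / 2] without
     leaving the principal range, so the powers of [Ci * tau] and [- Ci * tau] split. *)
  assert (Hs1 : 1 < Re s) by lra. assert (Harg : - (PI / 2) < arg_p tau < PI / 2).
  { unfold arg_p. assert (Hq : 0 < Re tau / Cmod tau) by (apply Rdiv_lt_0_compat; [exact HRe|now apply Cmod_pos]). assert (Hq1 : Re tau / Cmod tau <= 1).
    { apply Rmult_le_reg_r with (Cmod tau); [now apply Cmod_pos|]. unfold Rdiv. rewrite Rmult_assoc, Rinv_l, Rmult_1_r, Rmult_1_l by (apply Rgt_not_eq; now apply Cmod_pos).
      pose proof (Rabs_fst_le tau) as Hf. pose proof (Rle_abs (fst tau)). unfold Re in *. lra. }
    pose proof (acos_bound (Re tau / Cmod tau)). assert (Hac : acos (Re tau / Cmod tau) < PI / 2).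
    { apply Rnot_le_lt. intros Hle. pose proof (cos_decr_1 (PI / 2) (acos (Re tau / Cmod tau)) ltac:(lra) ltac:(lra) ltac:(lra) ltac:(lra) Hle) as Hc.
      rewrite cos_acos, cos_PI2 in Hc by lra. lra. } destruct (Rle_dec 0 (Im tau)); lra. }
  assert (Hup : forall y : R, 0 < y -> cpow (0 + y * h) (- s) = (Cexp (- (PI * Ci * s / 2)) * cpow tau (- s) * cpow y (- s))%C).
  { intros y Hy. replace (0 + y * h)%C with (y * (Ci * tau))%C by (unfold h; ring). rewrite cpow_scale, cpow_mult, cpow_Ci; auto; try apply Ci_nz.
    - replace (PI * Ci * - s / 2)%C with (- (PI * Ci * s / 2))%C by (unfold Cdiv; ring). ring.
    - rewrite arg_p_Ci. lra.
    - apply Cmult_neq_0; [apply Ci_nz|exact Ht0]. }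
  assert (Hdn : forall y : R, 0 < y -> cpow (0 + (- y)%R * h) (- s) = (Cexp (PI * Ci * s / 2) * cpow tau (- s) * cpow y (- s))%C).
  { intros y Hy. assert (Hmc : (- Ci)%C <> 0) by (intros E; apply (f_equal snd) in E; simpl in E; lra).
    replace (0 + (- y)%R * h)%C with (y * (- Ci * tau))%C by (unfold h; rewrite RtoC_opp; ring). rewrite cpow_scale, cpow_mult, cpow_mCi; auto.
    - replace (- (PI * Ci * - s / 2))%C with (PI * Ci * s / 2)%C by (unfold Cdiv; ring). ring.
    - rewrite arg_p_mCi. lra.
    - apply Cmult_neq_0; [exact Hmc|exact Ht0]. }
  apply Sum_unique. replace (cpow tau (- s) * (Cexp (- (PI * Ci * s / 2)) * P1 + Cexp (PI * Ci * s / 2) * P2))%C with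
    (Cexp (- (PI * Ci * s / 2)) * cpow tau (- s) * P1 + Cexp (PI * Ci * s / 2) * cpow tau (- s) * P2 + delta beta * 0)%C by ring.
  apply has_sum_Z_split.
  - eapply has_sum_ext; [|apply has_sum_scal, (psi_term_sum _ _ _ _ Hs1 H1)]. intros j. cbv beta.
    pose proof (first_index_pos beta j) as Hj. rewrite F_avg_slit; rewrite Hm.
    + unfold psi_term. destruct (Rlt_dec _ _) as [_|N]; [|lra]. rewrite Hup by lra. rewrite Rmult_0_l, Rplus_0_l. ring.
    + apply (base_slit kap tau Hk Ht). right. lra.
  - eapply has_sum_ext; [|apply has_sum_scal, (psi_term_sum _ _ _ _ Hs1 H2)]. intros j. cbv beta. pose proof (first_index_pos (- beta) j) as Hj.
    set (y := - beta + IZR (first_index (- beta) + Z.of_nat j)) in *.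
    assert (Ey : beta + IZR (- (first_index (- beta) + Z.of_nat j)) = - y) by (unfold y; rewrite opp_IZR; ring). rewrite F_avg_slit; rewrite Hm, Ey.
    + unfold psi_term. destruct (Rlt_dec _ _) as [_|N]; [|lra]. fold y. rewrite Hdn by (unfold y; lra). rewrite Rmult_0_l, Rplus_0_l.
      replace (- y * nu) with (y * - nu) by ring. ring.
    + apply (base_slit kap tau Hk Ht). right. unfold y. lra.
  - intros n Hn. unfold F_avg, F_term. rewrite Hm, Hn. destruct (Ceq_dec _ _) as [_|N]; [ring|]. exfalso. apply N. ring.
Qed.

(** Absolute summability allows the sum over [n] to be taken first. The rows are then sorted by the
    sign of [alpha + m]; rows on the left contribute a reflected full line, a half line and the B_1
    term, the row at 0 the B_2 term. *)
Lemma lattice_split P1 P2 P3 E1 E2 D0 :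
  has_sum (psi_term s beta nu) P1 -> has_sum (psi_term s (- beta) (- nu)) P2 -> has_sum (psi_term s (- alpha) (- mu)) P3 ->
  has_sum (fun k : nat => e ((first_point alpha + INR k) * mu)%R * Sum (Eterm beta nu h s (first_point alpha + INR k)))%C E1 ->
  has_sum (fun k : nat => e ((first_point (- alpha) + INR k) * - mu)%R * Sum (Eterm (- beta) (- nu) h s (first_point (- alpha) + INR k)))%C E2 ->
  has_sum (fun k : nat => e ((first_point (- alpha) + INR k) * - mu)%R * Sum (Zterm (frac_part beta) nu (RtoC (first_point (- alpha) + INR k)) h s))%C D0 ->
  exists Fp Fm, has_sum (F_term arg_p s alpha beta mu nu h) Fp /\ has_sum (F_term arg_m s alpha beta mu nu h) Fm /\
    ((Fp + Fm) / 2)%C = (E1 + (Cexp (- (PI * Ci * s)) * E2 + 2 * Ci * Csin (PI * s) * D0 + delta beta * (Ci * Csin (PI * s) * P3)) +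
      delta alpha * (cpow tau (- s) * (Cexp (- (PI * Ci * s / 2)) * P1 + Cexp (PI * Ci * s / 2) * P2)))%C.
Proof.
  intros H1 H2 H3 HE1 HE2 HD.
  pose proof (Sum_correct _ (F_term_summable kap tau Hk Ht arg_p alpha beta mu nu s ltac:(intros z; apply Rabs_le, arg_p_bound) Hs)) as Hp.
  pose proof (Sum_correct _ (F_term_summable kap tau Hk Ht arg_m alpha beta mu nu s arg_m_bound Hs)) as Hm. eexists. eexists. split; [exact Hp|]. split; [exact Hm|].
  assert (Hl : has_sum F_avg ((Sum (F_term arg_p s alpha beta mu nu h) + Sum (F_term arg_m s alpha beta mu nu h)) / 2)%C).
  { unfold F_avg. eapply has_sum_ext; [|unfold Cdiv; rewrite Cmult_comm; apply has_sum_scal, (has_sum_plus _ _ _ _ Hp Hm)]. intros p. cbv beta. apply Cmult_comm. }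
  assert (Hg := has_sum_fubini F_avg (fun m => Sum (fun n => F_avg (m, n))) _
    (fun m => Sum_correct _ (summable_slice F_avg m F_avg_summable)) Hl).
  apply (has_sum_unique _ _ _ Hg). apply has_sum_Z_split.
  - eapply has_sum_ext; [intros k; symmetry; apply slice_right|exact HE1].
  - eapply has_sum_ext; [intros k; symmetry; apply slice_left|]. assert (Hs1 : 1 < Re s) by lra. pose proof (psi_term_sum _ _ _ _ Hs1 H3) as H3'.
    eapply has_sum_ext; [|apply (has_sum_plus _ _ _ _ (has_sum_plus _ _ _ _ (has_sum_scal (Cexp (- (PI * Ci * s))) _ _ HE2)
      (has_sum_scal (2 * Ci * Csin (PI * s)) _ _ HD)) (has_sum_scal (delta beta) _ _ (has_sum_scal (Ci * Csin (PI * s)) _ _ H3')))].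
    intros k. cbv beta. unfold psi_term. destruct (Rlt_dec _ _) as [_|N]; [|exfalso; apply N, first_index_pos]. rewrite first_index_point. ring.
  - intros m Hm0. now apply slice_zero.
Qed.
End Split.

(** * Full lines and half lines summed over all rows *)

Lemma has_sum_shift (f : Z -> C) l : has_sum f l -> has_sum (fun n => f (n + 1)%Z) l.
Proof.
  intros H. apply (has_sum_image _ (fun n => (n - 1)%Z)); [intros; lia|intros b Hb; exfalso; apply (Hb (b + 1)%Z); lia|].
  eapply has_sum_ext; [|exact H]. intros n. cbv beta. f_equal. lia.
Qed.

Lemma has_sum_dot {A} (a : nat -> C) (v : nat -> A -> C) (l : nat -> C) n :
  (forall j, has_sum (v j) (l j)) -> has_sum (fun i => dot a (fun j => v j i) n) (dot a l n).
Proof.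
  intros H. induction n.
  - simpl. now apply has_sum_scal.
  - rewrite dot_S. eapply has_sum_ext; [intros i; symmetry; apply dot_S|]. apply has_sum_plus; [exact IHn|now apply has_sum_scal].
Qed.

Definition weight_nat (p : nat * nat) : R := (INR (fst p) + 1) * (INR (snd p) + 1).
Definition weight_int (p : nat * Z) : R := (INR (fst p) + 1) * (Rabs (IZR (snd p)) + 1).

Lemma weight_nat_ge p : 1 <= weight_nat p.
Proof. unfold weight_nat. pose proof (pos_INR (fst p)). pose proof (pos_INR (snd p)). nra. Qed.

Lemma weight_int_ge p : 1 <= weight_int p.
Proof. unfold weight_int. pose proof (pos_INR (fst p)). pose proof (Rabs_pos (IZR (snd p))). nra. Qed.

Lemma weight_nat_rsummable : rsummable (fun p => Rpower (weight_nat p) (- (2))).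
Proof.
  apply rsummable_le with (fun p : nat * nat => Rpower (INR (fst p) + 1) (- (2)) * Rpower (INR (snd p) + 1) (- (2))).
  - intros p. unfold weight_nat. pose proof (pos_INR (fst p)). pose proof (pos_INR (snd p)). rewrite Rpower_mult_distr by lra. lra.
  - apply (rsummable_prod (fun k => Rpower (INR k + 1) (- (2))) (fun k => Rpower (INR k + 1) (- (2)))); try (intros; left; apply exp_pos).
    all: apply rsummable_nat_power; lra.
Qed.

Lemma weight_int_rsummable : rsummable (fun p => Rpower (weight_int p) (- (2))).
Proof.
  apply rsummable_le with (fun p : nat * Z => Rpower (INR (fst p) + 1) (- (2)) * Rpower (Rabs (IZR (snd p)) + 1) (- (2))).
  - intros p. unfold weight_int. pose proof (pos_INR (fst p)). pose proof (Rabs_pos (IZR (snd p))). rewrite Rpower_mult_distr by lra. lra.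
  - apply (rsummable_prod (fun k => Rpower (INR k + 1) (- (2))) (fun k => Rpower (Rabs (IZR k) + 1) (- (2)))); try (intros; left; apply exp_pos).
    + apply rsummable_nat_power; lra.
    + apply rsummable_Z_power; lra.
Qed.

Definition bD (a0 : R) (h : C) (p : nat * nat) : C := (RtoC (a0 + INR (fst p)) + RtoC (INR (snd p) + 1) * h)%C.
Definition phiD (a0 mu nu : R) (p : nat * nat) : C := (e ((a0 + INR (fst p)) * mu)%R * e (- (INR (snd p) + 1) * nu)%R)%C.
Definition bE (a0 beta : R) (h : C) (p : nat * Z) : C := (RtoC (a0 + INR (fst p)) + RtoC (beta + IZR (snd p)) * h)%C.
Definition phiE (a0 beta mu nu : R) (p : nat * Z) : C := (e ((a0 + INR (fst p)) * mu)%R * e ((beta + IZR (snd p)) * nu)%R)%C.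
(** The constant [q] of [family] that [weight_lower] yields for rows starting at [a0]. *)
Definition qf (kap a0 : R) : R := (kap / (kap + 2)) ^ 2 * a0.

Lemma qf_pos kap a0 : 0 < kap -> 0 < a0 -> 0 < qf kap a0.
Proof. pos. Qed.

Lemma qf_le kap a0 : 0 < kap -> 0 < a0 <= 1 -> qf kap a0 <= 1.
Proof.
  intros H1 H2. unfold qf. assert (H : 0 < kap / (kap + 2) <= 1).
  { split; [pos|]. apply Rmult_le_reg_r with (kap + 2); [lra|]. unfold Rdiv. rewrite Rmult_assoc, Rinv_l by lra. lra. }
  set (c := kap / (kap + 2)) in *. nra.
Qed.

Section Sums.
Variables (kap : R) (tau : C) (a0 beta mu nu : R).
Hypothesis Hk : 0 < kap.
Hypothesis Ht : sector kap tau.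
Hypothesis Ha0 : 0 < a0 <= 1.
Hypothesis Hsmall : Cmod tau * (2 * Rabs beta + 4) <= a0.
Let h : C := (Ci * tau)%C.
Let a (k : nat) : R := a0 + INR k.

Lemma h_pos : 0 < Cmod h.
Proof. unfold h. rewrite Cmod_h. apply Ht. Qed.

Lemma h_small : Cmod h * (2 * Rabs beta + 4) <= a0.
Proof. unfold h. rewrite Cmod_h. exact Hsmall. Qed.

Lemma qh_le : qf kap a0 * Cmod h <= 1.
Proof. pose proof h_pos. pose proof h_small. pose proof (Rabs_pos beta). pose proof (qf_le kap a0 Hk Ha0). nra. Qed.

Lemma a_lower k : a0 * (INR k + 1) <= a k /\ a0 <= a k.
Proof. unfold a. pose proof (pos_INR k). nra. Qed.

Lemma family_D : family (qf kap a0) weight_nat h (phiD a0 mu nu) (bD a0 h).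
Proof.
  split.
  - intros [k m]. unfold phiD. rewrite Cmod_mult, !Cmod_e. ring.
  - intros [k m] t Htt. unfold bD, weight_nat. cbn [fst snd]. fold (a k). pose proof (pos_INR k). pose proof (pos_INR m).
    destruct (a_lower k) as [H1 H2]. pose proof h_pos. pose proof h_small. pose proof (Rabs_pos beta).
    replace (a k + (INR m + 1)%R * h - t * h)%C with (a k + RtoC (INR m + 1 - t) * h)%C by (rewrite (RtoC_minus (INR m + 1)); ring). split.
    + apply (base_slit kap tau Hk Ht). left. lra.
    + apply (weight_lower kap tau Hk Ht); try lra. fold h. rewrite Rabs_pos_eq by lra. nra.
Qed.

(** Here [y = beta + n - t] can be smaller in modulus than the weight [|n| + 1], but by at most
    [|beta| + 2]. The smallness of [tau] makes [|h|] times this deficit at most [a0 / 2], which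
    [weight_lower] tolerates. *)
Lemma family_E : family (qf kap a0) weight_int h (phiE a0 beta mu nu) (bE a0 beta h).
Proof.
  split.
  - intros [k n]. unfold phiE. rewrite Cmod_mult, !Cmod_e. ring.
  - intros [k n] t Htt. unfold bE, weight_int. cbn [fst snd]. fold (a k). pose proof (pos_INR k). pose proof (Rabs_pos (IZR n)).
    destruct (a_lower k) as [H1 H2]. pose proof h_pos. pose proof h_small.
    replace (a k + (beta + IZR n)%R * h - t * h)%C with (a k + RtoC (beta + IZR n - t) * h)%C by (rewrite (RtoC_minus (beta + IZR n)); ring). split.
    + apply (base_slit kap tau Hk Ht). left. lra.
    + apply (weight_lower kap tau Hk Ht); try lra. fold h. assert (Hy : Rabs (IZR n) <= Rabs (beta + IZR n - t) + (Rabs beta + 1)).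
      { replace (IZR n) with ((beta + IZR n - t) + (- beta + t)) at 1 by ring. rtri. apply Rplus_le_compat_l. rtri. rewrite Rabs_Ropp, (Rabs_pos_eq t) by lra. lra. }
      nra.
Qed.

Section FixS.
Variables (n : nat) (s : C).
Hypothesis Hs2 : 2 < Re s.
Hypothesis Hsn : 3 - INR n <= Re s.

Lemma s1h_nz : ((s - 1) * h)%C <> 0.
Proof. apply Cmult_neq_0; [apply minus_1_nz; lra|]. intros E. pose proof h_pos as H. rewrite E, Cmod_0 in H. lra. Qed.

Definition line_defects : C := Sum (defect 0 (- nu) n h (phiE a0 beta mu nu) (bE a0 beta h) s).

(** A full line has no starting point: the telescoping sum over all integers vanishes, and the line
    sum is given by its defects alone. With [x = 0] the lattice point is [b] itself, and the
    parameter is [- nu] because a step back by [h] multiplies the phase by [e (- nu)]. *)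
Lemma E_inner k : summable (Eterm beta nu h s (a k)) ->
  has_sum (fun j : Z => defect 0 (- nu) n h (phiE a0 beta mu nu) (bE a0 beta h) s (k, j))
    (- ((s - 1) * h * (e (a k * mu)%R * Sum (Eterm beta nu h s (a k)))))%C.
Proof.
  intros Hsum.
  pose proof (defect_summable 0 (- nu) n (qf kap a0) weight_int ltac:(lra) (qf_pos kap a0 Hk (proj1 Ha0)) weight_int_ge weight_int_rsummable h _ _ s h_pos qh_le family_E Hsn) as HD.
  pose proof (Sum_correct _ (summable_slice _ k HD)) as H1. pose proof (Sum_correct _ Hsum) as H2. set (b := fun j : Z => (a k + RtoC (beta + IZR j) * h)%C).
  set (u := fun j : Z => (e ((beta + IZR j) * nu)%R * Gval 0 (- nu) n h s (b j))%C).
  assert (Hstep : forall j, (u j - u (j + 1)%Z)%C = ((s - 1) * h * Eterm beta nu h s (a k) (j + 1)%Z +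
    e (- (a k * mu))%R * defect 0 (- nu) n h (phiE a0 beta mu nu) (bE a0 beta h) s (k, j + 1)%Z)%C).
  { intros j. unfold defect, em_defect, phiE, bE, Eterm, u, Gval. cbn [fst snd]. fold (a k).
    change (RtoC (a k) + RtoC (beta + IZR (j + 1)) * h)%C with (b (j + 1)%Z).
    assert (Eb : (b (j + 1)%Z - h)%C = b j) by (unfold b; rewrite plus_IZR, !RtoC_plus; ring).
    replace (b (j + 1)%Z - 0 * h)%C with (b (j + 1)%Z) by ring. rewrite Eb.
    assert (E1 : e ((beta + IZR j) * nu)%R = (e ((beta + IZR (j + 1)) * nu)%R * e (- nu)%R)%C).
    { rewrite <- e_plus, <- RtoC_plus. f_equal. f_equal. rewrite plus_IZR. ring. }
    assert (E2 : (e (- (a k * mu))%R * e (a k * mu)%R)%C = 1).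
    { rewrite <- e_plus, <- RtoC_plus, Rplus_opp_l. apply e_0. }
    assert (E3 : Phi h (s - 1) (b (j + 1)%Z) 1 = ((s - 1) * h * cpow (b (j + 1)%Z) (- s))%C).
    { unfold Phi. cbn [rf Cpow]. change (INR 0) with 0. change (INR 1) with 1. replace (- (s - 1) - 1)%C with (- s)%C by ring. ring. }
    assert (E4 : e (RtoC 0 * RtoC (- nu))%C = 1) by (rewrite Cmult_0_l; apply e_0).
    rewrite E1, E3, E4. set (G1 := dot _ _ _). set (G2 := dot _ _ _). set (Y := e ((beta + IZR (j + 1)) * nu)%R).
    transitivity ((s - 1) * h * (Y * cpow (b (j + 1)%Z) (- s)) + (e (- (a k * mu))%R * e (a k * mu)%R) * Y * (e (- nu)%R * G1 - G2 - 1 * ((s - 1) * h * cpow (b (j + 1)%Z) (- s))))%C; [rewrite E2; ring|ring]. }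
  set (Sd := Sum (fun j : Z => defect 0 (- nu) n h (phiE a0 beta mu nu) (bE a0 beta h) s (k, j))) in *.
  assert (H3 : ((s - 1) * h * Sum (Eterm beta nu h s (a k)) + e (- (a k * mu))%R * Sd)%C = 0).
  { destruct (a_lower k) as [La1 La2]. pose proof h_pos. pose proof h_small. set (c := kap / (kap + 2) * Rmin (a k / 2) (Cmod h)).
    assert (Hc0 : 0 < kap / (kap + 2)) by pos. assert (Hc : 0 < c) by pos.
    assert (Hlow : forall y (m : nat), INR m <= Rabs y + Rabs beta -> c * (1 + INR m) <= Cmod (a k + RtoC y * h)).
    { intros y m Hy. eapply Rle_trans; [|apply (sector_lower kap tau Hk Ht)]. fold h. unfold c. rewrite Rmult_assoc.
      apply Rmult_le_compat_l; [lra|]. pose proof (Rmin_r (a k / 2) (Cmod h)) as M2. pose proof (pos_INR m). rewrite (Rabs_pos_eq (a k)) by lra. nra. }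
    apply (has_sum_Z_telescope u).
    - eapply has_sum_ext; [intros j; symmetry; apply Hstep|].
      apply (has_sum_shift (fun j => (s - 1) * h * Eterm beta nu h s (a k) j + e (- (a k * mu))%R * defect 0 (- nu) n h (phiE a0 beta mu nu) (bE a0 beta h) s (k, j))%C).
      apply has_sum_plus; apply has_sum_scal; [exact H2|exact H1].
    - unfold u. apply (Gval_tends_0 0 (- nu) n h s (fun m => b (Z.of_nat m)) (fun m => (beta + IZR (Z.of_nat m)) * nu) c Hc); [|lra].
      intros m. apply Hlow. rewrite <- INR_IZR_INZ.
      replace (INR m) with ((beta + INR m) + - beta) at 1 by ring. eapply Rle_trans; [apply Rle_abs|]. rtri. rewrite Rabs_Ropp. lra.
    - unfold u. apply (Gval_tends_0 0 (- nu) n h s (fun m => b (- Z.of_nat m)%Z) (fun m => (beta + IZR (- Z.of_nat m)) * nu) c Hc); [|lra].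
      intros m. apply Hlow. rewrite opp_IZR, <- INR_IZR_INZ.
      replace (INR m) with (- (beta + - INR m) + beta) at 1 by ring. eapply Rle_trans; [apply Rle_abs|]. rtri. rewrite Rabs_Ropp. lra. }
  assert (E : Sd = (- ((s - 1) * h * (e (a k * mu)%R * Sum (Eterm beta nu h s (a k)))))%C).
  { assert (E2 : (e (a k * mu)%R * e (- (a k * mu))%R)%C = 1).
    { rewrite <- e_plus, <- RtoC_plus, Rplus_opp_r. apply e_0. }
    set (X := Sum (Eterm beta nu h s (a k))) in *.
    transitivity (e (a k * mu)%R * ((s - 1) * h * X + e (- (a k * mu))%R * Sd) - (s - 1) * h * (e (a k * mu)%R * X))%C.
    - transitivity ((e (a k * mu)%R * e (- (a k * mu))%R) * Sd)%C; [rewrite E2; ring|ring].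
    - rewrite H3. ring. }
  rewrite <- E. exact H1.
Qed.

Lemma E_sum : (forall k, summable (Eterm beta nu h s (a k))) ->
  has_sum (fun k : nat => e (a k * mu)%R * Sum (Eterm beta nu h s (a k)))%C (- (line_defects / ((s - 1) * h)))%C.
Proof.
  intros Hsum. pose proof s1h_nz as Hnz.
  pose proof (defect_summable 0 (- nu) n (qf kap a0) weight_int ltac:(lra) (qf_pos kap a0 Hk (proj1 Ha0)) weight_int_ge weight_int_rsummable h _ _ s h_pos qh_le family_E Hsn) as HD.
  pose proof (has_sum_fubini _ _ _ (fun k => E_inner k (Hsum k)) (Sum_correct _ HD)) as H. fold line_defects in H. apply (has_sum_scal (- (/ ((s - 1) * h)))%C) in H.
  replace (- (line_defects / ((s - 1) * h)))%C with (- (/ ((s - 1) * h)) * line_defects)%C by (unfold Cdiv; ring).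
  eapply has_sum_ext; [|exact H]. intros k. cbv beta. set (X := (e (a k * mu)%R * Sum _)%C). field. split; intros E; apply Hnz; rewrite E; ring.
Qed.

Variables (x : R) (Psi : C -> C).
Hypothesis Hx : 0 <= x <= 1.

Definition half_line_defects : C := Sum (defect x nu n h (phiD a0 mu nu) (bD a0 h) s).
(* The coefficients of [gam] in [(s - 1) (s - 2) h] times the half-line sums: the pole of [psi] is cancelled by a factor of the Pochhammer symbol, except for the first term. *)
Definition main_coef (w : C) (j : nat) : C :=
  match j with O => Psi (w - 1) | S i => (w - 2) * rf (w - 1) i * h ^ (S i) * Psi (w - 1 + INR (S i)) end%C.
Definition main_sum (m : nat) (w : C) : C := dot (gam x nu) (main_coef w) m.

Lemma main_coef_eq (w : C) j : (w - 2 + INR j)%C <> 0 ->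
  ((w - 2) * (rf (w - 1) j * h ^ j * (Psi (w - 1 + INR j) / (w - 2 + INR j))))%C = main_coef w j.
Proof.
  intros H. destruct j as [|i].
  - unfold main_coef. cbn [rf Cpow]. simpl INR in *. rewrite !Cplus_0_r in *. set (P := Psi _). field. exact H.
  - unfold main_coef. cbn [rf]. set (P := Psi _). set (r := rf _ _). set (hh := Cpow _ _).
    replace (w - 1 + INR i)%C with (w - 2 + INR (S i))%C by (rewrite S_INR, RtoC_plus; ring). field. exact H.
Qed.

(** [Hsum_eq] is summed over the rows. The [j]-th term of G at the starting points [a k] adds up to
    psi at [s - 1 + j], where [2 < Re s] guarantees convergence; these values form [main_sum], and
    the defects form a double series. *)
Lemma D_sum : (forall w, 1 < Re w -> has_sum (fun k : nat => e (a k * mu)%R * cpow (a k) (- w))%C (Psi w / (w - 1))%C) ->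
  has_sum (fun k : nat => e (a k * mu)%R * Sum (Zterm x nu (RtoC (a k)) h s))%C
    ((main_sum (n + 1) s / (s - 2) - half_line_defects) / ((s - 1) * h))%C.
Proof.
  intros HPsi. pose proof s1h_nz as Hnz.
  pose proof (defect_summable x nu n (qf kap a0) weight_nat Hx (qf_pos kap a0 Hk (proj1 Ha0)) weight_nat_ge weight_nat_rsummable h _ _ s h_pos qh_le family_D Hsn) as HD.
  pose proof (has_sum_fubini _ _ _ (fun k => Sum_correct _ (summable_slice _ k HD)) (Sum_correct _ HD)) as H1. fold half_line_defects in H1. cbv beta in H1.
  assert (Hs2nz : forall j, (s - 2 + INR j)%C <> 0).
  { intros j E. apply (f_equal Re) in E. pose proof (pos_INR j). simpl in E. unfold Re in *. lra. }
  assert (H2 : has_sum (fun k : nat => dot (gam x nu) (fun j => e (a k * mu)%R * Phi h (s - 1) (a k) j)%C (n + 1)) (main_sum (n + 1) s / (s - 2))%C).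
  { replace (main_sum (n + 1) s / (s - 2))%C with (dot (gam x nu) (fun j => (rf (s - 1) j * h ^ j) * (Psi (s - 1 + INR j) / (s - 2 + INR j)))%C (n + 1)).
    - apply (has_sum_dot (gam x nu) (fun j k => e (a k * mu)%R * Phi h (s - 1) (a k) j)%C). intros j. assert (Hj : 1 < Re (s - 1 + INR j)).
      { pose proof (pos_INR j). simpl. unfold Re in *. simpl. lra. }
      pose proof (HPsi _ Hj) as H. replace (s - 1 + INR j - 1)%C with (s - 2 + INR j)%C in H by ring.
      eapply has_sum_ext; [|apply has_sum_scal, H]. intros k. cbv beta. unfold Phi. replace (- (s - 1) - INR j)%C with (- (s - 1 + INR j))%C by ring. ring.
    - assert (E : main_sum (n + 1) s = ((s - 2) * dot (gam x nu) (fun j => (rf (s - 1) j * h ^ j) * (Psi (s - 1 + INR j) / (s - 2 + INR j)))%C (n + 1))%C).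
      { unfold main_sum. rewrite <- dot_scal_r. apply dot_ext; [auto|]. intros j _. symmetry. apply main_coef_eq, Hs2nz. }
      rewrite E. set (X := dot _ _ _). pose proof (Hs2nz O) as H. simpl in H. rewrite Cplus_0_r in H. field. exact H. }
  pose proof (has_sum_scal (/ ((s - 1) * h))%C _ _ (has_sum_plus _ _ _ _ H2 (has_sum_scal (- (1))%C _ _ H1))) as H3.
  replace ((main_sum (n + 1) s / (s - 2) - half_line_defects) / ((s - 1) * h))%C with (/ ((s - 1) * h) * (main_sum (n + 1) s / (s - 2) + - (1) * half_line_defects))%C by (unfold Cdiv; ring).
  eapply has_sum_ext; [|exact H3]. intros k. cbv beta. destruct (a_lower k) as [La1 La2]. pose proof (good_base kap tau Hk Ht (a k) ltac:(lra)) as Hg. fold h in Hg.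
  pose proof (Hsum_eq x nu _ (RtoC (a k)) h Hx Hg n s ltac:(lra)) as HH. unfold Hsum in HH.
  assert (ED : Sum (fun b : nat => defect x nu n h (phiD a0 mu nu) (bD a0 h) s (k, b)) = (e (a k * mu)%R * Sum (Dterm x nu n (RtoC (a k)) h s))%C).
  { apply Sum_unique. eapply has_sum_ext; [|apply has_sum_scal, Sum_correct, (Dterm_summable x nu _ _ _ Hx Hg n s); lra].
    intros m. unfold defect, phiD, bD, Dterm. cbn [fst snd]. fold (a k). ring. }
  rewrite ED, dot_scal_r. unfold Gval in HH. set (Z := Sum (Zterm _ _ _ _ _)) in *. set (G := dot _ _ _) in *. set (Y := Sum (Dterm _ _ _ _ _ _)) in *.
  transitivity (/ ((s - 1) * h) * (e (a k * mu)%R * (G - Y)))%C; [ring|]. rewrite HH. field. split; intros E; apply Hnz; rewrite E; ring.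
Qed.
End FixS.
End Sums.

(** * Continuation of the lattice sum in s *)

Lemma locally'_avoid (s c : C) : cnear' s (fun w : C => w <> c).
Proof.
  destruct (Ceq_dec s c) as [->|Hs]; [apply locally'_ne|]. apply locally_locally'. apply (ccont_ne (fun z => z)); [apply hol_ccont, hol_id|exact Hs].
Qed.

Lemma filter_forall_le {T} (F : (T -> Prop) -> Prop) {FF : Filter F} (P : nat -> T -> Prop) n :
  (forall k, F (P k)) -> F (fun w => forall k, (k <= n)%nat -> P k w).
Proof.
  intros H. induction n.
  - generalize (H O). apply filter_imp. intros w Hw k Hk. now replace k with O by lia.
  - generalize (filter_and _ _ IHn (H (S n))). apply filter_imp. intros w [H1 H2] k Hk. destruct (Nat.eq_dec k (S n)) as [->|]; [exact H2|]. apply H1. lia.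
Qed.

Lemma Csin_PI : Csin (PI * 1) = 0.
Proof.
  unfold Csin. assert (E : forall z, Re z = 0 -> Im z = PI \/ Im z = - PI -> Cexp z = - (1)).
  { intros z H1 [H2|H2]; unfold Cexp; rewrite H1, H2, exp_0, ?cos_neg, ?sin_neg, cos_PI, sin_PI; ceq. }
  rewrite !E; try (simpl; unfold Re, Im; simpl; ring).
  - unfold Cdiv. ring.
  - simpl; lra.
  - simpl; lra.
Qed.

Lemma Csin_2PI : Csin (PI * 2) = 0.
Proof.
  assert (E : Cexp (PI * Ci * 2) = 1).
  { replace (PI * Ci * 2)%C with (2 * PI * Ci * RtoC (IZR 1))%C by ring. apply (e_Z 1). }
  unfold Csin. replace (Ci * (PI * 2))%C with (PI * Ci * 2)%C by ring. rewrite Cexp_opp, E. unfold Cdiv. replace (/ 1)%C with (RtoC 1) by field. ring.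
Qed.

Lemma hol_Csin_PI s : hol (fun s => Csin (PI * s)) s.
Proof. cx. Qed.

Lemma hol_Cexp_PI s : hol (fun s => Cexp (- (PI * Ci * s))) s.
Proof. cx. Qed.

Lemma hol_shift_const (f : C -> C) (c s : C) : (forall s, hol f s) -> hol (fun w => f (w - 1 + c)%C) s.
Proof. intros H. apply (hol_comp f (fun w => w - 1 + c)%C); [apply H|]. cx. Qed.

Lemma hol_main_coef tau Psi k s : (forall s, hol Psi s) -> hol (fun w => main_coef tau Psi w k) s.
Proof.
  intros H. destruct k as [|i]; unfold main_coef.
  - apply (hol_comp Psi (fun w => w - 1)%C); [apply H|cx].
  - apply hol_mult; [apply hol_mult; [apply hol_mult; [cx|]|cx]|now apply hol_shift_const]. apply (hol_rf (fun w => w - 1)%C), hol_minus_id.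
Qed.

Lemma hol_main_sum tau nu x Psi m s : (forall s, hol Psi s) -> hol (main_sum tau nu x Psi m) s.
Proof. intros H. unfold main_sum. apply (hol_dot (gam x nu) (fun k w => main_coef tau Psi w k)). intros k. now apply hol_main_coef. Qed.

Section Main.
Variables (alpha beta mu nu : R) (B1 B2 Psi1 Psi2 Psi3 : C -> C).
Hypothesis HB1 : forall s, hol B1 s.
Hypothesis HB1l : forall s, cnear' s (fun w => calB1_left alpha mu w = B1 w).
Hypothesis HB2 : forall s, hol B2 s.
Hypothesis HB2l : forall s, cnear' s (fun w => calB2_left beta nu w = B2 w).
Hypothesis HP1 : forall s, hol Psi1 s.
Hypothesis HP1s : forall s, 1 < Re s -> has_sum (psi_term s beta nu) (Psi1 s / (s - 1))%C.
Hypothesis HP1l : forall s, cnear' s (fun w => psi w beta nu = (Psi1 w / (w - 1))%C).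
Hypothesis HP2 : forall s, hol Psi2 s.
Hypothesis HP2s : forall s, 1 < Re s -> has_sum (psi_term s (- beta) (- nu)) (Psi2 s / (s - 1))%C.
Hypothesis HP2l : forall s, cnear' s (fun w => psi w (- beta) (- nu) = (Psi2 w / (w - 1))%C).
Hypothesis HP3 : forall s, hol Psi3 s.
Hypothesis HP3s : forall s, 1 < Re s -> has_sum (psi_term s (- alpha) (- mu)) (Psi3 s / (s - 1))%C.
Hypothesis HP3l : forall s, cnear' s (fun w => psi w (- alpha) (- mu) = (Psi3 w / (w - 1))%C).
Let X := frac_part beta.
Let p1 := first_point alpha.
Let p2 := first_point (- alpha).

(** Both sides are holomorphic for [Re s > 1], so the identity on a punctured neighbourhood extends
    to its centre by continuity. *)
Lemma B1_sum s : 1 < Re s -> B1 s = (Ci * Csin (PI * s) * (Psi3 s / (s - 1)))%C.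
Proof.
  intros Hs. apply (ccont_eq_locally' B1 (fun s => Ci * Csin (PI * s) * (Psi3 s / (s - 1)))%C).
  - apply hol_ccont, HB1.
  - apply hol_ccont. apply hol_mult; [cx|]. apply hol_div; [apply HP3|cx|now apply minus_1_nz].
  - generalize (filter_and _ _ (HB1l s) (HP3l s)). apply filter_imp. intros w [E1 E2]. rewrite <- E1. unfold calB1_left. now rewrite E2.
Qed.

Lemma B2_sum s : 1 < Re s -> B2 s = (Cexp (- (PI * Ci * s / 2)) * (Psi1 s / (s - 1)) + Cexp (PI * Ci * s / 2) * (Psi2 s / (s - 1)))%C.
Proof.
  intros Hs. apply (ccont_eq_locally' B2 (fun s => Cexp (- (PI * Ci * s / 2)) * (Psi1 s / (s - 1)) + Cexp (PI * Ci * s / 2) * (Psi2 s / (s - 1)))%C).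
  - apply hol_ccont, HB2.
  - apply hol_ccont. apply hol_plus; (apply hol_mult; [first [apply hol_Cexp_mlin|apply hol_Cexp_lin]|]);
      (apply hol_div; [auto|cx|now apply minus_1_nz]).
  - generalize (filter_and _ _ (HB2l s) (filter_and _ _ (HP1l s) (HP2l s))). apply filter_imp. intros w [E1 [E2 E3]].
    rewrite <- E1. unfold calB2_left. rewrite E2, E3. ring.
Qed.

Section Tau.
Variables (kap : R) (tau : C).
Hypothesis Hk : 0 < kap.
Hypothesis Ht : sector kap tau.
Hypothesis Hsm1 : Cmod tau * (2 * Rabs beta + 4) <= p1.
Hypothesis Hsm2 : Cmod tau * (2 * Rabs beta + 4) <= p2.
Let h : C := (Ci * tau)%C.

Definition defect_part (n : nat) (s : C) : C := (line_defects tau p1 beta mu nu n s + Cexp (- (PI * Ci * s)) * line_defects tau p2 (- beta) (- mu) (- nu) n s)%C.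
(* [(s - 1) (s - 2) h] times the lattice sum without the [B_1] and [B_2] terms. *)
Definition remainder_num (n : nat) (s : C) : C :=
  (- (s - 2) * defect_part n s + 2 * Ci * Csin (PI * s) * (main_sum tau nu X Psi3 (n + 1) s - (s - 2) * half_line_defects tau p2 (- mu) nu n s X))%C.
(** The normalised lattice sum in a form that is holomorphic for [Re s > 3 - n]; different [n]
    continue the same function. *)
Definition lattice_num (n : nat) (s : C) : C :=
  (remainder_num n s + (s - 1) * (s - 2) * h * (delta beta * B1 s + delta alpha * (cpow tau (- s) * B2 s)))%C.

Lemma Hsm2' : Cmod tau * (2 * Rabs (- beta) + 4) <= p2.
Proof. rewrite Rabs_Ropp. exact Hsm2. Qed.

Lemma h_nz : h <> 0.
Proof. intros E. pose proof (h_pos kap tau Ht) as H. fold h in H. rewrite E, Cmod_0 in H. lra. Qed.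

Lemma line_defects_hol n s : 3 - INR n < Re s -> hol (fun s => line_defects tau p1 beta mu nu n s) s.
Proof.
  intros Hs. pose proof (first_point_bounds alpha) as Hp. fold p1 in Hp. unfold line_defects.
  apply (defect_sum_hol 0 (- nu) n (qf kap p1) weight_int ltac:(lra) (qf_pos _ _ Hk (proj1 Hp)) weight_int_ge weight_int_rsummable); auto.
  - apply (h_pos kap tau Ht).
  - now apply (qh_le kap tau p1 beta).
  - now apply family_E.
Qed.

Lemma line_defects_hol_opp n s : 3 - INR n < Re s -> hol (fun s => line_defects tau p2 (- beta) (- mu) (- nu) n s) s.
Proof.
  intros Hs. pose proof (first_point_bounds (- alpha)) as Hp. fold p2 in Hp. unfold line_defects.
  apply (defect_sum_hol 0 (- - nu) n (qf kap p2) weight_int ltac:(lra) (qf_pos _ _ Hk (proj1 Hp)) weight_int_ge weight_int_rsummable); auto.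
  - apply (h_pos kap tau Ht).
  - now apply (qh_le kap tau p2 beta).
  - apply family_E; auto. apply Hsm2'.
Qed.

Lemma half_line_defects_hol n s : 3 - INR n < Re s -> hol (fun s => half_line_defects tau p2 (- mu) nu n s X) s.
Proof.
  intros Hs. pose proof (first_point_bounds (- alpha)) as Hp. fold p2 in Hp. unfold half_line_defects.
  apply (defect_sum_hol X nu n (qf kap p2) weight_nat (frac_bounds beta) (qf_pos _ _ Hk (proj1 Hp)) weight_nat_ge weight_nat_rsummable); auto.
  - apply (h_pos kap tau Ht).
  - now apply (qh_le kap tau p2 beta).
  - now apply (family_D kap tau p2 beta).
Qed.

Lemma remainder_num_hol n s : 3 - INR n < Re s -> hol (remainder_num n) s.
Proof.
  intros Hs. unfold remainder_num, defect_part. apply hol_plus.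
  - apply hol_mult; [cx|]. apply hol_plus; [now apply line_defects_hol|]. apply hol_mult; [cx|now apply line_defects_hol_opp].
  - apply hol_mult; [cx|]. apply hol_minus; [now apply hol_main_sum|]. apply hol_mult; [cx|now apply half_line_defects_hol].
Qed.

Lemma lattice_num_hol n s : 3 - INR n < Re s -> hol (lattice_num n) s.
Proof. intros Hs. unfold lattice_num. apply hol_plus; [now apply remainder_num_hol|]. cx. Qed.

Lemma line_defects_1 n a0 b m v : line_defects tau a0 b m v n 1 = 0.
Proof.
  unfold line_defects. apply Sum_unique. eapply has_sum_ext; [|apply has_sum_zero]. intros p. unfold defect.
  replace (1 - 1)%C with (RtoC 0) by ring. rewrite em_defect_0. ring.
Qed.

(** The full-line defects vanish at [s = 1] by [em_defect_0]; all other terms carry [Csin (PI * s)]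
    or [s - 1]. Together with the zero at 2 this makes the division by [(s - 1) (s - 2)]
    harmless. *)
Lemma lattice_num_1 n : lattice_num n 1 = 0.
Proof. unfold lattice_num, remainder_num, defect_part. rewrite !line_defects_1, Csin_PI. ring. Qed.

Lemma lattice_num_2 n : lattice_num n 2 = 0.
Proof. unfold lattice_num, remainder_num. rewrite Csin_2PI. ring. Qed.

Lemma lattice_num_eq n s : 2 < Re s -> 3 - INR n <= Re s ->
  exists Fp Fm, has_sum (F_term arg_p s alpha beta mu nu h) Fp /\ has_sum (F_term arg_m s alpha beta mu nu h) Fm /\
    ((s - 1) * (s - 2) * h * ((Fp + Fm) / 2))%C = lattice_num n s.
Proof.
  intros Hs Hn. assert (Hs1 : 1 < Re s) by lra.
  pose proof (first_point_bounds alpha) as Hp1. fold p1 in Hp1. pose proof (first_point_bounds (- alpha)) as Hp2. fold p2 in Hp2.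
  assert (HE1 := E_sum kap tau p1 beta mu nu Hk Ht Hp1 Hsm1 n s Hs Hn). assert (HE2 := E_sum kap tau p2 (- beta) (- mu) (- nu) Hk Ht Hp2 Hsm2' n s Hs Hn).
  assert (HD := D_sum kap tau p2 beta (- mu) nu Hk Ht Hp2 Hsm2 n s Hs Hn X Psi3 (frac_bounds beta)).
  destruct (lattice_split kap tau alpha beta mu nu s Hk Ht Hs _ _ _ _ _ _ (HP1s s Hs1) (HP2s s Hs1) (HP3s s Hs1)
    (HE1 ltac:(intros k; unfold p1; rewrite <- first_index_point; apply (Eterm_summable kap tau Hk Ht); [exact Hs|rewrite first_index_point; fold p1; pose proof (pos_INR k); lra]))
    (HE2 ltac:(intros k; unfold p2; rewrite <- first_index_point; apply (Eterm_summable kap tau Hk Ht); [exact Hs|rewrite first_index_point; fold p2; pose proof (pos_INR k); lra]))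
    (HD ltac:(intros w Hw; eapply has_sum_ext; [|apply (psi_term_sum _ _ _ _ Hw (HP3s w Hw))]; intros k; cbv beta; unfold psi_term;
      destruct (Rlt_dec _ _) as [_|N]; [|exfalso; apply N, first_index_pos]; now rewrite first_index_point))) as [Fp [Fm [H1 [H2 H3]]]].
  exists Fp, Fm. split; [exact H1|]. split; [exact H2|]. rewrite H3. unfold lattice_num, remainder_num, defect_part. rewrite B1_sum, B2_sum by lra. fold h.
  pose proof (minus_1_nz s Hs1) as N1. pose proof h_nz as N3. assert (N2 : (s - 2)%C <> 0) by (apply Cminus_nz; intros E; rewrite E in Hs; simpl in Hs; lra).
  generalize (line_defects tau p1 beta mu nu n s) (line_defects tau p2 (- beta) (- mu) (- nu) n s) (main_sum tau nu X Psi3 (n + 1) s) (half_line_defects tau p2 (- mu) nu n s X).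
  generalize (Cexp (- (PI * Ci * s))) (Cexp (PI * Ci * s / 2)) (Cexp (- (PI * Ci * s / 2))) (cpow tau (- s)) (Csin (PI * s)) (delta alpha) (delta beta) (Psi1 s) (Psi2 s) (Psi3 s).
  revert N1 N2 N3. generalize h Ci. intros hh ii N1 N2 N3. intros. field. auto.
Qed.

(** Supplies the function that the [epsilon] in [F_continuation] asks for: the expressions of
    growing order are glued, and the zeros at 1 and 2 are divided out. *)
Lemma F_avg_entire : exists F, (forall s, hol F s) /\
  forall s, 2 < Re s -> exists Fp Fm, has_sum (F_term arg_p s alpha beta mu nu h) Fp /\ has_sum (F_term arg_m s alpha beta mu nu h) Fm /\
    F s = ((Fp + Fm) / 2)%C.
Proof.
  destruct (entire_extension (lattice_num 1) 2) as [G [HG1 HG2]].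
  - intros N. exists (lattice_num (N + 3)). split.
    + intros s Hs. apply lattice_num_hol. rewrite plus_INR. simpl. lra.
    + intros s Hs. destruct (lattice_num_eq 1 s Hs ltac:(simpl; lra)) as [Fp [Fm [H1 [H2 H3]]]].
      destruct (lattice_num_eq (N + 3) s Hs ltac:(rewrite plus_INR; simpl; pose proof (pos_INR N); lra)) as [Fp' [Fm' [H1' [H2' H3']]]].
      rewrite <- H3, <- H3', (has_sum_unique _ _ _ H1 H1'), (has_sum_unique _ _ _ H2 H2'). reflexivity.
  (* Order 5 is valid for [Re s > - 2], a half plane containing 1 and 2, so both zeros of the glued
     function can be read off from one expression. *)
  - assert (HG5 : forall s, - (2) < Re s -> G s = lattice_num 5 s).
    { intros s Hs. apply (hol_identity (fun s => - (2) < Re s) G (lattice_num 5) 3 s); [apply convex_halfplane| | | |exact Hs|].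
      - auto.
      - intros w Hw. apply lattice_num_hol. simpl. lra.
      - simpl. lra.
      - apply locally_locally'. generalize (halfplane_locally 2 (RtoC 3) ltac:(simpl; lra)). apply filter_imp. intros w Hw. rewrite HG2 by exact Hw.
        destruct (lattice_num_eq 1 w Hw ltac:(simpl; lra)) as [Fp [Fm [H1 [H2 H3]]]].
        destruct (lattice_num_eq 5 w Hw ltac:(simpl; lra)) as [Fp' [Fm' [H1' [H2' H3']]]].
        rewrite <- H3, <- H3', (has_sum_unique _ _ _ H1 H1'), (has_sum_unique _ _ _ H2 H2'). reflexivity. }
    destruct (entire_divide G 1 HG1) as [G1 [HG11 HG12]]; [rewrite HG5 by (simpl; lra); apply lattice_num_1|]. assert (HG1z : G1 2 = 0).
    { pose proof (HG12 2) as E. rewrite HG5, lattice_num_2 in E by (simpl; lra). replace (G1 2) with ((2 - 1) * G1 2)%C by ring. cx. }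
    destruct (entire_divide G1 2 HG11 HG1z) as [F [HF1 HF2]]. exists (fun s => F s * / h)%C. split; [cx|].
    intros s Hs. destruct (lattice_num_eq 1 s Hs ltac:(simpl; lra)) as [Fp [Fm [H1 [H2 H3]]]]. exists Fp, Fm. split; [exact H1|]. split; [exact H2|].
    rewrite <- HG2, HG12, HF2 in H3 by exact Hs. assert (N1 : (s - 1)%C <> 0) by (apply minus_1_nz; lra). pose proof h_nz as N3.
    assert (N2 : (s - 2)%C <> 0) by (apply Cminus_nz; intros E; rewrite E in Hs; simpl in Hs; lra).
    transitivity (((s - 1) * ((s - 2) * F s)) / ((s - 1) * (s - 2) * h))%C; [field; auto|]. rewrite <- H3. field. auto.
Qed.

(** The formula is available for every order [n], which leaves [n] free to be adapted to [J] and [s]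
    in the final estimate. *)
Lemma F_Z2_spec : (forall s, hol (fun s => F_Z2 s alpha beta mu nu h) s) /\
  forall n s, 3 - INR n < Re s -> ((s - 1) * (s - 2) * h * F_Z2 s alpha beta mu nu h)%C = lattice_num n s.
Proof.
  assert (HF : entire (F_continuation alpha beta mu nu h) /\ forall s : C, (2 < Re s)%R ->
      exists Fp Fm : C, has_sum (F_term arg_p s alpha beta mu nu h) Fp /\ has_sum (F_term arg_m s alpha beta mu nu h) Fm /\
        F_continuation alpha beta mu nu h s = ((Fp + Fm) / 2)%C).
  { apply (epsilon_spec (inhabits (fun _ => RtoC 0)) (fun f => entire f /\ forall s : C, (2 < Re s)%R ->
      exists Fp Fm : C, has_sum (F_term arg_p s alpha beta mu nu h) Fp /\ has_sum (F_term arg_m s alpha beta mu nu h) Fm /\ f s = ((Fp + Fm) / 2)%C)).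
    destruct F_avg_entire as [F [H1 H2]]. exists F. split; [|exact H2]. intros s. apply hol_holomorphic_at, H1. }
  destruct HF as [HF1 HF2]. assert (Hh : forall s, hol (fun s => F_Z2 s alpha beta mu nu h) s) by (intros s; apply hol_holomorphic_at, HF1).
  split; [exact Hh|]. intros n s Hs. set (q := RtoC (Rmax 3 (4 - INR n))). pose proof (Rmax_l 3 (4 - INR n)). pose proof (Rmax_r 3 (4 - INR n)).
  assert (Hq : Re q = Rmax 3 (4 - INR n)) by reflexivity. assert (Hq1 : 2 < Re q) by lra. assert (Hq2 : 3 - INR n < Re q) by lra.
  apply (hol_identity (fun s => 3 - INR n < Re s) (fun s => (s - 1) * (s - 2) * h * F_Z2 s alpha beta mu nu h)%C (lattice_num n) q s); [apply convex_halfplane| | | |exact Hs|].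
  - cx.
  - intros w Hw. now apply lattice_num_hol.
  - exact Hq2.
  - apply locally_locally'. generalize (filter_and _ _ (halfplane_locally 2 q Hq1) (halfplane_locally (3 - INR n) q Hq2)). apply filter_imp. intros w [Hw Hw2].
    destruct (lattice_num_eq n w Hw ltac:(lra)) as [Fp [Fm [H1 [H2 H3]]]]. destruct (HF2 w Hw) as [Fp' [Fm' [H1' [H2' H3']]]].
    unfold F_Z2. rewrite H3', <- H3, (has_sum_unique _ _ _ H1 H1'), (has_sum_unique _ _ _ H2 H2'). reflexivity.
Qed.
End Tau.
End Main.

(** * The finite sum S_J *)

Lemma rf_shift p k : rf p (S k) = (p * rf (p + 1) k)%C.
Proof.
  induction k; [simpl; ring|]. change (rf p (S (S k))) with (rf p (S k) * (p + INR (S k)))%C. rewrite IHk.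
  change (rf (p + 1) (S k)) with (rf (p + 1) k * (p + 1 + INR k))%C. rewrite S_INR, RtoC_plus. ring.
Qed.

(** The identity [(w)_(k-1) = (w - 1)_k / (w - 1)], also for [k = 0], matches the symbols of the
    statement with those of the expansion in [p = s - 1]. *)
Lemma poch_rf (s : C) k : cnear' s (fun w => poch w (Z.of_nat k - 1) = (rf (w - 1) k / (w - 1))%C).
Proof.
  destruct k as [|i].
  - generalize (poch_m1 s). apply filter_imp. intros w E. change (Z.of_nat 0 - 1)%Z with (-1)%Z. rewrite E. unfold Cdiv. simpl rf. ring.
  - generalize (filter_and _ _ (poch_nat s i) (locally'_avoid s 1)). apply filter_imp. intros w [E Hw].
    replace (Z.of_nat (S i) - 1)%Z with (Z.of_nat i) by lia. rewrite E, rf_shift. assert (Ew : forall z : C, (z - 1 + 1)%C = z) by (intros; ring). rewrite Ew.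
    apply Cminus_nz in Hw. revert Hw. generalize (rf w i). generalize (w : C). intros u r Hu. field. exact Hu.
Qed.

Lemma cpow_index (tau : C) k : tau <> 0 -> cpow tau (RtoC (IZR (Z.of_nat k - 1))) = (tau ^ k / tau)%C.
Proof.
  intros H. rewrite minus_IZR, <- INR_IZR_INZ, RtoC_minus. unfold Cminus, Cdiv. rewrite cpow_plus, cpow_nat, cpow_opp, cpow_1 by exact H. reflexivity.
Qed.

Lemma Cpow_mult (a b : C) k : ((a * b) ^ k)%C = (a ^ k * b ^ k)%C.
Proof. induction k; simpl; [ring|rewrite IHk; ring]. Qed.

Section SJ.
Variables (alpha beta mu nu : R) (Psi : C -> C) (tau : C).
Hypothesis HP : forall s, hol Psi s.
Hypothesis HPl : forall s, cnear' s (fun w => psi w (- alpha) (- mu) = (Psi w / (w - 1))%C).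
Hypothesis Htau : tau <> 0.
Let X := frac_part beta.
Let h : C := (Ci * tau)%C.

(** Up to normalisation S_J is the expansion of the half lines cut at order [J]. The shift from
    [tau^k] to [tau^(k-1)] leaves the quotient [h / tau], which is the [Ci] on the right. *)
Lemma S_J_expr_eq J (s : C) : cnear' s (fun w =>
  ((w - 1) * (w - 2) * h * S_J_expr J alpha beta mu nu tau w)%C = (2 * Ci * Csin (PI * w) * main_sum tau nu X Psi J w)%C).
Proof.
  assert (Hpsi : forall k, cnear' s (fun w => psi (w + IZR (Z.of_nat k - 1)) (- alpha) (- mu) = (Psi (w - 1 + INR k) / (w - 2 + INR k))%C)).
  { intros k. generalize (locally'_shift _ (IZR (Z.of_nat k - 1)) s (HPl (s + IZR (Z.of_nat k - 1))%C)). apply filter_imp. intros w ->.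
    rewrite minus_IZR, <- INR_IZR_INZ, RtoC_minus. assert (Ea : forall z : C, (z + (INR k - 1))%C = (z - 1 + INR k)%C) by (intros; ring).
    assert (Eb : forall z : C, (z - 1 + INR k - 1)%C = (z - 2 + INR k)%C) by (intros; ring). now rewrite Ea, Eb. }
  assert (Hnz : forall k, cnear' s (fun w : C => (w - 2 + INR k)%C <> 0)).
  { intros k. generalize (locally'_avoid s (2 - INR k)%C). apply filter_imp. intros w Hw E. apply Hw.
    apply (f_equal (fun z => z + (2 - INR k))%C) in E. rewrite Cplus_0_l in E. rewrite <- E. generalize (w : C). intros. ring. }
  generalize (filter_and _ _ (locally'_avoid s 1) (filter_forall_le _ (fun k w => _ /\ _ /\ _) J (fun k => filter_and _ _ (poch_rf s k) (filter_and _ _ (Hpsi k) (Hnz k))))).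
  apply filter_imp. intros w [Hw1 Hall]. apply Cminus_nz in Hw1.
  set (v := fun k : nat => (Ci ^ k * poch w (Z.of_nat k - 1) * psi (w + IZR (Z.of_nat k - 1)) (- alpha) (- mu) * cpow tau (IZR (Z.of_nat k - 1)))%C).
  assert (E : S_J_expr J alpha beta mu nu tau w = (2 * Csin (PI * w) * dot (gam X nu) v J)%C).
  { unfold S_J_expr. f_equal. rewrite dot_sum_n. apply sum_n_ext. intros k. unfold v, gam, X.
    change (Cnum k (frac_part beta) nu) with (Cnum k (RtoC (frac_part beta)) nu). cbv zeta. unfold Cdiv. match goal with |- @eq _ ?a ?b => change (@eq C a b) end. ring. }
  rewrite E. transitivity (2 * Csin (PI * w) * ((w - 1) * (w - 2) * h * dot (gam X nu) v J))%C; [ring|].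
  rewrite <- dot_scal_r. transitivity (2 * Csin (PI * w) * (Ci * main_sum tau nu X Psi J w))%C; [|ring]. f_equal.
  unfold main_sum. rewrite <- dot_scal_r. apply dot_ext; [auto|]. intros k Hkj. destruct (Hall k Hkj) as [E1 [E2 E3]].
  unfold v. rewrite E1, E2, cpow_index by exact Htau. rewrite <- main_coef_eq by exact E3. rewrite Cpow_mult. unfold h.
  revert Htau Hw1 E3. generalize (rf (w - 1) k) (Psi (w - 1 + INR k)%C) (Cpow Ci k) (Cpow tau k) (RtoC (INR k)). generalize Ci tau. generalize (w : C).
  intros u ii tt r P ik tk n H1 H2 H3. field. auto.
Qed.

(** The sine vanishes at 1 and 2 and thereby pays for both denominators; the resulting entire
    function has the value that [C_lim] picks. *)
Lemma S_J_spec J : exists SJ, (forall s, hol SJ s) /\ (forall s, S_J J s alpha beta mu nu tau = SJ s) /\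
  forall s, ((s - 1) * (s - 2) * h * SJ s)%C = (2 * Ci * Csin (PI * s) * main_sum tau nu X Psi J s)%C.
Proof.
  assert (Hh : h <> 0) by (apply Cmult_neq_0; [apply Ci_nz|exact Htau]). set (f := fun s => (2 * Ci * Csin (PI * s) * main_sum tau nu X Psi J s)%C).
  assert (Hf : forall s, hol f s).
  { intros s. unfold f. apply hol_mult; [cx|now apply hol_main_sum]. }
  assert (F1 : f 1 = 0) by (unfold f; rewrite Csin_PI; ring). assert (F2 : f 2 = 0) by (unfold f; rewrite Csin_2PI; ring).
  destruct (entire_divide f 1 Hf F1) as [f1 [H1 E1]]. assert (F3 : f1 2 = 0).
  { pose proof (E1 2) as E. rewrite F2 in E. replace (f1 2) with ((2 - 1) * f1 2)%C by ring. cx. }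
  destruct (entire_divide f1 2 H1 F3) as [f2 [H2 E2]]. assert (HSJ : forall s, hol (fun s => f2 s * / h)%C s) by cx.
  assert (HE : forall s, ((s - 1) * (s - 2) * h * (f2 s * / h))%C = f s).
  { intros s. rewrite E1, E2. field. exact Hh. }
  exists (fun s => f2 s * / h)%C. split; [exact HSJ|]. split; [|exact HE].
  intros s. apply C_lim_value. apply (removable_value _ (fun s => f2 s * / h)%C); [apply HSJ|].
  generalize (filter_and _ _ (S_J_expr_eq J s) (filter_and _ _ (locally'_avoid s 1) (locally'_avoid s 2))).
  apply filter_imp. intros w [E [N1 N2]]. apply Cminus_nz in N1, N2. fold (f w) in E. rewrite <- (HE w) in E.
  set (u := ((w - 1) * (w - 2) * h)%C) in *. assert (Hu : u <> 0) by (unfold u; exact (Cmult_neq_0 _ _ (Cmult_neq_0 _ _ N1 N2) Hh)).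
  transitivity (/ u * (u * S_J_expr J alpha beta mu nu tau w))%C.
  - rewrite Cmult_assoc, Cinv_l by exact Hu. ring.
  - rewrite E, Cmult_assoc, Cinv_l by exact Hu. ring.
Qed.
End SJ.

(** * The estimate of the remainder *)

Lemma main_sum_tail nu x Psi c r J i : (forall s, hol Psi s) -> 0 < r ->
  exists K, 0 <= K /\ forall tau t, Cmod tau <= 1 -> 0 <= t <= 1 ->
    Cmod (main_sum tau nu x Psi (J + i) (circ c r t) - main_sum tau nu x Psi J (circ c r t)) <= K * Cmod tau ^ (J + 1).
Proof.
  intros HP Hr. induction i as [|i [K [HK IH]]].
  - exists 0. split; [lra|]. intros tau t _ _. rewrite Nat.add_0_r. replace (_ - _)%C with (RtoC 0) by ring. rewrite Cmod_0. lra.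
  (* [g] is the coefficient of [h^(m+1)] in [main_coef]. It does not involve [tau], so its bound on
     the circle is uniform in [tau]. *)
  - set (m := (J + i)%nat). set (g := fun w : C => ((w - 2) * rf (w - 1) m * Psi (w - 1 + INR (S m)))%C). assert (Hg : forall w, hol g w).
    { intros w. unfold g. apply hol_mult; [apply hol_mult; [cx|]|now apply hol_shift_const]. apply (hol_rf (fun w => w - 1)%C), hol_minus_id. }
    destruct (con_bounded (fun y => g (circ c r y)) 0 1 ltac:(lra) (con_hol_circ g c r Hr (fun w _ => Hg w))) as [M [HM HMb]].
    exists (K + Cmod (gam x nu (S m)) * M). split; [pose proof (Cmod_ge_0 (gam x nu (S m))); nra|]. intros tau t Htau Htt.
    replace (J + S i)%nat with (S m) by (unfold m; lia). specialize (IH tau t Htau Htt). fold m in IH. specialize (HMb t Htt).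
    unfold main_sum in *. rewrite dot_S. set (D1 := dot _ _ m) in *. set (D0 := dot _ _ J) in *.
    replace (D1 + gam x nu (S m) * main_coef tau Psi (circ c r t) (S m) - D0)%C with ((D1 - D0) + gam x nu (S m) * main_coef tau Psi (circ c r t) (S m))%C by ring.
    ctri. rewrite Rmult_plus_distr_r. apply Rplus_le_compat; [exact IH|].
    assert (Ea : main_coef tau Psi (circ c r t) (S m) = (g (circ c r t) * (Ci * tau) ^ S m)%C) by (unfold main_coef, g; ring).
    rewrite Ea, Cmod_mult, Cmod_mult, Cmod_pow, Cmod_mult, Cmod_Ci, Rmult_1_l, Rmult_assoc. apply Rmult_le_compat_l; [pos|].
    apply Rmult_le_compat; [pos|pos|exact HMb|]. pose proof (Cmod_ge_0 tau). replace (S m) with ((J + 1) + i)%nat by (unfold m; lia). rewrite pow_add.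
    rewrite <- (Rmult_1_r (Cmod tau ^ (J + 1))) at 2. apply Rmult_le_compat_l; [pos|]. rewrite <- (pow1 i). apply pow_incr. lra.
Qed.

(** The circle around [s] must not pass through 1 or 2. That excludes at most two radii, so one of
    1, 1/2, 1/3 remains. *)
Lemma radius_avoiding u v : exists r, 0 < r <= 1 /\ u <> r /\ v <> r.
Proof.
  destruct (Req_dec_T u 1), (Req_dec_T v 1), (Req_dec_T u (1 / 2)), (Req_dec_T v (1 / 2));
    first [exists 1; split; [lra|split; lra] | exists (1 / 2); split; [lra|split; lra] | exists (1 / 3); split; [lra|split; lra]].
Qed.

Lemma remainder_bound alpha beta mu nu (J : nat) (s0 : C) eta : 0 < eta < PI / 2 ->
  exists M d : R, 0 < d /\ forall tau : C, 0 < Cmod tau < d -> Rabs (arg_p tau) <= PI / 2 - eta ->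
    Cmod (R_J J s0 alpha beta mu nu tau) <= M * Cmod tau ^ J.
Proof.
  intros Heta. destruct (calB1_spec alpha mu) as [B1 [HB1 [HB1l _]]]. destruct (calB2_spec beta nu) as [B2 [HB2 [HB2l _]]].
  destruct (psi_spec beta nu) as [Psi1 [HP1 [HP1s HP1l]]]. destruct (psi_spec (- beta) (- nu)) as [Psi2 [HP2 [HP2s HP2l]]].
  destruct (psi_spec (- alpha) (- mu)) as [Psi3 [HP3 [HP3s HP3l]]]. set (X := frac_part beta). set (p1 := first_point alpha). set (p2 := first_point (- alpha)).
  pose proof (first_point_bounds alpha) as Hp1. fold p1 in Hp1. pose proof (first_point_bounds (- alpha)) as Hp2. fold p2 in Hp2.
  set (kap := sin eta). assert (Hk : 0 < kap) by (apply sin_gt_0; lra). destruct (radius_avoiding (Cmod (s0 - 1)) (Cmod (s0 - 2))) as [r [Hr [Hr1 Hr2]]].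
  (* The order [n] meets three demands: [3 - n <= Re s0 - r], so that the formulas hold on the whole
     disc; [p = (n + 3 - s1) / 2 >= J + 1], the power of [h] left in the defects; and [J <= n]. *)
  set (s1 := Re s0 + r). destruct (nat_above (Rabs (4 - Re s0 + r) + Rabs (2 * INR J + 1 + s1) + INR J)) as [n Hn].
  pose proof (Rle_abs (4 - Re s0 + r)) as Hn1. pose proof (Rabs_pos (4 - Re s0 + r)).
  pose proof (Rle_abs (2 * INR J + 1 + s1)) as Hn2. pose proof (Rabs_pos (2 * INR J + 1 + s1)). pose proof (pos_INR J) as HJ.
  assert (HJn : (J <= n)%nat) by (apply INR_le; lra). set (S0 := Cmod (s0 - 1) + r). set (sl := Re s0 - r). assert (Hsl : 3 - INR n <= sl) by (unfold sl; lra).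
  set (p := INR n + 2 - (s1 + INR n + 1) / 2). assert (Hp : INR J + 1 <= p) by (unfold p; lra).
  destruct (defect_sum_bound 0 (- nu) n (qf kap p1) weight_int ltac:(lra) (qf_pos _ _ Hk (proj1 Hp1)) weight_int_ge weight_int_rsummable S0 sl s1 Hsl) as [K1 [HK1 H1]].
  destruct (defect_sum_bound 0 (- - nu) n (qf kap p2) weight_int ltac:(lra) (qf_pos _ _ Hk (proj1 Hp2)) weight_int_ge weight_int_rsummable S0 sl s1 Hsl) as [K2 [HK2 H2]].
  destruct (defect_sum_bound X nu n (qf kap p2) weight_nat (frac_bounds beta) (qf_pos _ _ Hk (proj1 Hp2)) weight_nat_ge weight_nat_rsummable S0 sl s1 Hsl) as [K3 [HK3 H3]].
  fold p in H1, H2, H3.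
  destruct (main_sum_tail nu X Psi3 s0 r J (n + 1 - J) HP3 (proj1 Hr)) as [K4 [HK4 H4]]. replace (J + (n + 1 - J))%nat with (n + 1)%nat in H4 by lia.
  destruct (con_bounded _ 0 1 ltac:(lra) (con_hol_circ (fun s => Cexp (- (PI * Ci * s))) s0 r (proj1 Hr) (fun w _ => hol_Cexp_PI w))) as [Me [HMe HMeb]].
  destruct (con_bounded _ 0 1 ltac:(lra) (con_hol_circ (fun s => Csin (PI * s)) s0 r (proj1 Hr) (fun w _ => hol_Csin_PI w))) as [Ms [HMs HMsb]].
  set (L := Cmod (s0 - 2) + r). set (q1 := Rabs (Cmod (s0 - 1) - r)). set (q2 := Rabs (Cmod (s0 - 2) - r)).
  assert (Hq1 : 0 < q1) by (apply Rabs_pos_lt; lra). assert (Hq2 : 0 < q2) by (apply Rabs_pos_lt; lra). set (KK := L * (K1 + Me * K2) + 2 * Ms * (K4 + L * K3)).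
  (* Small enough for the deficit allowed by [weight_lower] in the rows on both sides; it also gives
     [Cmod tau <= 1]. *)
  set (d := Rmin p1 p2 / (2 * Rabs beta + 4)). pose proof (Rabs_pos beta) as Hbeta. exists (KK / (q1 * q2)), d. assert (Hd : 0 < d) by pos. split; [exact Hd|].
  intros tau [Ht0 Htd] Harg. pose proof (arg_sector tau eta Heta Ht0 Harg) as Ht. fold kap in Ht. assert (Hsm : Cmod tau * (2 * Rabs beta + 4) <= Rmin p1 p2).
  { apply Rle_trans with (d * (2 * Rabs beta + 4)); [apply Rmult_le_compat_r; lra|]. unfold d. right. field. lra. }
  pose proof (Rmin_l p1 p2). pose proof (Rmin_r p1 p2).
  assert (Hsm1 : Cmod tau * (2 * Rabs beta + 4) <= p1) by lra. assert (Hsm2 : Cmod tau * (2 * Rabs beta + 4) <= p2) by lra. assert (Htau1 : Cmod tau <= 1) by nra.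
  assert (Htnz : tau <> 0) by (intros E; rewrite E, Cmod_0 in Ht0; lra). set (h := (Ci * tau)%C). assert (Hh : Cmod h = Cmod tau) by apply Cmod_h.
  destruct (F_Z2_spec alpha beta mu nu B1 B2 Psi1 Psi2 Psi3 HB1 HB1l HB2 HB2l HP1 HP1s HP1l HP2 HP2s HP2l HP3 HP3s HP3l kap tau Hk Ht Hsm1 Hsm2) as [HF HFG].
  destruct (S_J_spec alpha beta mu nu Psi3 tau HP3 HP3l Htnz J) as [SJ [HSJ [HSJ1 HSJ2]]]. fold X in HSJ2. fold h in HF, HFG, HSJ2.
  (* [Rf] replaces every [C_lim] by its entire representative, so it is holomorphic on the disc and
     the mean value bound applies. *)
  set (Rf := fun s => (F_Z2 s alpha beta mu nu h - delta beta * B1 s - delta alpha * B2 s * cpow tau (- s) - SJ s)%C).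
  assert (HRf : R_J J s0 alpha beta mu nu tau = Rf s0).
  { unfold R_J, Rf. rewrite (calB2_value B2 beta nu HB2 HB2l), HSJ1. unfold calB1.
    rewrite (C_lim_value _ _ _ (removable_value _ B1 s0 (HB1 s0) (HB1l s0))). reflexivity. }
  rewrite HRf. apply (hol_mean_bound Rf s0 r); [lra| |].
  - intros w _. unfold Rf. apply hol_minus; [|apply HSJ]. apply hol_minus; [apply hol_minus; [apply HF|]|].
    + apply hol_mult; [cx|apply HB1].
    + apply hol_mult; [cx|]. apply hol_cpow_exp, hol_opp, hol_id.
  - intros t Htt. set (w := circ s0 r t). pose proof (Cmod_circ s0 r t (proj1 Hr)) as Hw. fold w in Hw. assert (Hre : sl <= Re w <= s1).
    { pose proof (Rabs_fst_le (w - s0)) as Hx. change (fst (w - s0)%C) with (Re w - Re s0) in Hx. apply Rabs_le_between in Hx. unfold sl, s1. lra. }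
    assert (HwS : Cmod (w - 1) <= S0) by (pose proof (Cmod_triangle3 w s0 1); unfold S0; lra).
    assert (HwL : Cmod (w - 2) <= L) by (pose proof (Cmod_triangle3 w s0 2); unfold L; lra). assert (Hlow : forall c : C, Rabs (Cmod (s0 - c) - r) <= Cmod (w - c)).
    { intros c. apply Rabs_le. pose proof (Cmod_triangle3 s0 w c). pose proof (Cmod_triangle3 w c s0).
      rewrite (Cmod_minus_sym s0 w), (Cmod_minus_sym c s0) in *. lra. }
    pose proof (Hlow 1) as Hl1. fold q1 in Hl1. pose proof (Hlow 2) as Hl2. fold q2 in Hl2. set (P := Cmod tau ^ (J + 1)). assert (HpP : Rpower (Cmod h) p <= P).
    { rewrite Hh. unfold P. rewrite <- Rpower_pow by exact Ht0. unfold Rpower. apply exp_le_mono. rewrite plus_INR. simpl (INR 1).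
      assert (ln (Cmod tau) <= 0) by (rewrite <- ln_1; apply ln_le; lra). nra. }
    assert (Hfac : forall K Y, 0 <= K -> Y <= K * Rpower (Cmod h) p -> Y <= K * P).
    { intros K Y HK HY. eapply Rle_trans; [exact HY|]. now apply Rmult_le_compat_l. }
    assert (Hh0 : 0 < Cmod h) by lra. assert (D1 : Cmod (line_defects tau p1 beta mu nu n w) <= K1 * P).
    { apply Hfac; [exact HK1|]. apply H1; auto; [now apply (qh_le kap tau p1 beta)|now apply family_E]. }
    assert (D2 : Cmod (line_defects tau p2 (- beta) (- mu) (- nu) n w) <= K2 * P).
    { apply Hfac; [exact HK2|]. apply H2; auto; [now apply (qh_le kap tau p2 beta)|]. apply family_E; auto. now rewrite Rabs_Ropp. }
    assert (D3 : Cmod (half_line_defects tau p2 (- mu) nu n w X) <= K3 * P).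
    { apply Hfac; [exact HK3|]. apply H3; auto; [now apply (qh_le kap tau p2 beta)|now apply (family_D kap tau p2 beta)]. }
    specialize (H4 tau t Htau1 Htt). fold w P in H4. specialize (HMeb t Htt). specialize (HMsb t Htt). cbv beta in HMeb, HMsb. fold w in HMeb, HMsb.
    (* The B terms cancel against those in [lattice_num], and S_J removes the expansion up to order
       [J]; defects and the terms of order [J + 1] to [n + 1] are left. *)
    assert (Eq : ((w - 1) * (w - 2) * h * Rf w)%C = (- (w - 2) * defect_part alpha beta mu nu tau n w +
      2 * Ci * Csin (PI * w) * ((main_sum tau nu X Psi3 (n + 1) w - main_sum tau nu X Psi3 J w) - (w - 2) * half_line_defects tau p2 (- mu) nu n w X))%C).
    { specialize (HFG n w ltac:(unfold sl in *; lra)). specialize (HSJ2 w). unfold lattice_num, remainder_num in HFG. fold h X p2 in HFG. unfold Rf.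
      transitivity ((w - 1) * (w - 2) * h * F_Z2 w alpha beta mu nu h - (w - 1) * (w - 2) * h * (delta beta * B1 w + delta alpha * (cpow tau (- w) * B2 w)) - (w - 1) * (w - 2) * h * SJ w)%C; [ring|].
      rewrite HFG, HSJ2. ring. }
    assert (HEs : Cmod (defect_part alpha beta mu nu tau n w) <= (K1 + Me * K2) * P).
    { unfold defect_part. ctri. rewrite Rmult_plus_distr_r. apply Rplus_le_compat; [exact D1|].
      rewrite Cmod_mult, Rmult_assoc. apply Rmult_le_compat; auto using Cmod_ge_0. }
    assert (Hbig : Cmod ((w - 1) * (w - 2) * h * Rf w) <= KK * P).
    { rewrite Eq. ctri. unfold KK. rewrite Rmult_plus_distr_r. apply Rplus_le_compat.
      - rewrite Cmod_mult, Cmod_opp, Rmult_assoc. apply Rmult_le_compat; auto using Cmod_ge_0.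
      - rewrite !Cmod_mult, Cmod_Ci, Cmod_R, Rabs_pos_eq, Rmult_1_r by lra. rewrite !Rmult_assoc. apply Rmult_le_compat_l; [lra|].
        apply Rmult_le_compat; auto using Cmod_ge_0. ctrim. rewrite Rmult_plus_distr_r.
        apply Rplus_le_compat; [exact H4|]. rewrite Cmod_mult, Rmult_assoc. apply Rmult_le_compat; auto using Cmod_ge_0. }
    (* On the circle the factors [w - 1] and [w - 2] are bounded below by [q1] and [q2]. Dividing by
       [h] costs one power of [tau], which is why the numerator was estimated to order [J + 1]. *)
    rewrite !Cmod_mult, Hh in Hbig. unfold P in Hbig. rewrite pow_add, pow_1 in Hbig. assert (Hq : q1 * q2 * Cmod (Rf w) * Cmod tau <= KK * Cmod tau ^ J * Cmod tau).
    { rewrite (Rmult_assoc KK). eapply Rle_trans; [|exact Hbig].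
      replace (Cmod (w - 1) * Cmod (w - 2) * Cmod tau * Cmod (Rf w)) with (Cmod (w - 1) * Cmod (w - 2) * Cmod (Rf w) * Cmod tau) by ring.
      apply Rmult_le_compat_r; [lra|]. apply Rmult_le_compat_r; [pos|]. apply Rmult_le_compat; lra. }
    apply Rmult_le_reg_r in Hq; [|exact Ht0]. assert (Hqq : 0 < q1 * q2) by now apply Rmult_lt_0_compat.
    apply Rmult_le_reg_l with (q1 * q2); [exact Hqq|]. eapply Rle_trans; [exact Hq|]. right. field. lra.
Qed.

Theorem theorem2 : forall alpha beta mu nu : R,
  (forall s : C,
     has_value (calB1_left alpha mu) s (calB1 s alpha mu) /\
     has_value (calB1_right alpha mu) s (calB1 s alpha mu)) /\
  (forall s : C,
     has_value (calB2_left beta nu) s (calB2 s beta nu) /\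
     has_value (calB2_right beta nu) s (calB2 s beta nu)) /\
  (forall (J : nat) (s : C), - INR J < Re s ->
   forall eta : R, 0 < eta < PI / 2 ->
   exists M d : R, 0 < d /\
     forall tau : C, 0 < Cmod tau < d -> Rabs (arg_p tau) <= PI / 2 - eta ->
       Cmod (R_J J s alpha beta mu nu tau) <= M * Cmod tau ^ J).
Proof.
  intros alpha beta mu nu. split; [|split].
  - intros s. destruct (calB1_spec alpha mu) as [B [HB [HL HR]]]. unfold calB1.
    rewrite (C_lim_value _ _ _ (removable_value _ B s (HB s) (HL s))). split; now apply removable_value.
  - intros s. destruct (calB2_spec beta nu) as [B [HB [HL HR]]]. unfold calB2.
    rewrite (C_lim_value _ _ _ (removable_value _ B s (HB s) (HL s))). split; now apply removable_value.
  - intros J s _ eta Heta. now apply remainder_bound.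
Qed.
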